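(* Let positive numbers $C,\alpha,\delta$ satisfy $\delta\le1$ and $\alpha>2\left(1+\frac2\delta\right)$. Let $\mathbb T=\{z\in\mathbb C:|z|=1\}$, and let $\varphi:\mathbb R^2\times\mathbb R^2\to\mathbb C$ be a Lebesgue measurable function such that: (i) there exist Borel measurable $\tau_1,\tau_2:\mathbb R^2\times\mathbb R^2\to\mathbb T$ such that for every $r\in\mathbb R^2$, for almost all $(s,t)\in\mathbb R^2\times\mathbb R^2$, $\varphi(t+r,s+r)=\tau_1(r,t)\,\varphi(t,s)\,\tau_2(r,s)$; (ii) $\int_{\mathbb R^2}|\varphi(t,s)|^2\,ds=1$ for almost all $t\in\mathbb R^2$; (iii) $\operatorname{ess\,sup}_{(s,t)\in\mathbb R^2\times\mathbb R^2}(1+|t-s|)^{\alpha}|\varphi(t,s)|^2<\infty$. Let a Lebesgue measurable function $\psi:\mathbb C\to\mathbb R$ satisfy $\int_{\mathbb C}\exp\left(\frac1C|\psi(z)|\right)e^{-|z|^2}\,dz<\infty$, $\int_{\mathbb C}\psi(z)e^{-|z|^2}\,dz=0$, and $$\log\int_{\mathbb C}\exp\left|\psi\left(\frac{x+h+y}2\right)-\psi\left(\frac{x+h-y}2\right)\right|\cdot\frac1\pi e^{-|x|^2}\,dx\le C|y|^\delta$$ for all $y,h\in\mathbb C$. Then the random field $X=\psi(\varphi\star w_{\mathbb C})$ on $\mathbb R^2$, that is, $X_t=\psi\left(\int_{\mathbb R^2}\varphi(t,s)\,w_{\mathbb C}(s)\,ds\right)$, is splittable.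
   Context: Integrals over $\mathbb C$ are with respect to Lebesgue (area) measure. White noise. The white noise $w$ on $\mathbb R^2$ is the isonormal Gaussian process over $L_2(\mathbb R^2)$: $f\mapsto\int f(s)w_s\,ds$ is linear, with jointly Gaussian centered values of variance $\|f\|_2^2$. The complex white noise is $w_{\mathbb C}=\frac1{\sqrt2}(w_1+\mathrm i w_2)$ with $w_1,w_2$ independent copies of $w$; it is integrated against complex-valued $L_2$ functions. $G=\varphi\star w_{\mathbb C}$ is the complex Gaussian field $G_t=\int_{\mathbb R^2}\varphi(t,s)w_{\mathbb C}(s)\,ds$ (defined for almost all $t$), taken in a jointly measurable version; $\psi(G)$ denotes the random measure $B\mapsto\int_B\psi(G_t)\,dt$. Random fields on $\mathbb R^2$. A random field $X$ on $\mathbb R^2$ is a random locally finite signed Borel measure on $\mathbb R^2$ (a measurable map from a probability space to the space of such measures, with the $\sigma$-field generated by the evaluations $\nu\mapsto\nu(B)$, $B$ bounded Borel). Its value on $B$ is written $\int_B X_t\,dt$, and $\int_B|X_t|\,dt$ denotes its variation on $B$ (possibly infinite for unbounded $B$). An a.s. locally integrable random function $(X_t)_{t\in\mathbb R^2}$ is identified with the random measure $B\mapsto\int_B X_t\,dt$. Shifts and coordinate swaps such as $(X_{t_1+r,t_2})_{t_1,t_2}$, $(X_{t_2,t_1})_{t_1,t_2}$ are understood accordingly. Split: a split of $X$ is a triple $(X^0,X^-,X^+)$ of random fields on a common probability space (possibly different from that of $X$) such that $X^-,X^+$ are independent and $X,X^0,X^-,X^+$ are identically distributed. Its leak is the random field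 $Y$ with $Y_{t_1,t_2}=X^-_{t_1,t_2}-X^0_{t_1,t_2}$ for $t_1<0$ and $Y_{t_1,t_2}=X^+_{t_1,t_2}-X^0_{t_1,t_2}$ for $t_1\ge0$ (equality of the restricted signed measures). $Y$ is called a leak for $X$ if it is distributed like the leak of some split of $X$. Splittability on $\mathbb R^2$. ''Centered'' means $\mathbb E\int_A X_t\,dt=0$ for every bounded Borel $A\subset\mathbb R^2$. $X$ is $(1,1)$-splittable if: (a) $\mathbb E\exp\int_{[s,s+1)\times\mathbb R}|X_t|\,dt\le2$ for all $s\in\mathbb R$; (b) $X$ is centered; (c) for every $r\in\mathbb R$ there is a leak $Y$ for $(X_{t_1+r,t_2})_{t_1,t_2}$ with $\mathbb E\exp\int_{\mathbb R^2}|Y_t|\,dt\le2$. $X$ is $1$-splittable (that is, $(1,2)$-splittable) if: (a) $\mathbb E\exp\int_{[s_1,s_1+1)\times[s_2,s_2+1)}|X_t|\,dt\le2$ for all $s_1,s_2\in\mathbb R$; (b) $X$ is centered; (c) for every $r\in\mathbb R$ there is a leak $Y$ for $(X_{t_1+r,t_2})_{t_1,t_2}$ such that $(Y_{t_2,t_1})_{t_1,t_2}$ is $(1,1)$-splittable, and there is a leak $Y'$ for $(X_{t_2,t_1+r})_{t_1,t_2}$ such that $(Y'_{t_2,t_1})_{t_1,t_2}$ is $(1,1)$-splittable. $X$ is $C$-splittable if $\frac1C X$ is $1$-splittable; $X$ is splittable if it is $C$-splittable for some $C\in(0,\infty)$. *)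

(* Defs.v *)
From HB Require Import structures.
From mathcomp Require Import all_boot all_order all_algebra.
From mathcomp Require Import all_classical all_reals all_analysis.
From mathcomp Require Import measurable_realfun.
From mathcomp Require Import complex.

Set Implicit Arguments.
Unset Strict Implicit.
Unset Printing Implicit Defensive.

Import Order.TTheory GRing.Theory Num.Theory.
Import numFieldNormedType.Exports.
Import Normc.

Local Open Scope classical_set_scope.
Local Open Scope complex_scope.
Local Open Scope ring_scope.
Local Open Scope ereal_scope.

Notation plane R := (measurableTypeR R * measurableTypeR R)%type.

Section lebesgue_on_the_plane.
Context {R : realType}.

Definition leb2 : set (plane R) -> \bar R :=
  @lebesgue_measure R \x @lebesgue_measure R.

HB.instance Definition _ := Measure.on leb2.

Let leb2_sigma_finite : sigma_finite setT leb2.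
Proof.
have /sigma_finiteP[F [TF ndF Foo]] := sigma_finiteT (@lebesgue_measure R).
exists (fun n => F n `*` F n).
  rewrite -setXTT TF predeqE => -[x y]; split.
    move=> [/= [n _ Fnx] [k _ Gky]]; exists (maxn n k) => //; split.
    - by move: x Fnx; exact/subsetPset/ndF/leq_maxl.
    - by move: y Gky; exact/subsetPset/ndF/leq_maxr.
  by move=> [n _ []/= ? ?]; split; exists n.
move=> k; have [? ?] := Foo k; split; first exact: measurableX.
by rewrite [ltLHS]product_measure1E// lte_mul_pinfty// ge0_fin_numE.
Qed.

HB.instance Definition _ :=
  Measure_isSigmaFinite.Build _ _ _ leb2 leb2_sigma_finite.

Definition euclid (u : plane R) : R := Num.sqrt (u.1 ^+ 2 + u.2 ^+ 2).

(* The norm that MathComp-Analysis puts on a product is the max norm; it has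
   the same bounded sets as the Euclidean one. *)
Definition bounded_borel (B : set (plane R)) : Prop :=
  measurable B /\ bounded_set B.

Lemma bounded_coord (B : set (plane R)) : bounded_set B <->
  exists M : R, forall u, B u -> (`|u.1 : R| <= M)%R /\ (`|u.2 : R| <= M)%R.
Proof.
split=> [[M [_ /(_ (M + 1)%R)]]|[M BM]].
  rewrite ltrDl => /(_ ltr01) BM; exists (M + 1)%R => u /BM /=.
  by rewrite prod_normE ge_max => /andP[].
exists M; split; first exact: num_real.
move=> N /ltW MN u /BM[u1 u2] /=.
by rewrite prod_normE ge_max !(le_trans _ MN).
Qed.

End lebesgue_on_the_plane.

(* Measurability for the completion of mu. The underlying integral is a
   supremum over measurable simple functions lying below the (positive part of
   the) integrand, so it also gives the usual value on such functions. *)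
Definition completion_measurable d d' (T : measurableType d)
    (U : measurableType d') (R : realType) (mu : set T -> \bar R)
    (f : T -> U) : Prop :=
  forall B, measurable B -> completed_algebra_gen mu (f @^-1` B).

Section complex_plane.
Context {R : realType}.

Definition plane_of_C (z : R[i]) : plane R := (complex.Re z, complex.Im z).

Definition C_of_plane (u : plane R) : R[i] := u.1 +i* u.2.

End complex_plane.

(* The bounded Borel sets form a ring of sets. A locally finite signed Borel
   measure is a charge on this ring; outside the ring its values are
   irrelevant. *)
Definition bplane (R : realType) : Type := plane R.

Section bounded_borel_ring.
Context {R : realType}.

HB.instance Definition _ := Pointed.on (bplane R).

Definition bplane_display : measure_display.
Proof. by constructor. Qed.

Let bounded_borel0 : @bounded_borel R set0.
Proof. by split; [exact: measurable0|apply/bounded_coord; exists 0%R]. Qed.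

Let bounded_borelU : setU_closed (@bounded_borel R).
Proof.
move=> A B [mA bA] [mB bB]; split; first exact: measurableU.
move/bounded_coord : bA => [M MA]; move/bounded_coord : bB => [N NB].
apply/bounded_coord; exists (Num.max M N) => u.
by case=> [/MA|/NB] [u1 u2]; split; rewrite le_max ?u1 ?u2 ?orbT.
Qed.

Let bounded_borelD : setD_closed (@bounded_borel R).
Proof.
move=> A B [mA bA] [mB bB]; split; first exact: measurableD.
move/bounded_coord : bA => [M MA].
by apply/bounded_coord; exists M => u [/MA].
Qed.

HB.instance Definition _ := @isRingOfSets.Build bplane_display (bplane R)
  (@bounded_borel R) bounded_borel0 bounded_borelU bounded_borelD.

End bounded_borel_ring.

Definition signed_measure (R : realType) : Type :=
  {charge set (bplane R) -> \bar R}.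

Section signed_measure_space.
Context {R : realType}.

HB.instance Definition _ := gen_eqMixin (signed_measure R).
HB.instance Definition _ := gen_choiceMixin (signed_measure R).
HB.instance Definition _ := isPointed.Build (signed_measure R)
  (@czero _ (bplane R) R).

Definition signed_measure_ev (nu : signed_measure R) (B : set (plane R)) :
  \bar R := nu B.

Definition signed_measure_measurable : set (set (signed_measure R)) :=
  <<s \bigcup_(B in @bounded_borel R)
        preimage_set_system setT (signed_measure_ev ^~ B) measurable >>.

Let signed_measure_measurable0 : signed_measure_measurable set0.
Proof. exact: sigma_algebra0. Qed.

Let signed_measure_measurableC (U : set (signed_measure R)) :
  signed_measure_measurable U -> signed_measure_measurable (~` U).
Proof. exact: sigma_algebraC. Qed.

Let signed_measure_measurableU (F : (set (signed_measure R))^nat) :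
  (forall i, signed_measure_measurable (F i)) ->
  signed_measure_measurable (\bigcup_i F i).
Proof. exact: sigma_algebra_bigcup. Qed.

Definition signed_measure_display : measure_display.
Proof. by constructor. Qed.

HB.instance Definition _ :=
  @isMeasurable.Build signed_measure_display (signed_measure R)
    signed_measure_measurable signed_measure_measurable0
    signed_measure_measurableC signed_measure_measurableU.

(* |nu|(B); the pieces are bounded, but B may be any Borel set. *)
Definition variation (nu : signed_measure R) (B : set (plane R)) : \bar R :=
  ereal_sup [set s | exists (n : nat) (F : nat -> set (plane R)),
    [/\ forall i, bounded_borel (F i), forall i, F i `<=` B,
        trivIset setT F & s = \sum_(i < n) `|nu (F i)|]].

End signed_measure_space.

Section image_of_a_signed_measure.
Context {R : realType} (g : plane R -> plane R)
  (mg : forall B, bounded_borel B -> bounded_borel (g @^-1` B))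
  (nu : signed_measure R).

Definition image_charge (B : set (bplane R)) : \bar R := nu (g @^-1` B).

Let image_charge0 : image_charge set0 = 0.
Proof. by rewrite /image_charge preimage_set0 charge0. Qed.

Let image_charge_finite B : measurable B -> image_charge B \is a fin_num.
Proof. by move=> mB; apply: fin_num_measure; exact: mg mB. Qed.

Let image_charge_sigma_additive : semi_sigma_additive image_charge.
Proof.
move=> F mF tF mUF; rewrite /image_charge preimage_bigcup.
apply: charge_semi_sigma_additive.
- by move=> n; exact: mg (mF n).
- apply/trivIsetP => /= i j _ _ ij; rewrite -preimage_setI.
  by move/trivIsetP : tF => /(_ _ _ _ _ ij) ->//; rewrite preimage_set0.
- by rewrite -preimage_bigcup; exact: mg mUF.
Qed.

HB.instance Definition _ := isCharge.Build _ _ _ image_charge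
  image_charge0 image_charge_finite image_charge_sigma_additive.

Definition image_signed_measure : signed_measure R := image_charge.

End image_of_a_signed_measure.

Section shift_and_swap.
Context {R : realType}.

Lemma shift_bounded_borel (r : R) (B : set (plane R)) : bounded_borel B ->
  bounded_borel ((fun u : plane R => (u.1 - r, u.2)%R) @^-1` B).
Proof.
move=> [mB /bounded_coord[M BM]]; split.
  rewrite -[X in measurable X]setTI.
  suff mg : measurable_fun setT (fun u : plane R => (u.1 - r, u.2)%R).
    exact: mg.
  apply/measurable_fun_pair => /=; last exact: measurable_snd.
  by apply: measurable_funB => //; exact: measurable_fst.
apply/bounded_coord; exists (M + `|r|)%R => u /BM /= [u1 u2]; split.
  rewrite -[X in `|X|%R](subrK r) (le_trans (ler_normD _ _))//.
  by rewrite lerD2r.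
by rewrite (le_trans u2)// lerDl.
Qed.

Lemma swap_bounded_borel (B : set (plane R)) : bounded_borel B ->
  bounded_borel ((fun u : plane R => (u.2, u.1)) @^-1` B).
Proof.
move=> [mB /bounded_coord[M BM]]; split.
  rewrite -[X in measurable X]setTI.
  suff mg : measurable_fun setT (fun u : plane R => (u.2, u.1)).
    exact: mg.
  by apply/measurable_fun_pair => /=;
    [exact: measurable_snd|exact: measurable_fst].
by apply/bounded_coord; exists M => u /BM /= [].
Qed.

(* The field (X_(t1 + r, t2)) has value X (B + (r, 0)) on B. *)
Definition shift1 (r : R) (nu : signed_measure R) : signed_measure R :=
  image_signed_measure (@shift_bounded_borel r) nu.

Definition swap (nu : signed_measure R) : signed_measure R :=
  image_signed_measure swap_bounded_borel nu.

End shift_and_swap.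

Section splittability.
Context {R : realType}.

Definition same_law d d' (T : measurableType d) (T' : measurableType d')
    (P : probability T R) (P' : probability T' R)
    (X : T -> signed_measure R) (X' : T' -> signed_measure R) : Prop :=
  forall A, measurable A -> pushforward P X A = pushforward P' X' A.

Definition independent d (T : measurableType d) (P : probability T R)
    (X Y : T -> signed_measure R) : Prop :=
  forall A B, measurable A -> measurable B ->
    P (X @^-1` A `&` Y @^-1` B) = P (X @^-1` A) * P (Y @^-1` B).

Definition is_split d d' (T : measurableType d) (T' : measurableType d')
    (P : probability T R) (X : T -> signed_measure R)
    (Q : probability T' R) (X0 Xm Xp : T' -> signed_measure R) : Prop :=
  [/\ [/\ measurable_fun setT X0, measurable_fun setT Xm
        & measurable_fun setT Xp],
      independent Q Xm Xp
    & [/\ same_law Q P X0 X, same_law Q P Xm X & same_law Q P Xp X]].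

Definition is_leak_of_split d (T : measurableType d)
    (X0 Xm Xp Y : T -> signed_measure R) : Prop :=
  forall w (B : set (plane R)), bounded_borel B ->
    (B `<=` [set t | (t.1 < 0)%R] -> Y w B = Xm w B - X0 w B) /\
    (B `<=` [set t | (0 <= t.1)%R] -> Y w B = Xp w B - X0 w B).

Definition is_leak d d' (T : measurableType d) (T' : measurableType d')
    (P : probability T R) (X : T -> signed_measure R)
    (P' : probability T' R) (Y : T' -> signed_measure R) : Prop :=
  measurable_fun setT Y /\
  exists d0 (S : measurableType d0) (Q : probability S R)
      (X0 Xm Xp Z : S -> signed_measure R),
    [/\ is_split P X Q X0 Xm Xp, measurable_fun setT Z,
        is_leak_of_split X0 Xm Xp Z & same_law P' Q Y Z].

(* If the integral vanishes then X w A is integrable: the positive and the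
   negative part have the same integral, and +oo - +oo is -oo. *)
Definition centered d (T : measurableType d) (P : probability T R)
    (X : T -> signed_measure R) : Prop :=
  forall A : set (plane R), bounded_borel A -> \int[P]_w X w A = 0.

Definition exp_variation d (T : measurableType d) (P : probability T R)
    (X : T -> signed_measure R) (B : set (plane R)) : \bar R :=
  \int[P]_w expeR (variation (X w) B).

Definition splittable11 d (T : measurableType d) (P : probability T R)
    (X : T -> signed_measure R) : Prop :=
  [/\ forall s : R, exp_variation P X (`[s, (s + 1)%R[%classic `*` setT) <= 2%:E,
      centered P X
    & forall r : R,
        exists d' (T' : measurableType d') (P' : probability T' R)
            (Y : T' -> signed_measure R),
          is_leak P (shift1 r \o X) P' Y /\ exp_variation P' Y setT <= 2%:E].

Definition splittable12 d (T : measurableType d) (P : probability T R)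
    (X : T -> signed_measure R) : Prop :=
  [/\ forall s1 s2 : R, exp_variation P X
        (`[s1, (s1 + 1)%R[%classic `*` `[s2, (s2 + 1)%R[%classic) <= 2%:E,
      centered P X
    & forall r : R,
        (exists d' (T' : measurableType d') (P' : probability T' R)
            (Y : T' -> signed_measure R),
          is_leak P (shift1 r \o X) P' Y /\ splittable11 P' (swap \o Y)) /\
        (* shift1 r (swap X) is the field (X_(t2, t1 + r)) *)
        (exists d' (T' : measurableType d') (P' : probability T' R)
            (Y : T' -> signed_measure R),
          is_leak P (shift1 r \o swap \o X) P' Y /\
          splittable11 P' (swap \o Y))].

Definition C_splittable (C : R) d (T : measurableType d)
    (P : probability T R) (X : T -> signed_measure R) : Prop :=
  splittable12 P (fun w => cscale (C^-1)%R (X w) : signed_measure R).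

Definition splittable d (T : measurableType d) (P : probability T R)
    (X : T -> signed_measure R) : Prop :=
  exists2 C : R, (0 < C)%R & C_splittable C P X.

End splittability.

Section white_noise.
Context {R : realType}.

Definition square_integrable (f : plane R -> R) : Prop :=
  completion_measurable leb2 f /\ \int[leb2]_s ((f s) ^+ 2)%:E < +oo.

Definition L2norm (f : plane R -> R) : R :=
  Num.sqrt (fine (\int[leb2]_s ((f s) ^+ 2)%:E)).

(* normal_prob m 0 is not the Dirac mass at m. *)
Definition centered_gaussian_law (s : R) (B : set R) : \bar R :=
  if s == 0%R then @dirac _ (measurableTypeR R) 0%R R B else normal_prob 0%R s B.

Definition centered_gaussian d (T : measurableType d) (P : probability T R)
    (x : T -> R) (s : R) : Prop :=
  forall B : set R, measurable B -> P (x @^-1` B) = centered_gaussian_law s B.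

(* Joint Gaussianity: every linear combination is Gaussian. *)
Record is_white_noise d (T : measurableType d) (P : probability T R)
    (w : (plane R -> R) -> T -> R) : Prop := {
  white_noise_measurable : forall f, square_integrable f ->
    measurable_fun setT (w f) ;
  white_noise_linear : forall (a : R) f g,
    square_integrable f -> square_integrable g ->
    \forall o \ae P, (w (fun s => a * f s + g s) o = a * w f o + w g o)%R ;
  white_noise_jointly_gaussian :
    forall n (f : 'I_n -> plane R -> R) (c : 'I_n -> R),
    (forall i, square_integrable (f i)) ->
    exists s : R,
      centered_gaussian P (fun o => \sum_(i < n) c i * w (f i) o)%R s ;
  white_noise_variance : forall f, square_integrable f ->
    centered_gaussian P (w f) (L2norm f) }.

Definition noise_sigma_field d (T : measurableType d)
    (w : (plane R -> R) -> T -> R) : set (set T) :=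
  <<s [set w f @^-1` B | f in square_integrable
                       & B in (measurable : set (set R))] >>.

Definition independent_noises d (T : measurableType d) (P : probability T R)
    (w1 w2 : (plane R -> R) -> T -> R) : Prop :=
  forall A B, noise_sigma_field w1 A -> noise_sigma_field w2 B ->
    P (A `&` B) = P A * P B.

(* The integral of f with respect to (w1 + i w2) / sqrt 2. *)
Definition complex_noise (T : Type) (w1 w2 : (plane R -> R) -> T -> R)
    (f : plane R -> R[i]) (o : T) : R[i] :=
  let wf (w : (plane R -> R) -> T -> R) : R[i] :=
    w (fun s => complex.Re (f s)) o +i* w (fun s => complex.Im (f s)) o in
  (((Num.sqrt 2)^-1)%:C * (wf w1 + (0 +i* 1) * wf w2))%R.

(* A jointly measurable version of the field phi * w_C. *)
Definition is_complex_gaussian_field d (T : measurableType d)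
    (P : probability T R) (w1 w2 : (plane R -> R) -> T -> R)
    (phi : plane R -> plane R -> R[i]) (G : plane R -> T -> R[i]) : Prop :=
  measurable_fun setT (fun p : plane R * T => plane_of_C (G p.1 p.2)) /\
  \forall t \ae leb2, \forall o \ae P, G t o = complex_noise w1 w2 (phi t) o.

(* nu is the signed measure B |-> \int_B f(t) dt *)
Definition has_density (f : plane R -> R) (nu : signed_measure R) : Prop :=
  [/\ completion_measurable leb2 f,
      forall B, bounded_borel B -> \int[leb2]_(t in B) `|f t|%:E < +oo
    & forall B, bounded_borel B -> nu B = \int[leb2]_(t in B) (f t)%:E].

End white_noise.

(* Main.v *)
Require Import Defs.
From HB Require Import structures.
From mathcomp Require Import all_boot all_order all_algebra finmap.
From mathcomp Require Import all_classical all_reals all_analysis.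
From mathcomp Require Import measurable_realfun ess_sup_inf complex.
From mathcomp Require Import lra ring.

(** The kernel phi and the observable psi are first replaced by Borel versions that
    satisfy the decay and normalization everywhere. The field is then a fixed
    measurable function of an isonormal process Z on complex L2, and a split is
    realized on a product space by Z^- (f) = Z(f, 0), Z^+ (f) = Z(0, f) and
    Z^0 (f) = Z(f 1_L, f 1_{L^c}), where L is the half-plane; iterating on four
    copies of Z gives the leaks of leaks. All bounds come from one estimate: if two
    isonormal processes A and B have E A(f) B(g) = <f 1_E, g>, then
    E exp (c int_D |psi(A_t) - psi(B_t)| dt) is bounded as soon as the distance
    from t in D to the complement of E grows linearly in |t|. By Jensen's
    inequality it is enough to sum over the points t of a sparse lattice. There the
    sums A_t + B_t have a diagonally dominant Gram matrix, so they contain independent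
    complex Gaussian summands, which are integrated out with the Hoelder hypothesis on
    psi. What remains is E exp (C sum |A_t - B_t|^delta), where the variance of
    A_t - B_t decays polynomially in t; the sum of the delta-th powers of the standard
    deviations over the lattice converges because alpha > 2 (1 + 2 / delta). *)

Set Implicit Arguments.
Unset Strict Implicit.
Unset Printing Implicit Defensive.

Import Order.TTheory GRing.Theory Num.Theory.
Import numFieldNormedType.Exports.
Import Normc HBSimple HBNNSimple.

Local Open Scope classical_set_scope.
Local Open Scope complex_scope.
Local Open Scope ring_scope.

(** The form (f, g) |-> <f 1_E, g> is symmetric, so every sum S = A + B is uncorrelated with every
    difference D = A - B. Since A_t and B_t are (S_t + D_t)/2 and (S_t - D_t)/2, the Hoelder
    hypothesis applies with D_t as y, an independent summand of S_t as x and the rest of S_t as h.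
    The obstacle is that the values at different t are dependent, so that this cannot be done for
    all t at once; a lattice of large spacing, averaged over its offset, leaves enough independence.

    The exponent arises as follows. The variance of D_t is the mass of the kernel off E, which is
    O(|t|^-p) for p < alpha - 2; its power delta/2 is summable over a planar lattice when p delta /
    2 > 2. Some p satisfies both conditions exactly when alpha > 2 + 4/delta.

    The resulting bound depends on the constants of the kernel and of psi only, so a single small
    factor brings all comparisons of fields below 2. As the fields of a split live on another
    probability space, the passage from noise to field is a function that does not depend on the
    noise, and laws are compared through Gram matrices. *)

Section nonnegative_functions.
Context d (T : measurableType d) (R : realType).
Implicit Types f g : T -> \bar R.
Local Open Scope ereal_scope.

(** A simple function is a finite combination of indicators of its level sets, and every nonnegative
    measurable function is an increasing limit of simple ones. *)
Lemma ge0_measurable_fun_ind (P : (T -> \bar R) -> Prop) :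
  (forall A, measurable A -> P (fun x => (\1_A x)%:E)) ->
  (forall (c : R) f, (0 <= c)%R -> measurable_fun setT f ->
    (forall x, 0 <= f x) -> P f -> P (fun x => c%:E * f x)) ->
  (forall f g, measurable_fun setT f -> measurable_fun setT g ->
    (forall x, 0 <= f x) -> (forall x, 0 <= g x) -> P f -> P g ->
    P (fun x => f x + g x)) ->
  (forall (F : nat -> T -> \bar R), (forall n, measurable_fun setT (F n)) ->
    (forall n x, 0 <= F n x) -> (forall x, nondecreasing_seq (F ^~ x)) ->
    (forall n, P (F n)) -> P (fun x => limn (F ^~ x))) ->
  forall f, measurable_fun setT f -> (forall x, 0 <= f x) -> P f.
Proof.
move=> P1 PZ PD Plim f mf f0.
have Ph (h : {nnsfun T >-> R}) : P (fun x => (h x)%:E).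
  have -> : (fun x => (h x)%:E) =
      fun x => (\sum_(y <- fset_set (range h)) (y * \1_(h @^-1` [set y]) x)%:E)%E.
    apply/funext => x; rewrite sumEFin; congr EFin. by rewrite [LHS]fimfunE fsbig_finite.
  have : {in fset_set (range h), forall y : R, (0 <= y)%R}.
    by move=> y; rewrite in_fset_set// inE => -[x _ <-].
  suff Ps (s : seq R) : {in s, forall y : R, (0 <= y)%R} ->
      P (fun x => (\sum_(y <- s) (y * \1_(h @^-1` [set y]) x)%:E)%E) by exact: Ps.
  elim: s => [|y s IH] s0.
    under eq_fun do rewrite big_nil.
    have := P1 set0 measurable0.
    by under eq_fun do rewrite indic0.
  under eq_fun do rewrite big_cons.
  have y0 : (0 <= y)%R by apply: s0; rewrite inE eqxx.
  have s0' : {in s, forall y, (0 <= y)%R}.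
    by move=> z zs; apply: s0; rewrite inE zs orbT.
  have my z : measurable (h @^-1` [set z]) by [].
  apply: PD; last exact: IH.
  - apply/measurable_EFinP; apply: measurable_funM => //.
  - apply: emeasurable_sum => z; apply/measurable_EFinP.
    by apply: measurable_funM.
  - by move=> x; rewrite lee_fin mulr_ge0.
  - move=> x; rewrite big_seq; apply: sume_ge0 => z /s0' z0.
    by rewrite lee_fin mulr_ge0.
  - under eq_fun do rewrite EFinM.
    by apply: PZ => //; [apply/measurable_EFinP|exact: P1].
pose h := nnsfun_approx measurableT mf.
have -> : f = fun x => limn ((fun n x => (h n x)%:E) ^~ x).
  apply/funext => x; apply/esym/cvg_lim => //.
  exact: (cvg_nnsfun_approx measurableT mf (fun x _ => f0 x)).
apply: Plim => //.
- by move=> n; apply/measurable_EFinP.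
- by move=> n x; rewrite lee_fin.
- move=> x m n mn; rewrite lee_fin.
  by have /lefP := nd_nnsfun_approx measurableT mf mn; apply.
Qed.

Lemma ge0_integral_density (mu nu : {measure set T -> \bar R}) (p : T -> R) :
  measurable_fun setT p -> (forall x, 0 <= p x)%R ->
  (forall A, measurable A -> nu A = \int[mu]_(x in A) (p x)%:E) ->
  forall f, measurable_fun setT f -> (forall x, 0 <= f x) ->
  \int[nu]_x f x = \int[mu]_x (f x * (p x)%:E).
Proof.
move=> mp p0 nuE; apply: ge0_measurable_fun_ind.
- move=> A mA; rewrite integral_indic// setIT nuE// integral_mkcond.
  apply: eq_integral => x _; rewrite patchE indicE.
  by case: ifPn; rewrite ?mul1e ?mul0e.
- move=> c f c0 mf f0 IH.
  rewrite ge0_integralZl//.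
  under [RHS]eq_integral do rewrite -muleA.
  rewrite [RHS]ge0_integralZl ?IH//.
  + by apply: emeasurable_funM => //; apply/measurable_EFinP.
  + by move=> x _; rewrite mule_ge0// lee_fin.
- move=> f g mf mg f0 g0 IHf IHg.
  rewrite ge0_integralD// IHf IHg -ge0_integralD//.
  + by apply: eq_integral => x _; rewrite ge0_muleDl.
  + by move=> x _; rewrite mule_ge0// lee_fin.
  + by apply: emeasurable_funM => //; apply/measurable_EFinP.
  + by move=> x _; rewrite mule_ge0// lee_fin.
  + by apply: emeasurable_funM => //; apply/measurable_EFinP.
- move=> F mF F0 ndF IH.
  rewrite monotone_convergence//.
  transitivity (limn (fun n => \int[mu]_x (F n x * (p x)%:E))).
    by congr (limn _); apply/funext => n; exact: IH.
  rewrite -monotone_convergence//.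
  + apply: eq_integral => x _; rewrite muleC -limeMl//.
      by under eq_fun do rewrite muleC.
    by apply: ereal_nondecreasing_is_cvgn; exact: ndF.
  + by move=> n; apply: emeasurable_funM => //; apply/measurable_EFinP.
  + by move=> n x _; rewrite mule_ge0// lee_fin.
  + by move=> x _ m n mn; rewrite lee_wpmul2r ?lee_fin//; exact: ndF.
Qed.

End nonnegative_functions.

Section probability_integrals.
Context d (T : measurableType d) (R : realType) (P : probability T R).

Lemma bounded_integrable (f : T -> R) (M : R) : measurable_fun setT f ->
  (forall x, `|f x| <= M) -> P.-integrable setT (EFin \o f).
Proof.
move=> mf fM; apply: measurable_bounded_integrable => //.
  by rewrite ltey_eq fin_num_measure.
exists M; split; first exact: num_real.
by move=> N MN x _; apply: le_trans (fM x) (ltW MN).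
Qed.

End probability_integrals.

(** * Cosine integrals of the normal density *)

Section normal_cosine.
Context {R : realType}.
Local Notation mu := (@lebesgue_measure R).

(** The fundamental theorem of calculus on [-(n+1), n+1] followed by dominated convergence. This is
    the integration by parts behind the differential equation of the cosine integral. *)
Lemma Rintegral_derive_eq0 (F f : R -> R) :
  (forall x, is_derive x (1 : R) F (f x)) -> continuous f ->
  mu.-integrable setT (EFin \o f) ->
  (F n.+1%:R @[n --> \oo] --> 0) -> (F (- n.+1%:R) @[n --> \oo] --> 0) ->
  \int[mu]_x f x = 0.
Proof.
move=> dF cf fi F1 F2.
have mf := measurable_int _ fi.
have cF : continuous F.
  move=> x; apply: differentiable_continuous; apply/derivable1_diffP.
  by have [] := dF x.
have [] := @dominated_convergence _ _ _ mu setT measurableT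
    (fun n => EFin \o (f \_ `[- n.+1%:R, n.+1%:R])) (EFin \o f) (abse \o (EFin \o f)).
- move=> n; apply/measurable_EFinP; apply/measurable_restrict => //.
  by apply: measurable_funTS; apply/measurable_EFinP.
- by [].
- apply: aeW => x _; apply: cvg_near_cst.
  near=> n; rewrite /= patchE ifT//; apply/mem_set; rewrite /= in_itv/= -ler_norml.
  near: n; exists (Num.truncn `|x|) => // n /= xn.
  apply: ltW; apply: lt_le_trans (truncnS_gt _) _.
  by rewrite ler_nat ltnS.
- exact: integrable_abse.
- apply: aeW => x n _; rewrite /= patchE; case: ifPn => // _.
  by rewrite normr0 lee_fin.
move=> _ _ H.
rewrite /Rintegral; apply/EFin_inj; rewrite fineK; last exact: integrable_fin_num.
apply: (cvg_unique _ H) => //.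
have -> : (fun n => \int[mu]_x (EFin \o (f \_ `[(- n.+1%:R)%R, n.+1%:R%R])) x)%E =
    (fun n => (F n.+1%:R - F (- n.+1%:R))%:E).
  apply/funext => n.
  rewrite -[LHS](_ : (\int[mu]_(x in `[(- n.+1%:R)%R, n.+1%:R%R]) (f x)%:E)%E = _); last first.
    by rewrite integral_mkcond; apply: eq_integral => x _; rewrite /= !patchE; case: ifP.
  have lt0 : (- n.+1%:R < n.+1%:R :> R) by rewrite gtrN.
  rewrite (@continuous_FTC2 _ f F)//.
  - by apply: continuous_subspaceT.
  - split.
    + by move=> x _; have [] := dF x.
    + by apply: cvg_at_right_filter; exact: cF.
    + by apply: cvg_at_left_filter; exact: cF.
  - by move=> x _; rewrite derive1E; have [_] := dF x.
apply: cvg_EFin; first by apply: nearW.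
rewrite -(subr0 0).
exact: cvgB.
Unshelve. all: by end_near. Qed.

Lemma normal_pdf0E (s x : R) : s != 0 ->
  normal_pdf 0 s x = normal_peak s * expR (- x ^+ 2 / (s ^+ 2 *+ 2)).
Proof. by move=> s0; rewrite normal_pdfE// /normal_fun subr0. Qed.

Lemma is_derive_normal_pdf (s x : R) : s != 0 ->
  is_derive x (1 : R) (normal_pdf 0 s) (- (x / s ^+ 2) * normal_pdf 0 s x).
Proof.
move=> s0; have -> : normal_pdf 0 s = fun x : R =>
    normal_peak s * expR (- x ^+ 2 / (s ^+ 2 *+ 2)).
  by apply/funext => y; exact: normal_pdf0E.
apply: is_derive_eq.
rewrite /GRing.scale/= ?mulr0 ?add0r ?addr0 ?mulr1.
have s20 : s ^+ 2 != 0 by rewrite expf_eq0.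
by field.
Qed.

Lemma integrable_gauss (a : R) : 0 < a ->
  mu.-integrable setT (EFin \o (fun x => expR (- (a * x ^+ 2)))).
Proof.
move=> a0; pose s := Num.sqrt (a^-1 / 2).
have s2 : s ^+ 2 = a^-1 / 2 by rewrite sqr_sqrtr// divr_ge0// invr_ge0 ltW.
have s0 : s != 0 by rewrite sqrtr_eq0 -ltNge divr_gt0// invr_gt0.
have -> : EFin \o (fun x : R => expR (- (a * x ^+ 2))) =
   (fun x => (normal_peak s)^-1%:E * (normal_pdf 0 s x)%:E)%E.
  apply/funext => x; rewrite /= normal_pdf0E// -EFinM mulKf; last first.
    by rewrite gt_eqF// normal_peak_gt0.
  congr (expR _)%:E; rewrite s2 -mulr_natr divfK// invrK; lra.
by apply: integrableZl => //; exact: integrable_normal_pdf.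
Qed.

(** The exponent is cut in two equal halves: one absorbs |x| through 1 + y <= e^y, the other stays
    integrable. *)
Lemma integrable_normal_pdf1 (s : R) : s != 0 ->
  mu.-integrable setT (EFin \o (fun x => `|x| * normal_pdf 0 s x)).
Proof.
move=> s0.
have s20 : 0 < s ^+ 2 by rewrite exprn_even_gt0.
have mp := @measurable_normal_pdf R 0 s.
apply: (@le_integrable _ _ _ mu setT measurableT _
   (fun x => (normal_peak s * (1 + s ^+ 2))%:E *
     (expR (- ((s ^+ 2 *+ 4)^-1 * x ^+ 2)))%:E)%E).
- apply/measurable_EFinP; apply: measurable_funM => //.
- move=> x _ /=; rewrite lee_fin normrM normr_id.
  rewrite (ger0_norm (normal_pdf_ge0 _ _ _)) normal_pdf0E//.
  rewrite [leRHS]ger0_norm; last first.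
    by rewrite !mulr_ge0 ?expR_ge0 ?normal_peak_ge0 ?addr_ge0 ?sqr_ge0.
  rewrite mulrCA -!mulrA ler_wpM2l ?normal_peak_ge0//.
  have -> : - x ^+ 2 / (s ^+ 2 *+ 2) =
    - ((s ^+ 2 *+ 4)^-1 * x ^+ 2) - ((s ^+ 2 *+ 4)^-1 * x ^+ 2).
    have s21 : s ^+ 2 != 0 by rewrite gt_eqF.
    by field.
  rewrite expRD mulrCA (mulrC (1 + _)) ler_wpM2l ?expR_ge0//.
  set y := _^-1 * _; rewrite expRN ler_pdivrMr ?expR_gt0//.
  apply: (@le_trans _ _ ((1 + s ^+ 2) * (1 + y))); last first.
    by rewrite ler_wpM2l ?addr_ge0 ?sqr_ge0// expR_ge1Dx.
  have yE : x ^+ 2 = s ^+ 2 *+ 4 * y.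
    by rewrite /y mulrA divff ?mul1r// gt_eqF// pmulrn_lgt0.
  have y0 : 0 <= y by rewrite mulr_ge0 ?sqr_ge0// invr_ge0 pmulrn_lge0// ltW.
  rewrite -ler_sqr ?nnegrE ?mulr_ge0 ?addr_ge0 ?sqr_ge0//.
  rewrite ?real_normK ?num_real// yE.
  set u := s ^+ 2 in s20 *.
  rewrite -mulr_natl.
  nra.
- apply: integrableZl => //; apply: integrable_gauss.
  by rewrite invr_gt0 pmulrn_lgt0.
Qed.

(** Handles both boundary terms of the integration by parts; the sign [e] selects the end of the
    line. *)
Lemma normal_pdf_cvg0 (s : R) (e : bool) (f : R -> R) : s != 0 ->
  (forall x, `|f x| <= 1) ->
  (f ((-1) ^+ e * n.+1%:R) * normal_pdf 0 s ((-1) ^+ e * n.+1%:R)) @[n --> \oo] --> 0.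
Proof.
move=> s0 f1.
have s20 : 0 < s ^+ 2 by rewrite exprn_even_gt0.
apply: norm_cvg0.
pose c := normal_peak s * (s ^+ 2 *+ 2).
apply: (@squeeze_cvgr _ _ _ _ (cst 0) (fun n => c * harmonic n)).
- apply: nearW => n /=; rewrite normr_ge0/= normrM.
  apply: (@le_trans _ _ (normal_pdf 0 s ((-1) ^+ e * n.+1%:R))).
    by rewrite (ger0_norm (normal_pdf_ge0 _ _ _)) ler_piMl// normal_pdf_ge0.
  rewrite normal_pdf0E// exprMn sqrr_sign mul1r /c -mulrA.
  rewrite ler_wpM2l ?normal_peak_ge0// mulNr expRN.
  rewrite -[leRHS]invrK lef_pV2 ?posrE ?expR_gt0//; last first.
    by rewrite invr_gt0 mulr_gt0 ?invr_gt0// pmulrn_lgt0.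
  rewrite invfM invrK.
  apply: (@le_trans _ _ (n.+1%:R ^+ 2 / (s ^+ 2 *+ 2))); last first.
    by apply: le_trans (expR_ge1Dx _); rewrite lerDr.
  rewrite mulrC ler_wpM2r ?invr_ge0 ?mulrn_wge0 ?(ltW s20)// expr2.
  by rewrite ler_peMr// ler1n.
- exact: cvg_cst.
- rewrite -(mulr0 c); apply: cvgMr; exact: cvg_harmonic.
Qed.

(** Differentiating under the integral and integrating by parts gives J'(t) = - s^2 t J(t), so J(t)
    exp(s^2 t^2 / 2) is constant. The free phase b lets cosines alone carry the information of the
    complex characteristic function. *)
Lemma Rintegral_cos_normal_pdf (s t b : R) : s != 0 ->
  \int[mu]_x (cos (t * x + b) * normal_pdf 0 s x) =
  cos b * expR (- (s ^+ 2 * t ^+ 2 / 2)).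
Proof.
move=> s0.
have s20 : s ^+ 2 != 0 by rewrite expf_eq0.
have mp := @measurable_normal_pdf R 0 s.
pose J t := \int[mu]_x (cos (t * x + b) * normal_pdf 0 s x).
have maff (a : R) : measurable_fun setT (fun x : R => a * x + b).
  by apply: measurable_funD => //; exact: measurable_funM.
have ci a : mu.-integrable setT (EFin \o (fun x => cos (a * x + b) * normal_pdf 0 s x)).
  apply: (le_integrable measurableT _ _ (integrable_normal_pdf 0 s)).
    apply/measurable_EFinP; apply: measurable_funM => //.
    by apply: measurableT_comp (maff a); apply: continuous_measurable_fun; exact: continuous_cos.
  move=> x _ /=; rewrite lee_fin normrM ler_piMl//; exact: cos_max.
have si a : mu.-integrable setT
    (EFin \o (fun x => x * (sin (a * x + b) * normal_pdf 0 s x))).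
  apply: (le_integrable measurableT _ _ (integrable_normal_pdf1 s0)).
    apply/measurable_EFinP; apply: measurable_funM => //; apply: measurable_funM => //.
    by apply: measurableT_comp (maff a); apply: continuous_measurable_fun; exact: continuous_sin.
  move=> x _ /=; rewrite lee_fin !normrM normr_id ler_wpM2l//.
  by rewrite ler_piMl//; exact: sin_max.
have dJ a : is_derive a (1 : R) J (- (s ^+ 2 * a * J a)).
  have dcos u x : is_derive u (1 : R)
      (fun u => cos (u * x + b) * normal_pdf 0 s x)
      (- (x * (sin (u * x + b) * normal_pdf 0 s x))).
    apply: is_derive_eq.
    by rewrite /GRing.scale/= ?mulr0 ?add0r ?addr0 ?mulr1; ring.
  have H := @cvg_differentiation_under_integral R _ _ mu
    (fun u x => cos (u * x + b) * normal_pdf 0 s x) setT measurableT a (a - 1) (a + 1) _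
    (fun x _ => ci x) (fun u x _ _ => _) (fun x => `|x| * normal_pdf 0 s x) _
    (integrable_normal_pdf1 s0).
  have {}H : h^-1 *: (J (h + a) - J a) @[h --> 0^'] --> - (s ^+ 2 * a * J a).
    rewrite [X in _ --> X](_ : _ = \int[mu]_x
      (partial1of2 (fun u x => cos (u * x + b) * normal_pdf 0 s x) a x)); last first.
      have -> : (fun x => partial1of2 (fun u x => cos (u * x + b) * normal_pdf 0 s x) a x) =
         fun x => - (x * (sin (a * x + b) * normal_pdf 0 s x)).
        by apply/funext => x; rewrite partial1of2E; have [_] := dcos a x.
      (* The derivative of [F] is the difference of the two integrands to be identified, and [F]
         vanishes at both ends. *)
      pose F x := s ^+ 2 * (sin (a * x + b) * normal_pdf 0 s x).
      have : \int[mu]_x (s ^+ 2 * a * (cos (a * x + b) * normal_pdf 0 s x) -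
           x * (sin (a * x + b) * normal_pdf 0 s x)) = 0.
        apply: (@Rintegral_derive_eq0 F (fun x => s ^+ 2 * a * (cos (a * x + b) * normal_pdf 0 s x) -
           x * (sin (a * x + b) * normal_pdf 0 s x))).
        - move=> x; have := is_derive_normal_pdf x s0 => dp.
          apply: is_derive_eq.
          by rewrite /GRing.scale/= ?mulr0 ?add0r ?addr0 ?mulr1; field.
        - move=> x; apply: cvgB.
            apply: cvgMr; apply: cvgM; last exact: continuous_normal_pdf.
            apply: continuous_comp; last exact: continuous_cos.
            by apply: cvgD; [apply: cvgMr; exact: cvg_id|exact: cvg_cst].
          apply: cvgM; first exact: cvg_id.
          apply: cvgM; last exact: continuous_normal_pdf.
          apply: continuous_comp; last exact: continuous_sin.
          by apply: cvgD; [apply: cvgMr; exact: cvg_id|exact: cvg_cst].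
        - have := integrableB measurableT (integrableZl measurableT (s ^+ 2 * a) (ci a)) (si a).
          by apply: eq_integrable => // x _; rewrite /= EFinB EFinM.
        - rewrite -(mulr0 (s ^+ 2)); apply: cvgMr.
          have := @normal_pdf_cvg0 s false (fun x => sin (a * x + b)) s0 (fun x => sin_max _).
          by under eq_fun do rewrite mul1r.
        - rewrite -(mulr0 (s ^+ 2)); apply: cvgMr.
          have := @normal_pdf_cvg0 s true (fun x => sin (a * x + b)) s0 (fun x => sin_max _).
          by under eq_fun do rewrite mulN1r.
      rewrite RintegralB//; last first.
        by have := integrableZl measurableT (s ^+ 2 * a) (ci a); apply: eq_integrable.
      rewrite RintegralZl// => /eqP; rewrite subr_eq0 => /eqP ->.
      under [RHS]eq_Rintegral do rewrite -mulN1r.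
      by rewrite RintegralZl// mulN1r.
    apply: H.
    - by rewrite /= in_itv/= ltrBlDr !ltrDl ltr01.
    - by move=> u x; have [] := dcos u x.
    - by move=> x; rewrite mulr_ge0// normal_pdf_ge0.
    - move=> u x _ _; rewrite partial1of2E; have [_ ->] := dcos u x.
      rewrite normrN !normrM (ger0_norm (normal_pdf_ge0 _ _ _)) ler_wpM2l//.
      by rewrite ler_piMl ?normal_pdf_ge0//; exact: sin_max.
  apply: DeriveDef.
    apply/cvg_ex; exists (- (s ^+ 2 * a * J a)).
    by under eq_fun do rewrite scaler1.
  rewrite /derive; apply: cvg_lim => //.
  by under eq_fun do rewrite scaler1.
pose K t := J t * expR (s ^+ 2 * t ^+ 2 / 2).
have KE : K t = K 0.
  apply: is_derive_0_is_cst => x; have := dJ x => dJx.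
  apply: is_derive_eq.
  by rewrite /GRing.scale/= ?mulr0 ?add0r ?addr0 ?mulr1; field.
have J0 : J 0 = cos b.
  rewrite /J; under eq_Rintegral do rewrite mul0r add0r.
  rewrite RintegralZl//; last exact: integrable_normal_pdf.
  by rewrite /Rintegral integral_normal_pdf mulr1.
move: KE; rewrite /K J0 expr0n/= mulr0 mul0r expR0 mulr1 => <-.
by rewrite -[RHS]mulrA -expRD subrr expR0 mulr1.
Qed.

End normal_cosine.

(** * Indicators of intervals as limits of averaged cosines *)

Section dominated_Fubini.
Context d (T : measurableType d) d' (U : measurableType d') (R : realType).
Context (P : probability T R) (mu : {sigma_finite_measure set U -> \bar R}).
Variables (f : T * U -> R) (p : U -> R) (M : R).
Hypotheses (mf : measurable_fun setT f) (pi : mu.-integrable setT (EFin \o p)).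
Hypothesis fp : forall x y, `|f (x, y)| <= M * p y.

Lemma dominated_integrable2 x : mu.-integrable setT (fun y => (f (x, y))%:E).
Proof.
have /= pMi := integrableZl measurableT M pi.
apply: (le_integrable measurableT _ _ pMi).
  by apply/measurable_EFinP; exact: measurableT_comp.
by move=> y _; rewrite /= lee_fin; apply: le_trans (fp x y) (ler_norm _).
Qed.

Lemma dominated_integrable1 y : P.-integrable setT (fun x => (f (x, y))%:E).
Proof.
apply: (@bounded_integrable _ _ _ _ _ (M * p y)) => //.
exact: measurableT_comp.
Qed.

Lemma dominated_Fubini :
  \int[P]_x \int[mu]_y f (x, y) = \int[mu]_y \int[P]_x f (x, y).
Proof.
have M0 x : (\int[mu]_y `|(f (x, y))%:E| <= \int[mu]_y (M * p y)%:E)%E.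
  apply: ge0_le_integral => //.
  - by apply/measurable_EFinP; apply: measurableT_comp => //; exact: measurableT_comp.
  - by apply/measurable_EFinP; apply: measurable_funM => //; apply/measurable_EFinP;
      exact: measurable_int pi.
  - by move=> y _; rewrite lee_fin.
transitivity (fine (\int[P]_x \int[mu]_y (f (x, y))%:E)%E).
  congr fine; apply: eq_integral => x _.
  by rewrite fineK// integrable_fin_num//; exact: dominated_integrable2.
rewrite (@Fubini _ _ _ _ _ P mu (fun z => (f z)%:E)).
  congr fine; apply: eq_integral => y _.
  by rewrite fineK// integrable_fin_num//; exact: dominated_integrable1.
apply/integrable12ltyP; first exact/measurable_EFinP.
have /= pMi := integrable_fin_num measurableT (integrableZl measurableT M pi).
apply: (@le_lt_trans _ _ (\int[P]_x \int[mu]_y (M * p y)%:E)%E).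
  apply: ge0_le_integral => //.
  - by move=> x _; apply: integral_ge0.
  - apply: (measurable_fun_fubini_tonelli_F (fun z => `|(f z)%:E|)%E) => //.
    exact/measurable_EFinP/measurableT_comp.
  - by move=> x _; exact: M0.
rewrite integral_cst//= -ge0_fin_numE; last first.
  rewrite mule_ge0//; apply: integral_ge0 => y _; rewrite lee_fin.
  by apply: le_trans (fp point y).
by rewrite fin_numM// fin_num_measure.
Qed.

End dominated_Fubini.

Section interval_approximation.
Context {R : realType}.
Local Notation mu := (@lebesgue_measure R).

Lemma normal_peak_sqrt2 (s : R) :
  normal_peak s = Num.sqrt 2 * normal_peak (Num.sqrt 2 * s).
Proof.
rewrite /normal_peak exprMn sqr_sqrtr//.
have -> : 2 * s ^+ 2 * pi *+ 2 = 2 * (s ^+ 2 * pi *+ 2) by rewrite -mulrA mulrnAr.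
rewrite [in RHS]sqrtrM//.
by rewrite invfM mulrA mulfV ?mul1r// gt_eqF// sqrtr_gt0.
Qed.

(** Half of the exponent is estimated by exp(-y) <= 1/y, which gives 4 (s/e)^2; the other half is,
    up to the factor sqrt 2, the density of deviation sqrt 2 s. *)
Lemma normal_tail (s e x : R) (A : set (measurableTypeR R)) : s != 0 -> 0 < e -> measurable A ->
  (forall z, A z -> e <= `|z - x|) ->
  \int[mu]_(z in A) normal_pdf x s z <= Num.sqrt 2 * 4 * (s / e) ^+ 2.
Proof.
move=> s0 e0 mA Ae.
have s20 : 0 < s ^+ 2 by rewrite exprn_even_gt0.
set s' := Num.sqrt 2 * s.
have s'0 : s' != 0 by rewrite mulf_eq0 negb_or s0 andbT gt_eqF// sqrtr_gt0.
have ip := integrable_normal_pdf x.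
have iA t : mu.-integrable A (EFin \o normal_pdf x t).
  by apply: (integrableS measurableT) (ip t).
pose c := Num.sqrt 2 * 4 * (s / e) ^+ 2.
have c0 : 0 <= c by rewrite mulr_ge0 ?sqr_ge0// mulr_ge0 ?sqrtr_ge0.
apply: (@le_trans _ _ (\int[mu]_(z in A) (c * normal_pdf x s' z))).
  apply: le_Rintegral => //.
    by have := integrableZl mA c (iA s'); apply: eq_integrable.
  move=> z Az; rewrite !normal_pdfE// /normal_fun normal_peak_sqrt2 -/s'.
  rewrite /c -[leLHS]mulrA -[leRHS]mulrA -[leRHS]mulrA ler_wpM2l ?sqrtr_ge0//.
  rewrite mulrA [leRHS]mulrCA.
  rewrite ler_wpM2l ?normal_peak_ge0//.
  have -> : - (z - x) ^+ 2 / (s ^+ 2 *+ 2) =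
     - ((z - x) ^+ 2 / (s ^+ 2 *+ 4)) - (z - x) ^+ 2 / (s' ^+ 2 *+ 2).
    have s21 : s ^+ 2 != 0 by rewrite gt_eqF.
    by rewrite /s' exprMn sqr_sqrtr//; field.
  rewrite mulNr expRD ler_wpM2r ?expR_ge0//.
  rewrite expRN -[leRHS]invrK lef_pV2 ?posrE ?expR_gt0//; last first.
    by rewrite invr_gt0 mulr_gt0// exprn_even_gt0//= mulf_neq0// invr_eq0 gt_eqF.
  apply: (@le_trans _ _ ((z - x) ^+ 2 / (s ^+ 2 *+ 4))); last first.
    by apply: le_trans (expR_ge1Dx _); rewrite lerDr.
  have -> : (4 * (s / e) ^+ 2)^-1 = e ^+ 2 / (s ^+ 2 *+ 4).
    by field; rewrite ?s0 ?(gt_eqF e0).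
  rewrite ler_wpM2r//; first by rewrite invr_ge0 pmulrn_lge0// ltW.
  by rewrite -[leRHS]real_normK ?num_real// ler_sqr ?nnegrE ?(ltW e0)//; exact: Ae.
rewrite RintegralZl// -[leRHS]mulr1 ler_wpM2l//.
rewrite -lee_fin /Rintegral fineK; last by apply: integrable_fin_num => //; exact: iA.
rewrite -(integral_normal_pdf x s'); apply: ge0_subset_integral => //.
- by apply/measurable_EFinP; exact: measurable_normal_pdf.
- by move=> z _; rewrite lee_fin normal_pdf_ge0.
Qed.

Definition itv_approx (u v : R) n : set (measurableTypeR R) := `[u + n.+1%:R^-1, v - n.+1%:R^-1].

Lemma measurable_itv_approx u v n : measurable (itv_approx u v n).
Proof. exact: measurable_itv. Qed.
Local Hint Resolve measurable_itv_approx : core.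

(** The deviation (n+1)^-2 is negligible against the margin 1/(n+1) by which [itv_approx] shrinks
    the interval. Hence the mollified indicator tends to 0 at the endpoints u and v as well, and the
    limit is the indicator of the open interval. *)
Definition approx_sd n : R := n.+1%:R ^- 2.

Definition itv_mollifier (u v : R) n (x : R) : R :=
  \int[mu]_(z in itv_approx u v n) normal_pdf x (approx_sd n) z.

Lemma approx_sd_neq0 n : approx_sd n != 0.
Proof. by rewrite invr_eq0 expf_eq0/= pnatr_eq0. Qed.

Lemma itv_mollifier_bounds u v n x : 0 <= itv_mollifier u v n x <= 1.
Proof.
apply/andP; split.
  by apply: Rintegral_ge0 => z _; exact: normal_pdf_ge0.
rewrite -lee_fin /itv_mollifier /Rintegral fineK; last first.
  apply: integrable_fin_num => //.
  by apply: (integrableS measurableT) (integrable_normal_pdf x (approx_sd n)).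
rewrite -(integral_normal_pdf x (approx_sd n)); apply: ge0_subset_integral => //.
- by apply/measurable_EFinP; exact: measurable_normal_pdf.
- by move=> z _; rewrite lee_fin normal_pdf_ge0.
Qed.

Lemma approx_sd_tail_cvg0 (e : R) : 0 < e ->
  Num.sqrt 2 * 4 * (approx_sd n / e) ^+ 2 @[n --> \oo] --> 0.
Proof.
move=> e0; rewrite -(mulr0 (Num.sqrt 2 * 4)); apply: cvgMr.
rewrite -[X in _ --> X](mulr0 0); under eq_fun do rewrite expr2.
suff H : (approx_sd n / e) @[n --> \oo] --> 0 by exact: cvgM.
rewrite -(mul0r e^-1); apply: cvgMl.
rewrite -[X in _ --> X](mulr0 0).
rewrite (_ : approx_sd = fun n => harmonic n * harmonic n); last first.
  by apply/funext => n; rewrite /approx_sd -exprVn expr2.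
by apply: cvgM; exact: cvg_harmonic.
Qed.

Lemma cvg_itv_mollifier u v x :
  itv_mollifier u v n x @[n --> \oo] --> (\1_(`]u, v[%classic : set (measurableTypeR R)) x : R).
Proof.
have [xuv|xuv] := boolP (x \in `]u, v[).
  rewrite indicE mem_set//=.
  move: xuv; rewrite in_itv/= => /andP[ux xv].
  pose e := Num.min (x - u) (v - x) / 2.
  have e0 : 0 < e by rewrite divr_gt0// lt_min !subr_gt0 ux.
  apply: (@squeeze_cvgr _ _ _ _
      (fun n => 1 - Num.sqrt 2 * 4 * (approx_sd n / e) ^+ 2) (cst 1)).
  - near=> n.
    apply/andP; split; last by have /andP[] := itv_mollifier_bounds u v n x.
    have n1 : n.+1%:R^-1 <= e.
      apply/ltW; near: n.
      have /cvgr0_norm_lt/(_ _ e0) := @cvg_harmonic R.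
      apply: filterS => n /=; rewrite ger0_norm//.
    rewrite lerBlDr -[leLHS](_ : fine (\int[mu]_z (normal_pdf x (approx_sd n) z)%:E)%E = 1); last first.
      by rewrite integral_normal_pdf.
    rewrite -/(Rintegral _ _ _) -(setUv (itv_approx u v n)) Rintegral_setU//.
    + rewrite lerD2l; apply: normal_tail => //; first exact: approx_sd_neq0.
        exact: measurableC.
      move=> z /= /negP; rewrite in_itv/= negb_and -!ltNge => H.
      have eu : e * 2 <= x - u by rewrite /e divfK// ge_min lexx.
      have ev : e * 2 <= v - x by rewrite /e divfK// ge_min lexx orbT.
      move: n1 H eu ev; move: (n.+1%:R^-1) => h; clearbody e => n1 H eu ev.
      case/orP: H => H.
        rewrite (distrC z) ler_normr; apply/orP; left; lra.
      rewrite ler_normr; apply/orP; left; lra.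
    + exact: measurableC.
    + rewrite setUv; exact: integrable_normal_pdf.
    + by apply/disj_setPS => z [].
  - rewrite -[X in _ --> X]subr0; apply: cvgB; first exact: cvg_cst.
    exact: approx_sd_tail_cvg0.
  - exact: cvg_cst.
rewrite indicE memNset//=; last by move=> /= xx; rewrite xx in xuv.
pose b n : R := Num.sqrt 2 * 4 * n.+1%:R^-1 ^+ 2.
apply: (@squeeze_cvgr _ _ _ _ (cst 0) b).
- apply: nearW => n.
  have /andP[-> _] /= := itv_mollifier_bounds u v n x.
  have n0 : 0 < n.+1%:R^-1 :> R by rewrite invr_gt0.
  apply: (@le_trans _ _ (Num.sqrt 2 * 4 * (approx_sd n / n.+1%:R^-1) ^+ 2)).
    apply: normal_tail => //; first exact: approx_sd_neq0.
    move=> z; rewrite /itv_approx /= in_itv/= => /andP[uz zv].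
    move: xuv; rewrite in_itv/= negb_and -!leNgt.
    move: n0 uz zv; move: (n.+1%:R^-1) => h n0 uz zv /orP[xu|vx].
      rewrite ler_normr; apply/orP; left; lra.
    rewrite distrC ler_normr; apply/orP; left; lra.
  rewrite /approx_sd /b invrK.
  have -> // : n.+1%:R ^- 2 * n.+1%:R = n.+1%:R^-1 :> R.
  by rewrite expr2 invfM -mulrA mulVf ?mulr1 ?pnatr_eq0.
- exact: cvg_cst.
- have H : b n @[n --> \oo] --> Num.sqrt 2 * 4 * (0 * 0 : R).
    rewrite /b; under eq_fun do rewrite expr2.
    by apply: cvgMr; apply: cvgM; exact: cvg_harmonic.
  by rewrite !mulr0 in H.
Unshelve. all: by end_near. Qed.

End interval_approximation.

Section trigonometric_transfer.
Context {R : realType}.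
Local Notation mu := (@lebesgue_measure R).

Lemma measurable_cos_comp d (T : measurableType d) (f : T -> R) :
  measurable_fun setT f -> measurable_fun setT (fun x => cos (f x)).
Proof.
by apply: measurableT_comp; apply: continuous_measurable_fun; exact: continuous_cos.
Qed.

Section one_space.
Context d (T : measurableType d) (P : probability T R).
Variables (W X : T -> R) (M : R).
Local Notation mR := (measurableTypeR R).
Hypotheses (mW : measurable_fun setT W) (mX : measurable_fun setT X).
Hypothesis WM : forall x, `|W x| <= M.

(** The Gaussian bump around z is the average of cos(a (X - z)) over a normal variable a of
    deviation s, and Fubini takes this average outside. So the left side is determined by cosine
    integrals of X with weight W. *)
Lemma Rintegral_normal_cos (s z : R) : s != 0 ->
  \int[P]_x (W x * expR (- (s ^+ 2 * (X x - z) ^+ 2 / 2))) =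
  \int[mu]_a ((\int[P]_x (W x * cos (a * X x + - (a * z)))) * normal_pdf 0 s a).
Proof.
move=> s0.
pose f (q : T * mR) := W q.1 * cos (q.2 * X q.1 + - (q.2 * z)) * normal_pdf 0 s q.2.
have mf : measurable_fun setT f.
  apply: measurable_funM; last first.
    by apply: measurableT_comp => //; exact: measurable_normal_pdf.
  apply: measurable_funM; first exact: measurableT_comp.
  apply: measurable_cos_comp; apply: measurable_funD.
    by apply: measurable_funM => //; exact: measurableT_comp.
  by apply: measurableT_comp => //; exact: measurable_funM.
have fM x a : `|f (x, a)| <= M * normal_pdf 0 s a.
  rewrite /f /= normrM (ger0_norm (normal_pdf_ge0 _ _ _)) ler_wpM2r ?normal_pdf_ge0//.
  rewrite normrM; apply: le_trans (WM x); rewrite ler_piMr//; exact: cos_max.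
have := dominated_Fubini P mf (integrable_normal_pdf 0 s) fM.
rewrite /f /= => H.
transitivity (\int[P]_x \int[mu]_a (W x * cos (a * X x + - (a * z)) * normal_pdf 0 s a)).
  apply: eq_Rintegral => x _.
  under [RHS]eq_Rintegral do rewrite -mulrA.
  rewrite RintegralZl//; last first.
    apply: (le_integrable measurableT _ _ (integrable_normal_pdf 0 s)).
      apply/measurable_EFinP; apply: measurable_funM => //; last first.
        exact: measurable_normal_pdf.
      apply: measurable_cos_comp; apply: measurable_funD => //.
        exact: measurable_funM.
      by apply: measurableT_comp => //; exact: measurable_funM.
    move=> a _ /=; rewrite lee_fin normrM ler_piMl//; exact: cos_max.
  congr (_ * _).
  transitivity (\int[mu]_a (cos ((X x - z) * a + 0) * normal_pdf 0 s a)).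
    by rewrite Rintegral_cos_normal_pdf// cos0 mul1r.
  by apply: eq_Rintegral => a _; rewrite addr0 (mulrC (X x - z)) mulrBr.
rewrite H; apply: eq_Rintegral => a _.
rewrite RintegralZr//.
apply: (@bounded_integrable _ _ _ _ _ M).
  apply: measurable_funM => //; apply: measurable_cos_comp; apply: measurable_funD => //.
  exact: measurable_funM.
move=> x; rewrite normrM; apply: le_trans (WM x); rewrite ler_piMr//; exact: cos_max.
Qed.

(** The density is symmetric in its centre and its argument. It is written with the reciprocal of
    the deviation, to which [Rintegral_normal_cos] applies. *)
Lemma Rintegral_itv_mollifier u v n :
  \int[P]_x (W x * itv_mollifier u v n (X x)) =
  \int[mu]_(z in itv_approx u v n) (normal_peak (approx_sd n) *
    \int[P]_x (W x * expR (- ((approx_sd n)^-1 ^+ 2 * (X x - z) ^+ 2 / 2)))).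
Proof.
set s := approx_sd n; have s0 : s != 0 := approx_sd_neq0 n.
set A := itv_approx u v n.
have mA : measurable A := measurable_itv_approx u v n.
pose f (q : T * mR) := W q.1 * (normal_peak s * expR (- (s^-1 ^+ 2 * (X q.1 - q.2) ^+ 2 / 2))) * \1_A q.2.
have mf : measurable_fun setT f.
  apply: measurable_funM; last by apply: measurableT_comp => //.
  apply: measurable_funM; first exact: measurableT_comp.
  apply: measurable_funM => //; apply: measurableT_comp => //.
  apply: measurableT_comp => //; apply: measurable_funM => //.
  apply: measurable_funM => //; apply: measurable_funX => //.
  by apply: measurable_funB => //; exact: measurableT_comp.
have Ai : mu.-integrable setT (EFin \o (\1_A : mR -> R)).
  apply/integrableP; split; first exact/measurable_EFinP.
  under eq_integral do rewrite /= ger0_norm//.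
  rewrite integral_indic// setIT.
  have := lebesgue_measure_itv `[u + n.+1%:R^-1, v - n.+1%:R^-1].
  by move=> /= H; rewrite [X in (X < _)%E]H; case: ifP => _; rewrite -?EFinB ltry.
have fM x z : `|f (x, z)| <= (M * normal_peak s) * \1_A z.
  rewrite /f /= normrM (ger0_norm (_ : 0 <= \1_A z)) // ler_wpM2r//.
  rewrite normrM ler_pM//.
  rewrite ger0_norm ?mulr_ge0 ?normal_peak_ge0 ?expR_ge0//.
  rewrite ler_piMr ?normal_peak_ge0// -[leRHS]expR0 ler_expR oppr_le0.
  by apply: mulr_ge0; [apply: mulr_ge0; exact: sqr_ge0|rewrite invr_ge0].
have := dominated_Fubini P mf Ai fM.
rewrite /f /= => H.
transitivity (\int[P]_x \int[mu]_z f (x, z)).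
  apply: eq_Rintegral => x _.
  rewrite /f /= /itv_mollifier -/A -/s.
  rewrite [in LHS]Rintegral_mkcond -RintegralZl//; last first.
    rewrite -restrict_EFin; apply: (integrable_mkcond _ mA).1.
    by apply: (integrableS measurableT) (integrable_normal_pdf (X x) s).
  apply: eq_Rintegral => z _; rewrite patchE indicE.
  case: ifPn => _; last by rewrite !mulr0.
  rewrite mulr1 normal_pdfE// /normal_fun; congr (_ * (_ * expR _)).
  by rewrite -sqrrN opprB; field.
rewrite H//; rewrite [RHS]Rintegral_mkcond; apply: eq_Rintegral => z _.
rewrite patchE indicE; case: ifPn => _; last first.
  by under eq_Rintegral do rewrite mulr0; rewrite Rintegral_cst// mul0r.
under eq_Rintegral do rewrite mulr1 mulrCA.
rewrite RintegralZl//.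
apply: (@bounded_integrable _ _ _ _ _ M).
  apply: measurable_funM => //; apply: measurableT_comp => //.
  apply: measurableT_comp => //; apply: measurable_funM => //.
  apply: measurable_funM => //; apply: measurable_funX => //.
  exact: measurable_funB.
move=> x; rewrite normrM; apply: le_trans (WM x); rewrite ler_piMr//.
rewrite ger0_norm ?expR_ge0// -[leRHS]expR0 ler_expR oppr_le0.
by apply: mulr_ge0; [apply: mulr_ge0; exact: sqr_ge0|rewrite invr_ge0].
Qed.

Lemma cvg_Rintegral_itv_mollifier u v :
  \int[P]_x (W x * itv_mollifier u v n (X x)) @[n --> \oo] -->
  \int[P]_x (W x * \1_(`]u, v[%classic : set R) (X x)).
Proof.
have mm n : measurable_fun setT (itv_mollifier u v n).
  have : measurable_fun setT (fun x => \int[mu]_z ((normal_pdf x (approx_sd n) z *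
       \1_(itv_approx u v n) z))%:E)%E.
    apply: (@measurable_fun_fubini_tonelli_F _ _ _ _ _ mu (fun q : mR * mR =>
        (normal_pdf q.1 (approx_sd n) q.2 * \1_(itv_approx u v n) q.2)%:E)).
      have mA : measurable (itv_approx u v n) := measurable_itv_approx u v n.
      apply/measurable_EFinP; apply: measurable_funM.
        2: by apply: measurableT_comp => //.
      under eq_fun do rewrite normal_pdfE ?approx_sd_neq0//.
      apply: measurable_funM => //; apply: measurableT_comp => //.
      apply: measurable_funM => //; apply: measurableT_comp => //.
      by apply: measurable_funX => //; exact: measurable_funB.
    by move=> q; rewrite lee_fin mulr_ge0// normal_pdf_ge0.
  have mf : measurable_fun setT (@fine R) by exact: fine_measurable.
  move=> /(measurableT_comp mf); apply: eq_measurable_fun => x _ /=.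
  rewrite /itv_mollifier /Rintegral [in RHS]integral_mkcond; congr fine.
  apply: eq_integral => z _; rewrite patchE indicE.
  by case: ifPn; rewrite ?mulr1 ?mulr0.
have mbnd (g : R -> R) : measurable_fun setT g -> (forall x, 0 <= g x <= 1) ->
    P.-integrable setT (EFin \o (fun x => W x * g (X x))).
  move=> mg g01; apply: (@bounded_integrable _ _ _ _ _ M).
    by apply: measurable_funM => //; exact: measurableT_comp.
  move=> x; have /andP[g0 g1] := g01 (X x).
  by rewrite normrM; apply: le_trans (WM x); rewrite ler_piMr// ger0_norm.
have i01 x : 0 <= (\1_(`]u, v[%classic : set R) x : R) <= 1.
  by rewrite indicE; case: (_ \in _) => /=; rewrite ?lexx ?ler01.
have mi : measurable_fun setT (\1_(`]u, v[%classic : set R) : R -> R) by [].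
have [] := @dominated_convergence _ _ _ P setT measurableT
  (fun n x => (W x * itv_mollifier u v n (X x))%:E)
  (fun x => (W x * \1_(`]u, v[%classic : set R) (X x))%:E) (cst M%:E).
- by move=> n; exact: measurable_int (mbnd _ (mm n) (itv_mollifier_bounds u v n)).
- exact: measurable_int (mbnd _ mi i01).
- apply: aeW => x _; apply: cvg_EFin; first exact: nearW.
  by apply: cvgMr; exact: cvg_itv_mollifier.
- by apply: (@bounded_integrable _ _ _ _ (cst M) `|M|).
- apply: aeW => x n _ /=; rewrite lee_fin normrM; apply: le_trans (WM x).
  have /andP[g0 g1] := itv_mollifier_bounds u v n (X x).
  by rewrite ler_piMr// ger0_norm.
move=> _ _ H.
apply: (@fine_cvg _ _ _ _ (fun n => \int[P]_x (W x * itv_mollifier u v n (X x))%:E)%E).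
by rewrite fineK//; apply: integrable_fin_num => //; exact: mbnd mi i01.
Qed.

End one_space.

(** One coordinate passes from cosines to indicators. The weights W and W' carry the coordinates
    that have already passed and the cosines that are still present. *)
Lemma trig_transfer_itv d (T : measurableType d) (P : probability T R)
    d' (T' : measurableType d') (P' : probability T' R)
    (W X : T -> R) (W' X' : T' -> R) (M : R) :
  measurable_fun setT W -> measurable_fun setT X ->
  measurable_fun setT W' -> measurable_fun setT X' ->
  (forall x, `|W x| <= M) -> (forall x, `|W' x| <= M) ->
  (forall a b, \int[P]_x (W x * cos (a * X x + b)) =
               \int[P']_x (W' x * cos (a * X' x + b))) ->
  forall u v, \int[P]_x (W x * \1_(`]u, v[%classic : set R) (X x)) =
              \int[P']_x (W' x * \1_(`]u, v[%classic : set R) (X' x)).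
Proof.
move=> mW mX mW' mX' WM WM' H u v.
have C := cvg_Rintegral_itv_mollifier (P := P) (u := u) (v := v) mW mX WM.
have C' := cvg_Rintegral_itv_mollifier (P := P') (u := u) (v := v) mW' mX' WM'.
apply: (cvg_unique _ C) => //; move: C'.
suff -> : (fun n => \int[P']_x (W' x * itv_mollifier u v n (X' x))) =
   (fun n => \int[P]_x (W x * itv_mollifier u v n (X x))) by [].
apply/funext => n; rewrite (Rintegral_itv_mollifier P mW mX WM).
rewrite (Rintegral_itv_mollifier P' mW' mX' WM').
apply: eq_Rintegral => z _; congr (_ * _).
have sn : (approx_sd n)^-1 != 0 :> R by rewrite invr_eq0 approx_sd_neq0.
rewrite (Rintegral_normal_cos P mW mX WM)// (Rintegral_normal_cos P' mW' mX' WM')//.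
by apply: eq_Rintegral => a _; rewrite H.
Qed.

End trigonometric_transfer.

Definition mkRV d d' (T : measurableType d) (T' : measurableType d') (f : T -> T')
    (mf : measurable_fun setT f) : {mfun T >-> T'} :=
  HB.pack f (isMeasurableFun.Build _ _ _ _ _ mf).

(** * Laws of families of random variables over an arbitrary index set *)

Section state_space.
Context (I : Type) (R : realType).

(** Boxes restrict finitely many coordinates; concatenating the lists intersects the boxes, so they
    form a pi-system. *)
Definition box (s : seq (I * (R * R))) : set (I -> R) :=
  [set x | all (fun q => x q.1 \in `]q.2.1, q.2.2[%R) s].

Definition boxes : set (set (I -> R)) := range box.

(** The product space with the sigma-algebra generated by the boxes. The state of a noise is the
    family of all its values, so a functional of the noise is a function on states. *)
Definition state : Type := I -> R.

HB.instance Definition _ := Pointed.copy state (g_sigma_algebraType boxes).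
HB.instance Definition _ := Measurable.copy state (g_sigma_algebraType boxes).

Lemma box_cat s t : box (s ++ t) = box s `&` box t.
Proof.
apply/seteqP; split => x; rewrite /box /= all_cat; first by move/andP.
by move=> [-> ->].
Qed.

Lemma measurable_box s : measurable (box s : set state).
Proof. by apply: sub_sigma_algebra; exists s. Qed.

Lemma measurable_eval (i : I) : measurable_fun setT (fun x : state => x i).
Proof.
apply: (measurability _ (RGenOInfty.measurableE R)) => _ [_ [a ->] <-].
rewrite setTI.
have -> : (fun x : state => x i) @^-1` `]a, +oo[ =
    \bigcup_n box [:: (i, (a, n%:R))].
  apply/seteqP; split => x /=.
    rewrite in_itv/= andbT => ax; exists (Num.truncn `|x i|).+1 => //=.
    rewrite /box /= andbT in_itv/= ax /=.
    by apply: le_lt_trans (ler_norm _) (truncnS_gt _).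
  by move=> [n _]; rewrite /box /= andbT !in_itv/= andbT => /andP[].
by apply: bigcup_measurable => n _; exact: measurable_box.
Qed.

Lemma measurable_to_state d (T : measurableType d) (f : T -> state) :
  (forall i, measurable_fun setT (fun w => f w i)) -> measurable_fun setT f.
Proof.
move=> mf; apply: (@measurability _ _ T state setT f boxes) => // _ [_ [s _ <-] <-].
rewrite setTI; elim: s => [|q s IH].
  have -> : f @^-1` box [::] = setT by apply/seteqP; split.
  exact: measurableT.
rewrite -cat1s box_cat preimage_setI; apply: measurableI => //.
have -> : f @^-1` box [:: q] = (fun w => f w q.1) @^-1` `]q.2.1, q.2.2[%classic.
  by apply/seteqP; split => w; rewrite /box /= andbT.
by rewrite -[X in measurable X]setTI; apply: mf.
Qed.

Definition lincomb (L : seq (R * I)) (x : I -> R) : R :=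
  \sum_(q <- L) q.1 * x q.2.

End state_space.

Section equality_of_laws.
Context (I : Type) (R : realType).
Context d (T : measurableType d) (P : probability T R) (xi : T -> state I R).
Context d' (T' : measurableType d') (P' : probability T' R)
  (xi' : T' -> state I R).
Hypothesis mxi : forall i, measurable_fun setT (fun w => xi w i).
Hypothesis mxi' : forall i, measurable_fun setT (fun w => xi' w i).
Hypothesis cosE : forall L b, \int[P]_w cos (lincomb L (xi w) + b) =
  \int[P']_w cos (lincomb L (xi' w) + b).

Let bx (s : seq (I * (R * R))) (x : I -> R) : R :=
  \prod_(q <- s) \1_(`]q.2.1, q.2.2[%classic : set R) (x q.1).

Let bx_bound s x : `|bx s x| <= 1.
Proof.
rewrite /bx; elim: s => [|q s IH]; first by rewrite big_nil normr1.
rewrite big_cons normrM indicE; case: (_ \in _); rewrite ?normr1 ?mul1r//.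
by rewrite normr0 mul0r.
Qed.

Let measurable_bx d1 (U : measurableType d1) (f : U -> state I R) s :
  (forall i, measurable_fun setT (fun w => f w i)) ->
  measurable_fun setT (fun w => bx s (f w)).
Proof.
move=> mf; rewrite /bx; elim: s => [|q s IH].
  by under eq_fun do rewrite big_nil; exact: measurable_cst.
under eq_fun do rewrite big_cons.
apply: measurable_funM => //.
have mi : measurable (`]q.2.1, q.2.2[%classic : set R) by exact: measurable_itv.
by apply: (@measurableT_comp _ _ _ _ _ _ (\1_(`]q.2.1, q.2.2[%classic : set R) : R -> R)).
Qed.

Let measurable_lincomb d1 (U : measurableType d1) (f : U -> state I R) L :
  (forall i, measurable_fun setT (fun w => f w i)) ->
  measurable_fun setT (fun w => lincomb L (f w)).
Proof.
move=> mf; rewrite /lincomb; apply: measurable_sum => q.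
exact: measurable_funM.
Qed.

(** Induction on the number of indicator factors. A product of two cosines is half a sum of two
    cosines of longer combinations, so the assumption of [trig_transfer_itv] for the new coordinate
    follows from the induction hypothesis. *)
Let bx_cosE s L b : \int[P]_w (bx s (xi w) * cos (lincomb L (xi w) + b)) =
  \int[P']_w (bx s (xi' w) * cos (lincomb L (xi' w) + b)).
Proof.
elim: s L b => [|q s IH] L b.
  rewrite /bx; under eq_Rintegral do rewrite big_nil mul1r.
  by under [RHS]eq_Rintegral do rewrite big_nil mul1r.
have mW d1 (U : measurableType d1) (f : U -> state I R) t K c :
    (forall i, measurable_fun setT (fun w => f w i)) ->
    measurable_fun setT (fun w => bx t (f w) * cos (lincomb K (f w) + c)).
  move=> mf; apply: measurable_funM; first exact: measurable_bx.
  apply: measurable_cos_comp; apply: measurable_funD => //.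
  exact: measurable_lincomb.
have W1 t K c (x : I -> R) : `|bx t x * cos (lincomb K x + c)| <= 1.
  by rewrite normrM mulr_ile1//; exact: cos_max.
have := @trig_transfer_itv R _ _ P _ _ P'
  (fun w => bx s (xi w) * cos (lincomb L (xi w) + b)) (fun w => xi w q.1)
  (fun w => bx s (xi' w) * cos (lincomb L (xi' w) + b)) (fun w => xi' w q.1)
  1 (mW _ _ _ _ _ _ mxi) (mxi _) (mW _ _ _ _ _ _ mxi') (mxi' _)
  (fun w => W1 _ _ _ _) (fun w => W1 _ _ _ _) _ q.2.1 q.2.2.
have bxS (x : I -> R) : bx (q :: s) x * cos (lincomb L x + b) =
   bx s x * cos (lincomb L x + b) * \1_(`]q.2.1, q.2.2[%classic : set R) (x q.1).
  by rewrite /bx big_cons; ring.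
under [in X in _ -> X]eq_Rintegral do rewrite bxS.
under [in X in _ -> _ = X]eq_Rintegral do rewrite bxS.
apply => a c.
have prodE (x : I -> R) : bx s x * cos (lincomb L x + b) * cos (a * x q.1 + c) =
    2^-1 * (bx s x * cos (lincomb ((a, q.1) :: L) x + (b + c)) +
            bx s x * cos (lincomb ((- a, q.1) :: L) x + (b - c))).
  rewrite -mulrDr mulrCA -mulrA; congr (_ * _).
  rewrite /lincomb !big_cons /=.
  have -> : a * x q.1 + (\sum_(j <- L) j.1 * x j.2) + (b + c) =
     ((\sum_(j <- L) j.1 * x j.2) + b) + (a * x q.1 + c) by ring.
  have -> : - a * x q.1 + (\sum_(j <- L) j.1 * x j.2) + (b - c) =
     ((\sum_(j <- L) j.1 * x j.2) + b) - (a * x q.1 + c) by ring.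
  set y := _ + b; set z := _ + c.
  by rewrite (cosD y z) (cosB y z); field.
under eq_Rintegral do rewrite prodE.
under [RHS]eq_Rintegral do rewrite prodE.
have iW (K : seq (R * I)) (e : R) : P.-integrable setT
    (EFin \o (fun w => bx s (xi w) * cos (lincomb K (xi w) + e))).
  by apply: (@bounded_integrable _ _ _ _ _ 1) => //; exact: mW.
have iW' (K : seq (R * I)) (e : R) : P'.-integrable setT
    (EFin \o (fun w => bx s (xi' w) * cos (lincomb K (xi' w) + e))).
  by apply: (@bounded_integrable _ _ _ _ _ 1) => //; exact: mW.
have iD K K' e e' : P.-integrable setT
    (EFin \o (fun w => bx s (xi w) * cos (lincomb K (xi w) + e) +
                       bx s (xi w) * cos (lincomb K' (xi w) + e'))).
  have := integrableD measurableT (iW K e) (iW K' e').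
  exact: eq_integrable.
have iD' K K' e e' : P'.-integrable setT
    (EFin \o (fun w => bx s (xi' w) * cos (lincomb K (xi' w) + e) +
                       bx s (xi' w) * cos (lincomb K' (xi' w) + e'))).
  have := integrableD measurableT (iW' K e) (iW' K' e').
  exact: eq_integrable.
by rewrite !RintegralZl// !RintegralD// !IH.
Qed.

Lemma eq_law (A : set (state I R)) : measurable A ->
  P (xi @^-1` A) = P' (xi' @^-1` A).
Proof.
have mx : measurable_fun setT xi by exact: measurable_to_state.
have mx' : measurable_fun setT xi' by exact: measurable_to_state.
have intbx d1 (U : measurableType d1) (Q : probability U R) (f : U -> state I R) s :
    measurable_fun setT f ->
    \int[Q]_w (bx s (f w) * cos (lincomb [::] (f w) + 0)) = fine (Q (f @^-1` box s)).
  move=> mf.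
  have -> : Q (f @^-1` box s) = (\int[Q]_w (\1_(f @^-1` box s) w)%:E)%E.
    rewrite integral_indic ?setIT//.
    by rewrite -[X in measurable X]setTI; apply: mf => //; exact: measurable_box.
  apply: eq_Rintegral => w _.
  rewrite /lincomb big_nil addr0 cos0 mulr1 indicE.
  have -> : (w \in f @^-1` box s) = all (fun q => f w q.1 \in `]q.2.1, q.2.2[%R) s.
    by apply/idP/idP => [/set_mem//|H]; exact/mem_set.
  rewrite /bx; elim: s => [|q s IH]; first by rewrite big_nil.
  rewrite big_cons IH /= indicE mem_setE.
  by case: (_ \in _); rewrite ?mul1r ?mul0r.
move=> mA; rewrite -[LHS]/(distribution P (mkRV mx) A).
rewrite -[RHS]/(distribution P' (mkRV mx') A).
apply: (@measure_unique _ R (state I R) (@boxes I R) (fun=> setT) erefl _ _ _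
  (distribution P (mkRV mx)) (distribution P' (mkRV mx'))) mA => //.
- by move=> _ _ [s _ <-] [t _ <-]; exists (s ++ t) => //; rewrite box_cat.
- by move=> _; exists [::] => //; apply/seteqP; split.
- by rewrite bigcup_const.
- move=> _ [s _ <-].
  have mb := @measurable_box I R s.
  rewrite -[LHS]fineK ?fin_num_measure// -[RHS]fineK ?fin_num_measure//.
  congr EFin; transitivity (\int[P]_w (bx s (xi w) * cos (lincomb [::] (xi w) + 0))).
    by rewrite intbx.
  by rewrite bx_cosE intbx.
- by move=> n; rewrite ltey_eq fin_num_measure.
Qed.

Lemma eq_law_integral (f : state I R -> \bar R) :
  measurable_fun setT f -> (forall x, 0 <= f x)%E ->
  (\int[P]_w f (xi w) = \int[P']_w f (xi' w))%E.
Proof.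
move=> mf f0.
have mx : measurable_fun setT xi by exact: measurable_to_state.
have mx' : measurable_fun setT xi' by exact: measurable_to_state.
rewrite -[LHS](@ge0_integral_distribution _ _ _ _ R P (mkRV mx))//.
rewrite -[RHS](@ge0_integral_distribution _ _ _ _ R P' (mkRV mx'))//.
by apply: eq_measure_integral => A mA _; exact: eq_law.
Qed.

End equality_of_laws.

(** * Isonormal processes over inner product spaces *)

Section inner_products.
Context {R : realType}.

(** Only semidefinite: square integrable functions are kept as functions and not identified up to
    null sets. *)
Record inner_product (V : lmodType R) (ip : V -> V -> R) : Prop := {
  ip_sym : forall u v, ip u v = ip v u ;
  ip_linear : forall a u v w, ip (a *: u + v) w = a * ip u w + ip v w ;
  ip_ge0 : forall v, 0 <= ip v v }.

Section theory.
Context (V : lmodType R) (ip : V -> V -> R) (hip : inner_product ip).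

Lemma ip0l v : ip 0 v = 0.
Proof.
have := ip_linear hip 1 0 0 v; rewrite scaler0 addr0 mul1r => /eqP.
by rewrite eq_sym -subr_eq0 addrK => /eqP.
Qed.

Lemma ip0r v : ip v 0 = 0. Proof. by rewrite (ip_sym hip) ip0l. Qed.

Lemma ipZl a u v : ip (a *: u) v = a * ip u v.
Proof. by rewrite -[a *: u]addr0 (ip_linear hip) ip0l addr0. Qed.

Lemma ipZr a u v : ip u (a *: v) = a * ip u v.
Proof. by rewrite (ip_sym hip) ipZl (ip_sym hip). Qed.

Lemma ipDl u v w : ip (u + v) w = ip u w + ip v w.
Proof. by rewrite -[u]scale1r (ip_linear hip) mul1r scale1r. Qed.

Lemma ipDr u v w : ip u (v + w) = ip u v + ip u w.
Proof. by rewrite (ip_sym hip) ipDl !(ip_sym hip u). Qed.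

Lemma ipNl u v : ip (- u) v = - ip u v.
Proof. by rewrite -scaleN1r ipZl mulN1r. Qed.

Lemma ipNr u v : ip u (- v) = - ip u v.
Proof. by rewrite -scaleN1r ipZr mulN1r. Qed.

Lemma ip_suml I (s : seq I) (P : pred I) (u : I -> V) v :
  ip (\sum_(i <- s | P i) u i) v = \sum_(i <- s | P i) ip (u i) v.
Proof. by elim/big_rec2: _ => [|i x y _ <-]; rewrite ?ip0l ?ipDl. Qed.

Lemma ip_sumr I (s : seq I) (P : pred I) (u : I -> V) v :
  ip v (\sum_(i <- s | P i) u i) = \sum_(i <- s | P i) ip v (u i).
Proof. by elim/big_rec2: _ => [|i x y _ <-]; rewrite ?ip0r ?ipDr. Qed.

End theory.

Definition prod_ip (V W : lmodType R) (ip : V -> V -> R) (ip' : W -> W -> R)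
  (u v : (V * W)%type) : R := ip u.1 v.1 + ip' u.2 v.2.

Lemma prod_inner_product (V W : lmodType R) (ip : V -> V -> R) (ip' : W -> W -> R) :
  inner_product ip -> inner_product ip' -> inner_product (prod_ip ip ip').
Proof.
move=> h h'; split => [u v|a u v w|v]; rewrite /prod_ip.
- by rewrite (ip_sym h) (ip_sym h').
- by rewrite /= (ip_linear h) (ip_linear h'); ring.
- by rewrite addr_ge0// ?(ip_ge0 h) ?(ip_ge0 h').
Qed.

End inner_products.

Section products_of_probabilities.
Context d (T : measurableType d) d' (T' : measurableType d') (R : realType).
Context (P : probability T R) (P' : probability T' R).

Lemma ae_fst (A : set T) : (\forall x \ae P, A x) ->
  \forall z \ae (P \x P')%E, A z.1.
Proof.
move=> [N [mN N0 AN]]; exists (N `*` setT); split.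
- exact: measurableX.
- transitivity (P N * P' setT)%E; first exact: product_measure1E.
  by rewrite N0 mul0e.
- by move=> z /= Az; split => //; exact: AN.
Qed.

Lemma ae_snd (A : set T') : (\forall x \ae P', A x) ->
  \forall z \ae (P \x P')%E, A z.2.
Proof.
move=> [N [mN N0 AN]]; exists (setT `*` N); split.
- exact: measurableX.
- transitivity (P setT * P' N)%E; first exact: product_measure1E.
  by rewrite N0 mule0.
- by move=> z /= Az; split => //; exact: AN.
Qed.

Lemma Rintegral_prod (f : T * T' -> R) (M : R) : measurable_fun setT f ->
  (forall z, `|f z| <= M) ->
  \int[(P \x P')%E]_z f z = \int[P]_x \int[P']_y f (x, y).
Proof.
move=> mf fM.
have fi := @bounded_integrable _ _ _ (P \x P')%E f M mf fM.
rewrite /Rintegral -(integral12_prod_meas1 fi) /fubini_F; congr fine.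
apply: eq_integral => x _; rewrite fineK//; apply: integrable_fin_num => //.
by apply: (@bounded_integrable _ _ _ _ _ M) => //; exact: measurableT_comp.
Qed.

End products_of_probabilities.

Lemma ae_eq_Rintegral d (T : measurableType d) (R : realType) (P : probability T R)
    (f g : T -> R) : measurable_fun setT f -> measurable_fun setT g ->
  (\forall x \ae P, f x = g x) -> \int[P]_x f x = \int[P]_x g x.
Proof.
move=> mf mg fg; rewrite /Rintegral; congr fine; apply: ae_eq_integral => //.
- exact/measurable_EFinP.
- exact/measurable_EFinP.
- by apply: filterS fg => x -> .
Qed.

Section isonormal_processes.
Context {R : realType}.

(** The null set in the linearity may depend on the combination. The Fourier form of Gaussianity
    covers variance zero without a case distinction, and joint Gaussianity follows from linearity,
    as a linear combination of values is almost surely a value. *)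
Record isonormal d (T : measurableType d) (P : probability T R) (V : lmodType R)
    (ip : V -> V -> R) (Z : V -> T -> R) : Prop := {
  isonormal_measurable : forall v, measurable_fun setT (Z v) ;
  isonormal_linear : forall a u v,
    \forall w \ae P, Z (a *: u + v) w = a * Z u w + Z v w ;
  isonormal_cos : forall v b, \int[P]_w cos (Z v w + b) =
    cos b * expR (- (ip v v / 2)) }.

Section linear_combinations.
Context d (T : measurableType d) (P : probability T R) (V : lmodType R)
  (ip : V -> V -> R) (Z : V -> T -> R) (hZ : isonormal P ip Z).

Lemma isonormal0 : \forall w \ae P, Z 0 w = 0.
Proof.
apply: filterS (isonormal_linear hZ 1 0 0) => w; rewrite scaler0 addr0 mul1r.
by move=> /eqP; rewrite eq_sym -subr_eq0 addrK => /eqP.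
Qed.

Lemma isonormalD u v : \forall w \ae P, Z (u + v) w = Z u w + Z v w.
Proof.
by apply: filterS (isonormal_linear hZ 1 u v) => w; rewrite scale1r mul1r.
Qed.

Lemma isonormalZ a u : \forall w \ae P, Z (a *: u) w = a * Z u w.
Proof.
have := isonormal_linear hZ a u 0; have := isonormal0.
by apply: filterS2 => w ->; rewrite !addr0.
Qed.

Lemma isonormal_lincomb I (v : I -> V) (L : seq (R * I)) :
  \forall w \ae P, Z (\sum_(q <- L) q.1 *: v q.2) w = lincomb L (fun i => Z (v i) w).
Proof.
rewrite /lincomb; elim: L => [|q L IH].
  by apply: filterS isonormal0 => w; rewrite !big_nil.
have := isonormal_linear hZ q.1 (v q.2) (\sum_(q <- L) q.1 *: v q.2).
by move: IH; apply: filterS2 => w; rewrite !big_cons => -> ->.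
Qed.

Lemma isonormal_lincomb_cos (hip : inner_product ip) I (v : I -> V)
    (L : seq (R * I)) b :
  \int[P]_w cos (lincomb L (fun i => Z (v i) w) + b) =
  cos b * expR (- (\sum_(q <- L) \sum_(r <- L) q.1 * (r.1 * ip (v q.2) (v r.2)) / 2)).
Proof.
have mZ := isonormal_measurable hZ.
transitivity (\int[P]_w cos (Z (\sum_(q <- L) q.1 *: v q.2) w + b)).
  apply: ae_eq_Rintegral.
  - apply: measurable_cos_comp; apply: measurable_funD => //.
    by apply: measurable_sum => q; exact: measurable_funM.
  - by apply: measurable_cos_comp; exact: measurable_funD.
  - by apply: filterS (isonormal_lincomb v L) => w ->.
rewrite (isonormal_cos hZ); congr (_ * expR (- _)).
rewrite (ip_suml hip) mulr_suml; apply: eq_bigr => q _.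
rewrite (ipZl hip) (ip_sumr hip) mulr_sumr mulr_suml; apply: eq_bigr => r _.
by rewrite (ipZr hip).
Qed.

End linear_combinations.

Section gram.
Context d (T : measurableType d) (P : probability T R) (V : lmodType R)
  (ip : V -> V -> R) (Z : V -> T -> R) (hip : inner_product ip)
  (hZ : isonormal P ip Z).
Context d' (T' : measurableType d') (P' : probability T' R) (V' : lmodType R)
  (ip' : V' -> V' -> R) (Z' : V' -> T' -> R) (hip' : inner_product ip')
  (hZ' : isonormal P' ip' Z').
Context (I : Type) (v : I -> V) (v' : I -> V').
Hypothesis gram : forall i j, ip (v i) (v j) = ip' (v' i) (v' j).

Lemma gram_cos L b :
  \int[P]_w cos (lincomb L (fun i => Z (v i) w) + b) =
  \int[P']_w cos (lincomb L (fun i => Z' (v' i) w) + b).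
Proof.
rewrite (isonormal_lincomb_cos hZ hip) (isonormal_lincomb_cos hZ' hip').
by under eq_bigr do under eq_bigr do rewrite gram.
Qed.

(** By linearity the cosine integrals depend on the inner products alone. This compares families
    that live on unrelated spaces V and V' and unrelated probability spaces. *)
Lemma gram_law (A : set (state I R)) : measurable A ->
  P [set w | A (fun i => Z (v i) w)] = P' [set w | A (fun i => Z' (v' i) w)].
Proof.
move=> mA; apply: (@eq_law I R _ T P (fun w i => Z (v i) w) _ T' P'
  (fun w i => Z' (v' i) w)) => //.
- by move=> i; exact: isonormal_measurable hZ _.
- by move=> i; exact: isonormal_measurable hZ' _.
- exact: gram_cos.
Qed.

Lemma gram_integral (f : state I R -> \bar R) :
  measurable_fun setT f -> (forall x, 0 <= f x)%E ->
  (\int[P]_w f (fun i => Z (v i) w) = \int[P']_w f (fun i => Z' (v' i) w))%E.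
Proof.
move=> mf f0; apply: (@eq_law_integral I R _ T P (fun w i => Z (v i) w) _ T' P'
  (fun w i => Z' (v' i) w)) => //.
- by move=> i; exact: isonormal_measurable hZ _.
- by move=> i; exact: isonormal_measurable hZ' _.
- exact: gram_cos.
Qed.

End gram.

Lemma isonormal_pullback d (T : measurableType d) (P : probability T R)
    (V U : lmodType R) (ip : V -> V -> R) (ipU : U -> U -> R) (Z : V -> T -> R)
    (j : U -> V) : isonormal P ip Z -> linear j ->
  (forall u, ip (j u) (j u) = ipU u u) -> isonormal P ipU (Z \o j).
Proof.
move=> hZ lj jip; split.
- by move=> v; exact: isonormal_measurable hZ _.
- by move=> a u v; rewrite /= lj; exact: isonormal_linear hZ _ _ _.
- by move=> v b; rewrite /= (isonormal_cos hZ) jip.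
Qed.

Definition prod_noise d d' (T : measurableType d) (T' : measurableType d')
    (V W : lmodType R) (Z : V -> T -> R) (Z' : W -> T' -> R)
    (v : (V * W)%type) (w : T * T') : R := Z v.1 w.1 + Z' v.2 w.2.

Lemma isonormal_prod d d' (T : measurableType d) (T' : measurableType d')
    (P : probability T R) (P' : probability T' R) (V W : lmodType R)
    (ip : V -> V -> R) (ip' : W -> W -> R) (Z : V -> T -> R) (Z' : W -> T' -> R) :
  isonormal P ip Z -> isonormal P' ip' Z' ->
  isonormal (P \x P')%E (prod_ip ip ip') (prod_noise Z Z').
Proof.
move=> hZ hZ'.
have mZ v : measurable_fun setT (prod_noise Z Z' v).
  apply: measurable_funD.
    by apply: measurableT_comp => //; exact: isonormal_measurable hZ _.
  by apply: measurableT_comp => //; exact: isonormal_measurable hZ' _.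
split => //.
- move=> a u v.
  have := ae_fst P' (isonormal_linear hZ a u.1 v.1).
  have := ae_snd P (isonormal_linear hZ' a u.2 v.2).
  by apply: filterS2 => w; rewrite /prod_noise /= => -> ->; ring.
- move=> v b; rewrite (@Rintegral_prod _ _ _ _ _ _ _ _ 1).
  + under eq_Rintegral => x _.
      rewrite /prod_noise /=.
      under eq_Rintegral do rewrite (addrC (Z v.1 x)) -addrA.
      rewrite (isonormal_cos hZ'); over.
    rewrite RintegralZr//.
      by rewrite (isonormal_cos hZ) -mulrA -expRD /prod_ip mulrDl opprD.
    apply: (@bounded_integrable _ _ _ _ _ 1).
      apply: measurable_cos_comp; apply: measurable_funD => //.
      exact: isonormal_measurable hZ _.
    by move=> x; exact: cos_max.
  + by apply: measurable_cos_comp; exact: measurable_funD.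
  + by move=> z; exact: cos_max.
Qed.

End isonormal_processes.

(** * The standard complex Gaussian law *)

Section complex_gaussian.
Context {R : realType}.
Local Notation mu := (@lebesgue_measure R).

(** The law with density pi^-1 exp(-|z|^2) has real and imaginary parts of variance 1/2. *)
Definition half_sd : R := (Num.sqrt 2)^-1.

Lemma half_sd_neq0 : half_sd != 0.
Proof. by rewrite invr_eq0 gt_eqF// sqrtr_gt0. Qed.

Lemma half_sd_sq : half_sd ^+ 2 = 2^-1.
Proof. by rewrite /half_sd exprVn sqr_sqrtr. Qed.

Definition complex_gaussian : probability (plane R) R :=
  (normal_prob 0 half_sd \x normal_prob 0 half_sd)%E.

Lemma ge0_integral_normal_prob (s : R) (f : measurableTypeR R -> \bar R) :
  measurable_fun setT f -> (forall x, 0 <= f x)%E ->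
  (\int[normal_prob 0 s]_x f x = \int[mu]_x (f x * (normal_pdf 0 s x)%:E))%E.
Proof.
apply: ge0_integral_density => //; first exact: measurable_normal_pdf.
exact: normal_pdf_ge0.
Qed.

Lemma normal_prob_isonormal (s : R) : s != 0 ->
  isonormal (normal_prob 0 s) (fun a b : R^o => s ^+ 2 * (a * b)) (fun (a : R^o) x => a * x).
Proof.
move=> s0; have mM (a : R) : measurable_fun setT (fun x : measurableTypeR R => a * x).
  by apply: measurable_funM.
split.
- by move=> a; exact: mM.
- by move=> a u v; apply: aeW => x; rewrite mulrDl mulrA.
- move=> a b.
  have mc : measurable_fun setT (fun x : measurableTypeR R => cos (a * x + b)).
    by apply: measurable_cos_comp; apply: measurable_funD.
  have ic1 : (normal_prob 0 s).-integrable setT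
      (EFin \o (fun x : measurableTypeR R => cos (a * x + b) + 1)).
    apply: (@bounded_integrable _ _ _ _ _ 2); first exact: measurable_funD.
    move=> x; apply: le_trans (ler_normD _ _) _; rewrite normr1.
    by rewrite (_ : 2 = 1 + 1)// lerD2r; exact: cos_max.
  have ic : (normal_prob 0 s).-integrable setT
      (EFin \o (fun x : measurableTypeR R => cos (a * x + b))).
    by apply: (@bounded_integrable _ _ _ _ _ 1) => // x; exact: cos_max.
  have i1 : (normal_prob 0 s).-integrable setT
      (EFin \o (cst 1 : measurableTypeR R -> R)).
    by apply: (@bounded_integrable _ _ _ _ _ 1) => // x /=; rewrite normr1.
  have icp : mu.-integrable setT
      (EFin \o (fun x => cos (a * x + b) * normal_pdf 0 s x)).
    apply: (le_integrable measurableT _ _ (integrable_normal_pdf 0 s)).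
      apply/measurable_EFinP; apply: measurable_funM => //.
      exact: measurable_normal_pdf.
    move=> x _ /=; rewrite lee_fin normrM ler_piMl//; exact: cos_max.
  (* Adding 1 makes the integrand nonnegative, which the density formula requires. *)
  have H : \int[normal_prob 0 s]_x (cos (a * x + b) + 1) =
      \int[mu]_x (cos (a * x + b) * normal_pdf 0 s x) + 1.
    rewrite {1}/Rintegral ge0_integral_normal_prob.
    - rewrite -[X in _ = _ + X](_ : \int[mu]_x normal_pdf 0 s x = 1); last first.
        by rewrite /Rintegral integral_normal_pdf.
      rewrite -RintegralD//; last exact: integrable_normal_pdf.
      congr fine; apply: eq_integral => x _.
      by rewrite -EFinM mulrDl mul1r.
    - by apply/measurable_EFinP; exact: measurable_funD.
    - move=> x; rewrite lee_fin -lerBlDr sub0r.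
      by have := cos_max (a * x + b); rewrite ler_norml => /andP[].
  move: H; rewrite RintegralD//.
  rewrite [X in _ + X](_ : _ = 1); last first.
    by rewrite Rintegral_cst//= probability_setT mulr1.
  by move=> /addIr ->; rewrite Rintegral_cos_normal_pdf.
Qed.

Lemma complex_gaussian_isonormal :
  isonormal complex_gaussian
    (prod_ip (fun a b : R^o => 2^-1 * (a * b)) (fun a b : R^o => 2^-1 * (a * b)))
    (prod_noise (fun (a : R^o) (x : measurableTypeR R) => a * x)
                (fun (a : R^o) (x : measurableTypeR R) => a * x)).
Proof.
have := normal_prob_isonormal half_sd_neq0; rewrite half_sd_sq => h.
exact: isonormal_prod.
Qed.

Lemma ge0_integral_complex_gaussian (f : plane R -> \bar R) :
  measurable_fun setT f -> (forall x, 0 <= f x)%E ->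
  (\int[complex_gaussian]_z f z =
   \int[leb2]_z (f z * (pi^-1 * expR (- (z.1 ^+ 2 + z.2 ^+ 2)))%:E))%E.
Proof.
move=> mf f0.
have mp := @measurable_normal_pdf R 0 half_sd.
have pE x : normal_pdf 0 half_sd x = (Num.sqrt pi)^-1 * expR (- x ^+ 2) :> R.
  rewrite normal_pdf0E ?half_sd_neq0// /normal_peak half_sd_sq; congr (_^-1 * _).
    by congr Num.sqrt; rewrite -mulr_natl mulrA mulfV ?mul1r.
  by rewrite -mulr_natl mulfV ?divr1.
rewrite fubini_tonelli1// /fubini_F ge0_integral_normal_prob//; last 2 first.
- exact: measurable_fun_fubini_tonelli_F.
- by move=> x; exact: integral_ge0.
rewrite [RHS]fubini_tonelli1 /fubini_F; last 2 first.
- apply: emeasurable_funM => //; apply/measurable_EFinP; apply: measurable_funM => //.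
  apply: measurableT_comp => //; apply: measurableT_comp => //.
  by apply: measurable_funD; apply: measurable_funX => //; exact: measurableT_comp.
- move=> z; rewrite mule_ge0// lee_fin mulr_ge0 ?expR_ge0//.
  by rewrite invr_ge0 pi_ge0.
apply: eq_integral => x _.
rewrite ge0_integral_normal_prob//; last exact: measurableT_comp.
rewrite muleC -ge0_integralZl//; last 3 first.
- apply: emeasurable_funM; last exact/measurable_EFinP.
  exact: measurableT_comp.
- by move=> y _; rewrite mule_ge0// lee_fin normal_pdf_ge0.
- by rewrite lee_fin normal_pdf_ge0.
apply: eq_integral => y _ /=.
rewrite muleCA -EFinM; congr (_ * _%:E)%E.
rewrite !pE mulrACA -invfM -expr2 sqr_sqrtr ?pi_ge0// -expRD.
by rewrite opprD.
Qed.

End complex_gaussian.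

(** * The space of square integrable functions on the plane *)

Section square_integrable_functions.
Context {R : realType}.

(** Borel functions rather than functions measurable for the completion, and no quotient by null
    sets: masks and kernels can then be handled pointwise. *)
Definition L2pred : {pred plane R -> R} := fun f =>
  `[< measurable_fun setT f /\ (\int[leb2]_s ((f s) ^+ 2)%:E < +oo)%E >].

Lemma L2predP (f : plane R -> R) : reflect (measurable_fun setT f /\
  (\int[leb2]_s ((f s) ^+ 2)%:E < +oo)%E) (f \in L2pred).
Proof. exact: asboolP. Qed.

Lemma measurable_sqr d (T : measurableType d) (f : T -> R) :
  measurable_fun setT f -> measurable_fun setT (fun s => ((f s) ^+ 2)%:E).
Proof. by move=> mf; apply/measurable_EFinP; exact: measurable_funX. Qed.

Lemma L2pred_le (f g : plane R -> R) : measurable_fun setT f ->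
  (forall s, `|f s| <= `|g s|) -> g \in L2pred -> f \in L2pred.
Proof.
move=> mf fg /L2predP[mg g2]; apply/L2predP; split => //.
apply: le_lt_trans g2; apply: ge0_le_integral => //.
- by move=> s _; rewrite lee_fin sqr_ge0.
- exact: measurable_sqr.
- exact: measurable_sqr.
- move=> s _; rewrite lee_fin -(real_normK (num_real (f s))).
  by rewrite -(real_normK (num_real (g s))) ler_sqr ?nnegrE.
Qed.

Lemma L2pred_submod_closed : submod_closed L2pred.
Proof.
split.
  apply/L2predP; split; first exact: measurable_cst.
  by under eq_integral do rewrite expr0n/=; rewrite integral0 ltry.
move=> a f g /L2predP[mf f2] /L2predP[mg g2]; apply/L2predP; split.
  by apply: measurable_funD => //; exact: measurable_funM.
apply: (@le_lt_trans _ _ (\int[leb2]_s ((2 * a ^+ 2)%:E * ((f s) ^+ 2)%:E +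
    2%:E * ((g s) ^+ 2)%:E))%E).
  apply: ge0_le_integral => //.
  - by move=> s _; rewrite lee_fin sqr_ge0.
  - apply: measurable_sqr; apply: measurable_funD => //; exact: measurable_funM.
  - by apply: emeasurable_funD; apply: emeasurable_funM => //; exact: measurable_sqr.
  - move=> s _; rewrite -!EFinM -EFinD lee_fin.
    change ((a * f s + g s) ^+ 2 <= 2 * a ^+ 2 * f s ^+ 2 + 2 * g s ^+ 2).
    rewrite -subr_ge0 (_ : _ - _ = (a * f s - g s) ^+ 2) ?sqr_ge0//; ring.
rewrite ge0_integralD//; last 4 first.
- move=> s _; rewrite -EFinM lee_fin; apply: mulr_ge0 (sqr_ge0 _).
  by apply: mulr_ge0 (sqr_ge0 _).
- by apply: emeasurable_funM => //; exact: measurable_sqr.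
- by move=> s _; rewrite -EFinM lee_fin; apply: mulr_ge0 (sqr_ge0 _).
- by apply: emeasurable_funM => //; exact: measurable_sqr.
rewrite !ge0_integralZl//; do ?[exact: measurable_sqr];
  do ?[by move=> s _; rewrite lee_fin sqr_ge0]; last first.
  by rewrite lee_fin; apply: mulr_ge0 (sqr_ge0 _).
rewrite lte_add_pinfty// lte_mul_pinfty// lee_fin.
by apply: mulr_ge0 (sqr_ge0 _).
Qed.

HB.instance Definition _ := GRing.isSubmodClosed.Build R (plane R -> R) L2pred
  L2pred_submod_closed.

Record L2 := MkL2 { L2fun :> plane R -> R ; L2funP : L2fun \in L2pred }.

HB.instance Definition _ := [isSub for L2fun].
HB.instance Definition _ := [Choice of L2 by <:].
HB.instance Definition _ := [SubChoice_isSubLmodule of L2 by <:].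

Lemma measurable_L2 (f : L2) : measurable_fun setT f.
Proof. by have /L2predP[] := L2funP f. Qed.

Lemma L2_lty (f : L2) : (\int[leb2]_s ((f s) ^+ 2)%:E < +oo)%E.
Proof. by have /L2predP[] := L2funP f. Qed.

Definition toL2 (f : plane R -> R) : L2 := insubd 0 f.

Lemma toL2E f : f \in L2pred -> toL2 f = f :> (plane R -> R).
Proof. by move=> hf; rewrite /toL2 (insubdK 0). Qed.

Definition ip2 (f g : L2) : R := \int[leb2]_s (f s * g s).

Lemma integrable_L2M (f g : L2) : leb2.-integrable setT (fun s => (f s * g s)%:E).
Proof.
apply/integrableP; split.
  by apply/measurable_EFinP; apply: measurable_funM; exact: measurable_L2.
apply: (@le_lt_trans _ _ (\int[leb2]_s (((f s) ^+ 2)%:E + ((g s) ^+ 2)%:E))%E).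
  apply: ge0_le_integral => //.
  - apply/measurable_EFinP; apply: measurableT_comp => //.
    by apply: measurable_funM; exact: measurable_L2.
  - by apply: emeasurable_funD; apply: measurable_sqr; exact: measurable_L2.
  - move=> s _ /=; rewrite lee_fin normrM.
    rewrite -(real_normK (num_real (f s))) -(real_normK (num_real (g s))).
    have : 0 <= (`|f s| - `|g s|) ^+ 2 by exact: sqr_ge0.
    have : 0 <= `|f s| * `|g s| by rewrite mulr_ge0.
    by move: `|f s| `|g s| => x y; rewrite sqrrB; lra.
rewrite ge0_integralD//; do ?[by move=> s _; rewrite lee_fin sqr_ge0];
  do ?[by apply: measurable_sqr; exact: measurable_L2].
by rewrite lte_add_pinfty// L2_lty.
Qed.

Lemma ip2_sqr (f : L2) : (\int[leb2]_s ((f s) ^+ 2)%:E)%E = (ip2 f f)%:E.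
Proof.
rewrite /ip2 /Rintegral fineK; last first.
  by apply: integrable_fin_num => //; exact: integrable_L2M.
by apply: eq_integral => s _; rewrite expr2.
Qed.

Lemma inner_product_ip2 : inner_product ip2.
Proof.
split => [f g|a f g h|f].
- by apply: eq_Rintegral => s _; rewrite mulrC.
- rewrite /ip2 -RintegralZl//; last exact: integrable_L2M.
  rewrite -RintegralD//; last 2 first.
  + have := integrableZl measurableT a (integrable_L2M f h).
    exact: eq_integrable.
  + exact: integrable_L2M.
  by apply: eq_Rintegral => s _; rewrite mulrA -mulrDl.
- by apply: Rintegral_ge0 => s _; rewrite -expr2 sqr_ge0.
Qed.

End square_integrable_functions.
Arguments L2 : clear implicits.

(** * Almost sure convergence of Gaussian sequences *)

Section first_moments.
Context {R : realType}.

Definition normal_abs_moment : R :=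
  fine (\int[@lebesgue_measure R]_x (`|x| * normal_pdf 0 1 x)%:E)%E.

Lemma isonormal_one_law d (T : measurableType d) (P : probability T R)
    (V : lmodType R) (ip : V -> V -> R) (Z : V -> T -> R) (v : V)
    (f : R -> \bar R) : inner_product ip -> isonormal P ip Z ->
  measurable_fun setT f -> (forall x, 0 <= f x)%E ->
  (\int[P]_w f (Z v w) =
   \int[normal_prob (0 : R) 1]_x f (Num.sqrt (ip v v) * x)%R)%E.
Proof.
move=> hip hZ mf f0.
have hN := normal_prob_isonormal (oner_neq0 R).
have hipN : inner_product (fun a b : R^o => 1 ^+ 2 * (a * b)).
  split => [a b|a b c e|a]; rewrite expr1n !mul1r.
  - by rewrite mulrC.
  - by rewrite mulrDl mulrA.
  - by rewrite -expr2 sqr_ge0.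
pose v' (u : unit) : R^o := Num.sqrt (ip v v).
have gr i j : ip ((fun=> v) i) ((fun=> v) j) = 1 ^+ 2 * (v' i * v' j).
  by rewrite expr1n mul1r /v' -expr2 sqr_sqrtr// (ip_ge0 hip).
apply: (gram_integral hip hZ hipN hN gr (f := fun x : state unit R => f (x tt))) => //.
by apply: measurableT_comp => //; exact: measurable_eval.
Qed.

Lemma isonormal_abs d (T : measurableType d) (P : probability T R)
    (V : lmodType R) (ip : V -> V -> R) (Z : V -> T -> R) (v : V) :
  inner_product ip -> isonormal P ip Z ->
  (\int[P]_w `|Z v w|%:E = (Num.sqrt (ip v v) * normal_abs_moment)%:E)%E.
Proof.
move=> hip hZ.
have mn : measurable_fun setT (fun x : R => `|x|%:E) by exact/measurable_EFinP.
have fin : (\int[@lebesgue_measure R]_x (`|x| * normal_pdf 0 1 x)%:E)%E \is a fin_num.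
  apply: integrable_fin_num => //; apply: integrable_normal_pdf1.
  exact: oner_neq0.
rewrite (isonormal_one_law v hip hZ mn)//.
rewrite ge0_integral_normal_prob; last 2 first.
- apply/measurable_EFinP; apply: measurableT_comp => //.
- by move=> x; rewrite lee_fin.
rewrite EFinM /normal_abs_moment fineK// -ge0_integralZl ?lee_fin ?sqrtr_ge0//;
  last 2 first.
- apply/measurable_EFinP; apply: measurable_funM => //.
  exact: measurable_normal_pdf.
- by move=> x _; rewrite lee_fin mulr_ge0// normal_pdf_ge0.
apply: eq_integral => x _.
by rewrite -!EFinM normrM ger0_norm ?sqrtr_ge0// mulrA.
Qed.

(** The first absolute moments are proportional to the standard deviations and thus summable. So the
    series of the |Z (v k)| has a finite expectation and converges almost surely. *)
Lemma isonormal_cvg0 d (T : measurableType d) (P : probability T R)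
    (V : lmodType R) (ip : V -> V -> R) (Z : V -> T -> R) (v : nat -> V) :
  inner_product ip -> isonormal P ip Z ->
  (forall k, Num.sqrt (ip (v k) (v k)) <= (2^-1) ^+ k) ->
  \forall w \ae P, Z (v k) w @[k --> \oo] --> 0.
Proof.
move=> hip hZ vk.
have mZ k : measurable_fun setT (fun w => `|Z (v k) w|%:E).
  apply/measurable_EFinP; apply: measurableT_comp => //.
  exact: isonormal_measurable hZ _.
have c0 : 0 <= normal_abs_moment.
  apply: fine_ge0; apply: integral_ge0 => x _.
  by rewrite lee_fin mulr_ge0// normal_pdf_ge0.
have S : (\int[P]_w \sum_(0 <= k <oo) `|Z (v k) w|%:E < +oo)%E.
  rewrite integral_nneseries//.
  under eq_eseriesr do rewrite (isonormal_abs _ hip hZ).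
  apply: (@le_lt_trans _ _ (\sum_(0 <= k <oo) ((2^-1) ^+ k * normal_abs_moment)%:E)%E).
    apply: lee_nneseries => k _; rewrite lee_fin ?mulr_ge0 ?sqrtr_ge0//.
    by rewrite ler_wpM2r.
  have H : series (geometric normal_abs_moment 2^-1) n @[n --> \oo] -->
      normal_abs_moment / (1 - 2^-1).
    apply: cvg_geometric_series; rewrite ger0_norm ?invr_ge0//.
    by rewrite invf_lt1// ltr1n.
  rewrite (_ : (\sum_(0 <= k <oo) _)%E = (normal_abs_moment * (1 - 2^-1)^-1)%:E) ?ltry//.
  apply: cvg_lim => //.
  apply: (@cvg_trans _ ((fun n => (series (geometric normal_abs_moment 2^-1) n)%:E) @ \oo)).
    apply: near_eq_cvg; apply: nearW => n.
    rewrite /series /= -sumEFin; apply: eq_bigr => k _.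
    by rewrite /geometric /= mulrC.
  by apply: cvg_EFin => //; exact: nearW.
have mS : measurable_fun setT (fun w => \sum_(0 <= k <oo) `|Z (v k) w|%:E)%E.
  by apply: ge0_emeasurable_sum => // k w _ _; rewrite lee_fin.
have iS : P.-integrable setT (fun w => \sum_(0 <= k <oo) `|Z (v k) w|%:E)%E.
  apply/integrableP; split => //.
  rewrite (eq_integral (fun w => \sum_(0 <= k <oo) `|Z (v k) w|%:E)%E)// => w _.
  by rewrite gee0_abs//; apply: nneseries_ge0 => k _ _; rewrite lee_fin.
apply: filterS (integrable_ae measurableT iS) => w /(_ I) fS.
apply: norm_cvg0.
have T0 : (\sum_(N <= k <oo) `|Z (v k) w|%:E)%E @[N --> \oo] --> 0%E.
  apply: nneseries_tail_cvg => [|k _]; last by rewrite lee_fin.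
  by move: fS; rewrite fin_numE => /andP[_]; rewrite ltey.
suff : `|Z (v k) w|%:E @[k --> \oo] --> 0%E by move/fine_cvg.
apply: (@squeeze_cvge _ _ _ _ (cst 0%E)) T0; last exact: cvg_cst.
apply: nearW => k; rewrite lee_fin normr_ge0/=.
apply: (@le_trans _ _ (\sum_(k <= i < k.+1) `|Z (v i) w|%:E)%E).
  by rewrite big_nat1.
by apply: nneseries_lim_ge => n _ _; rewrite lee_fin.
Qed.

End first_moments.

(** * Jointly measurable versions of integrals against the noise *)

Section measurable_versions.
Context {R : realType}.

(** A single [Gam] serves every isonormal process on every probability space. All fields of a split
    are thus the same measurable function of different noises. *)
Definition has_version (k : plane R -> L2 R) : Prop :=
  exists Gam : plane R * state (L2 R) R -> R, measurable_fun setT Gam /\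
    forall t d (T : measurableType d) (P : probability T R) (Z : L2 R -> T -> R),
      isonormal P ip2 Z -> \forall w \ae P, Gam (t, fun f => Z f w) = Z (k t) w.

Definition kernel_version (k : plane R * plane R -> R) : Prop :=
  has_version (fun t => toL2 (fun s => k (t, s))).

Lemma has_version_rank1 (a : plane R -> R) (f : L2 R) : measurable_fun setT a ->
  has_version (fun t => a t *: f).
Proof.
move=> ma; exists (fun q => a q.1 * (q.2 : L2 R -> R) f); split.
  apply: measurable_funM; first exact: measurableT_comp.
  by apply: (measurableT_comp (@measurable_eval _ _ f)).
move=> t d T P Z hZ.
by apply: filterS (isonormalZ hZ (a t) f) => w ->.
Qed.

Lemma has_versionD k k' : has_version k -> has_version k' ->
  has_version (fun t => k t + k' t).
Proof.
move=> [G [mG GE]] [G' [mG' GE']].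
exists (fun q => G q + G' q); split; first exact: measurable_funD.
move=> t d T P Z hZ.
have := isonormalD hZ (k t) (k' t); have := GE t d T P Z hZ; have := GE' t d T P Z hZ.
by apply: filterS3 => w -> -> ->.
Qed.

Lemma has_versionZ c k : has_version k -> has_version (fun t => c *: k t).
Proof.
move=> [G [mG GE]]; exists (fun q => c * G q); split; first exact: measurable_funM.
move=> t d T P Z hZ.
by have := isonormalZ hZ c (k t); have := GE t d T P Z hZ; apply: filterS2 => w -> ->.
Qed.

Lemma measurable_select d (T : measurableType d) d' (U : measurableType d')
    (F : nat -> T -> U) (N : T -> nat) : (forall n, measurable_fun setT (F n)) ->
  (forall n, measurable [set t | N t = n]) -> measurable_fun setT (fun t => F (N t) t).
Proof.
move=> mF mN _ B mB; rewrite setTI.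
have -> : (fun t => F (N t) t) @^-1` B =
    \bigcup_n ([set t | N t = n] `&` F n @^-1` B).
  apply/seteqP; split => t /=; first by exists (N t).
  by move=> [n _ [<-]].
apply: bigcupT_measurable => n; apply: measurableI => //.
by rewrite -[X in measurable X]setTI; exact: mF.
Qed.

(* The approximant used at time t is the first one that is 4^-m-close to the
   limit, so that Borel-Cantelli applies at every t. *)
Lemma has_version_lim (k_ : nat -> plane R -> L2 R) (k : plane R -> L2 R) :
  (forall n, measurable_fun setT (fun t => ip2 (k_ n t - k t) (k_ n t - k t))) ->
  (forall t, ip2 (k_ n t - k t) (k_ n t - k t) @[n --> \oo] --> 0) ->
  (forall n, has_version (k_ n)) -> has_version k.
Proof.
move=> mD D0 vk.
pose D n t := ip2 (k_ n t - k t) (k_ n t - k t).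
have exN m t : exists n, D n t <= (4^-1) ^+ m.
  have e0 : 0 < (4^-1 : R) ^+ m by rewrite exprn_gt0.
  have /cvgr0_norm_le/(_ _ e0)[n _ nP] := D0 t.
  by exists n; apply: le_trans (ler_norm _) (nP _ _) => /=.
pose N m t := ex_minn (exN m t).
have ND m t : D (N m t) t <= (4^-1) ^+ m by rewrite /N; case: ex_minnP.
have mN m n : measurable [set t | N m t = n].
  have mle i : measurable [set t | D i t <= (4^-1) ^+ m].
    rewrite -[X in measurable X]setTI; apply: measurable_fun_le => //.
    exact: mD.
  have -> : [set t | N m t = n] = [set t | D n t <= (4^-1) ^+ m] `&`
      \bigcap_(i in [set i | (i < n)%N]) ~` [set t | D i t <= (4^-1) ^+ m].
    apply/seteqP; split => t /=.
      move=> <-; split; first exact: ND.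
      move=> i /= iN Di; move: iN; rewrite /N; case: ex_minnP => p _ /(_ i Di) pi.
      by rewrite ltnNge pi.
    move=> [Dn Dlt]; rewrite /N; case: ex_minnP => p Dp pmin.
    apply/eqP; rewrite eqn_leq pmin//= leqNgt; apply/negP => pn.
    exact: (Dlt p pn).
  apply: measurableI => //; apply: bigcap_measurableType => // i _.
  exact: measurableC.
have {vk} /choice[Gam GamP] := vk.
pose H m (q : plane R * state (L2 R) R) := Gam (N m q.1) q.
(* The approximants converge only almost surely; the upper limit is defined and measurable
   everywhere and agrees with the limit where it exists. *)
exists (fun q => fine (limn_esup (fun m => (H m q)%:E))); split.
  apply: measurableT_comp; first exact: fine_measurable.
  apply: measurable_fun_limn_esup => m; apply/measurable_EFinP.
  apply: measurable_select => [n|n]; first by have [] := GamP n.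
  have -> : [set t : plane R * state (L2 R) R | N m t.1 = n] =
      [set t | N m t = n] `*` setT by apply/seteqP; split => q //= [].
  exact: measurableX.
move=> t d T P Z hZ.
pose v m := k_ (N m t) t - k t.
have vC : \forall w \ae P, Z (v m) w @[m --> \oo] --> 0.
  apply: (isonormal_cvg0 inner_product_ip2 hZ) => m.
  have p0 : 0 <= (2^-1 : R) ^+ m by rewrite exprn_ge0// invr_ge0.
  rewrite -[leRHS](ger0_norm p0) -sqrtr_sqr ler_wsqrtr//.
  rewrite -exprM mulnC exprM (_ : 2^-1 ^+ 2 = 4^-1); first exact: ND.
  by rewrite exprVn -natrX.
have GE : \forall w \ae P, forall m, H m (t, fun f => Z f w) = Z (k_ (N m t) t) w.
  apply: ae_foralln => m; have [_] := GamP (N m t).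
  by move=> /(_ t d T P Z hZ); apply: filterS => w <-.
have VE : \forall w \ae P, forall m, Z (k_ (N m t) t) w = Z (v m) w + Z (k t) w.
  apply: ae_foralln => m.
  by have := isonormalD hZ (v m) (k t); apply: filterS => w <-; rewrite /v subrK.
move: vC GE VE; apply: filterS3 => w vC GE VE.
have : (H m (t, fun f => Z f w))%:E @[m --> \oo] --> (Z (k t) w)%:E.
  apply: cvg_EFin; first exact: nearW.
  rewrite -[X in _ --> X]add0r.
  under eq_fun do rewrite /= GE VE.
  by apply: cvgD => //; exact: cvg_cst.
by move/cvg_limn_einf_sup => -[_ ->].
Qed.

Lemma L2_addE (f g : L2 R) s : (f + g : L2 R) s = f s + g s.
Proof. by []. Qed.

Lemma L2_subE (f g : L2 R) s : (f - g : L2 R) s = f s - g s.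
Proof. by []. Qed.

Lemma L2_scaleE a (f : L2 R) s : (a *: f : L2 R) s = a * f s.
Proof. by []. Qed.

Lemma L2_inj (f g : L2 R) : (forall s, f s = g s) -> f = g.
Proof. by move=> fg; apply/val_inj/funext. Qed.

Lemma eq_has_version k k' : (forall t, k t = k' t) -> has_version k -> has_version k'.
Proof. by move=> /funext ->. Qed.

Section limits_of_kernels.
Variables (k_ : nat -> plane R * plane R -> R) (k g : plane R * plane R -> R).
Hypotheses (mk_ : forall n, measurable_fun setT (k_ n)) (mk : measurable_fun setT k).
Hypothesis g2 : forall t, (fun s => g (t, s)) \in L2pred.
Hypotheses (k_g : forall n q, `|k_ n q| <= `|g q|) (kg : forall q, `|k q| <= `|g q|).
Hypothesis k_k : forall q, k_ n q @[n --> \oo] --> k q.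

(** For each t, dominated convergence by 4 g^2 gives convergence of the sections in L2, as
    [has_version_lim] demands. *)
Lemma kernel_version_lim : (forall n, kernel_version (k_ n)) -> kernel_version k.
Proof.
have k_2 n t : (fun s => k_ n (t, s)) \in L2pred.
  by apply: L2pred_le (g2 t) => //; exact: measurableT_comp.
have k2 t : (fun s => k (t, s)) \in L2pred.
  by apply: L2pred_le (g2 t) => //; exact: measurableT_comp.
have subE n t s : (toL2 (fun s => k_ n (t, s)) - toL2 (fun s => k (t, s)) : L2 R) s =
    k_ n (t, s) - k (t, s).
  by rewrite L2_subE !toL2E.
have ipE n t : (ip2 (toL2 (fun s => k_ n (t, s)) - toL2 (fun s => k (t, s)))
    (toL2 (fun s => k_ n (t, s)) - toL2 (fun s => k (t, s))))%:E =
    (\int[leb2]_s ((k_ n (t, s) - k (t, s)) ^+ 2)%:E)%E.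
  by rewrite -ip2_sqr; apply: eq_integral => s _; rewrite subE.
apply: has_version_lim => [n|t].
  apply/measurable_EFinP.
  rewrite (_ : EFin \o _ = fun t => \int[leb2]_s ((k_ n (t, s) - k (t, s)) ^+ 2)%:E)%E; last first.
    by apply/funext => t; exact: ipE.
  apply: (measurable_fun_fubini_tonelli_F (fun q : plane R * plane R => ((k_ n q - k q) ^+ 2)%:E)).
    by apply: measurable_sqr; exact: measurable_funB.
  by move=> q; rewrite lee_fin sqr_ge0.
suff : (\int[leb2]_s ((k_ n (t, s) - k (t, s)) ^+ 2)%:E)%E @[n --> \oo] --> 0%E.
  move=> H; apply: (@fine_cvg _ _ _ _ (fun n =>
    (ip2 (toL2 (fun s => k_ n (t, s)) - toL2 (fun s => k (t, s)))
         (toL2 (fun s => k_ n (t, s)) - toL2 (fun s => k (t, s))))%:E)).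
  apply: cvg_trans H; apply: near_eq_cvg; apply: nearW => n /=.
  by rewrite ipE.
have msec (f : plane R * plane R -> R) : measurable_fun setT f ->
    measurable_fun setT (fun s => f (t, s)) by move=> mf; exact: measurableT_comp.
have /L2predP[mg gfin] := g2 t.
have [] := @dominated_convergence _ _ _ (@leb2 R) setT measurableT
  (fun n s => ((k_ n (t, s) - k (t, s)) ^+ 2)%:E) (cst 0%E)
  (fun s => ((4 : R)%:E * ((g (t, s)) ^+ 2)%:E)%E).
- by move=> n; apply: measurable_sqr; apply: measurable_funB; exact: msec.
- exact: measurable_cst.
- apply: aeW => s _; apply: cvg_EFin; first exact: nearW.
  have H : k_ n (t, s) - k (t, s) @[n --> \oo] --> (0 : R).
    rewrite -(subrr (k (t, s))); apply: cvgB; last exact: cvg_cst.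
    exact: k_k.
  rewrite -(mulr0 (0 : R)); under eq_fun do rewrite expr2.
  exact: cvgM.
- apply: integrableZl => //; apply/integrableP; split; first exact: measurable_sqr.
  under eq_integral do rewrite gee0_abs ?lee_fin ?sqr_ge0//.
  exact: gfin.
- apply: aeW => s n _.
  change (`|((k_ n (t, s) - k (t, s)) ^+ 2)%:E| <= (4 * g (t, s) ^+ 2)%:E)%E.
  rewrite gee0_abs lee_fin ?sqr_ge0//.
  rewrite -[leLHS]real_normK ?num_real// -(real_normK (num_real (g _))).
  rewrite (_ : 4 = 2 ^+ 2); last by rewrite -natrX.
  rewrite -exprMn ler_sqr ?nnegrE ?mulr_ge0//.
  apply: le_trans (ler_normB _ _) _.
  by rewrite mulr_natl mulr2n lerD.
by move=> _ _; rewrite integral_cst// mul0e.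
Qed.

End limits_of_kernels.

(** Bounded squares exhausting the plane. They make indicators square integrable here, and later
    test local integrability. *)
Definition window n : set (plane R) :=
  `[- n%:R, n%:R]%classic `*` `[- n%:R, n%:R]%classic.

Lemma measurable_window n : measurable (window n).
Proof. by apply: measurableX; exact: measurable_itv. Qed.

Lemma leb2_window_lty n : (leb2 (window n) < +oo)%E.
Proof.
rewrite /leb2 /window product_measure1E; do ?exact: measurable_itv.
have H : @lebesgue_measure R (`[- n%:R, n%:R]%classic : set R) \is a fin_num.
  by rewrite lebesgue_measure_itv /=; case: ifP.
by rewrite ltey_eq fin_numM.
Qed.

Lemma L2pred_indic (B : set (plane R)) : measurable B -> (leb2 B < +oo)%E ->
  (\1_B : plane R -> R) \in L2pred.
Proof.
move=> mB Boo; apply/L2predP; split => //.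
rewrite (eq_integral (fun s => (\1_B s)%:E)); first by rewrite integral_indic ?setIT.
by move=> s _; rewrite indicE; case: (_ \in _); rewrite ?expr1n ?expr0n.
Qed.

Lemma window_indic_L2 n : (\1_(window n) : plane R -> R) \in L2pred.
Proof. by apply: L2pred_indic; [exact: measurable_window|exact: leb2_window_lty]. Qed.

Lemma kernel_version0 : kernel_version (fun=> 0).
Proof.
apply: (@eq_has_version (fun=> 0 *: (0 : L2 R))); last first.
  by apply: has_version_rank1; exact: measurable_cst.
move=> t; apply: L2_inj => s; rewrite L2_scaleE mul0r toL2E//.
by have := rpred0 L2pred; exact.
Qed.

(** Dynkin induction on A: the indicator of a rectangle is a kernel of rank one, complements follow
    by linearity, and for a disjoint union the partial sums take only the values 0 and 1, so they
    are dominated by the window. *)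
Lemma kernel_version_indic n (A : set (plane R * plane R)) : measurable A ->
  kernel_version (fun q => \1_A q * \1_(window n) q.2).
Proof.
have mW := measurable_window n.
have mWf : measurable_fun setT (fun q : plane R * plane R => \1_(window n) q.2 : R).
  by apply: (@measurableT_comp _ _ _ _ _ _ (\1_(window n) : plane R -> R)).
have L2W (f : plane R * plane R -> R) t : measurable_fun setT f ->
    (forall q, `|f q| <= 1) -> (fun s => f (t, s) * \1_(window n) s) \in L2pred.
  move=> mf f1; apply: L2pred_le (window_indic_L2 n) => [|s].
    by apply: measurable_funM => //; exact: measurableT_comp.
  by rewrite normrM ler_piMl.
have ind1 (B : set (plane R * plane R)) q : `|\1_B q : R| <= 1.
  by rewrite indicE; case: (_ \in _); rewrite ?normr1 ?normr0.
pose G := [set A1 `*` B1 | A1 in (measurable : set (set (plane R))) &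
  B1 in (measurable : set (set (plane R)))].
have GE : (measurable : set (set (plane R * plane R))) = <<s G >>.
  exact: measurable_prod_measurableType.
rewrite GE; apply: (@dynkin_induction _ _ G
  (fun A => kernel_version (fun q => \1_A q * \1_(window n) q.2))).
- exact: GE.
- move=> _ _ [A1 mA1 [B1 mB1 <-]] [A2 mA2 [B2 mB2 <-]].
  rewrite -setXI; exists (A1 `&` A2); first exact: measurableI.
  by exists (B1 `&` B2) => //; exact: measurableI.
- apply: (@eq_has_version (fun=> 1 *: toL2 (\1_(window n)))); last first.
    by apply: has_version_rank1; exact: measurable_cst.
  move=> t; apply: L2_inj => s; rewrite L2_scaleE toL2E ?window_indic_L2//.
  have mT : measurable_fun setT (\1_setT : plane R * plane R -> R).
    exact: measurable_indic.
  by rewrite (toL2E (L2W _ t mT (ind1 setT))) indicT.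
- move=> _ [A1 mA1 [B1 mB1 <-]].
  pose f : plane R -> R := \1_(B1 `&` window n).
  have f2 : f \in L2pred.
    apply: L2pred_indic; first exact: measurableI.
    apply: le_lt_trans (leb2_window_lty n); apply: le_measure; rewrite ?inE//.
    exact: measurableI.
  apply: (@eq_has_version (fun t => (\1_A1 t : R) *: toL2 f)); last first.
    exact: has_version_rank1.
  move=> t; apply: L2_inj => s; rewrite L2_scaleE toL2E//.
  rewrite toL2E; last by apply: L2W => //; apply: measurable_indic; exact: measurableX.
  rewrite /f indicI /= !indicE; move: (s \in window n) => b; rewrite in_setX /=.
  by case: (t \in A1); case: (s \in B1); rewrite /= ?mul1r ?mul0r.
- move=> A1 mA1 vA1.
  apply: (@eq_has_version (fun t => 1 *: toL2 (\1_(window n)) +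
     (-1) *: toL2 (fun s => \1_A1 (t, s) * \1_(window n) s))); last first.
    apply: has_versionD; first by apply: has_version_rank1; exact: measurable_cst.
    exact: has_versionZ.
  have mA1' : measurable (~` A1) by exact: measurableC.
  move=> t; apply: L2_inj => s; rewrite L2_addE !L2_scaleE toL2E ?window_indic_L2//.
  rewrite !toL2E; do ?[by apply: L2W => //; exact: measurable_indic].
  by rewrite !indicE in_setC; case: (_ \in A1) => /=; ring.
- move=> F mF tF vF.
  pose S m (q : plane R * plane R) : R := \sum_(i < m) \1_(F i) q.
  have SE q i m : F i q -> S m q = (i < m)%:R.
    move=> Fi; have Fj j : j != i -> \1_(F j) q = 0 :> R.
      move=> ji; rewrite indicE memNset// => Fjq.
      have : (F j `&` F i) q by [].
      by move/trivIsetP : tF => /(_ j i I I ji) ->.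
    rewrite /S; case: ltnP => im.
      rewrite (bigD1 (Ordinal im))//= big1 ?addr0.
        by rewrite indicE mem_set.
      by move=> j /eqP ji; apply: Fj; apply/eqP => jE; apply: ji; exact/val_inj.
    rewrite big1// => j _; apply: Fj; apply: contraTN im => /eqP <-.
    by rewrite -ltnNge.
  have S0 q m : (forall i, ~ F i q) -> S m q = 0.
    by move=> nF; rewrite /S big1// => i _; rewrite indicE memNset.
  have S1 m q : `|S m q| <= 1.
    have [[i Fi]|nF] := pselect (exists i, F i q).
      by rewrite (SE q i)//; case: (_ < _)%N; rewrite ?normr1 ?normr0.
    by rewrite S0 ?normr0// => i Fi; apply: nF; exists i.
  have mS m : measurable_fun setT (S m).
    by apply: measurable_sum => i; exact: measurable_indic.
  have mU : measurable (\bigcup_k F k) by exact: bigcupT_measurable.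
  apply: (@kernel_version_lim (fun m q => S m q * \1_(window n) q.2) _
     (fun q => \1_(window n) q.2)).
  + by move=> m; exact: measurable_funM.
  + by apply: measurable_funM => //; exact: measurable_indic.
  + by move=> t; exact: window_indic_L2.
  + by move=> m q; rewrite normrM ler_piMl.
  + by move=> q; rewrite normrM ler_piMl.
  + move=> q; apply: cvgMl.
    have [[i Fi]|nF] := pselect (exists i, F i q).
      rewrite indicE mem_set; last by exists i.
      apply: cvg_near_cst; exists i.+1 => // m /= im.
      by rewrite (SE q i)// im.
    rewrite indicE memNset; last by move=> [i _ Fi]; apply: nF; exists i.
    apply: cvg_near_cst; apply: nearW => m.
    by rewrite S0// => i Fi; apply: nF; exists i.
  + elim=> [|m IH].
      apply: (eq_has_version _ kernel_version0) => t.
      by apply: L2_inj => s; congr (toL2 _ s); apply/funext => u; rewrite /S big_ord0 mul0r.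
    apply: (eq_has_version _ (has_versionD IH (vF m))) => t.
    apply: L2_inj => s; rewrite L2_addE !toL2E; last 3 first.
    * exact: L2W.
    * by apply: L2W => //; exact: measurable_indic.
    * exact: L2W.
    by rewrite /S big_ord_recr/= mulrDl.
Qed.

Lemma kernel_version_nnsfun n (h : {nnsfun (plane R * plane R)%type >-> R}) :
  kernel_version (fun q => h q * \1_(window n) q.2).
Proof.
have mW := measurable_window n.
have L2W (f : plane R * plane R -> R) t : measurable_fun setT f ->
    (exists M, forall q, `|f q| <= M) -> (fun s => f (t, s) * \1_(window n) s) \in L2pred.
  move=> mf [M f1].
  apply: (L2pred_le _ _ (rpredZ M (window_indic_L2 n))).
    by apply: measurable_funM => //; exact: measurableT_comp.
  move=> s; rewrite normrM [leRHS]normrM ler_wpM2r//.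
  by apply: le_trans (f1 _) (ler_norm _).
have hE q : h q = \sum_(y <- fset_set (range h)) y * \1_(h @^-1` [set y]) q.
  by rewrite [LHS]fimfunE fsbig_finite.
rewrite (_ : (fun q => _) = fun q => (\sum_(y <- fset_set (range h))
    y * \1_(h @^-1` [set y]) q) * \1_(window n) q.2); last first.
  by apply/funext => q; rewrite hE.
elim: (enum_fset (fset_set (range h))) => [|y r IH].
  apply: (eq_has_version _ kernel_version0) => t.
  by apply: L2_inj => s; congr (toL2 _ s); apply/funext => u; rewrite big_nil mul0r.
have my z : measurable (h @^-1` [set z]) by [].
have bnd (r' : seq R) : exists M : R, forall q,
    `|\sum_(y <- r') y * \1_(h @^-1` [set y]) q| <= M.
  elim: r' => [|z r' [M MP]]; first by exists 0 => q; rewrite big_nil normr0.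
  exists (`|z| + M) => q; rewrite big_cons; apply: le_trans (ler_normD _ _) _.
  rewrite lerD// normrM ler_piMr// indicE; case: (_ \in _); rewrite ?normr1 ?normr0//.
have ms (r' : seq R) : measurable_fun setT
    (fun q => \sum_(y <- r') y * \1_(h @^-1` [set y]) q).
  by apply: measurable_sum => z; apply: measurable_funM => //; exact: measurable_indic.
apply: (eq_has_version _ (has_versionD (has_versionZ y (kernel_version_indic n (my y))) IH)) => t.
apply: L2_inj => s; rewrite L2_addE L2_scaleE !toL2E; last 3 first.
- exact: (L2W (fun q => \sum_(z <- y :: r) z * \1_(h @^-1` [set z]) q)).
- exact: (L2W (fun q => \sum_(z <- r) z * \1_(h @^-1` [set z]) q)).
- apply: (L2W (\1_(h @^-1` [set y]))); first exact: measurable_indic.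
  by exists 1 => q; rewrite indicE; case: (_ \in _); rewrite ?normr1 ?normr0.
by rewrite big_cons mulrDl mulrA.
Qed.

Lemma cvg_window_indic (s : plane R) : (\1_(window n) s : R) @[n --> \oo] --> (1 : R).
Proof.
apply: cvg_near_cst.
exists (maxn (Num.truncn `|s.1|).+1 (Num.truncn `|s.2|).+1) => // n /=.
rewrite geq_max => /andP[n1 n2]; rewrite indicE mem_set//.
split; rewrite /= in_itv/= -ler_norml; apply/ltW; apply: lt_le_trans (truncnS_gt _) _;
  by rewrite ler_nat.
Qed.

Lemma kernel_has_version_ge0 (k : plane R * plane R -> R) : measurable_fun setT k ->
  (forall q, 0 <= k q) -> (forall t, (fun s => k (t, s)) \in L2pred) -> kernel_version k.
Proof.
move=> mk k0 k2.
have mek : measurable_fun setT (EFin \o k) by exact/measurable_EFinP.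
pose h := nnsfun_approx measurableT mek.
have hk n q : h n q <= k q.
  rewrite -lee_fin nnsfun_approxE; apply: le_approx => //.
  by move=> x _; rewrite lee_fin.
apply: (@kernel_version_lim (fun n q => h n q * \1_(window n) q.2) _ k) => //.
- move=> n; apply: measurable_funM => //.
  have mW := measurable_window n.
  by apply: (@measurableT_comp _ _ _ _ _ _ (\1_(window n) : plane R -> R)).
- move=> n q; rewrite normrM !ger0_norm//.
  rewrite (le_trans _ (hk n q))// ler_piMr// indicE; by case: (_ \in _).
- move=> q; rewrite -[k q]mulr1; apply: cvgM; last exact: cvg_window_indic.
  have ek0 x : setT x -> (0 <= (EFin \o k) x)%E by rewrite lee_fin.
  exact: (fine_cvg (@cvg_nnsfun_approx _ _ _ _ measurableT _ mek ek0 q I)).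
- by move=> n; exact: kernel_version_nnsfun.
Qed.

Theorem kernel_has_version (k : plane R * plane R -> R) : measurable_fun setT k ->
  (forall t, (fun s => k (t, s)) \in L2pred) -> kernel_version k.
Proof.
move=> mk k2.
have mn : measurable_fun setT (fun q => `|k q|) by exact: measurableT_comp.
have L2p (f : plane R * plane R -> R) t : measurable_fun setT f ->
    (forall q, `|f q| <= `|k q|) -> (fun s => f (t, s)) \in L2pred.
  by move=> mf fk; apply: L2pred_le (k2 t) => //; exact: measurableT_comp.
pose kp q := (`|k q| + k q) / 2; pose km q := (`|k q| - k q) / 2.
have mkp : measurable_fun setT kp by apply: measurable_funM => //; exact: measurable_funD.
have mkm : measurable_fun setT km by apply: measurable_funM => //; exact: measurable_funB.
have kk q : - `|k q| <= k q <= `|k q| by rewrite -ler_norml.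
have kp0 q : 0 <= kp q by have /andP[] := kk q; rewrite /kp; lra.
have km0 q : 0 <= km q by have /andP[] := kk q; rewrite /km; lra.
have kpk q : `|kp q| <= `|k q| by rewrite ger0_norm//; have /andP[] := kk q; rewrite /kp; lra.
have kmk q : `|km q| <= `|k q| by rewrite ger0_norm//; have /andP[] := kk q; rewrite /km; lra.
have vp : kernel_version kp by apply: kernel_has_version_ge0 => // t; exact: L2p.
have vm : kernel_version km by apply: kernel_has_version_ge0 => // t; exact: L2p.
apply: (eq_has_version _ (has_versionD vp (has_versionZ (-1) vm))) => t.
apply: L2_inj => s; rewrite L2_addE L2_scaleE !toL2E; last 3 first.
- exact: L2p.
- exact: L2p.
- exact: L2p.
by rewrite /kp /km; field.
Qed.

End measurable_versions.

(** * Integrating out independent Gaussian summands *)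

Section independent_directions.
Context {R : realType}.

Lemma inner_product_regular (c : R) : 0 <= c ->
  inner_product (fun a b : R^o => c * (a * b)).
Proof.
move=> c0; split => [a b|a b u v|a]; rewrite /=.
- by rewrite (mulrC a).
- by rewrite /GRing.scale /=; ring.
- by rewrite mulr_ge0// -expr2 sqr_ge0.
Qed.

Context d (T : measurableType d) (P : probability T R) (V : lmodType R)
  (ip : V -> V -> R) (Z : V -> T -> R).
Hypotheses (hip : inner_product ip) (hZ : isonormal P ip Z).

(* Two orthogonal directions of variance 1/2 that are orthogonal to the family v
   behave like a standard complex Gaussian variable independent of it. *)
Lemma peel_complex_gaussian (x0 x1 : V) (I : Type) (v : I -> V)
    (Phi : plane R * state I R -> \bar R) :
  measurable_fun setT Phi -> (forall q, 0 <= Phi q)%E ->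
  ip x0 x0 = 2^-1 -> ip x1 x1 = 2^-1 -> ip x0 x1 = 0 ->
  (forall i, ip x0 (v i) = 0) -> (forall i, ip x1 (v i) = 0) ->
  (\int[P]_w Phi ((Z x0 w, Z x1 w), fun i => Z (v i) w) =
   \int[P]_w \int[complex_gaussian]_z Phi (z, fun i => Z (v i) w))%E.
Proof.
move=> mPhi Phi0 x00 x11 x01 x0v x1v.
have mZ := isonormal_measurable hZ.
pose f (x : state (bool + I) R) :=
  Phi ((x (inl false), x (inl true)), fun i => x (inr i)).
have mf : measurable_fun setT f.
  apply: (measurableT_comp mPhi); apply/measurable_fun_pair => /=.
    by apply/measurable_fun_pair => /=; exact: measurable_eval.
  by apply: measurable_to_state => i; exact: measurable_eval.
have hc : inner_product (fun a b : R^o => 2^-1 * (a * b)).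
  by apply: inner_product_regular; rewrite invr_ge0.
have hZ1 := isonormal_prod complex_gaussian_isonormal hZ.
have hip1 := prod_inner_product (prod_inner_product hc hc) hip.
pose u (k : bool + I) : V :=
  match k with inl b => if b then x1 else x0 | inr i => v i end.
pose u' (k : bool + I) : (R^o * R^o * V)%type :=
  match k with inl b => if b then ((0, 1), 0) else ((1, 0), 0)
             | inr i => ((0, 0), v i) end.
have gr i j : ip (u i) (u j) =
    prod_ip (prod_ip (fun a b : R^o => 2^-1 * (a * b))
                     (fun a b : R^o => 2^-1 * (a * b))) ip (u' i) (u' j).
  rewrite /prod_ip; case: i => [[]|i]; case: j => [[]|j] /=;
    rewrite ?(mulr0, mul0r, mulr1, addr0, add0r, ip0l hip, ip0r hip)//.
  - by rewrite (ip_sym hip).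
  - by rewrite (ip_sym hip).
  - by rewrite (ip_sym hip).
have -> : (\int[P]_w Phi ((Z x0 w, Z x1 w), fun i => Z (v i) w) =
    \int[P]_w f (fun k => Z (u k) w))%E by [].
rewrite (gram_integral hip hZ hip1 hZ1 gr mf); last by move=> x; exact: Phi0.
have msZ : measurable_fun setT (fun w => (fun i => Z (v i) w) : state I R).
  exact: measurable_to_state.
have mP1 : measurable_fun setT (fun q : plane R * T => Phi (q.1, fun i => Z (v i) q.2)).
  apply: (measurableT_comp mPhi); apply/measurable_fun_pair => //=.
  exact: (measurableT_comp msZ).
transitivity (\int[(complex_gaussian \x P)%E]_q Phi (q.1, fun i => Z (v i) q.2))%E.
  apply: ae_eq_integral => //.
    apply: (measurableT_comp mf); apply: measurable_to_state => k.
    exact: isonormal_measurable hZ1 _.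
  (* In [prod_noise] the two new directions come with the summand Z 0, which vanishes almost
     surely. *)
  have := ae_snd complex_gaussian (isonormal0 hZ).
  apply: filterS => q Z0 _; rewrite /f /prod_noise /=.
  congr (Phi (_, _)).
    rewrite Z0 [RHS]surjective_pairing; congr pair; ring.
  by apply/funext => i; rewrite !mul0r !add0r.
rewrite fubini_tonelli2//.
Qed.

End independent_directions.

Section orthonormal_families.
Context {R : realType}.

(** Each new orthonormal vector is realized by one more independent normal factor. This supplies
    fresh Gaussians outside the given noise, from which vectors with a prescribed Gram matrix are
    built. *)
Lemma orthonormal_exists (J : eqType) (s : seq J) :
  exists (d : measure_display) (T : measurableType d) (P : probability T R)
    (V : lmodType R) (ip : V -> V -> R) (Z : V -> T -> R) (e : J -> V),
  [/\ inner_product ip, isonormal P ip Z &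
      {in s &, forall i j, ip (e i) (e j) = (i == j)%:R}].
Proof.
elim: s => [|j0 s [d [T [P [V [ip [Z [e [hip hZ eo]]]]]]]]].
  exists _, _, (normal_prob (0 : R) 1), R^o, (fun a b : R^o => 1 ^+ 2 * (a * b)),
    (fun (a : R^o) (x : measurableTypeR R) => a * x), (fun=> 0).
  split=> //; first exact: inner_product_regular (sqr_ge0 _).
  exact: normal_prob_isonormal (oner_neq0 R).
have h1 := inner_product_regular (sqr_ge0 (1 : R)).
have hN := normal_prob_isonormal (oner_neq0 R).
exists _, _, (P \x normal_prob (0 : R) 1)%E, (V * R^o)%type,
  (prod_ip ip (fun a b : R^o => 1 ^+ 2 * (a * b))),
  (prod_noise Z (fun (a : R^o) (x : measurableTypeR R) => a * x)),
  (fun j => if j == j0 then (0, 1) else (e j, 0)).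
split; [exact: prod_inner_product|exact: isonormal_prod|].
move=> i j; rewrite !inE /prod_ip.
case: (eqVneq i j0) => [->|i0] /=; case: (eqVneq j j0) => [->|j1] /= is_ js;
  rewrite ?(ip0l hip) ?(ip0r hip) ?expr1n ?mul1r ?mulr1 ?mulr0 ?mul0r ?add0r ?addr0.
- by [].
- by [].
- by rewrite (negbTE i0).
- exact: eo.
Qed.

(* A diagonally dominant symmetric matrix A is the Gram matrix of the vectors
   sum_m (a_km e_km + b_km e_mk), where 2 a_kl b_kl = A_kl off the diagonal. *)
Lemma diagonally_dominant_gram (K : eqType) (s : seq K) (A : K -> K -> R)
    (V : lmodType R) (ip : V -> V -> R) (e : K -> K -> V) :
  inner_product ip -> uniq s -> (forall k l, A k l = A l k) ->
  (forall k, k \in s -> \sum_(l <- s | l != k) `|A k l| <= A k k) ->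
  (forall k l m p, k \in s -> l \in s -> m \in s -> p \in s ->
     ip (e k l) (e m p) = ((k == m) && (l == p))%:R) ->
  exists v : K -> V,
    [/\ {in s &, forall k l, ip (v k) (v l) = A k l} &
        forall x, (forall m p, m \in s -> p \in s -> ip x (e m p) = 0) ->
          forall k, ip x (v k) = 0].
Proof.
move=> hip us Asym dom eo.
(* The slack of row k goes to e_kk. Each off-diagonal entry costs row k the amount |A_kl|, half
   through [a] and half through [b], which also carries the sign. *)
pose c k := A k k - \sum_(l <- s | l != k) `|A k l|.
pose a k m := if m == k then Num.sqrt (c k) else Num.sqrt (`|A k m| / 2).
pose b k m := if m == k then 0 else Num.sg (A k m) * Num.sqrt (`|A k m| / 2).
pose v1 k := \sum_(m <- s) a k m *: e k m.
pose v2 k := \sum_(m <- s) b k m *: e m k.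
have sum_delta (f : K -> R) k : k \in s -> \sum_(m <- s) f m * (k == m)%:R = f k.
  move=> ks; rewrite (bigD1_seq k)//= eqxx mulr1 big1 ?addr0// => m /negPf mk.
  by rewrite eq_sym mk mulr0.
have v11 : {in s &, forall k l, ip (v1 k) (v1 l) = (k == l)%:R * \sum_(m <- s) a k m * a l m}.
  move=> k l ks ls; rewrite (ip_suml hip) mulr_sumr big_seq [RHS]big_seq.
  apply: eq_bigr => m ms; rewrite (ipZl hip) (ip_sumr hip) big_seq.
  under eq_bigr => p ps do rewrite (ipZr hip) eo//.
  rewrite -big_seq; case: eqP => _ /=; last by rewrite big1 ?mulr0 ?mul0r// => p _; rewrite mulr0.
  by rewrite sum_delta// mul1r.
have v22 : {in s &, forall k l, ip (v2 k) (v2 l) = (k == l)%:R * \sum_(m <- s) b k m * b l m}.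
  move=> k l ks ls; rewrite (ip_suml hip) mulr_sumr big_seq [RHS]big_seq.
  apply: eq_bigr => m ms; rewrite (ipZl hip) (ip_sumr hip) big_seq.
  under eq_bigr => p ps do rewrite (ipZr hip) eo// andbC.
  rewrite -big_seq; case: eqP => _ /=; last by rewrite big1 ?mulr0 ?mul0r// => p _; rewrite mulr0.
  by rewrite sum_delta// mul1r.
have v12 : {in s &, forall k l, ip (v1 k) (v2 l) = a k l * b l k}.
  move=> k l ks ls; rewrite (ip_suml hip) big_seq.
  under eq_bigr => m ms.
    rewrite (ipZl hip) (ip_sumr hip) big_seq.
    under eq_bigr => p ps do rewrite (ipZr hip) eo// -mulnb natrM mulrA.
    rewrite -big_seq -mulr_suml sum_delta//.
    over.
  rewrite -big_seq.
  under eq_bigr => m _ do rewrite mulrA (eq_sym m).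
  by rewrite (sum_delta (fun m => a k m * b l k)).
(* The value 0 outside s makes the orthogonality claim true for every k. *)
exists (fun k => if k \in s then v1 k + v2 k else 0); split => [k l ks ls|x xe k]; last first.
  case: ifPn => [ks|_]; last by rewrite (ip0r hip).
  rewrite (ipDr hip) !(ip_sumr hip) !big_seq.
  by rewrite !big1 ?addr0// => m ms; rewrite (ipZr hip) xe// mulr0.
rewrite ks ls (ipDl hip) !(ipDr hip) v11// v12// v22//.
rewrite (ip_sym hip (v2 k)) v12//.
have [->|kl] := eqVneq k l; last first.
  have lk : (l == k) = false by rewrite eq_sym (negbTE kl).
  rewrite !mul0r add0r addr0 /a /b (negbTE kl) lk (Asym l k).
  by rewrite mulrCA -expr2 sqr_sqrtr ?divr_ge0// -mulrDr -splitr -numEsg.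
rewrite !mul1r.
have bkk : b l l = 0 by rewrite /b eqxx.
rewrite bkk mulr0 addr0 add0r (bigD1_seq l)//= (bigD1_seq (F := fun m => b l m * b l m) l)//=.
rewrite bkk mulr0 add0r {1 2}/a eqxx -expr2 sqr_sqrtr; last by rewrite subr_ge0 dom.
rewrite -addrA -big_split/= (eq_bigr (fun m => `|A l m|)); first by rewrite subrK.
move=> m ml; rewrite /a /b (negbTE ml) -!expr2 exprMn sqr_sqrtr ?divr_ge0//.
rewrite sqr_sg; case: eqP => [->|_]; first by rewrite normr0 mul0r mulr0 addr0.
by rewrite mul1r -splitr.
Qed.

End orthonormal_families.

Section independent_factors.
Context {R : realType}.
Context d (T : measurableType d) (P : probability T R) (V : lmodType R)
  (ip : V -> V -> R) (Z : V -> T -> R).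
Hypotheses (hip : inner_product ip) (hZ : isonormal P ip Z).
Variables (F : plane R * plane R -> R) (H : plane R -> R).
Hypotheses (mF : measurable_fun setT F) (F0 : forall q, 0 <= F q).
Hypotheses (mH : measurable_fun setT H) (H0 : forall y, 0 <= H y).
Hypothesis FH : forall h y,
  (\int[complex_gaussian]_z (F (((z : plane R) + h)%R, y))%:E <= (H y)%:E)%E.

Definition cval (u : nat -> bool -> V) (i : nat) (w : T) : plane R :=
  (Z (u i false) w, Z (u i true) w).

(** The pairs x_i are peeled off one at a time. Given everything else, v_i and y_i act as the
    constants h and y in [FH], so the integral over x_i replaces the factor F by H. *)
Lemma integral_independent_factors (x v y : nat -> bool -> V) (r : seq nat) :
  uniq r ->
  (forall i b j c, i \in r -> j \in r ->
    ip (x i b) (x j c) = ((i == j) && (b == c))%:R / 2) ->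
  (forall i b j c, i \in r -> ip (x i b) (v j c) = 0) ->
  (forall i b j c, i \in r -> ip (x i b) (y j c) = 0) ->
  (\int[P]_w (\prod_(i <- r) F ((cval x i w + cval v i w)%R, cval y i w))%:E <=
   \int[P]_w (\prod_(i <- r) H (cval y i w))%:E)%E.
Proof.
move=> ur xx xv xy.
have mZ := isonormal_measurable hZ.
have mcval u i : measurable_fun setT (cval u i).
  by apply/measurable_fun_pair => /=; exact: mZ.
have mplane d1 (U : measurableType d1) (f g : U -> plane R) :
    measurable_fun setT f -> measurable_fun setT g ->
    measurable_fun setT (fun u => (f u + g u)%R).
  move=> mf mg; apply/measurable_fun_pair => /=; apply: measurable_funD;
    by apply: measurableT_comp.
pose Y := state (nat * bool) R.
pose yst (w : T) : Y := fun k => Z (y k.1 k.2) w.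
(* The weight G collects the factors H gained so far; it depends on the y only and is thus untouched
   by later peelings. *)
suff gen (s : seq nat) (G : Y -> R) : uniq s -> {subset s <= r} ->
    measurable_fun setT G -> (forall q, 0 <= G q) ->
    (\int[P]_w ((\prod_(i <- s) F ((cval x i w + cval v i w)%R, cval y i w)) *
       G (yst w))%:E <= \int[P]_w ((\prod_(i <- s) H (cval y i w)) * G (yst w))%:E)%E.
  have := gen r (fun=> 1) ur (fun=> id) (measurable_cst _) (fun=> ler01).
  by under eq_integral do rewrite mulr1; under [X in (_ <= X)%E]eq_integral do rewrite mulr1.
elim: s G => [|i s IH] G us sr mG G0.
  rewrite le_eqVlt; apply/orP; left; apply/eqP; apply: eq_integral => w _.
  by rewrite !big_nil.
have [iNs us'] : i \notin s /\ uniq s by move: us => /= /andP[].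
have ir : i \in r by apply: sr; rewrite inE eqxx.
have sr' : {subset s <= r} by move=> j js; apply: sr; rewrite inE js orbT.
pose I := (nat * bool + (nat * bool + nat * bool))%type.
(* Vectors x_j with j outside s are replaced by 0, so that the whole family is orthogonal to the
   pair x_i being peeled off. *)
pose fam (k : I) : V := match k with
  | inl p => if p.1 \in s then x p.1 p.2 else 0
  | inr (inl p) => v p.1 p.2 | inr (inr p) => y p.1 p.2 end.
pose cx (j : nat) (q : state I R) : plane R := (q (inl (j, false)), q (inl (j, true))).
pose cv (j : nat) (q : state I R) : plane R :=
  (q (inr (inl (j, false))), q (inr (inl (j, true)))).
pose cy (j : nat) (q : state I R) : plane R :=
  (q (inr (inr (j, false))), q (inr (inr (j, true)))).
pose gy (q : state I R) : Y := fun k => q (inr (inr k)).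
pose rest (q : state I R) : R :=
  (\prod_(j <- s) F ((cx j q + cv j q)%R, cy j q)) * G (gy q).
have mst k : measurable_fun setT (fun q : state I R => q k) := measurable_eval k.
have mcx j : measurable_fun setT (cx j).
  by apply/measurable_fun_pair => /=; exact: mst.
have mcv j : measurable_fun setT (cv j).
  by apply/measurable_fun_pair => /=; exact: mst.
have mcy j : measurable_fun setT (cy j).
  by apply/measurable_fun_pair => /=; exact: mst.
have mgy : measurable_fun setT gy by apply: measurable_to_state => k; exact: mst.
have mprod d1 (U : measurableType d1) (t : seq nat) (f : nat -> U -> R) :
    (forall j, measurable_fun setT (f j)) ->
    measurable_fun setT (fun u => \prod_(j <- t) f j u).
  move=> mf; elim: t => [|j t IHt].
    by under eq_fun do rewrite big_nil; exact: measurable_cst.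
  by under eq_fun do rewrite big_cons; exact: measurable_funM.
have mrest : measurable_fun setT rest.
  apply: measurable_funM; last exact: measurableT_comp.
  apply: mprod => j; apply: (measurableT_comp mF).
  by apply/measurable_fun_pair => //=; exact: mplane.
have rest0 q : 0 <= rest q by rewrite mulr_ge0// prodr_ge0.
pose Phi (q : plane R * state I R) : \bar R :=
  (F ((q.1 + cv i q.2)%R, cy i q.2) * rest q.2)%:E.
have mPhi : measurable_fun setT Phi.
  apply/measurable_EFinP; apply: measurable_funM; last exact: (measurableT_comp mrest).
  apply: (measurableT_comp mF); apply/measurable_fun_pair => /=.
    by apply: mplane => //; exact: (measurableT_comp (mcv i)).
  exact: (measurableT_comp (mcy i)).
have famE w : rest (fun k => Z (fam k) w) =
    (\prod_(j <- s) F ((cval x j w + cval v j w)%R, cval y j w)) * G (yst w).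
  congr (_ * _); rewrite big_seq [RHS]big_seq; apply: eq_bigr => j js.
  by rewrite /cx /cv /cy /fam /= js.
have -> : (\int[P]_w ((\prod_(j <- i :: s) F ((cval x j w + cval v j w)%R, cval y j w)) *
     G (yst w))%:E = \int[P]_w Phi ((Z (x i false) w, Z (x i true) w),
       fun k => Z (fam k) w))%E.
  by apply: eq_integral => w _; rewrite big_cons /Phi /= famE -mulrA.
have xE b k : ip (x i b) (fam k) = 0.
  rewrite /fam; case: k => [[j c]|[[j c]|[j c]]] /=; rewrite ?xv ?xy//.
  case: ifPn => [js|_]; last by rewrite (ip0r hip).
  have ij : (i == j) = false by apply: contraNF iNs => /eqP ->.
  by rewrite (xx _ _ _ _ ir (sr' _ js)) ij mul0r.
rewrite (peel_complex_gaussian hip hZ mPhi); first last.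
- by move=> k; exact: xE.
- by move=> k; exact: xE.
- by rewrite xx// eqxx mul0r.
- by rewrite xx// !eqxx mul1r.
- by rewrite xx// !eqxx mul1r.
- by move=> q; rewrite lee_fin mulr_ge0.
have mfam : measurable_fun setT (fun w => (fun k => Z (fam k) w) : state I R).
  by apply: measurable_to_state => k; exact: mZ.
apply: (@le_trans _ _ (\int[P]_w ((\prod_(j <- s) F ((cval x j w + cval v j w)%R,
    cval y j w)) * (H (yst w (i, false), yst w (i, true)) * G (yst w)))%:E)%E).
  apply: ge0_le_integral => //.
  - by move=> w _; apply: integral_ge0 => z _; rewrite lee_fin mulr_ge0.
  - apply: (measurable_fun_fubini_tonelli_G (m1 := complex_gaussian)
      (fun q : plane R * T => Phi (q.1, fun k => Z (fam k) q.2))).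
      apply: (measurableT_comp mPhi); apply/measurable_fun_pair => //=.
      exact: (measurableT_comp mfam).
    by move=> q; rewrite lee_fin mulr_ge0.
  - apply/measurable_EFinP; apply: measurable_funM.
      apply: mprod => j; apply: (measurableT_comp mF).
      by apply/measurable_fun_pair => //=; exact: mplane.
    apply: measurable_funM; first exact: (measurableT_comp mH (mcval y i)).
    apply: (measurableT_comp mG); apply: measurable_to_state => k; exact: mZ.
  - move=> w _; rewrite /Phi /=.
    under eq_integral do rewrite EFinM.
    rewrite ge0_integralZr//; last 3 first.
    + apply/measurable_EFinP; apply: (measurableT_comp mF).
      by apply/measurable_fun_pair => //=; exact: mplane.
    + by move=> z _; rewrite lee_fin.
    + by rewrite lee_fin.
    rewrite mulrCA -famE [leRHS]EFinM; apply: lee_wpmul2r; first by rewrite lee_fin.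
    exact: FH.
have mG' : measurable_fun setT (fun q : Y => H (q (i, false), q (i, true)) * G q).
  apply: measurable_funM => //; apply: (measurableT_comp mH).
  by apply/measurable_fun_pair => /=; exact: measurable_eval.
apply: le_trans (IH (fun q => H (q (i, false), q (i, true)) * G q) us' sr' mG' _) _.
  by move=> q; rewrite mulr_ge0.
rewrite le_eqVlt; apply/orP; left; apply/eqP; apply: eq_integral => w _.
by rewrite big_cons mulrCA mulrA.
Qed.

End independent_factors.

Section diagonally_dominant_factors.
Context {R : realType}.
Context d (T : measurableType d) (P : probability T R) (V : lmodType R)
  (ip : V -> V -> R) (Z : V -> T -> R).
Hypotheses (hip : inner_product ip) (hZ : isonormal P ip Z).
Variables (F : plane R * plane R -> R) (H : plane R -> R).
Hypotheses (mF : measurable_fun setT F) (F0 : forall q, 0 <= F q).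
Hypotheses (mH : measurable_fun setT H) (H0 : forall y, 0 <= H y).
Hypothesis FH : forall h y,
  (\int[complex_gaussian]_z (F (((z : plane R) + h)%R, y))%:E <= (H y)%:E)%E.

Definition pairs (r : seq nat) : seq (nat * bool) :=
  [seq (i, b) | i <- r, b <- [:: false; true]].

(** After 1/2 is taken off the diagonal, the Gram matrix of s is still diagonally dominant, hence a
    Gram matrix. So s has the law of x + v, where the x are independent of variance 1/2 and
    orthogonal to v and y, and the x can be integrated out. *)
Lemma integral_diagonally_dominant (s y : nat -> bool -> V) (r : seq nat) :
  uniq r -> (forall i b j c, ip (s i b) (y j c) = 0) ->
  (forall k, k \in pairs r ->
    2^-1 + \sum_(l <- pairs r | l != k) `|ip (s k.1 k.2) (s l.1 l.2)| <=
    ip (s k.1 k.2) (s k.1 k.2)) ->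
  (\int[P]_w (\prod_(i <- r) F (cval Z s i w, cval Z y i w))%:E <=
   \int[P]_w (\prod_(i <- r) H (cval Z y i w))%:E)%E.
Proof.
move=> ur sy dom; set ps := pairs r in dom *.
have psE i b : ((i, b) \in ps) = (i \in r).
  apply/allpairsP/idP => [[[j c] [/= jr _ [-> _]]]//|ir].
  by exists (i, b) => /=; split => //; case: b.
have ups : uniq ps by apply: allpairs_uniq => // -[i b] [j c].
pose A (k l : nat * bool) : R := ip (s k.1 k.2) (s l.1 l.2) - (k == l)%:R / 2.
(* One orthonormal vector for each x, and one for each pair of indices to build the v. *)
pose J : eqType := (nat * bool + (nat * bool) * (nat * bool))%type.
pose sJ : seq J := map inl ps ++ map inr [seq (k, l) | k <- ps, l <- ps].
have [d0 [T0 [P0 [V0 [ip0 [Z0 [e [hip0 hZ0 eo]]]]]]]] := @orthonormal_exists R J sJ.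
have inlJ k : (inl k \in sJ) = (k \in ps).
  by rewrite mem_cat (mem_map (f := inl))//= ?orbF//; [|move=> ? ? []];
    case: (k \in ps) => //=; apply/negP => /mapP[].
have inrJ k l : k \in ps -> l \in ps -> inr (k, l) \in sJ.
  move=> ks ls; rewrite mem_cat; apply/orP; right; apply: map_f.
  by apply/allpairsP; exists (k, l).
have Asym k l : A k l = A l k by rewrite /A (ip_sym hip) eq_sym.
have Adom k : k \in ps -> \sum_(l <- ps | l != k) `|A k l| <= A k k.
  move=> ks; rewrite {2}/A eqxx lerBrDl mul1r.
  apply: le_trans (dom k ks); rewrite lerD2l le_eqVlt; apply/orP; left; apply/eqP.
  by apply: eq_bigr => l lk; rewrite /A eq_sym (negbTE lk) mul0r subr0.
have eE k l m p : k \in ps -> l \in ps -> m \in ps -> p \in ps ->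
    ip0 (e (inr (k, l))) (e (inr (m, p))) = ((k == m) && (l == p))%:R.
  by move=> ks ls ms pss; rewrite eo ?inrJ.
have [v [vA vx]] := diagonally_dominant_gram hip0 ups Asym Adom eE.
pose x (k : nat * bool) : V0 := half_sd *: e (inl k).
have xx k l : k \in ps -> l \in ps -> ip0 (x k) (x l) = (k == l)%:R / 2.
  move=> ks ls; rewrite /x (ipZl hip0) (ipZr hip0) eo ?inlJ//.
  by rewrite mulrA -expr2 half_sd_sq mulrC.
have xv k l : k \in ps -> ip0 (x k) (v l) = 0.
  move=> ks; apply: vx => m p ms pss.
  by rewrite /x (ipZl hip0) eo ?inlJ ?inrJ// mulr0.
have hZ1 := isonormal_prod hZ0 hZ.
have hip1 := prod_inner_product hip0 hip.
pose Z1 := prod_noise Z0 Z.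
pose x' i b : (V0 * V)%type := (x (i, b), 0).
pose v' i b : (V0 * V)%type := (v (i, b), 0).
pose y' i b : (V0 * V)%type := (0, y i b).
have mcv d1 (U : measurableType d1) (W : lmodType R) (ZW : W -> U -> R) u i :
    (forall w, measurable_fun setT (ZW w)) -> measurable_fun setT (cval ZW u i).
  by move=> mZW; apply/measurable_fun_pair => /=; exact: mZW.
have mprod d1 (U : measurableType d1) (t : seq nat) (f : nat -> U -> R) :
    (forall j, measurable_fun setT (f j)) ->
    measurable_fun setT (fun u => \prod_(j <- t) f j u).
  move=> mf; elim: t => [|j t IHt].
    by under eq_fun do rewrite big_nil; exact: measurable_cst.
  by under eq_fun do rewrite big_cons; exact: measurable_funM.
have mZ1 := isonormal_measurable hZ1.
pose K := (nat * bool + nat * bool)%type.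
pose u (k : K) : V := match k with inl p => if p.1 \in r then s p.1 p.2 else 0
                                 | inr p => y p.1 p.2 end.
(* The copy with the Gram matrix of [u]: x + v lives in the auxiliary space and y in the original
   one. *)
pose u' (k : K) : (V0 * V)%type := match k with
  | inl p => if p.1 \in r then x' p.1 p.2 + v' p.1 p.2 else 0
  | inr p => y' p.1 p.2 end.
pose cS (j : nat) (q : state K R) : plane R := (q (inl (j, false)), q (inl (j, true))).
pose cY (j : nat) (q : state K R) : plane R := (q (inr (j, false)), q (inr (j, true))).
have mcS j : measurable_fun setT (cS j).
  by apply/measurable_fun_pair => /=; exact: measurable_eval.
have mcY j : measurable_fun setT (cY j).
  by apply/measurable_fun_pair => /=; exact: measurable_eval.
have gr i j : ip (u i) (u j) = prod_ip ip0 ip (u' i) (u' j).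
  rewrite /prod_ip; case: i => [[i b]|[i b]]; case: j => [[j c]|[j c]] /=.
  - case: ifPn => ir; last by rewrite !(ip0l hip) !(ip0l hip0) addr0.
    case: ifPn => jr; last by rewrite !(ip0r hip) !(ip0r hip0) addr0.
    rewrite /= !addr0 (ip0r hip) addr0 !(ipDl hip0) !(ipDr hip0).
    rewrite xx ?psE// xv ?psE// (ip_sym hip0 (v _) (x _)) xv ?psE// vA ?psE//.
    by rewrite /A /= add0r addr0 addrC subrK.
  - by case: ifPn => ir; rewrite /= (ip0r hip0) add0r ?sy ?addr0 ?(ip0l hip).
  - by rewrite (ip_sym hip (y i b)) (ip_sym hip (y i b)); case: ifPn => ir;
      rewrite /= (ip0l hip0) add0r ?(ip_sym hip (y i b)) ?sy ?addr0 ?(ip0l hip).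
  - by rewrite (ip0l hip0) add0r.
pose f (q : state K R) : \bar R := (\prod_(i <- r) F (cS i q, cY i q))%:E.
have mf : measurable_fun setT f.
  apply/measurable_EFinP; apply: mprod => j; apply: (measurableT_comp mF).
  by apply/measurable_fun_pair.
have f0 q : (0 <= f q)%E by rewrite lee_fin prodr_ge0.
pose g (q : state K R) : \bar R := (\prod_(i <- r) H (cY i q))%:E.
have mg : measurable_fun setT g.
  by apply/measurable_EFinP; apply: mprod => j; exact: (measurableT_comp mH).
have g0 q : (0 <= g q)%E by rewrite lee_fin prodr_ge0.
have -> : (\int[P]_w (\prod_(i <- r) F (cval Z s i w, cval Z y i w))%:E =
    \int[P]_w f (fun k => Z (u k) w))%E.
  apply: eq_integral => w _; congr EFin; rewrite big_seq [RHS]big_seq.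
  by apply: eq_bigr => i ir; rewrite /cS /cY /u /= ir.
have -> : (\int[P]_w (\prod_(i <- r) H (cval Z y i w))%:E =
    \int[P]_w g (fun k => Z (u k) w))%E by [].
rewrite (gram_integral hip hZ hip1 hZ1 gr mf f0).
rewrite (gram_integral hip hZ hip1 hZ1 gr mg g0).
have := @integral_independent_factors R _ _ _ _ _ _ hip1 hZ1 F H mF F0 mH H0 FH x' v' y' r ur.
move=> /(_ _ _ _) IF; apply: le_trans (IF _ _ _); last 3 first.
- move=> i b j c ir jr; rewrite /prod_ip /= (ip0l hip) addr0 xx ?psE//.
- by move=> i b j c ir; rewrite /prod_ip /= (ip0l hip) addr0 xv ?psE.
- by move=> i b j c ir; rewrite /prod_ip /= (ip0l hip) (ip0r hip0) addr0.
rewrite le_eqVlt; apply/orP; left; apply/eqP; apply: ae_eq_integral => //.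
- apply: (measurableT_comp mf); apply: measurable_to_state => k; exact: mZ1.
- apply/measurable_EFinP; apply: mprod => j; apply: (measurableT_comp mF).
  apply/measurable_fun_pair => /=; last exact: mcv.
  have mx := mcv _ _ _ _ x' j mZ1; have mv := mcv _ _ _ _ v' j mZ1.
  by apply/measurable_fun_pair => /=; apply: measurable_funD; exact: mZ1.
have : \forall w \ae (P0 \x P)%E, forall i b,
    Z1 (x' i b + v' i b) w = Z1 (x' i b) w + Z1 (v' i b) w.
  apply: ae_foralln => i.
  have := isonormalD hZ1 (x' i false) (v' i false).
  have := isonormalD hZ1 (x' i true) (v' i true).
  by apply: filterS2 => w h1 h2 [].
apply: filterS => w hw _; congr EFin; rewrite big_seq [RHS]big_seq.
by apply: eq_bigr => i ir; rewrite /cS /cY /u' /= ir -/Z1 !hw.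
Qed.

End diagonally_dominant_factors.

(** * Polynomial decay and changes of variables in the plane *)

Section polynomial_decay.
Context {R : realType}.
Local Notation mu := (@lebesgue_measure R).

Lemma powR_decay_lty (q : R) : 1 < q ->
  (\int[mu]_x ((1 + `|x|) `^ (- q))%:E < +oo)%E.
Proof.
move=> q1.
have pos (x : R) : 0 < 1 + `|x| by rewrite ltr_pwDl.
pose f (x : R) := expR (- q * ln (1 + `|x|)).
have fE x : (1 + `|x|) `^ (- q) = f x by rewrite /powR gt_eqF.
under eq_integral do rewrite fE.
have cn : continuous (fun x : R => 1 + `|x|).
  by move=> x; apply: cvgD; [exact: cvg_cst|exact: norm_continuous].
have cf : continuous f.
  move=> x; apply: continuous_comp; last exact: continuous_expR.
  apply: cvgM; first exact: cvg_cst.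
  by apply: continuous_comp; [exact: cn|exact: continuous_ln].
rewrite (ge0_symfun_integralT (fun x => expR_ge0 _) cf); last first.
  by move=> x; rewrite /f /= normrN.
rewrite lte_mul_pinfty// -set_itvcy.
pose F (x : R) := - (q - 1)^-1 * expR ((1 - q) * ln (1 + x)).
have dF (x : R) : 0 < 1 + x ->
    is_derive x 1 F (expR ((1 - q) * ln (1 + x)) * (1 + x)^-1).
  move=> x0; rewrite /F.
  have d1 : is_derive x 1 (fun x => 1 + x : R) 1.
    apply: (is_derive_eq (is_deriveD (is_derive_cst _ _ _) (is_derive_id _ _))).
    by rewrite add0r.
  have d2 : is_derive x 1 (fun x => ln (1 + x) : R) ((1 + x)^-1 * 1).
    by apply: (@is_derive1_comp _ (@ln R) (fun x => 1 + x)); exact: is_derive1_ln.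
  have d3 : is_derive x 1 (fun x => expR ((1 - q) * ln (1 + x)))
      (expR ((1 - q) * ln (1 + x)) * ((1 - q) * ((1 + x)^-1 * 1))).
    apply: (@is_derive1_comp _ (@expR R) (fun x => (1 - q) * ln (1 + x))).
  apply: (is_derive_eq (is_deriveZ (- (q - 1)^-1) d3)); rewrite /GRing.scale /= mulr1.
  have q0 : q - 1 != 0 by rewrite gt_eqF ?subr_gt0.
  by field; rewrite q0 gt_eqF.
rewrite (@ge0_continuous_FTC2y _ f F 0 0).
- by rewrite sub0e -EFinN ltry.
- by move=> x _; exact: expR_ge0.
- exact: continuous_subspaceT.
- rewrite -(mulr0 (- (q - 1)^-1)); apply: cvgM; first exact: cvg_cst.
  have -> : (fun x : R => expR ((1 - q) * ln (1 + x))) =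
     (fun x => expR (- ((q - 1) * ln (1 + x)))).
    by apply/funext => x; rewrite -mulNr opprB.
  apply: (@cvg_comp _ _ _ (fun x => (q - 1) * ln (1 + x)) (fun y => expR (- y)) _ (@pinfty_nbhs R)).
    apply: gt0_cvgMry; first by rewrite subr_gt0.
    apply/cvgryPge => A; near=> x.
    rewrite -[A]expRK ler_ln ?posrE ?expR_gt0//; last first.
      by rewrite addr_gt0//; near: x; exact: nbhs_pinfty_gt.
    by rewrite (le_trans (y := x)) ?lerDr//; near: x; exact: nbhs_pinfty_ge.
  exact: cvgr_expR.
- by move=> x x0; apply: (@ex_derive _ _ _ _ _ _ _ (dF x _)); rewrite addr_gt0.
- apply: cvg_at_right_filter; apply: differentiable_continuous; apply/derivable1_diffP.
  by apply: (@ex_derive _ _ _ _ _ _ _ (dF 0 _)); rewrite addr0.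
- move=> x; rewrite in_itv/= andbT => x0.
  rewrite derive1E (@derive_val _ _ _ _ _ _ _ (dF x _)) ?addr_gt0// /f ger0_norm ?(ltW x0)//.
  have {2}<- : expR (ln (1 + x)) = 1 + x by rewrite lnK// posrE addr_gt0.
  by rewrite -expRN -expRD; congr expR; ring.
Unshelve. all: by end_near.
Qed.

Lemma leb2_tonelli1 (f : plane R -> \bar R) : measurable_fun setT f ->
  (forall u, 0 <= f u)%E -> (\int[leb2]_u f u = \int[mu]_x \int[mu]_y f (x, y))%E.
Proof. by move=> mf f0; rewrite fubini_tonelli1. Qed.

Lemma leb2_tonelli2 (f : plane R -> \bar R) : measurable_fun setT f ->
  (forall u, 0 <= f u)%E -> (\int[leb2]_u f u = \int[mu]_y \int[mu]_x f (x, y))%E.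
Proof. by move=> mf f0; rewrite fubini_tonelli2. Qed.

Lemma ge0_integral_shift (a : R) (h : measurableTypeR R -> \bar R) :
  measurable_fun setT h -> (forall x, 0 <= h x)%E ->
  (\int[mu]_x h (x + a)%R = \int[mu]_x h x)%E.
Proof.
move=> mh h0.
have ms : measurable_fun [set: measurableTypeR R]
    ((fun x => x + a) : measurableTypeR R -> measurableTypeR R) by apply: measurable_funD.
rewrite -(@ge0_integral_pushforward _ _ _ _ _ _ ms mu setT h)//.
apply: eq_measure_integral => A mA _; symmetry.
apply: (@lebesgue_measure_unique R (pushforward mu (mkRV ms))) => // _ [[b c] _ <-].
rewrite lebesgue_measure_itv /= /pushforward.
have -> : (fun x : R => x + a) @^-1` `]b, c]%classic = `]b - a, c - a]%classic.
  by apply/seteqP; split => x /=; rewrite !in_itv/= ltrBlDr lerBrDr.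
rewrite lebesgue_measure_itv /= !lte_fin ltrBDr.
by rewrite subrK -!EFinD; case: ifP => // _; congr EFin; ring.
Qed.

(* Used instead of the Euclidean norm: it is smaller, and invariant under swap. *)
Definition mnorm (u : plane R) : R := Num.max `|u.1| `|u.2|.

Definition preserves_leb2 (g : plane R -> plane R) : Prop :=
  measurable_fun setT g /\ forall h : plane R -> \bar R, measurable_fun setT h ->
    (forall u, 0 <= h u)%E -> (\int[leb2]_u h (g u) = \int[leb2]_u h u)%E.

Lemma preserves_leb2_id : preserves_leb2 id.
Proof. by split. Qed.

Lemma preserves_leb2_comp g g' : preserves_leb2 g -> preserves_leb2 g' ->
  preserves_leb2 (g \o g').
Proof.
move=> [mg gE] [mg' gE']; split; first exact: measurableT_comp.
move=> h mh h0; rewrite -(gE h mh h0); apply: (gE' (h \o g)).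
  exact: measurableT_comp.
by move=> u; exact: h0.
Qed.

Lemma preserves_leb2_shift (a b : R) :
  preserves_leb2 (fun u => ((u.1 + a)%R, (u.2 + b)%R)).
Proof.
have ms (c : R) : measurable_fun [set: measurableTypeR R]
    ((fun x => x + c) : measurableTypeR R -> measurableTypeR R) by apply: measurable_funD.
have mg : measurable_fun setT (fun u : plane R => ((u.1 + a)%R, (u.2 + b)%R) : plane R).
  by apply/measurable_fun_pair => /=; apply: measurable_funD => //.
split => // h mh h0.
rewrite (leb2_tonelli1 (f := fun u => h (u.1 + a, u.2 + b)%R))//; last exact: (measurableT_comp mh).
rewrite leb2_tonelli1//=.
transitivity (\int[mu]_x (fun x => \int[mu]_y h (x, y)) (x + a)%R)%E.
  apply: eq_integral => x _.
  by apply: (ge0_integral_shift b (h := fun y => h (x + a, y)%R)) => //; exact: measurableT_comp.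
apply: (ge0_integral_shift a (h := fun x => \int[mu]_y h (x, y))%E).
  exact: measurable_fun_fubini_tonelli_F.
by move=> x; exact: integral_ge0.
Qed.

Lemma preserves_leb2_swap : preserves_leb2 (fun u => (u.2, u.1)).
Proof.
have mg : measurable_fun setT (fun u : plane R => (u.2, u.1) : plane R).
  by apply/measurable_fun_pair.
split => // h mh h0.
rewrite (leb2_tonelli1 (f := fun u => h (u.2, u.1)))//; last exact: (measurableT_comp mh).
by rewrite leb2_tonelli2.
Qed.

Definition decay (p : R) (u : plane R) : R := (1 + mnorm u) `^ (- p).

Lemma mnorm_ge0 u : 0 <= mnorm u.
Proof. by rewrite le_max normr_ge0. Qed.

Lemma decay_ge0 p u : 0 <= decay p u. Proof. exact: powR_ge0. Qed.

Lemma decay_gt0 p u : 0 < decay p u.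
Proof. by apply: powR_gt0; rewrite ltr_pwDl// mnorm_ge0. Qed.

Lemma mnormD u v : mnorm (u.1 + v.1, u.2 + v.2) <= mnorm u + mnorm v.
Proof.
rewrite /mnorm ge_max; apply/andP; split; apply: le_trans (ler_normD _ _) _;
  by apply: lerD; rewrite le_max lexx ?orbT.
Qed.

Lemma measurable_mnorm : measurable_fun setT mnorm.
Proof.
by apply: measurable_maxr; apply: measurableT_comp => //; exact: normr_measurable.
Qed.

Lemma measurable_decay p : measurable_fun setT (decay p).
Proof.
apply: (@measurableT_comp _ _ _ _ _ _ (fun x : R => x `^ (- p)) _
  (fun u => 1 + mnorm u)) => //; apply: measurable_funD => //.
exact: measurable_mnorm.
Qed.

Lemma le_decay p u v c : 0 <= p -> 1 <= c -> 1 + mnorm u <= c * (1 + mnorm v) ->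
  decay p v <= c `^ p * decay p u.
Proof.
move=> p0 c1 uv; have c0 : 0 < c by exact: lt_le_trans c1.
have p1 w : 0 < 1 + mnorm w by rewrite ltr_pwDl// mnorm_ge0.
rewrite /decay !powRN -ler_pdivrMr ?invr_gt0 ?powR_gt0// invrK mulrC.
rewrite -ler_pdivlMr ?invrK ?invr_gt0 ?powR_gt0// -powRM ?(ltW c0) ?(ltW (p1 _))//.
rewrite ge0_ler_powR// ?nnegrE ?(ltW (p1 _))//.
by rewrite mulr_ge0 ?(ltW c0) ?(ltW (p1 _)).
Qed.

(** The max norm dominates both coordinates, so the decay is at most a product of two
    one-dimensional decays of exponent p/2 > 1. *)
Lemma decay_lty p : 2 < p -> (\int[leb2]_u (decay p u)%:E < +oo)%E.
Proof.
move=> p2; have q1 : 1 < p / 2 by rewrite ltr_pdivlMr// mul1r.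
pose j (x : measurableTypeR R) := ((1 + `|x|) `^ (- (p / 2)))%:E.
have mj : measurable_fun setT j.
  apply/measurable_EFinP.
  apply: (@measurableT_comp _ _ _ _ _ _ (fun x : R => x `^ (- (p / 2))) _
    (fun x : measurableTypeR R => 1 + `|x|)) => //.
  by apply: measurable_funD => //; exact: normr_measurable.
have j0 x : (0 <= j x)%E by rewrite lee_fin powR_ge0.
have jl := powR_decay_lty q1.
have mjj : measurable_fun setT (fun u : plane R => j u.1 * j u.2)%E.
  by apply: emeasurable_funM; exact: measurableT_comp.
apply: (@le_lt_trans _ _ (\int[leb2]_u (j u.1 * j u.2))%E).
  apply: ge0_le_integral => //.
  - by move=> u _; rewrite lee_fin decay_ge0.
  - by apply/measurable_EFinP; exact: measurable_decay.
  - move=> u _; rewrite /j -EFinM lee_fin /decay !powRN -invfM.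
    have pos (x : R) : 0 < 1 + `|x| by rewrite ltr_pwDl.
    have pm : 0 < 1 + mnorm u by rewrite ltr_pwDl// mnorm_ge0.
    rewrite lef_pV2 ?posrE ?mulr_gt0 ?powR_gt0//.
    rewrite [in leRHS](splitr p) powRD ?(gt_eqF pm) ?implybT//.
    by apply: ler_pM; rewrite ?powR_ge0//; apply: ge0_ler_powR;
      rewrite ?nnegrE ?(ltW (lt_trans ltr01 q1)) ?(ltW (pos _)) ?(ltW pm)//;
      rewrite lerD2l le_max lexx ?orbT.
rewrite leb2_tonelli1//=; last by move=> u; rewrite mule_ge0.
under eq_integral do rewrite ge0_integralZl//.
rewrite ge0_integralZr//; last exact: integral_ge0.
by rewrite lte_mul_pinfty//; [exact: integral_ge0|rewrite ge0_fin_numE//; exact: integral_ge0].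
Qed.

End polynomial_decay.

(** * Restricting functions to a part of the plane *)

Section masks.
Context {R : realType}.

Definition mask (E : set (plane R)) (f : L2 R) : L2 R :=
  toL2 (fun s => \1_E s * f s).

Context (E : set (plane R)) (mE : measurable E).

Let mask_pred (f : L2 R) : (fun s => \1_E s * f s) \in @L2pred R.
Proof.
apply: (@L2pred_le _ _ f); last exact: L2funP.
  by apply: measurable_funM; [exact: measurable_indic|exact: measurable_L2].
by move=> s; rewrite indicE; case: (s \in E); rewrite ?mul1r ?mul0r ?normr0.
Qed.

Lemma maskE (f : L2 R) s : mask E f s = \1_E s * f s.
Proof. by rewrite /mask toL2E. Qed.

Lemma mask_linear : linear (mask E).
Proof.
move=> a f g; apply: L2_inj => s; rewrite L2_addE L2_scaleE !maskE.
by rewrite L2_addE L2_scaleE; ring.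
Qed.

Lemma ip2_mask (f g : L2 R) : ip2 (mask E f) g = \int[leb2]_s (\1_E s * (f s * g s)).
Proof. by apply: eq_Rintegral => s _; rewrite maskE mulrA. Qed.

Lemma ip2_mask_mask (f g : L2 R) : ip2 (mask E f) (mask E g) = ip2 (mask E f) g.
Proof.
apply: eq_Rintegral => s _; rewrite !maskE indicE.
by case: (s \in E); rewrite ?mul1r ?mul0r.
Qed.

Lemma ip2_maskr (f g : L2 R) : ip2 f (mask E g) = ip2 (mask E f) g.
Proof. by apply: eq_Rintegral => s _; rewrite !maskE mulrCA mulrA. Qed.

End masks.

Lemma maskC (R : realType) (E : set (plane R)) (f : L2 R) : measurable E ->
  f = mask E f + mask (~` E) f.
Proof.
move=> mE; have mCE := measurableC mE.
apply: L2_inj => s; rewrite L2_addE !maskE// !indicE in_setC.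
by case: (s \in E); rewrite /= ?mul1r ?mul0r ?addr0 ?add0r.
Qed.

(** * A square lattice and its cells *)

Section lattice.
Context {R : realType} (M : R) (M0 : 0 < M).

(** Cells are numbered through an encoding of pairs of integers, so that lattice sums run over
    natural numbers; [is_corner] singles out the numbers that encode a pair. *)
Definition cell_index (u : plane R) : nat :=
  choice.pickle (Num.floor (u.1 / M), Num.floor (u.2 / M)).

Definition is_corner (n : nat) : bool := (pickle_inv n : option (int * int)) != None.

Definition corner (n : nat) : plane R :=
  if (pickle_inv n : option (int * int)) is Some p then (M * p.1%:~R, M * p.2%:~R)
  else (0, 0).

Definition base_cell : set (plane R) :=
  [set u | (0 <= u.1 < M) && (0 <= u.2 < M)].

Lemma measurable_base_cell : measurable base_cell.
Proof.
have -> : base_cell = `[0, M[%classic `*` `[0, M[%classic.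
  by apply/seteqP; split => -[x y] /=; rewrite /base_cell/= !in_itv /= => /andP.
by apply: measurableX.
Qed.

Lemma leb2_base_cell : leb2 base_cell = (M ^+ 2)%:E.
Proof.
have -> : base_cell = `[0, M[%classic `*` `[0, M[%classic.
  by apply/seteqP; split => -[x y] /=; rewrite /base_cell/= !in_itv /= => /andP.
transitivity (lebesgue_measure (`[0%R, M[%classic : set R) *
  lebesgue_measure (`[0%R, M[%classic : set R))%E; first exact: product_measure1E.
rewrite !lebesgue_measure_itv/= lte_fin M0.
by rewrite -EFinB subr0 -EFinM expr2.
Qed.

Lemma cell_indexP n (u : plane R) :
  (cell_index u == n) = is_corner n && (u - corner n \in base_cell).
Proof.
rewrite /is_corner /corner; apply/eqP/andP => [<-|].
  rewrite /cell_index pickleK_inv; split => //; apply/mem_set; rewrite /base_cell /=.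
  have fl (x : R) : 0 <= x - M * (Num.floor (x / M))%:~R < M.
    have /andP[h1 h2] := floor_itv (x / M).
    rewrite ler_pdivlMr// in h1; rewrite intrD ltr_pdivrMr// in h2.
    by apply/andP; split; lra.
  by rewrite !fl.
case E : (pickle_inv n) => [[i j]|] [//= _ /set_mem].
rewrite /base_cell /= => /andP[h1 h2].
have fl (x : R) (i' : int) : 0 <= x - M * i'%:~R < M -> Num.floor (x / M) = i'.
  move=> /andP[g1 g2]; apply: floor_def; rewrite ler_pdivlMr// intrD ltr_pdivrMr//.
  by apply/andP; split; lra.
have := @pickle_invK (int * int)%type n; rewrite E /= => <-.
by rewrite /cell_index (fl _ _ h1) (fl _ _ h2).
Qed.

Lemma corner_dist n k : is_corner n -> is_corner k -> n != k ->
  M <= mnorm (corner n - corner k).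
Proof.
rewrite /is_corner /corner.
case En : (pickle_inv n) => [[i j]|//]; case Ek : (pickle_inv k) => [[i' j']|//] _ _ nk.
have d (a b : int) : a != b -> M <= `|M * a%:~R - M * b%:~R|.
  move=> ab; rewrite -mulrBr normrM (ger0_norm (ltW M0)) ler_peMr ?(ltW M0)//.
  by rewrite -intrB -intr_norm (ler_int _ 1) -gtz0_ge1 normr_gt0 subr_eq0.
rewrite /mnorm le_max /=; have [ii|/d -> //] := eqVneq i i'.
have [jj|/d -> //] := eqVneq j j'; last by rewrite orbT.
case/eqP: nk; have := @pickle_invK (int * int)%type n; have := @pickle_invK (int * int)%type k.
by rewrite En Ek ii jj /= => -> ->.
Qed.

Lemma measurable_subr (c : plane R) : measurable_fun setT (fun u : plane R => u - c).
Proof.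
by apply/measurable_fun_pair => /=; apply: measurable_funD => //.
Qed.

Lemma preserves_leb2_sub (c : plane R) : preserves_leb2 (fun u : plane R => u - c).
Proof. exact: (preserves_leb2_shift (- c.1) (- c.2)). Qed.

(** Every cell is transported to the base cell. Summed over n, this turns an integral over the plane
    into an integral of lattice sums over the offset. *)
Lemma ge0_integral_cell n (h : plane R -> \bar R) : measurable_fun setT h ->
  (forall u, 0 <= h u)%E -> is_corner n ->
  (\int[leb2]_u ((cell_index u == n)%:R%:E * h u) =
   \int[leb2]_(v in base_cell) h (v + corner n)%R)%E.
Proof.
move=> mh h0 cn; have mb := measurable_base_cell.
have ma : measurable_fun setT (fun v : plane R => v + corner n).
  have := measurable_subr (- corner n); apply: eq_measurable_fun => u _.
  by rewrite opprK.
have mh' := measurableT_comp mh ma.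
pose h' (v : plane R) := ((\1_base_cell v)%:E * h (v + corner n)%R)%E.
have mI : measurable_fun setT (fun v : plane R => (\1_base_cell v : R)%:E).
  by apply/measurable_EFinP; exact: measurable_indic.
transitivity (\int[leb2]_v h' v)%E.
  rewrite -((preserves_leb2_sub (corner n)).2 h').
  - apply: eq_integral => u _; rewrite /h' subrK indicE cell_indexP cn /=.
    by [].
  - by apply: emeasurable_funM.
  - by move=> u; rewrite mule_ge0// lee_fin indicE.
rewrite [RHS]integral_mkcond; apply: eq_integral => v _.
rewrite /h' patchE indicE; case: (v \in base_cell); first by rewrite mul1e.
by rewrite mul0e.
Qed.

(** The cells based at the points corner n + v are disjoint and of area M^2, and G n is a lower
    bound of g on the n-th one: the left side is a lower sum of the integral. *)
Lemma lattice_sum (r : seq nat) (v : plane R) (G : nat -> R) (g : plane R -> R) :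
  uniq r -> {in r, forall n, is_corner n} -> measurable_fun setT g ->
  (forall u, 0 <= g u) -> (forall n, 0 <= G n) ->
  (forall n u, n \in r -> base_cell (u - (corner n + v)) -> G n <= g u) ->
  ((M ^+ 2 * \sum_(n <- r) G n)%:E <= \int[leb2]_u (g u)%:E)%E.
Proof.
move=> ur rc mg g0 G0 Gg; have mb := measurable_base_cell.
pose I n (u : plane R) : R := \1_base_cell (u - (corner n + v)).
have mI n : measurable_fun setT (I n).
  by apply: (measurableT_comp (measurable_indic mb)); exact: measurable_subr.
have I0 n u : 0 <= I n u by rewrite /I indicE.
have iI n : (\int[leb2]_u (I n u)%:E = (M ^+ 2)%:E)%E.
  rewrite ((preserves_leb2_sub (corner n + v)).2 (fun u => (\1_base_cell u)%:E)).
  - by rewrite integral_indic// setIT; exact: leb2_base_cell.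
  - by apply/measurable_EFinP; exact: measurable_indic.
  - by move=> u; rewrite lee_fin indicE.
have mIG n : measurable_fun setT (fun u => (I n u * g u)%:E).
  by apply/measurable_EFinP; exact: measurable_funM.
apply: (@le_trans _ _ (\sum_(n <- r) \int[leb2]_u (I n u * g u)%:E)%E).
  rewrite mulr_sumr -sumEFin big_seq [leRHS]big_seq; apply: lee_sum => n nr.
  rewrite mulrC EFinM -(iI n) -ge0_integralZl//; last 3 first.
  - exact/measurable_EFinP.
  - by move=> u _; rewrite lee_fin.
  - by rewrite lee_fin.
  apply: ge0_le_integral => //.
  - by move=> u _; rewrite mule_ge0// lee_fin.
  - by apply: emeasurable_funM => //; exact/measurable_EFinP.
  - move=> u _; rewrite -EFinM lee_fin /I indicE mulrC.
    case: (boolP (_ \in _)) => [/set_mem ub|_]; last by rewrite !mul0r.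
    by rewrite !mul1r; exact: Gg.
rewrite -ge0_integral_sum//; last first.
  by move=> n u _; rewrite lee_fin mulr_ge0.
apply: ge0_le_integral => //.
- by move=> u _; apply: sume_ge0 => n _; rewrite lee_fin mulr_ge0.
- exact: emeasurable_sum.
- exact/measurable_EFinP.
move=> u _; rewrite sumEFin lee_fin -mulr_suml ler_piMl//.
rewrite /I; under eq_bigr do rewrite indicE.
have -> : \sum_(n <- r) ((u - (corner n + v) \in base_cell)%:R : R) =
    \sum_(n <- r) (cell_index (u - v) == n)%:R.
  rewrite big_seq [RHS]big_seq; apply: eq_bigr => n nr.
  by rewrite cell_indexP rc//= opprD addrA addrAC.
case: (boolP (cell_index (u - v) \in r)) => [ir|iNr].
  by rewrite (bigD1_seq (cell_index (u - v)))//= eqxx big1 ?addr0// => n /negPf;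
    rewrite eq_sym => ->.
rewrite big_seq big1// => n nr; case: eqP => // e.
by rewrite -e (negbTE iNr) in nr *.
Qed.

End lattice.

(** * Kernels with polynomial decay and the Gram matrix of the field *)

Section good_kernels.
Context {R : realType}.

Definition halve (u : plane R) : plane R := (u.1 / 2, u.2 / 2).

Lemma mnorm_halve u : mnorm (halve u) = mnorm u / 2.
Proof. by rewrite /mnorm /= !normrM normfV (ger0_norm (ler0n _ 2)) maxr_pMl ?invr_ge0. Qed.

Lemma mnormN (u : plane R) : mnorm (- u) = mnorm u.
Proof. by rewrite /mnorm /= !normrN. Qed.

Lemma mnorm_add (u v : plane R) : mnorm (u + v) <= mnorm u + mnorm v.
Proof. exact: mnormD. Qed.

Lemma decay_le p (u v : plane R) : 0 <= p -> mnorm u <= mnorm v -> decay p v <= decay p u.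
Proof.
move=> p0 uv; have := @le_decay R p u v 1 p0 (lexx _).
by rewrite powR1 !mul1r lerD2l; apply.
Qed.

Lemma ge0_integral_decay (gam : plane R -> plane R) p (t : plane R) : preserves_leb2 gam ->
  (\int[leb2]_s (decay p (t - gam s))%:E = \int[leb2]_u (decay p u)%:E)%E.
Proof.
move=> [mgam gamE]; pose h (u : plane R) := (decay p (u - t))%:E.
have mh : measurable_fun setT h.
  apply/measurable_EFinP; apply: (measurableT_comp (measurable_decay p)).
  exact: measurable_subr.
transitivity (\int[leb2]_s h (gam s))%E.
  by apply: eq_integral => s _; rewrite /h /decay -mnormN opprB.
have h0 u : (0 <= h u)%E by rewrite lee_fin decay_ge0.
rewrite (gamE h mh h0).
apply: ((preserves_leb2_sub t).2 (fun u => (decay p u)%:E)).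
  by apply/measurable_EFinP; exact: measurable_decay.
by move=> u; rewrite lee_fin decay_ge0.
Qed.

Definition decay_mass (p : R) : R := fine (\int[leb2]_u (decay p u)%:E)%E.

Lemma decay_massE p : 2 < p -> (\int[leb2]_u (decay p u)%:E)%E = (decay_mass p)%:E.
Proof.
move=> p2; rewrite fineK// ge0_fin_numE; first exact: decay_lty.
by apply: integral_ge0 => u _; rewrite lee_fin decay_ge0.
Qed.

Lemma decay_mass_ge0 p : 0 <= decay_mass p.
Proof. by apply/fine_ge0/integral_ge0 => u _; rewrite lee_fin decay_ge0. Qed.

Lemma measurable_decay_sub (gam : plane R -> plane R) p (t : plane R) :
  measurable_fun setT gam -> measurable_fun setT (fun s => decay p (t - gam s)).
Proof.
move=> mgam.
have -> : (fun s => decay p (t - gam s)) = (fun s => decay p (gam s - t)).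
  by apply/funext => s; rewrite /decay -mnormN opprB.
apply: (measurableT_comp (measurable_decay p)).
exact: (measurableT_comp (measurable_subr t)).
Qed.

(** One of t and t' is at distance at least |t - t'| / 2 from gam s. Its decay is bounded by the
    value at half the distance, and the other decay is integrated. *)
Lemma overlap_le (gam : plane R -> plane R) (t t' : plane R) : preserves_leb2 gam ->
  (\int[leb2]_s (decay 3 (t - gam s) * decay 3 (t' - gam s))%:E <=
   (2 * decay_mass 3 * decay 3 (halve (t - t')))%:E)%E.
Proof.
move=> hgam; have mgam := hgam.1.
have m3 t0 := measurable_decay_sub 3 t0 mgam.
pose H := decay 3 (halve (t - t')).
apply: (@le_trans _ _ (\int[leb2]_s (H%:E * ((decay 3 (t - gam s))%:E + (decay 3 (t' - gam s))%:E)))%E).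
  apply: ge0_le_integral => //.
  - by move=> s _; rewrite lee_fin mulr_ge0 ?decay_ge0.
  - by apply/measurable_EFinP; exact: measurable_funM.
  - by apply: emeasurable_funM => //; apply: emeasurable_funD; exact/measurable_EFinP.
  move=> s _; rewrite -EFinD -EFinM lee_fin.
  have [d1 d2] := (decay_ge0 3 (t - gam s), decay_ge0 3 (t' - gam s)).
  have tri : mnorm (t - t') <= mnorm (t - gam s) + mnorm (t' - gam s).
    rewrite -(mnormN (t' - _)) opprB (le_trans _ (mnorm_add _ _))//.
    by rewrite addrA subrK.
  have [le12|lt21] := leP (mnorm (t' - gam s)) (mnorm (t - gam s)).
    have : decay 3 (t - gam s) <= H.
      by apply: decay_le => //; rewrite mnorm_halve ler_pdivrMr//; lra.
    by move=> h; rewrite (le_trans (ler_wpM2r d2 h))// ler_wpM2l ?decay_ge0// lerDr.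
  have : decay 3 (t' - gam s) <= H.
    by apply: decay_le => //; rewrite mnorm_halve ler_pdivrMr//; lra.
  move=> h; rewrite mulrC (le_trans (ler_wpM2r d1 h))// ler_wpM2l ?decay_ge0//.
  by rewrite lerDl.
rewrite ge0_integralZl//; last 3 first.
- by apply: emeasurable_funD; exact/measurable_EFinP.
- by move=> s _; rewrite -EFinD lee_fin addr_ge0 ?decay_ge0.
- by rewrite lee_fin decay_ge0.
rewrite ge0_integralD//; do ?[exact/measurable_EFinP]; last 2 first.
- by move=> s _; rewrite lee_fin decay_ge0.
- by move=> s _; rewrite lee_fin decay_ge0.
rewrite !ge0_integral_decay// decay_massE ?ltr_nat// -EFinD -EFinM lee_fin.
by rewrite le_eqVlt; apply/orP; left; apply/eqP; rewrite /H; ring.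
Qed.

Lemma Rintegral_le_bound (f : plane R -> R) (g : plane R -> R) (B : R) :
  measurable_fun setT f -> measurable_fun setT g -> (forall s, `|f s| <= g s) ->
  (\int[leb2]_s (g s)%:E <= B%:E)%E -> `|\int[leb2]_s f s| <= B.
Proof.
move=> mf mg fg gB.
have h : (\int[leb2]_s `|f s|%:E <= B%:E)%E.
  apply: le_trans gB; apply: ge0_le_integral => //.
  - by apply/measurable_EFinP; exact: measurableT_comp.
  - exact/measurable_EFinP.
  - by move=> s _; rewrite lee_fin.
have fi : leb2.-integrable setT (EFin \o f).
  apply/integrableP; split; first exact/measurable_EFinP.
  by apply: le_lt_trans (ltry B); exact: h.
rewrite -lee_fin (le_trans _ h)// /Rintegral -[leRHS]fineK.
  by rewrite lee_fin; exact: le_normr_Rintegral.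
by rewrite ge0_fin_numE ?integral_ge0// (le_lt_trans h) ?ltry.
Qed.

(* k false and k true are the real and the imaginary part of phi(t, s), and gam
   absorbs the changes of coordinates applied to t. *)
Record good_kernel (K a : R) (k : bool -> plane R * plane R -> R)
    (gam : plane R -> plane R) : Prop := {
  gk_measurable : forall b, measurable_fun setT (k b) ;
  gk_decay : forall t s,
    k false (t, s) ^+ 2 + k true (t, s) ^+ 2 <= K * decay a (t - gam s) ;
  gk_norm : forall t,
    (\int[leb2]_s (k false (t, s) ^+ 2 + k true (t, s) ^+ 2)%:E = 1)%E ;
  gk_leb2 : preserves_leb2 gam }.

Definition HC : lmodType R := (L2 R * L2 R)%type.

Definition ipC : HC -> HC -> R := prod_ip (@ip2 R) (@ip2 R).

Definition maskHC (E : set (plane R)) (f : HC) : HC := (mask E f.1, mask E f.2).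

(* kvec k true t is i times kvec k false t up to the sign convention of Z(f1, f2)
   = w1(f1) - w2(f2): the pair of their images is the value of the field at t. *)
Definition turn (b : bool) (f g : L2 R) : HC := if b then (g, - f) else (f, g).

Definition kvec (k : bool -> plane R * plane R -> R) (b : bool) (t : plane R) : HC :=
  turn b (toL2 (fun s => k false (t, s))) (toL2 (fun s => k true (t, s))).

Lemma inner_product_ipC : inner_product ipC.
Proof. by apply: prod_inner_product; exact: inner_product_ip2. Qed.

Lemma maskHC_linear E : measurable E -> linear (maskHC E).
Proof. by move=> mE a f g; rewrite /maskHC /= !mask_linear. Qed.

Lemma ipC_maskHC E f g : measurable E ->
  [/\ ipC (maskHC E f) (maskHC E g) = ipC (maskHC E f) g &
      ipC f (maskHC E g) = ipC (maskHC E f) g].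
Proof. by move=> mE; rewrite /ipC /prod_ip /= !ip2_mask_mask// !ip2_maskr. Qed.

Lemma ipC_maskC E f g : measurable E ->
  ipC f g = ipC (maskHC E f) g + ipC (maskHC (~` E) f) g.
Proof.
move=> mE; rewrite -(ipDl inner_product_ipC); congr (ipC _ _).
by rewrite [LHS]surjective_pairing /= [in LHS](maskC f.1 mE) [in X in (_, X) = _](maskC f.2 mE).
Qed.

Section turns.
Context (E : set (plane R)) (mE : measurable E) (f g f' g' : L2 R).

Let hip := @inner_product_ip2 R.

Let maskN h : mask E (- h) = - mask E h.
Proof.
by apply: L2_inj => s; rewrite -[- h]scaleN1r -[- mask _ _]scaleN1r !(maskE, L2_scaleE)//; ring.
Qed.

Lemma ipC_turn_same b : ipC (maskHC E (turn b f g)) (turn b f g) =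
  ip2 (mask E f) f + ip2 (mask E g) g.
Proof.
rewrite /ipC /prod_ip; case: b; rewrite /= //.
by rewrite maskN (ipNl hip) (ipNr hip) opprK addrC.
Qed.

(** The two cross terms cancel by symmetry of the masked inner product. Thus the real and the
    imaginary part of the field at one point are uncorrelated, even if only the noise in E is
    kept. *)
Lemma ipC_turn_diff b c : b != c -> ipC (maskHC E (turn b f g)) (turn c f g) = 0.
Proof.
have sym h h' : ip2 (mask E h) h' = ip2 (mask E h') h.
  by rewrite -ip2_maskr// (ip_sym hip).
rewrite /ipC /prod_ip; case: b; case: c; rewrite //= => _.
  by rewrite maskN (ipNl hip) (sym f g) subrr.
by rewrite (ipNr hip) (sym f g) subrr.
Qed.

Lemma ipC_turn_le b c B :
  (forall h h', h \in [:: f; g] -> h' \in [:: f'; g'] -> `|ip2 (mask E h) h'| <= B) ->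
  `|ipC (maskHC E (turn b f g)) (turn c f' g')| <= B + B.
Proof.
move=> hB; rewrite /ipC /prod_ip; apply: le_trans (ler_normD _ _) _.
by case: b; case: c; rewrite /= ?maskN ?(ipNl hip) ?(ipNr hip) ?normrN;
  apply: lerD; apply: hB; rewrite !inE eqxx ?orbT.
Qed.

End turns.

Context (K a : R) (k : bool -> plane R * plane R -> R) (gam : plane R -> plane R).
Hypotheses (K0 : 0 <= K) (a6 : 6 <= a) (hk : good_kernel K a k gam).

Let mk b t : measurable_fun setT (fun s => k b (t, s)).
Proof. exact: (measurableT_comp (gk_measurable hk b)). Qed.

Lemma gk_L2 b t : (fun s => k b (t, s)) \in @L2pred R.
Proof.
apply/L2predP; split; first exact: mk.
apply: (@le_lt_trans _ _ 1%E); last by rewrite ltry.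
rewrite -(gk_norm hk t); apply: ge0_le_integral => //.
- by move=> s _; rewrite lee_fin sqr_ge0.
- exact/measurable_sqr.
- by apply/measurable_EFinP; apply: measurable_funD; apply: measurable_funX.
- by move=> s _; rewrite lee_fin; case: b; rewrite ?lerDl ?lerDr sqr_ge0.
Qed.

(** Since a >= 6, the bound on the square of k gives a decay of exponent 3 for k itself; 3 exceeds
    2, so this decay is integrable over the plane. *)
Lemma gk_abs b t s : `|k b (t, s)| <= Num.sqrt K * decay 3 (t - gam s).
Proof.
rewrite -[leRHS]ger0_norm ?mulr_ge0 ?sqrtr_ge0 ?decay_ge0//.
rewrite -ler_sqr ?nnegrE// !real_normK ?num_real// exprMn sqr_sqrtr//.
apply: (@le_trans _ _ (K * decay a (t - gam s))).
  apply: le_trans (gk_decay hk t s).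
  by case: b; rewrite ?lerDl ?lerDr sqr_ge0.
apply: ler_wpM2l => //.
have pm : 0 < 1 + mnorm (t - gam s) by rewrite ltr_pwDl// mnorm_ge0.
rewrite /decay expr2 -powRD ?(gt_eqF pm) ?implybT//.
apply: ler_powR; first by rewrite lerDl mnorm_ge0.
by rewrite -opprD lerN2 -natrD.
Qed.

Lemma kvec_overlap b c t t' E : measurable E ->
  `|ipC (maskHC E (kvec k b t)) (kvec k c t')| <=
    4 * K * decay_mass 3 * decay 3 (halve (t - t')).
Proof.
move=> mE.
have comp (b1 b2 : bool) : `|ip2 (mask E (toL2 (fun s => k b1 (t, s)))) (toL2 (fun s => k b2 (t', s)))|
    <= K * (2 * decay_mass 3 * decay 3 (halve (t - t'))).
  rewrite ip2_mask//.
  under eq_Rintegral do rewrite !toL2E ?gk_L2//.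
  apply: (@Rintegral_le_bound _ (fun s => K * (decay 3 (t - gam s) * decay 3 (t' - gam s)))).
  - apply: measurable_funM; first exact: measurable_indic.
    exact: measurable_funM.
  - apply: measurable_funM => //; apply: measurable_funM;
      exact: measurable_decay_sub (gk_leb2 hk).1.
  - move=> s; rewrite normrM indicE (@le_trans _ _ (`|k b1 (t, s)| * `|k b2 (t', s)|))//.
      rewrite [X in _ * X]normrM ler_piMl ?mulr_ge0//.
      by case: (_ \in _); rewrite ?normr1 ?normr0.
    rewrite -{1}(sqr_sqrtr K0) expr2 mulrACA.
    by apply: ler_pM => //; exact: gk_abs.
  - under eq_integral do rewrite EFinM.
    rewrite ge0_integralZl//; last 2 first.
    + apply/measurable_EFinP; apply: measurable_funM;
        exact: measurable_decay_sub (gk_leb2 hk).1.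
    + by move=> s _; rewrite lee_fin mulr_ge0 ?decay_ge0.
    by rewrite [leRHS]EFinM lee_wpmul2l ?lee_fin//; apply: overlap_le (gk_leb2 hk).
have -> : 4 * K * decay_mass 3 * decay 3 (halve (t - t')) =
  K * (2 * decay_mass 3 * decay 3 (halve (t - t'))) +
  K * (2 * decay_mass 3 * decay 3 (halve (t - t'))) by ring.
by apply: ipC_turn_le => // h h'; rewrite !inE => /orP[]/eqP -> /orP[]/eqP ->.
Qed.

Lemma kvec_diag b t E : measurable E ->
  (ipC (maskHC E (kvec k b t)) (kvec k b t))%:E =
  (\int[leb2]_(s in E) (k false (t, s) ^+ 2 + k true (t, s) ^+ 2)%:E)%E.
Proof.
move=> mE.
have sq c : (ip2 (mask E (toL2 (fun s => k c (t, s)))) (toL2 (fun s => k c (t, s))))%:E =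
    (\int[leb2]_(s in E) (k c (t, s) ^+ 2)%:E)%E.
  rewrite -ip2_mask_mask// -ip2_sqr [RHS]integral_mkcond; apply: eq_integral => s _.
  rewrite maskE// toL2E ?gk_L2// patchE indicE.
  by case: (_ \in _); rewrite ?mul1r// mul0r expr0n.
have m2 c : measurable_fun E (fun s => (k c (t, s) ^+ 2)%:E).
  by apply: measurable_funTS; exact: measurable_sqr.
have s0 c s : E s -> (0 <= (k c (t, s) ^+ 2)%:E)%E by rewrite lee_fin sqr_ge0.
apply: (etrans (congr1 EFin (ipC_turn_same mE _ _ b))).
apply: (etrans (congr2 adde (sq false) (sq true))); symmetry.
exact: (ge0_integralD leb2 mE (s0 _) (m2 _) (s0 _) (m2 _)).
Qed.

Lemma kvec_cross t E b c : measurable E -> b != c ->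
  ipC (maskHC E (kvec k b t)) (kvec k c t) = 0.
Proof.
by move=> mE bc; exact: ipC_turn_diff.
Qed.

End good_kernels.

(** * Exponential moments: convexity, Jensen, Gaussian tails *)

Section exponential_bounds.
Context {R : realType}.

(* Both e^u and 1 lie above the tangent of exp at the weighted sum. *)
Lemma expR_convex_sum (I : Type) (r : seq I) (w u : I -> R) :
  (forall i, 0 <= w i) -> \sum_(i <- r) w i <= 1 ->
  expR (\sum_(i <- r) w i * u i) <=
    \sum_(i <- r) w i * expR (u i) + (1 - \sum_(i <- r) w i).
Proof.
move=> w0 w1; set A := \sum_(i <- r) w i * u i; set W := \sum_(i <- r) w i in w1 *.
have tan x : expR A * (1 + x - A) <= expR x.
  rewrite -[in leRHS](subrK A x) expRD mulrC ler_wpM2r ?expR_ge0//.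
  by rewrite -addrA expR_ge1Dx.
have h1 : \sum_(i <- r) w i * (expR A * (1 + u i - A)) <= \sum_(i <- r) w i * expR (u i).
  by apply: ler_sum => i _; exact: ler_wpM2l.
have h2 : (1 - W) * (expR A * (1 - A)) <= 1 - W.
  rewrite -[leRHS]mulr1 ler_wpM2l ?subr_ge0//.
  by have := tan 0; rewrite addr0 expR0.
apply: le_trans (lerD h1 h2).
have -> : \sum_(i <- r) w i * (expR A * (1 + u i - A)) = expR A * (W * (1 - A) + A).
  rewrite /W /A mulr_suml -big_split /= mulr_sumr; apply: eq_bigr => i _; ring.
by rewrite le_eqVlt; apply/orP; left; apply/eqP; ring.
Qed.

Lemma measurable_expeR d (T : measurableType d) (f : T -> \bar R) :
  measurable_fun setT f -> measurable_fun setT (fun x => expeR (f x)).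
Proof.
move=> mf; apply: (measurability _ (ErealGenOInfty.measurableE R)) => _ [_ [x ->] <-].
rewrite setTI; have [x0|x0] := ltP x 0.
  rewrite (_ : _ @^-1` _ = setT)//; apply/seteqP; split => // w _ /=.
  by rewrite in_itv/= andbT (lt_le_trans _ (expeR_ge0 _))// lte_fin.
rewrite (_ : _ @^-1` _ = setT `&` [set w | (lne x%:E < f w)%E]).
  exact: emeasurable_fun_o_infty.
rewrite setTI; apply/seteqP; split => w /=; rewrite in_itv/= andbT;
  by rewrite -[X in (X < expeR _)%E]lneK ?lte_expeR// in_itv/= lee_fin x0 leey.
Qed.

Lemma expeR_le_lim (u : nat -> \bar R) (l B : \bar R) :
  u @ \oo --> l -> (forall n, expeR (u n) <= B)%E -> (expeR l <= B)%E.
Proof.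
move=> ul uB; have B0 : (0 <= B)%E := le_trans (expeR_ge0 _) (uB 0%N).
have BK : expeR (lne B) = B by apply: lneK; rewrite in_itv/= B0 leey.
rewrite -BK lee_expeR -(cvg_lim _ ul)//; apply: lime_le.
  by apply/cvg_ex; exists l.
by apply: nearW => n; rewrite -lee_expeR BK.
Qed.

(** The exponential lies above its tangent at the mean A of h. The constant e^A A is added to both
    sides to keep the integrands nonnegative. If h has an infinite integral, so has e^h. *)
Lemma jensen_expeR d (T : measurableType d) (mu : {measure set T -> \bar R})
    (Q : set T) (c : R) (h : T -> R) : measurable Q -> 0 < c -> mu Q = c%:E ->
  measurable_fun setT h -> (forall x, 0 <= h x) ->
  (expeR (c^-1%:E * \int[mu]_(x in Q) (h x)%:E) <=
   c^-1%:E * \int[mu]_(x in Q) (expR (h x))%:E)%E.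
Proof.
move=> mQ c0 muQ mh h0.
have mhQ : measurable_fun Q (fun x => (h x)%:E).
  by apply/measurable_EFinP; exact: measurable_funTS.
have meQ : measurable_fun Q (fun x => (expR (h x))%:E).
  by apply/measurable_EFinP; apply: measurable_funTS; exact: measurableT_comp.
have ih0 : (0 <= \int[mu]_(x in Q) (h x)%:E)%E by apply: integral_ge0 => x _; rewrite lee_fin.
have ci : (0 < c^-1%:E)%E by rewrite lte_fin invr_gt0.
case E : (\int[mu]_(x in Q) (h x)%:E)%E ih0 => [s| |] // s0; last first.
  rewrite (_ : \int[mu]_(x in Q) (expR (h x))%:E = +oo)%E.
    by rewrite gt0_muley// leey.
  apply/eqP; rewrite -leye_eq -E; apply: ge0_le_integral => //.
  - by move=> x _; rewrite lee_fin.
  - by move=> x _; rewrite lee_fin; apply: le_trans (expR_ge1Dx _); rewrite lerDr.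
rewrite -EFinM /= -(lee_pmul2l (x := c%:E)) ?lte_fin//.
rewrite [leRHS]muleA -[X in (_ <= X * _)%E]EFinM mulfV ?gt_eqF// mul1e.
set A := c^-1 * s.
pose g x := expR A * (1 + (h x - A)).
have tan x : g x + expR A * A <= expR (h x) + expR A * A.
  rewrite lerD2r /g -[in leRHS](subrK A (h x)) expRD [leRHS]mulrC.
  by rewrite ler_wpM2l ?expR_ge0// expR_ge1Dx.
have gE x : g x + expR A * A = expR A * (1 + h x) by rewrite /g; ring.
have A0 : 0 <= A by rewrite mulr_ge0// invr_ge0 ltW.
have cstQ (r : R) : (\int[mu]_(x in Q) r%:E = (r * c)%:E)%E.
  by rewrite integral_cst// muQ EFinM.
have : (\int[mu]_(x in Q) (expR A * (1 + h x))%:E <=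
    \int[mu]_(x in Q) (expR (h x) + expR A * A)%:E)%E.
  apply: ge0_le_integral => //.
  - by move=> x _; rewrite lee_fin mulr_ge0 ?expR_ge0// addr_ge0.
  - apply/measurable_EFinP; apply: measurable_funM => //.
    by apply: measurable_funD => //; exact: measurable_funTS.
  - apply/measurable_EFinP; apply: measurable_funD => //.
    exact/measurable_EFinP.
  - by move=> x _; rewrite lee_fin -gE.
under eq_integral do rewrite EFinM EFinD.
under [X in (_ <= X)%E]eq_integral do rewrite EFinD.
rewrite ge0_integralZl//; do ?[by apply: emeasurable_funD];
  do ?[by move=> x _; rewrite -EFinD lee_fin addr_ge0];
  do ?[by rewrite lee_fin expR_ge0].
rewrite ge0_integralD//; do ?[by move=> x _; rewrite lee_fin].
have eA : forall x, Q x -> (0 <= (expR A * A)%:E)%E.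
  by move=> x _; rewrite lee_fin mulr_ge0 ?expR_ge0.
rewrite (ge0_integralD mu mQ _ meQ eA)//.
rewrite !cstQ E -EFinD -EFinM.
case: (\int[mu]_(x in Q) (expR (h x))%:E)%E => [r| |]; [|by rewrite !leey|by rewrite addNye leeNy_eq].
rewrite -EFinD !lee_fin mul1r -subr_ge0 => H; rewrite -subr_ge0.
apply: le_trans H _; rewrite le_eqVlt; apply/orP; left; apply/eqP.
have -> : s = c * A by rewrite /A mulrA mulfV ?mul1r ?gt_eqF.
by ring.
Qed.

(** The exponent has 1 + |x| because this dominates |x|^delta whenever 0 < delta <= 1. *)
Definition normal_exp_moment (c : R) : \bar R :=
  (\int[normal_prob (0 : R) 1]_x (expR (c * (1 + `|x|)))%:E)%E.

(** By c |x| <= c^2 + x^2 / 4, what remains of the density is exp(-x^2 / 4), a multiple of the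
    normal density of variance 2. *)
Lemma normal_exp_moment_lty c : 0 <= c -> (normal_exp_moment c < +oo)%E.
Proof.
move=> c0; rewrite /normal_exp_moment.
have mE : measurable_fun [set: measurableTypeR R] (fun x => (expR (c * (1 + `|x|)))%:E).
  apply/measurable_EFinP; apply: measurableT_comp => //; apply: measurable_funM => //.
  by apply: measurable_funD => //; exact: normr_measurable.
rewrite ge0_integral_normal_prob//.
pose s : R := Num.sqrt 2.
have s0 : s != 0 by rewrite gt_eqF ?sqrtr_gt0.
have s2 : s ^+ 2 = 2 by rewrite sqr_sqrtr.
pose D := normal_peak 1 / normal_peak s * expR (c + c ^+ 2).
have D0 : 0 <= D by rewrite mulr_ge0 ?expR_ge0// divr_ge0 ?normal_peak_ge0.
apply: (@le_lt_trans _ _ (\int[@lebesgue_measure R]_x (D%:E * (normal_pdf 0 s x)%:E))%E).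
  apply: ge0_le_integral => //.
  - by move=> x _; rewrite mule_ge0// lee_fin ?expR_ge0// normal_pdf_ge0.
  - by apply: emeasurable_funM => //; apply/measurable_EFinP; exact: measurable_normal_pdf.
  - by apply: emeasurable_funM => //; apply/measurable_EFinP; exact: measurable_normal_pdf.
  move=> x _; rewrite -!EFinM lee_fin !normal_pdf0E ?oner_neq0//.
  have -> : D * (normal_peak s * expR (- x ^+ 2 / (s ^+ 2 *+ 2))) =
      normal_peak 1 * expR (c + c ^+ 2 - x ^+ 2 / 4).
    rewrite expRD /D s2 (_ : 2 *+ 2 = 4 :> R); last by ring.
    rewrite mulNr; field.
    by rewrite gt_eqF ?normal_peak_gt0.
  rewrite mulrCA ler_wpM2l ?normal_peak_ge0// -expRD ler_expR expr1n.
  rewrite -(real_normK (num_real x)); move: `|x| => y.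
  have : 0 <= (c - y / 2) ^+ 2 by exact: sqr_ge0.
  by rewrite sqrrB; lra.
rewrite ge0_integralZl//.
- by rewrite integral_normal_pdf mule1 ltry.
- by apply/measurable_EFinP; exact: measurable_normal_pdf.
- by move=> x _; rewrite lee_fin normal_pdf_ge0.
Qed.

(* Jensen's inequality with the weights lam n reduces the sum to one term. *)
Lemma exp_moment_small_gaussians d (T : measurableType d) (P : probability T R)
    (V : lmodType R) (ip : V -> V -> R) (Z : V -> T -> R) (C delta Lam : R)
    (y : nat -> bool -> V) (lam : nat -> R) (r : seq nat) :
  inner_product ip -> isonormal P ip Z -> 0 < C -> 0 < delta <= 1 -> 0 < Lam ->
  (forall n, 0 < lam n) -> \sum_(n <- r) lam n <= Lam ->
  (forall n b, n \in r -> ip (y n b) (y n b) `^ (delta / 2) <= lam n) ->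
  (\int[P]_w (\prod_(n <- r) expR (C * (`|(cval Z y n w).1| +
       `|(cval Z y n w).2|) `^ delta))%:E <=
   2%:E * normal_exp_moment (2 * Lam * C)%R + 1)%E.
Proof.
move=> hip hZ C0 /andP[d0 d1] Lam0 lam0 sLam ylam.
have mZ := isonormal_measurable hZ.
(* The exponent to be bounded is the sum of the u n with the weights lam n / Lam. The factor Lam /
   lam n offsets the smallness of the n-th variance, so that all u n have a common bound. *)
pose u n (w : T) : R := Lam / lam n * (C * (`|(cval Z y n w).1| + `|(cval Z y n w).2|) `^ delta).
have mu n : measurable_fun setT (u n).
  apply: measurable_funM => //; apply: measurable_funM => //.
  apply: (@measurableT_comp _ _ _ _ _ _ (fun x : R => x `^ delta) _ (fun w => `|Z (y n false) w| + `|Z (y n true) w|)) => //.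
  by apply: measurable_funD; apply: measurableT_comp => //; exact: normr_measurable.
have meu n : measurable_fun setT (fun w => (expR (u n w))%:E).
  by apply/measurable_EFinP; exact: measurableT_comp.
pose B := (2%:E * normal_exp_moment (2 * Lam * C)%R)%E.
have one n b : n \in r -> (\int[P]_w (expR (Lam / lam n * (C * (2 * `|Z (y n b) w|) `^ delta)))%:E
    <= normal_exp_moment (2 * Lam * C)%R)%E.
  move=> nr.
  have mf : measurable_fun setT (fun x : R => (expR (Lam / lam n * (C * (2 * `|x|) `^ delta)))%:E).
    apply/measurable_EFinP; apply: measurableT_comp => //.
    apply: measurable_funM => //; apply: measurable_funM => //.
    apply: (@measurableT_comp _ _ _ _ _ _ (fun x : R => x `^ delta) _ (fun x : R => 2 * `|x|)) => //.
    by apply: measurable_funM => //; exact: normr_measurable.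
  rewrite (isonormal_one_law (y n b) hip hZ mf); last by move=> x; rewrite lee_fin expR_ge0.
  apply: ge0_le_integral; [exact: measurableT|by move=> x _; rewrite lee_fin expR_ge0| | |].
  - apply: (measurableT_comp mf); exact: measurable_funM.
  - apply/measurable_EFinP; apply: measurableT_comp => //; apply: measurable_funM => //.
    by apply: measurable_funD => //; exact: normr_measurable.
  move=> x _; rewrite lee_fin ler_expR; set nu := ip _ _.
  have nu0 : 0 <= nu by exact: ip_ge0 hip _.
  have -> : (2 * `|Num.sqrt nu * x|) `^ delta = 2 `^ delta * (nu `^ (delta / 2) * `|x| `^ delta).
    rewrite normrM (ger0_norm (sqrtr_ge0 _)) !powRM ?mulr_ge0 ?sqrtr_ge0//.
    by rewrite -powR12_sqrt// -powRrM (mulrC delta).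
  have x1 : `|x| `^ delta <= 1 + `|x|.
    have [xle|xge] := leP `|x| 1.
      have : `|x| `^ delta <= 1 `^ delta by apply: ge0_ler_powR; rewrite ?nnegrE// ltW.
      by rewrite powR1 => h; rewrite (le_trans h)// lerDl.
    have : `|x| `^ delta <= `|x| `^ 1 by apply: ler_powR => //; exact: ltW.
    by rewrite powRr1// => h; rewrite (le_trans h)// lerDr.
  have two : 2 `^ delta <= 2 :> R.
    by rewrite -[leRHS]powRr1//; apply: ler_powR => //; rewrite ler1n.
  have -> : 2 * Lam * C * (1 + `|x|) = Lam / lam n * (C * (2 * (lam n * (1 + `|x|)))).
    by field; rewrite gt_eqF.
  apply: ler_wpM2l; first by rewrite divr_ge0 ?ltW.
  apply: ler_wpM2l; first exact: ltW.
  apply: ler_pM; rewrite ?powR_ge0 ?mulr_ge0 ?powR_ge0//.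
  by apply: ler_pM; rewrite ?powR_ge0//; exact: ylam.
(* The sum of the two absolute values is at most twice the larger one, and the exponential for the
   larger one is at most the sum of both exponentials: hence the factor 2 in [B]. *)
have uB n : n \in r -> (\int[P]_w (expR (u n w))%:E <= B)%E.
  move=> nr; rewrite /B -[X in (X%:E * _)%E]/(1 + 1) EFinD ge0_muleDl// mul1e.
  apply: le_trans (leeD (one n false nr) (one n true nr)).
  have mb b : measurable_fun setT (fun w => (expR (Lam / lam n * (C * (2 * `|Z (y n b) w|) `^ delta)))%:E).
    apply/measurable_EFinP; apply: measurableT_comp => //.
    apply: measurable_funM => //; apply: measurable_funM => //.
    apply: (@measurableT_comp _ _ _ _ _ _ (fun x : R => x `^ delta) _ (fun w => 2 * `|Z (y n b) w|)) => //.
    by apply: measurable_funM => //; apply: measurableT_comp => //; exact: normr_measurable.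
  have e0 b w : setT w -> (0 <= (expR (Lam / lam n * (C * (2 * `|Z (y n b) w|) `^ delta)))%:E)%E.
    by rewrite lee_fin expR_ge0.
  rewrite -(ge0_integralD P measurableT (e0 false) (mb false) (e0 true) (mb true)).
  apply: ge0_le_integral => //.
  - exact: emeasurable_funD.
  move=> w _; rewrite -EFinD lee_fin /u /=.
  have mono (a b : R) : 0 <= a -> 0 <= b -> b <= a ->
      expR (Lam / lam n * (C * (a + b) `^ delta)) <= expR (Lam / lam n * (C * (2 * a) `^ delta)).
    move=> a0 b0 ba; rewrite ler_expR; apply: ler_wpM2l; first by rewrite divr_ge0 ?ltW.
    apply: ler_wpM2l; first exact: ltW.
    by apply: ge0_ler_powR; rewrite ?nnegrE ?addr_ge0 ?mulr_ge0//; [exact: ltW|lra].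
  have [le|/ltW le] := leP `|Z (y n true) w| `|Z (y n false) w|.
    by apply: (le_trans (mono _ _ _ _ le)) => //; rewrite lerDl expR_ge0.
  by rewrite addrC; apply: (le_trans (mono _ _ _ _ le)) => //; rewrite lerDr expR_ge0.
have sl : \sum_(n <- r) lam n / Lam <= 1 by rewrite -mulr_suml ler_pdivrMr// mul1r.
have l0 n : 0 <= lam n / Lam by rewrite divr_ge0 ?ltW.
apply: (@le_trans _ _ (\int[P]_w (\sum_(n <- r) ((lam n / Lam)%:E * (expR (u n w))%:E) + 1%:E))%E).
  apply: ge0_le_integral => //.
  - by move=> w _; rewrite lee_fin prodr_ge0// => n _; rewrite expR_ge0.
  - apply/measurable_EFinP.
    have -> : (fun w => \prod_(n <- r) expR (C * (`|(cval Z y n w).1| + `|(cval Z y n w).2|) `^ delta)) =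
        (fun w => expR (\sum_(n <- r) lam n / Lam * u n w)).
      apply/funext => w; rewrite expR_sum; apply: eq_bigr => n _.
      by congr expR; rewrite /u; field; rewrite !gt_eqF.
    by apply: measurableT_comp => //; apply: measurable_sum => n; exact: measurable_funM.
  - apply: emeasurable_funD => //; apply: emeasurable_sum => n.
    exact: emeasurable_funM.
  move=> w _; rewrite (eq_bigr (fun n => (lam n / Lam * expR (u n w))%:E)); last by move=> n _; rewrite EFinM.
  rewrite sumEFin -EFinD lee_fin.
  have -> : \prod_(n <- r) expR (C * (`|(cval Z y n w).1| + `|(cval Z y n w).2|) `^ delta) =
      expR (\sum_(n <- r) lam n / Lam * u n w).
    rewrite expR_sum; apply: eq_bigr => n _.
    by congr expR; rewrite /u; field; rewrite !gt_eqF.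
  apply: (le_trans (expR_convex_sum (fun n => u n w) l0 sl)).
  by rewrite lerD2l lerBlDr lerDl sumr_ge0.
have m1 n : measurable_fun setT (fun w => ((lam n / Lam)%:E * (expR (u n w))%:E)%E).
  exact: emeasurable_funM.
have p1 n w : setT w -> (0 <= (lam n / Lam)%:E * (expR (u n w))%:E)%E.
  by move=> _; rewrite mule_ge0// lee_fin ?expR_ge0.
rewrite ge0_integralD//; last 2 first.
- by move=> w _; apply: sume_ge0 => n _; exact: p1.
- exact: emeasurable_sum.
rewrite ge0_integral_sum// integral_cst//= probability_setT mule1.
apply: leeD => //.
have B0 : (0 <= B)%E.
  by rewrite mule_ge0//; apply: integral_ge0 => x _; rewrite lee_fin expR_ge0.
apply: (@le_trans _ _ (\sum_(n <- r) (lam n / Lam)%:E * B)%E).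
  rewrite big_seq [leRHS]big_seq; apply: lee_sum => n nr.
  rewrite ge0_integralZl//; last by rewrite lee_fin.
  by apply: lee_wpmul2l; [rewrite lee_fin|exact: uB].
rewrite -ge0_sume_distrl; last by move=> n _; rewrite lee_fin.
by rewrite sumEFin -[leRHS]mul1e lee_wpmul2r// lee_fin.
Qed.

End exponential_bounds.

(** * Decay sums over a shifted lattice *)

Section lattice_sums.
Context {R : realType} (M : R) (M1 : 1 <= M) (v : plane R).

Let M0 : 0 < M. Proof. exact: lt_le_trans M1. Qed.

(** The offset v is kept free because it will range over the base cell. *)
Definition site (n : nat) : plane R := corner M n + v.

Lemma base_cell_mnorm (u : plane R) : base_cell M u -> mnorm u <= M.
Proof.
rewrite /base_cell /mnorm /= => /andP[/andP[h1 h2] /andP[h3 h4]].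
by rewrite ge_max !ger0_norm// !ltW.
Qed.

(** For u in the cell of a site n other than i, |u - site i| <= M + |site i - site n| <= 2 |site i -
    site n|, which is four times the argument of the decay; the exponent 3 gives 64 = 4^3. The
    factor M^2 on the left makes the sum small for a sparse lattice. *)
Lemma site_overlap_sum (r : seq nat) i : uniq r -> {in r, forall n, is_corner n} ->
  is_corner i ->
  M ^+ 2 * \sum_(n <- r | n != i) decay 3 (halve (site i - site n)) <= 64 * decay_mass 3.
Proof.
move=> ur rc ci; rewrite -big_filter -lee_fin.
have mg : measurable_fun setT (fun u : plane R => 64 * decay 3 (u - site i)).
  apply: measurable_funM => //; apply: (measurableT_comp (measurable_decay 3)).
  exact: measurable_subr.
apply: (@le_trans _ _ (\int[leb2]_u (64 * decay 3 (u - site i))%:E)%E).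
  apply: (@lattice_sum R M M0 _ v (fun n => decay 3 (halve (site i - site n))))=> //.
  - by rewrite filter_uniq.
  - by move=> n; rewrite mem_filter => /andP[_ /rc].
  - by move=> u; rewrite mulr_ge0 ?decay_ge0.
  - by move=> n; rewrite decay_ge0.
  move=> n u; rewrite mem_filter => /andP[ni nr] /base_cell_mnorm uM.
  rewrite (_ : 64 = 4 `^ 3); last by rewrite powR_mulrn// -natrX.
  apply: le_decay => //; first by rewrite ler1n.
  have rho : M <= mnorm (site i - site n).
    rewrite (_ : site i - site n = corner M i - corner M n).
      by apply: corner_dist => //; [exact: rc|rewrite eq_sym].
    by rewrite /site opprD addrACA subrr addr0.
  rewrite mnorm_halve.
  have : mnorm (u - site i) <= mnorm (u - site n) + mnorm (site i - site n).
    rewrite -(mnormN (site i - _)) opprB (le_trans _ (mnorm_add _ _))//.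
    by rewrite addrA subrK.
  rewrite -/(site n) in uM.
  by lra.
under eq_integral do rewrite EFinM.
rewrite ge0_integralZl//; last 2 first.
- by apply/measurable_EFinP; apply: (measurableT_comp (measurable_decay 3)); exact: measurable_subr.
- by move=> u _; rewrite lee_fin decay_ge0.
have := (preserves_leb2_sub (site i)).2 (fun u => (decay 3 u)%:E).
move=> ->; last 2 first.
- by apply/measurable_EFinP; exact: measurable_decay.
- by move=> u; rewrite lee_fin decay_ge0.
by rewrite decay_massE ?ltr_nat// EFinM.
Qed.

(** Inside the cell of the n-th site, 1 + |u| <= (1 + M) (1 + |site n|). *)
Lemma site_decay_sum (q : R) (r : seq nat) : 2 < q -> uniq r ->
  {in r, forall n, is_corner n} ->
  \sum_(n <- r) decay q (site n) <= (1 + M) `^ q * decay_mass q.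
Proof.
move=> q2 ur rc; set S := \sum_(n <- r) _.
have S0 : 0 <= S by apply: sumr_ge0 => n _; exact: decay_ge0.
apply: (@le_trans _ _ (M ^+ 2 * S)).
  by rewrite ler_peMl// exprn_ege1.
rewrite -lee_fin.
apply: (@le_trans _ _ (\int[leb2]_u ((1 + M) `^ q * decay q u)%:E)%E).
  apply: (@lattice_sum R M M0 _ v (fun n => decay q (site n))) => //.
  - by apply: measurable_funM => //; exact: measurable_decay.
  - by move=> u; rewrite mulr_ge0 ?decay_ge0 ?powR_ge0.
  - by move=> n; rewrite decay_ge0.
  move=> n u nr /base_cell_mnorm uM; rewrite -/(site n) in uM.
  apply: le_decay; [by apply: le_trans (ltW q2)|by rewrite lerDl ltW|].
  have := mnorm_add (u - site n) (site n); rewrite subrK.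
  have := mnorm_ge0 (site n); move: (mnorm (site n)) (mnorm u) => x y x0 yle.
  have : 0 <= M * x by rewrite mulr_ge0// ltW.
  by rewrite mulrDl mul1r mulrDr mulr1; lra.
under eq_integral do rewrite EFinM.
rewrite ge0_integralZl//; last 3 first.
- by apply/measurable_EFinP; exact: measurable_decay.
- by move=> u _; rewrite lee_fin decay_ge0.
- by rewrite lee_fin powR_ge0.
by rewrite decay_massE// EFinM.
Qed.

End lattice_sums.

(** * Exponential moment of the difference of two coupled fields *)

Section field_versions.
Context {R : realType} (k : bool -> plane R * plane R -> R)
  (Gam : bool -> plane R * state (@HC R) R -> R).

Definition field_version : Prop :=
  (forall b, measurable_fun setT (Gam b)) /\
  forall b t d (T : measurableType d) (P : probability T R) (Z : @HC R -> T -> R),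
    isonormal P (@ipC R) Z -> \forall w \ae P, Gam b (t, fun f => Z f w) = Z (kvec k b t) w.

(** The factor [half_sd] is the 1/sqrt 2 in the definition of the complex white noise. *)
Definition field_at (q : plane R * state (@HC R) R) : plane R :=
  (half_sd * Gam false q, half_sd * Gam true q).

Lemma measurable_field_at : field_version -> measurable_fun setT field_at.
Proof.
by move=> [mG _]; apply/measurable_fun_pair => /=; apply: measurable_funM.
Qed.

End field_versions.

Section field_differences.
Context {R : realType} (K a C delta : R) (psi : plane R -> R).
Hypotheses (K0 : 0 <= K) (C0 : 0 < C) (d01 : 0 < delta <= 1)
  (a_gt : 2 + 4 / delta < a) (mpsi : measurable_fun setT psi).
Hypothesis psi_holder : forall y h : plane R,
  (\int[complex_gaussian]_x (expR `|psi (halve ((x : plane R) + h + y)%R)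
                              - psi (halve (x + h - y)%R)|)%:E <=
   (expR (C * (`|y.1| + `|y.2|) `^ delta))%:E)%E.

Let d0 : 0 < delta. Proof. by case/andP: d01. Qed.

Let a6 : 6 <= a.
Proof.
case/andP: d01 => _ d1; apply: le_trans (ltW a_gt).
have : 4 <= 4 / delta by rewrite ler_pdivlMr// ler_piMr.
lra.
Qed.

(** So large that the off-diagonal entries in each row of the Gram matrix of the sampled sums add up
    to at most 1/2, as [mix_dominant] requires. *)
Definition spacing : R := 1 + 64 * (48 * (K * decay_mass 3 ^+ 2)).
(** The midpoint of 4/delta and a - 2. Being below a - 2 it leaves an exponent a - [tail_exp] > 2,
    which is integrable; being above 4/delta it makes [weight_exp] exceed 2, so that the weights are
    summable over the lattice. *)
Definition tail_exp : R := (a - 2 + 4 / delta) / 2.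
Definition tail_const : R := K * 2 `^ tail_exp * decay_mass (a - tail_exp) + 1.
Definition weight_exp : R := tail_exp * (delta / 2).
Definition total_weight : R := 1 + tail_const `^ (delta / 2) *
  ((1 + spacing) `^ weight_exp * decay_mass weight_exp).
(** A function of K, a, C and delta alone: one scaling factor will suit all positions and all
    leaks. *)
Definition field_bound : \bar R :=
  (2%:E * normal_exp_moment (2 * total_weight * C)%R + 1)%E.

Let spacing1 : 1 <= spacing.
Proof. have h : 0 <= K * decay_mass 3 ^+ 2 by apply: mulr_ge0 K0 (sqr_ge0 _).
by rewrite lerDl pmulr_rge0// pmulr_rge0. Qed.

Let tail_expE : 4 / delta < tail_exp.
Proof. by rewrite /tail_exp; move: a_gt; set e := 4 / delta; lra. Qed.

Let tail_rest2 : 2 < a - tail_exp.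
Proof. by rewrite /tail_exp; move: a_gt; set e := 4 / delta; lra. Qed.

Let tail_exp0 : 0 <= tail_exp.
Proof. by apply: le_trans (ltW tail_expE); rewrite divr_ge0// ltW. Qed.

Let weight_exp2 : 2 < weight_exp.
Proof.
have := tail_expE; rewrite ltr_pdivrMr// => h.
by rewrite /weight_exp mulrA ltr_pdivlMr//; lra.
Qed.

Let tail_const0 : 0 < tail_const.
Proof. by rewrite ltr_wpDl// !mulr_ge0 ?powR_ge0 ?decay_mass_ge0. Qed.

Lemma total_weight_gt0 : 0 < total_weight.
Proof. by rewrite ltr_pwDl// !mulr_ge0 ?powR_ge0 ?decay_mass_ge0. Qed.

Lemma field_bound_fin : field_bound \is a fin_num.
Proof.
have h := @normal_exp_moment_lty R (2 * total_weight * C).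
have h0 : (0 <= normal_exp_moment (2 * total_weight * C)%R)%E.
  by apply: integral_ge0 => x _; rewrite lee_fin expR_ge0.
rewrite /field_bound fin_numD andbT fin_numM// ge0_fin_numE// h//.
by rewrite !mulr_ge0 ?ltW// total_weight_gt0.
Qed.

Context (k : bool -> plane R * plane R -> R) (gam : plane R -> plane R)
  (hk : good_kernel K a k gam).
Context d (T : measurableType d) (P : probability T R) (V : lmodType R)
  (ip : V -> V -> R) (Z : V -> T -> R) (al be : @HC R -> V) (D E : set (plane R)).
Hypotheses (hip : inner_product ip) (hZ : isonormal P ip Z)
  (lal : linear al) (lbe : linear be)
  (alE : forall f g, ip (al f) (al g) = ipC f g)
  (beE : forall f g, ip (be f) (be g) = ipC f g)
  (mE : measurable E) (mD : measurable D)
  (albeE : forall f g, ip (al f) (be g) = ipC (maskHC E f) g)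
  (DE : forall t s, D t -> ~ E s -> 1 + mnorm t <= 2 * (1 + mnorm (t - gam s))).

(** The values c = 1 and c = -1 give the sum and the difference over sqrt 2; by symmetry of the
    masked form they are orthogonal. With this normalization the two fields are exactly the halves
    of mix 1 + mix (-1) and mix 1 - mix (-1). *)
Definition mix (c : R) (f : @HC R) : V := half_sd *: (c *: be f + al f).

Lemma ip_mix c e f g : ip (mix c f) (mix e g) =
  ((1 + c * e) * ipC f g + (c + e) * ipC (maskHC E f) g) / 2.
Proof.
have bal : ip (be f) (al g) = ipC (maskHC E f) g.
  rewrite (ip_sym hip) albeE (ip_sym (@inner_product_ipC R)).
  by have [_ ->] := ipC_maskHC f g mE.
rewrite /mix (ipZl hip) (ipZr hip) mulrA -expr2 half_sd_sq.
rewrite (ipDl hip) !(ipDr hip) !(ipZl hip) !(ipZr hip) beE alE albeE bal.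
by rewrite mulrC; congr (_ / 2); ring.
Qed.

Lemma mix_value c f : \forall w \ae P, Z (mix c f) w =
  half_sd * (c * Z (be f) w + Z (al f) w).
Proof.
have := isonormalZ hZ half_sd (c *: be f + al f).
have := isonormal_linear hZ c (be f) (al f).
by apply: filterS2 => w h ->; rewrite h.
Qed.

(** The decay of exponent a is factored in two: off E the factor of exponent [tail_exp] is
    controlled by |t| through [DE], and the remaining factor is integrated over s. *)
Lemma kvec_tail b t : D t ->
  ipC (maskHC (~` E) (kvec k b t)) (kvec k b t) <= tail_const * decay tail_exp t.
Proof.
move=> Dt; have mCE := measurableC mE.
have hgam := gk_leb2 hk.
have p2 := tail_rest2.
rewrite -lee_fin (kvec_diag hk)//.
have mdec := measurable_decay_sub (a - tail_exp) t hgam.1.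
apply: (@le_trans _ _ (\int[leb2]_(s in ~` E)
   ((K * 2 `^ tail_exp * decay tail_exp t)%:E * (decay (a - tail_exp) (t - gam s))%:E))%E).
  apply: ge0_le_integral => //.
  - by move=> s _; rewrite lee_fin addr_ge0 ?sqr_ge0.
  - apply: measurable_funTS; apply/measurable_EFinP; apply: measurable_funD;
      apply: measurable_funX; exact: (measurableT_comp (gk_measurable hk _)).
  - apply: measurable_funTS; apply: emeasurable_funM => //; exact/measurable_EFinP.
  move=> s Es; rewrite -EFinM lee_fin; apply: le_trans (gk_decay hk t s) _.
  rewrite -!mulrA; apply: ler_wpM2l => //; rewrite mulrA.
  have pm : 0 < 1 + mnorm (t - gam s) by rewrite ltr_pwDl// mnorm_ge0.
  have -> : decay a (t - gam s) = decay tail_exp (t - gam s) * decay (a - tail_exp) (t - gam s).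
    rewrite /decay -powRD ?(gt_eqF pm) ?implybT//; congr (_ `^ _); ring.
  apply: ler_wpM2r; first exact: decay_ge0.
  by apply: le_decay => //; [rewrite ler1n|exact: DE].
rewrite ge0_integralZl//; last 3 first.
- by apply: measurable_funTS; exact/measurable_EFinP.
- by move=> s _; rewrite lee_fin decay_ge0.
- by rewrite lee_fin !mulr_ge0 ?powR_ge0 ?decay_ge0.
apply: (@le_trans _ _ ((K * 2 `^ tail_exp * decay tail_exp t)%:E * (decay_mass (a - tail_exp))%:E)%E).
  apply: lee_wpmul2l; first by rewrite lee_fin !mulr_ge0 ?powR_ge0 ?decay_ge0.
  rewrite -(decay_massE p2) -(ge0_integral_decay (a - tail_exp) t hgam).
  apply: ge0_subset_integral => //; first exact/measurable_EFinP.
  by move=> s _; rewrite lee_fin decay_ge0.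
rewrite -EFinM lee_fin /tail_const mulrAC mulrDl lerDl mul1r; exact: decay_ge0.
Qed.

Let F (q : plane R * plane R) : R :=
  expR `|psi (halve (q.1 + q.2)%R) - psi (halve (q.1 - q.2)%R)|.

Let H (y : plane R) : R := expR (C * (`|y.1| + `|y.2|) `^ delta).

Lemma maskHC_setT (f : @HC R) : maskHC setT f = f.
Proof.
rewrite /maskHC [RHS]surjective_pairing; congr (_, _);
  by apply: L2_inj => s; rewrite maskE// indicT mul1r.
Qed.

Definition mix_site (c : R) (v : plane R) (n : nat) (b : bool) : V :=
  mix c (kvec k b (site spacing v n)).

(** The variance of a sum is 1 plus the mass of the kernel on E, hence at least 1. One half of it is
    reserved for the independent summand; the other half has to exceed the overlaps with the
    remaining sites. *)
Lemma mix_dominant (v : plane R) (r : seq nat) (i : nat) (b : bool) : uniq r ->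
  {in r, forall n, is_corner n} -> i \in r ->
  2^-1 + \sum_(l <- pairs r | l != (i, b)) `|ip (mix_site 1 v i b) (mix_site 1 v l.1 l.2)| <=
    ip (mix_site 1 v i b) (mix_site 1 v i b).
Proof.
move=> ur rc ir; set s := mix_site 1 v; pose t n := site spacing v n.
have kd n b' : ipC (kvec k b' (t n)) (kvec k b' (t n)) = 1.
  apply: EFin_inj; have := @kvec_diag R K a k gam hk b' (t n) setT measurableT.
  by rewrite maskHC_setT => ->; exact: gk_norm hk _.
have B n b1 c1 : `|ip (s i b1) (s n c1)| <= 8 * K * decay_mass 3 * decay 3 (halve (t i - t n)).
  rewrite ip_mix mulr1 -mulrDr mulrC mulrA mulVf// mul1r.
  have h1 := @kvec_overlap R K a k gam K0 a6 hk b1 c1 (t i) (t n) setT measurableT.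
  have h2 := @kvec_overlap R K a k gam K0 a6 hk b1 c1 (t i) (t n) E mE.
  rewrite maskHC_setT in h1; apply: le_trans (ler_normD _ _) _.
  by move: h1 h2; rewrite -/(t n) -/(t i); lra.
have cross c1 : b != c1 -> ip (s i b) (s i c1) = 0.
  move=> bc; rewrite ip_mix (kvec_cross k (t i) mE bc).
  have := kvec_cross k (t i) measurableT bc; rewrite maskHC_setT => ->.
  by rewrite !mulr0 addr0 mul0r.
have diag : 1 <= ip (s i b) (s i b).
  rewrite ip_mix kd mulr1; have := @kvec_diag R K a k gam hk b (t i) E mE.
  set x := ipC _ _ => xE; have : 0 <= x.
    rewrite -lee_fin xE; apply: integral_ge0 => u _.
    by rewrite lee_fin addr_ge0 ?sqr_ge0.
  by lra.
suff : \sum_(l <- pairs r | l != (i, b)) `|ip (s i b) (s l.1 l.2)| <= 2^-1 by lra.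
(* Each site contributes a real and an imaginary direction, each bounded by 8 K and the decay. *)
pose G n := 16 * K * decay_mass 3 * decay 3 (halve (t i - t n)).
apply: (@le_trans _ _ (\sum_(n <- r | n != i) G n)).
  rewrite big_mkcond /pairs big_allpairs_dep /= [leRHS]big_mkcond /=.
  apply: ler_sum => n _; rewrite !big_cons big_nil addr0 /= !xpair_eqE.
  have [->|ni] /= := eqVneq n i.
    have [eb|nb] /= := eqVneq false b.
      have tb : true != b by rewrite -eb.
      by rewrite tb add0r cross ?normr0 // eq_sym.
    by rewrite cross ?normr0 1?eq_sym// add0r; case: ifP => // tb; move: nb tb; case: (b).
  rewrite /G; have := B n b false; have := B n b true; lra.
rewrite -mulr_sumr.
have := site_overlap_sum spacing1 v ur rc (rc _ ir); rewrite -/(t i).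
under eq_bigr do rewrite -/(t _).
set S := \sum_(n <- r | _) _ => hS.
have S0 : 0 <= S by apply: sumr_ge0 => n _; exact: decay_ge0.
have I0 := decay_mass_ge0 (R := R) 3.
pose m := K * decay_mass 3.
have m0 : 0 <= m by rewrite mulr_ge0.
(* the spacing was chosen so that 2 * 16 * 64 * K * I ^ 2 <= spacing ^ 2 *)
have h1 : m * (spacing ^+ 2 * S) <= m * (64 * decay_mass 3) by exact: ler_wpM2l.
have h2 : spacing <= spacing ^+ 2 by rewrite expr2 ler_peMr// (le_trans ler01).
have h3 : m * S * spacing <= m * S * spacing ^+ 2 by rewrite ler_wpM2l// mulr_ge0.
have h4 : spacing = 1 + 3 * 1024 * (m * decay_mass 3) by rewrite /spacing /m; ring.
have h5 : 0 <= m * decay_mass 3 by rewrite mulr_ge0.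
have h6 : m * S * spacing <= 64 * (m * decay_mass 3).
  apply: le_trans h3 _; rewrite (_ : m * S * _ = m * (spacing ^+ 2 * S)); last by ring.
  by apply: le_trans h1 _; rewrite le_eqVlt; apply/orP; left; apply/eqP; ring.
have -> : 16 * K * decay_mass 3 * S = 16 * (m * S) by rewrite /m; ring.
have sp0 : 0 < spacing by exact: lt_le_trans spacing1.
rewrite -(ler_pM2r sp0) -mulrA; move: h6 h5; rewrite h4.
by move: (m * decay_mass 3) (m * S * _) => x y; lra.
Qed.

(** Once the sums are integrated out, only the differences are left. The variance of a difference is
    precisely the mass of the kernel off E, and [kvec_tail] raised to the power delta/2 gives the
    weights [lam]. *)
Lemma lattice_product_bound (v : plane R) (r : seq nat) : uniq r ->
  {in r, forall n, is_corner n} -> {in r, forall n, D (site spacing v n)} ->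
  (\int[P]_w (\prod_(n <- r) F (cval Z (mix_site 1 v) n w, cval Z (mix_site (-1) v) n w))%:E
    <= field_bound)%E.
Proof.
move=> ur rc rD; pose s c := mix_site c v.
have mhalve : measurable_fun setT (@halve R).
  by apply/measurable_fun_pair => /=; apply: measurable_funM => //.
have mF : measurable_fun setT F.
  apply: measurableT_comp => //; apply: measurableT_comp; first exact: normr_measurable.
  have m1 (c : R) : measurable_fun setT
      (fun q : plane R * plane R => halve (q.1.1 + c * q.2.1, q.1.2 + c * q.2.2)).
    apply: (measurableT_comp mhalve); apply/measurable_fun_pair => /=;
      apply: measurable_funD; try apply: measurable_funM => //;
      by do 2 apply: measurableT_comp => //.
  apply: measurable_funB; apply: (measurableT_comp mpsi).
    by have := m1 1; under eq_fun do rewrite !mul1r.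
  by have := m1 (-1); under eq_fun do rewrite !mulN1r.
have mH : measurable_fun setT H.
  apply: measurableT_comp => //; apply: measurable_funM => //.
  apply: (@measurableT_comp _ _ _ _ _ _ (fun x : R => x `^ delta) _
    (fun y : plane R => `|y.1| + `|y.2|)) => //.
  by apply: measurable_funD; apply: measurableT_comp => //; exact: normr_measurable.
have F0 q : 0 <= F q by exact: expR_ge0.
have H0 y : 0 <= H y by exact: expR_ge0.
have FH h y : (\int[complex_gaussian]_z (F (((z : plane R) + h)%R, y))%:E <= (H y)%:E)%E.
  exact: psi_holder.
have sy i b j c : ip (mix_site 1 v i b) (mix_site (-1) v j c) = 0.
  by rewrite /mix_site ip_mix mul1r subrr !mul0r addr0 mul0r.
have dom l : l \in pairs r -> 2^-1 + \sum_(m <- pairs r | m != l)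
    `|ip (mix_site 1 v l.1 l.2) (mix_site 1 v m.1 m.2)| <=
    ip (mix_site 1 v l.1 l.2) (mix_site 1 v l.1 l.2).
  by move=> /allpairsP[[j c] [/= jr _ ->]]; exact: mix_dominant.
apply: (le_trans (integral_diagonally_dominant hip hZ mF F0 mH H0 FH ur sy dom)).
pose lam n := tail_const `^ (delta / 2) * decay weight_exp (site spacing v n).
apply: (@exp_moment_small_gaussians R _ _ P V ip Z C delta total_weight (s (-1)) lam r) => //.
- exact: total_weight_gt0.
- by move=> n; exact: mulr_gt0 (powR_gt0 _ tail_const0) (decay_gt0 _ _).
- rewrite -mulr_sumr (@le_trans _ _ (total_weight - 1))// ?gerBl//.
  rewrite /total_weight addrAC subrr add0r; apply: ler_wpM2l; first exact: powR_ge0.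
  exact: site_decay_sum.
move=> n b nr; rewrite /s /mix_site ip_mix mulrNN mulr1 -opprD mulNr.
rewrite (ipC_maskC _ _ mE); set x := ipC (maskHC E _) _; set z := ipC (maskHC (~` E) _) _.
have -> : ((1 + 1) * (x + z) - (1 + 1) * x) / 2 = z by field.
apply: (@le_trans _ _ ((tail_const * decay tail_exp (site spacing v n)) `^ (delta / 2))).
  apply: ge0_ler_powR; rewrite ?nnegrE ?divr_ge0 ?(ltW d0)//.
  - rewrite /z; have [<- _] := ipC_maskHC (kvec k b (site spacing v n)) (kvec k b (site spacing v n)) (measurableC mE).
    exact: ip_ge0 (@inner_product_ipC R) _.
  - by rewrite mulr_ge0 ?decay_ge0// ltW.
  - by apply: kvec_tail; exact: rD.
by rewrite powRM ?decay_ge0 ?(ltW tail_const0)// /lam /decay -powRrM /weight_exp mulNr.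
Qed.

Context (Gam : bool -> plane R * state (@HC R) R -> R) (hGam : field_version k Gam).

Let A (w : T) : state (@HC R) R := fun f => Z (al f) w.
Let B (w : T) : state (@HC R) R := fun f => Z (be f) w.

Let hA : isonormal P (@ipC R) (Z \o al).
Proof. by apply: isonormal_pullback hZ lal _ => u; exact: alE. Qed.

Let hB : isonormal P (@ipC R) (Z \o be).
Proof. by apply: isonormal_pullback hZ lbe _ => u; exact: beE. Qed.

Let mA : measurable_fun setT A.
Proof. by apply: measurable_to_state => f; exact: isonormal_measurable hZ _. Qed.

Let mB : measurable_fun setT B.
Proof. by apply: measurable_to_state => f; exact: isonormal_measurable hZ _. Qed.

Let gap (t : plane R) (w : T) : R :=
  \1_D t * `|psi (field_at Gam (t, A w)) - psi (field_at Gam (t, B w))|.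

Let mgap : measurable_fun setT (fun q : T * plane R => gap q.2 q.1).
Proof.
have mfa (f : T -> state (@HC R) R) : measurable_fun setT f ->
    measurable_fun setT (fun q : T * plane R => psi (field_at Gam (q.2, f q.1))).
  move=> mf; apply: (measurableT_comp mpsi).
  apply: (measurableT_comp (measurable_field_at hGam)).
  by apply/measurable_fun_pair => //=; exact: (measurableT_comp mf).
apply: measurable_funM; first by apply: measurableT_comp => //; exact: measurable_indic.
by apply: measurableT_comp; [exact: normr_measurable|apply: measurable_funB; exact: mfa].
Qed.

Let gap0 t w : 0 <= gap t w.
Proof. by rewrite mulr_ge0// indicE. Qed.

Lemma lattice_exp_bound (v : plane R) (r : seq nat) : uniq r ->
  {in r, forall n, is_corner n} ->
  (\int[P]_w (expR (\sum_(n <- r) gap (site spacing v n) w))%:E <= field_bound)%E.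
Proof.
move=> ur rc; pose r' := [seq n <- r | site spacing v n \in D].
have ur' : uniq r' by rewrite filter_uniq.
have rc' : {in r', forall n, is_corner n} by move=> n; rewrite mem_filter => /andP[_ /rc].
have rD' : {in r', forall n, D (site spacing v n)}.
  by move=> n; rewrite mem_filter => /andP[/set_mem].
apply: le_trans (lattice_product_bound ur' rc' rD').
have mZ := isonormal_measurable hZ.
have mgapw t : measurable_fun setT (gap t).
  by apply: (@measurableT_comp _ _ _ _ _ _ (fun q : T * plane R => gap q.2 q.1) _ (fun w => (w, t))).
rewrite le_eqVlt; apply/orP; left; apply/eqP; apply: ae_eq_integral => //.
- apply/measurable_EFinP; apply: measurableT_comp => //; exact: measurable_sum.
- apply/measurable_EFinP.
  have -> : (fun w => \prod_(n <- r') F (cval Z (mix_site 1 v) n w, cval Z (mix_site (-1) v) n w)) =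
     (fun w => expR (\sum_(n <- r') `|psi (halve (cval Z (mix_site 1 v) n w + cval Z (mix_site (-1) v) n w)%R)
        - psi (halve (cval Z (mix_site 1 v) n w - cval Z (mix_site (-1) v) n w)%R)|)).
    by apply/funext => w; rewrite expR_sum.
  apply: measurableT_comp => //; apply: measurable_sum => n.
  apply: measurableT_comp; first exact: normr_measurable.
  by apply: measurable_funB; apply: (measurableT_comp mpsi); apply/measurable_fun_pair => /=;
    apply: measurable_funM => //; [apply: measurable_funD|apply: measurable_funD|apply: measurable_funB|apply: measurable_funB]; exact: mZ.
(* The sites are countably many, so one null set suffices for all identities between versions and
   noise. *)
have : \forall w \ae P, forall n b,
    [/\ Z (mix_site 1 v n b) w = half_sd * (1 * Z (be (kvec k b (site spacing v n))) w
           + Z (al (kvec k b (site spacing v n))) w),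
       Z (mix_site (-1) v n b) w = half_sd * (-1 * Z (be (kvec k b (site spacing v n))) w
           + Z (al (kvec k b (site spacing v n))) w),
       Gam b (site spacing v n, A w) = Z (al (kvec k b (site spacing v n))) w &
       Gam b (site spacing v n, B w) = Z (be (kvec k b (site spacing v n))) w].
  apply: ae_foralln => n.
  have ev b := mix_value 1 (kvec k b (site spacing v n)).
  have ew b := mix_value (-1) (kvec k b (site spacing v n)).
  have eA b := (hGam.2 b (site spacing v n) _ _ _ _ hA).
  have eB b := (hGam.2 b (site spacing v n) _ _ _ _ hB).
  have both b : \forall w \ae P, [/\ Z (mix_site 1 v n b) w = half_sd * (1 * Z (be (kvec k b (site spacing v n))) w
           + Z (al (kvec k b (site spacing v n))) w),
       Z (mix_site (-1) v n b) w = half_sd * (-1 * Z (be (kvec k b (site spacing v n))) w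
           + Z (al (kvec k b (site spacing v n))) w),
       Gam b (site spacing v n, A w) = Z (al (kvec k b (site spacing v n))) w &
       Gam b (site spacing v n, B w) = Z (be (kvec k b (site spacing v n))) w].
    move: (ev b); apply: filter_app; move: (ew b); apply: filter_app.
    by move: (eA b) (eB b); apply: filterS2 => w ? ? ? ?; split.
  by move: (both false) (both true); apply: filterS2 => w hf ht [].
apply: filterS => w hw _; congr EFin.
rewrite expR_sum /r' big_filter [RHS]big_mkcond /=; apply: eq_bigr => n _.
rewrite /gap indicE; case: (site spacing v n \in D); last by rewrite mul0r expR0.
have [p1 p2 p3 p4] := hw n false; have [q1 q2 q3 q4] := hw n true.
have eA : halve (cval Z (mix_site 1 v) n w + cval Z (mix_site (-1) v) n w)%R =
    field_at Gam (site spacing v n, A w).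
  by rewrite /halve /field_at /= p1 p2 p3 q1 q2 q3; congr (_, _); field.
have eB : halve (cval Z (mix_site 1 v) n w - cval Z (mix_site (-1) v) n w)%R =
    field_at Gam (site spacing v n, B w).
  by rewrite /halve /field_at /= p1 p2 p4 q1 q2 q4; congr (_, _); field.
by rewrite mul1r /F [fst _]/= [snd _]/= eA eB.
Qed.

(** The integral over D is the integral of the lattice sum over the offset v in the base cell, whose
    area is spacing^2. Jensen's inequality for the uniform law of v, followed by Fubini, reduces the
    claim to the bound for each fixed v. This is done for the first N cells, and monotone
    convergence lets N grow. *)
Lemma exp_moment_field_difference :
  (\int[P]_w expeR ((spacing ^+ 2)^-1%:E *
      \int[leb2]_(t in D) `|psi (field_at Gam (t, A w)) - psi (field_at Gam (t, B w))|%:E) <=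
   field_bound)%E.
Proof.
set c := (spacing ^+ 2)^-1.
have sp0 : 0 < spacing by exact: lt_le_trans spacing1.
have c0 : 0 <= c by rewrite invr_ge0 exprn_ge0// ltW.
have mgapw t : measurable_fun setT (gap t).
  by apply: (@measurableT_comp _ _ _ _ _ _ (fun q : T * plane R => gap q.2 q.1) _ (fun w => (w, t))).
have mgapt w : measurable_fun setT (gap^~ w).
  apply: (@measurableT_comp _ _ _ _ _ _ (fun q : T * plane R => gap q.2 q.1) _ (fun t => (w, t))) => //.
  by apply/measurable_fun_pair => /=.
pose I n (t : plane R) : R := (cell_index spacing t == n)%:R.
have mI n : measurable_fun setT (I n).
  have -> : I n = (fun t => (is_corner n)%:R * \1_(base_cell spacing) (t - corner spacing n)).
    apply/funext => t; rewrite /I cell_indexP// indicE.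
    by case: (is_corner n); rewrite ?mul1r ?mul0r.
  apply: measurable_funM => //.
  apply: (measurableT_comp (measurable_indic (measurable_base_cell spacing))).
  exact: measurable_subr.
pose S N (t : plane R) : R := \sum_(n <- iota 0 N) I n t.
have SE N t : S N t = (cell_index spacing t < N)%:R.
  rewrite /S /I; have [lt|ge] := ltnP (cell_index spacing t) N.
    rewrite (bigD1_seq (cell_index spacing t)) ?mem_iota ?iota_uniq//= eqxx big1 ?addr0//.
    by move=> n /negPf; rewrite eq_sym => ->.
  rewrite big_seq big1// => n; rewrite mem_iota add0n => /andP[_ nN].
  by case: eqP => // e; move: ge; rewrite e leqNgt nN.
have mS N : measurable_fun setT (S N) by exact: measurable_sum.
have S0 N t : 0 <= S N t by rewrite SE.
pose W N w := (\int[leb2]_t (S N t * gap t w)%:E)%E.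
have mSg N : measurable_fun setT (fun q : T * plane R => (S N q.2 * gap q.2 q.1)%:E).
  by apply/measurable_EFinP; apply: measurable_funM => //; exact: (measurableT_comp (mS N)).
have Sg0 N t w : (0 <= (S N t * gap t w)%:E)%E by rewrite lee_fin mulr_ge0.
have mW N : measurable_fun setT (W N).
  exact: (measurable_fun_fubini_tonelli_F (m2 := leb2) (fun q : T * plane R => (S N q.2 * gap q.2 q.1)%:E)).
have WN N : (\int[P]_w expeR (c%:E * W N w) <= field_bound)%E.
  pose r := [seq n <- iota 0 N | is_corner n].
  have ur : uniq r by rewrite filter_uniq ?iota_uniq.
  have rc : {in r, forall n, is_corner n} by move=> n; rewrite mem_filter => /andP[].
  pose h (v : plane R) (w : T) := \sum_(n <- r) gap (site spacing v n) w.
  have msite n : measurable_fun setT (fun v : plane R => site spacing v n).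
    have := measurable_subr (- corner spacing n); apply: eq_measurable_fun => u _.
    by rewrite /site opprK addrC.
  have mh : measurable_fun setT (fun q : T * plane R => h q.2 q.1).
    apply: measurable_sum => n.
    apply: (@measurableT_comp _ _ _ _ _ _ (fun q : T * plane R => gap q.2 q.1) _
      (fun q : T * plane R => (q.1, site spacing q.2 n))) => //.
    by apply/measurable_fun_pair => //=; exact: (measurableT_comp (msite n)).
  have h0 v w : 0 <= h v w by apply: sumr_ge0 => n _.
  have mhw w : measurable_fun setT (h^~ w).
    apply: (@measurableT_comp _ _ _ _ _ _ (fun q : T * plane R => h q.2 q.1) _ (fun t => (w, t))) => //.
    by apply/measurable_fun_pair => /=.
  have mQ := measurable_base_cell spacing.
  have WE w : W N w = (\int[leb2]_(v in base_cell spacing) (h v w)%:E)%E.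
    rewrite /W /S; under eq_integral do rewrite mulr_suml -sumEFin.
    have mIg n : measurable_fun setT (fun t => (I n t * gap t w)%:E).
      by apply/measurable_EFinP; exact: measurable_funM.
    have Ig0 n t : setT t -> (0 <= (I n t * gap t w)%:E)%E.
      by move=> _; rewrite lee_fin mulr_ge0.
    rewrite ge0_integral_sum//.
    rewrite (eq_bigr (fun n => if is_corner n then
        (\int[leb2]_(v in base_cell spacing) (gap (site spacing v n) w)%:E)%E else 0%E)).
      rewrite -big_mkcond -big_filter -/r /h.
      under [RHS]eq_integral do rewrite -sumEFin.
      rewrite ge0_integral_sum//; last by move=> n t _; rewrite lee_fin.
      move=> n; apply: measurable_funTS; apply/measurable_EFinP.
      exact: (measurableT_comp (mgapt w) (msite n)).
    move=> n _; case: ifPn => [cn|ncn]; last first.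
      rewrite integral0_eq// => t _; rewrite /I cell_indexP// (negbTE ncn) /=.
      by rewrite mul0r.
    under eq_integral do rewrite EFinM.
    rewrite (ge0_integral_cell sp0 (h := fun t => (gap t w)%:E))//.
    - by apply: eq_integral => v _; rewrite /site addrC.
    - exact/measurable_EFinP.
    - by move=> u; rewrite lee_fin.
  pose f (q : T * plane R) : \bar R := (c * (\1_(base_cell spacing) q.2 * expR (h q.2 q.1)))%:E.
  have mf : measurable_fun setT f.
    apply/measurable_EFinP; apply: measurable_funM => //; apply: measurable_funM.
      exact: (measurableT_comp (measurable_indic mQ)).
    exact: measurableT_comp.
  have f0 q : (0 <= f q)%E by rewrite lee_fin !mulr_ge0 ?expR_ge0// indicE.
  have mu_cell : leb2 (base_cell spacing) = (spacing ^+ 2)%:E by exact: leb2_base_cell.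
  have s20 : 0 < spacing ^+ 2 by rewrite exprn_gt0.
  apply: (@le_trans _ _ (\int[P]_w \int[leb2]_v f (w, v))%E).
    apply: ge0_le_integral => //.
    - by move=> w _; exact: expeR_ge0.
    - by apply: measurable_expeR; exact: emeasurable_funM.
    - exact: (measurable_fun_fubini_tonelli_F (m2 := leb2) f).
    move=> w _; rewrite WE; apply: le_trans (jensen_expeR mQ s20 mu_cell (mhw w) (h0^~ w)) _.
    rewrite -ge0_integralZl//; do ?[by rewrite lee_fin];
      do ?[by apply: measurable_funTS; apply/measurable_EFinP; exact: measurableT_comp].
    rewrite integral_mkcond le_eqVlt; apply/orP; left; apply/eqP; apply: eq_integral => v _.
    rewrite patchE /f /= indicE; case: (v \in _); first by rewrite mul1r EFinM.
    by rewrite mul0r mulr0.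
  rewrite (fubini_tonelli f mf f0).
  apply: (@le_trans _ _ (\int[leb2]_v ((c * \1_(base_cell spacing) v)%:E * field_bound))%E).
    apply: ge0_le_integral => //.
    - by move=> v _; exact: integral_ge0.
    - exact: (measurable_fun_fubini_tonelli_G (m1 := P) f).
    - apply: emeasurable_funM => //; apply/measurable_EFinP; apply: measurable_funM => //.
    move=> v _; rewrite /f /=.
    under eq_integral do rewrite mulrA EFinM.
    have mhv : measurable_fun setT (h v).
      by apply: (@measurableT_comp _ _ _ _ _ _ (fun q : T * plane R => h q.2 q.1) _ (fun t => (t, v))).
    have meh : measurable_fun setT (fun w => (expR (h v w))%:E).
      by apply/measurable_EFinP; exact: measurableT_comp.
    rewrite ge0_integralZl//; do ?[by rewrite lee_fin mulr_ge0// indicE].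
    by apply: lee_wpmul2l; [rewrite lee_fin mulr_ge0// indicE|exact: lattice_exp_bound].
  have fb0 : (0 <= field_bound)%E.
    rewrite /field_bound adde_ge0// mule_ge0//; apply: integral_ge0 => x _.
    by rewrite lee_fin expR_ge0.
  rewrite ge0_integralZr//; last 2 first.
  - by apply/measurable_EFinP; apply: measurable_funM.
  - by move=> v _; rewrite lee_fin mulr_ge0// indicE.
  under eq_integral do rewrite EFinM.
  rewrite ge0_integralZl//; do ?[by apply/measurable_EFinP; exact: measurable_indic];
    do ?[by move=> v _; rewrite lee_fin indicE]; do ?[by rewrite lee_fin].
  have -> : (\int[leb2]_x (\1_(base_cell spacing) x)%:E = (spacing ^+ 2)%:E)%E.
    by rewrite integral_indic// setIT; exact: mu_cell.
  by rewrite -EFinM /c mulVf ?mul1e// gt_eqF.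
pose g N w := expeR (c%:E * W N w).
have ndS : forall t, nondecreasing_seq (S^~ t).
  move=> t N N' NN'; rewrite !SE ler_nat.
  by case: (ltnP _ N) => // /leq_trans -> //.
have ndW w : nondecreasing_seq (W^~ w).
  move=> N N' NN'; apply: ge0_le_integral => //.
  - by apply/measurable_EFinP; exact: measurable_funM.
  - by apply/measurable_EFinP; exact: measurable_funM.
  - by move=> t _; rewrite lee_fin ler_wpM2r//; exact: ndS.
have ndg w : nondecreasing_seq (g^~ w).
  by move=> N N' NN'; rewrite /g lee_expeR lee_wpmul2l ?lee_fin//; exact: ndW.
have mg N : measurable_fun setT (g N).
  by apply: measurable_expeR; exact: emeasurable_funM.
have limW w : W N w @[N --> \oo] --> (\int[leb2]_(t in D)
    `|psi (field_at Gam (t, A w)) - psi (field_at Gam (t, B w))|%:E)%E.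
  have -> : (\int[leb2]_(t in D) `|psi (field_at Gam (t, A w)) - psi (field_at Gam (t, B w))|%:E =
      \int[leb2]_t limn (fun N => (S N t * gap t w)%:E))%E.
    rewrite integral_mkcond; apply: eq_integral => t _; symmetry; apply/cvg_lim => //.
    apply: cvg_near_cst; exists (cell_index spacing t).+1 => // N /= tN.
    rewrite SE tN mul1r patchE /gap indicE; case: (_ \in _); first by rewrite mul1r.
    by rewrite mul0r.
  apply: cvg_monotone_convergence => //.
  - by move=> N; apply/measurable_EFinP; exact: measurable_funM.
  - by move=> t _ N N' NN'; rewrite lee_fin ler_wpM2r//; exact: ndS.
apply: (@le_trans _ _ (\int[P]_w limn (g^~ w))%E).
  have mlim : measurable_fun setT (fun w => limn (g^~ w)).
    apply: (emeasurable_fun_cvg g _ mg) => w _; apply: ereal_nondecreasing_is_cvgn; exact: ndg.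
  apply: ge0_le_integral => //.
  - by move=> w _; exact: expeR_ge0.
  - apply: measurable_expeR; apply: emeasurable_funM => //.
    by apply: (emeasurable_fun_cvg W _ mW) => w _; exact: limW.
  move=> w _; apply: (@expeR_le_lim _ (fun N => c%:E * W N w)%E).
    by apply: cvgeZl => //; exact: limW.
  move=> N; apply: lime_ge; first by apply: ereal_nondecreasing_is_cvgn; exact: ndg.
  by exists N => // n /= Nn; exact: ndg.
have g0 N w : (0 <= g N w)%E by exact: expeR_ge0.
rewrite (monotone_convergence P measurableT mg (fun N w _ => g0 N w) (fun w _ => ndg w)).
apply: lime_le; last by apply: nearW => N; exact: WN.
apply: ereal_nondecreasing_is_cvgn => N N' NN'; apply: ge0_le_integral => //.
by move=> w _; exact: ndg.
Qed.

End field_differences.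

(** * Signed measures with densities, and leaks of such measures *)

Section densities.
Context {R : realType}.

(** [has_density] with a Borel function, a form which is stable under composition with Borel changes
    of coordinates. *)
Definition dens (nu : signed_measure R) (f : plane R -> R) : Prop :=
  [/\ measurable_fun setT f,
      forall B, bounded_borel B -> (\int[leb2]_(t in B) `|f t|%:E < +oo)%E &
      forall B, bounded_borel B -> nu B = (\int[leb2]_(t in B) (f t)%:E)%E].

Lemma dens_integrable (f : plane R -> R) (B : set (plane R)) : measurable_fun setT f ->
  measurable B -> (\int[leb2]_(t in B) `|f t|%:E < +oo)%E ->
  leb2.-integrable B (EFin \o f).
Proof.
move=> mf mB fB; apply/integrableP; split => //.
by apply/measurable_EFinP; exact: measurable_funTS.
Qed.

Lemma bounded_borelI (B A : set (plane R)) : bounded_borel B -> measurable A ->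
  bounded_borel (B `&` A).
Proof.
move=> [mB /bounded_coord[M BM]] mA; split; first exact: measurableI.
by apply/bounded_coord; exists M => u [/BM].
Qed.

Lemma bounded_borel_window (B : set (plane R)) : bounded_borel B ->
  exists n, B `<=` window n.
Proof.
move=> [_ /bounded_coord[M BM]]; exists (Num.truncn `|M|).+1 => u /BM[u1 u2].
have h : M <= (Num.truncn `|M|).+1%:R.
  by apply: le_trans (ler_norm M) (ltW _); exact: truncnS_gt.
by split => /=; rewrite in_itv /= -ler_norml; [exact: le_trans u1 h|exact: le_trans u2 h].
Qed.

Lemma window_bounded_borel n : bounded_borel (@window R n).
Proof.
split; first exact: measurable_window.
by apply/bounded_coord; exists n%:R => u [] /=; rewrite !in_itv /= -!ler_norml.
Qed.

Definition locally_integrable (f : plane R -> R) : Prop :=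
  measurable_fun setT f /\ forall n, (\int[leb2]_(t in window n) `|f t|%:E < +oo)%E.

Lemma locally_integrable_lty f B : locally_integrable f -> bounded_borel B ->
  (\int[leb2]_(t in B) `|f t|%:E < +oo)%E.
Proof.
move=> [mf fw] hB; have [n Bn] := bounded_borel_window hB.
apply: le_lt_trans (fw n); apply: ge0_subset_integral => //; first exact: hB.1.
  exact: measurable_window.
by apply: measurable_funTS; apply/measurable_EFinP; exact: measurableT_comp.
Qed.

Section density_charge.
Variable f : plane R -> R.

(** Sample functions are locally integrable only almost surely. The zero measure is the default for
    all others, so that every sample gives a signed measure. *)
Definition density_value (B : set (bplane R)) : \bar R :=
  if `[< locally_integrable f >] then (\int[leb2]_(t in (B : set (plane R))) (f t)%:E)%E else 0%E.

Let density_value0 : density_value set0 = 0%E.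
Proof. by rewrite /density_value integral_set0; case: ifP. Qed.

Let density_value_fin B : measurable B -> density_value B \is a fin_num.
Proof.
move=> hB; rewrite /density_value; case: ifPn => // /asboolP hf.
apply: integrable_fin_num; first exact: hB.1.
by apply: (dens_integrable hf.1 hB.1); exact: locally_integrable_lty.
Qed.

Let density_value_sigma_additive : semi_sigma_additive density_value.
Proof.
move=> F mF tF mUF; rewrite /density_value; case: asboolP => [hf|_]; last first.
  by rewrite (_ : (fun n => _) = cst 0%E); [exact: cvg_cst|apply/funext => n; rewrite big1].
set U := \bigcup_n F n in mUF *.
have fU := locally_integrable_lty hf mUF.
have mU : measurable (U : set (plane R)) by exact: mUF.1.
pose g (t : plane R) := (\1_U t * f t)%:E.
have gE B : B `<=` U -> (\int[leb2]_(t in (B : set (plane R))) g t =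
    \int[leb2]_(t in B) (f t)%:E)%E.
  move=> BU; apply: eq_integral => t /set_mem Bt.
  by rewrite /g indicE mem_set ?mul1r//; exact: BU.
have mg : measurable_fun setT g.
  by apply/measurable_EFinP; apply: measurable_funM hf.1; exact: measurable_indic.
have ig : leb2.-integrable setT g.
  apply/integrableP; split => //; apply: le_lt_trans fU.
  rewrite [leRHS]integral_mkcond le_eqVlt; apply/orP; left; apply/eqP.
  apply: eq_integral => t _; rewrite patchE /g /= indicE.
  by case: (t \in U); rewrite ?mul1r// mul0r normr0.
have cv := @charge_semi_sigma_additive _ _ _ (induced_charge ig) F (fun n => (mF n).1) tF mU.
have E : (fun n => \sum_(0 <= i < n) (\int[leb2]_(t in F i) (f t)%:E)%E)%E =
    (fun n => \sum_(0 <= i < n) induced_charge ig (F i))%E.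
  apply/funext => n; apply: eq_bigr => i _.
  by rewrite -[RHS]/(\int[leb2]_(t in F i) g t)%E gE//; exact: bigcup_sup.
by rewrite E -(gE U).
Qed.

HB.instance Definition _ := isCharge.Build _ _ _ density_value
  density_value0 density_value_fin density_value_sigma_additive.

Definition density_measure : signed_measure R := density_value.

Lemma dens_density_measure : locally_integrable f -> dens density_measure f.
Proof.
move=> hf; split; [exact: hf.1|by move=> B; exact: locally_integrable_lty|].
move=> B _; rewrite -[LHS]/(density_value B) /density_value; case: asboolP => //.
Qed.

End density_charge.

Section leak.
Variables (nu0 num nup : signed_measure R).

Definition left_half : set (plane R) := [set t | t.1 < 0].

Lemma measurable_left_half : measurable left_half.
Proof.
rewrite -[X in measurable X]setTI.
have -> : left_half = (fst : plane R -> R) @^-1` `]-oo, 0[%classic.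
  by apply/seteqP; split => t /=; rewrite in_itv.
exact: (@measurable_fst _ _ (measurableTypeR R) (measurableTypeR R)).
Qed.

(** A leak is prescribed on sets lying on one side of the line t_1 = 0; cutting B along this line
    extends it to all bounded Borel sets. *)
Definition leak_value (B : set (bplane R)) : \bar R :=
  (num (B `&` left_half) + nup (B `&` ~` left_half) - nu0 B)%E.

Let hl (B : set (bplane R)) : measurable B ->
  measurable (B `&` left_half : set (bplane R)).
Proof. by move=> hB; exact: (bounded_borelI hB measurable_left_half). Qed.

Let hr (B : set (bplane R)) : measurable B ->
  measurable (B `&` ~` left_half : set (bplane R)).
Proof.
by move=> hB; exact: (bounded_borelI hB (measurableC measurable_left_half)).
Qed.

Let leak_value0 : leak_value set0 = 0%E.
Proof. by rewrite /leak_value !set0I !charge0 adde0 subee. Qed.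

Let leak_value_fin B : measurable B -> leak_value B \is a fin_num.
Proof.
move=> hB; rewrite /leak_value fin_numB fin_numD.
by rewrite !fin_num_measure//; [exact: hr|exact: hl].
Qed.

Let leak_value_sigma_additive : semi_sigma_additive leak_value.
Proof.
move=> F mF tF mUF; rewrite /leak_value.
have cut (nu : signed_measure R) (L : set (plane R)) :
    (forall B : set (bplane R), measurable B -> measurable (B `&` L : set (bplane R))) ->
    (fun n => \sum_(0 <= i < n) nu (F i `&` L))%E @ \oo --> nu (\bigcup_n F n `&` L).
  move=> hL; rewrite setI_bigcupl; apply: charge_semi_sigma_additive.
  - by move=> n; exact: hL.
  - exact: trivIset_setIr.
  - by rewrite -setI_bigcupl; exact: hL.
rewrite (_ : (fun n => _) = (fun n => (\sum_(0 <= i < n) num (F i `&` left_half)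
   + \sum_(0 <= i < n) nup (F i `&` ~` left_half)) - \sum_(0 <= i < n) nu0 (F i))%E); last first.
  apply/funext => n; rewrite -big_split /= -sumeN.
    by rewrite -big_split.
  by move=> i j _ _; rewrite fin_num_adde_defl// fin_num_measure.
have f1 := fin_num_measure num _ (hl mUF); have f2 := fin_num_measure nup _ (hr mUF).
have f0 := fin_num_measure nu0 _ mUF.
apply: cvgeB.
- by rewrite fin_num_adde_defl// fin_numN.
- apply: cvgeD; first by rewrite fin_num_adde_defr.
  + exact: cut hl.
  + exact: cut hr.
- exact: charge_semi_sigma_additive.
Qed.

HB.instance Definition _ := isCharge.Build _ _ _ leak_value
  leak_value0 leak_value_fin leak_value_sigma_additive.

Definition leak_measure : signed_measure R := leak_value.

End leak.

Lemma leak_measureP d (T : measurableType d) (X0 Xm Xp : T -> signed_measure R) :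
  is_leak_of_split X0 Xm Xp (fun w => leak_measure (X0 w) (Xm w) (Xp w)).
Proof.
move=> w B hB; rewrite -[leak_measure _ _ _ B]/(leak_value _ _ _ B) /leak_value.
split=> BL.
  have -> : B `&` ~` left_half = set0.
    by apply/seteqP; split => // t [/BL].
  by rewrite charge0 adde0 setIidl.
have -> : B `&` left_half = set0.
  apply/seteqP; split => // t [/BL /=]; rewrite /left_half /=.
  by rewrite leNgt => /negP.
rewrite charge0 add0e setIidl// => t /BL /=; rewrite /left_half /=.
by rewrite leNgt => /negP.
Qed.

Lemma integral_preserves (g : plane R -> plane R) (h : plane R -> \bar R) :
  preserves_leb2 g -> measurable_fun setT h ->
  (\int[leb2]_u h (g u) = \int[leb2]_u h u)%E.
Proof.
move=> [mg gE] mh; rewrite integralE [RHS]integralE; congr (_ - _)%E.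
  transitivity (\int[leb2]_u (h^\+ (g u)))%E; first by apply: eq_integral => u _; rewrite !funeposE.
  by apply: gE => //; exact: measurable_funepos.
transitivity (\int[leb2]_u (h^\- (g u)))%E; first by apply: eq_integral => u _; rewrite !funenegE.
by apply: gE => //; exact: measurable_funeneg.
Qed.

Lemma integral_preserves_in (g : plane R -> plane R) (h : plane R -> \bar R)
    (B : set (plane R)) : preserves_leb2 g -> measurable B -> measurable_fun setT h ->
  (\int[leb2]_(u in g @^-1` B) h (g u) = \int[leb2]_(u in B) h u)%E.
Proof.
move=> hg mB mh; rewrite integral_mkcond [RHS]integral_mkcond.
rewrite -(integral_preserves (h := (h \_ B)%E) hg).
  by apply: eq_integral => u _; rewrite !patchE.
by apply/measurable_restrict => //; rewrite setTI; exact: measurable_funTS.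
Qed.

Lemma dens_image (g g' : plane R -> plane R) hg (nu : signed_measure R) (f : plane R -> R) :
  preserves_leb2 g -> measurable_fun setT g' -> (forall u, g' (g u) = u) ->
  dens nu f -> dens (@image_signed_measure R g hg nu) (f \o g').
Proof.
move=> pg mg' gK [mf fl fE].
have mf' : measurable_fun setT (f \o g') by exact: measurableT_comp.
have eB (F : R -> R) B : measurable_fun setT F -> bounded_borel B ->
    (\int[leb2]_(t in g @^-1` B) (F (f t))%:E = \int[leb2]_(t in B) (F (f (g' t)))%:E)%E.
  move=> mF hB; rewrite -(integral_preserves_in (h := fun t => (F (f (g' t)))%:E) pg hB.1).
    by apply: eq_integral => u _; rewrite gK.
  by apply/measurable_EFinP; exact: measurableT_comp.
split=> // B hB.
  rewrite -(eB (fun x => `|x|))//.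
  by apply: fl; exact: hg.
rewrite -[LHS]/(nu (g @^-1` B)) fE; last exact: hg.
exact: (eB id).
Qed.

Lemma dens_shift1 r nu f : dens nu f -> dens (shift1 r nu) (fun t => f (t.1 + r, t.2)).
Proof.
move=> h; apply: (@dens_image (fun u => (u.1 - r, u.2)) (fun t => (t.1 + r, t.2))) h.
- have := @preserves_leb2_shift R (- r) 0; congr preserves_leb2.
  by apply/funext => u; rewrite addr0.
- by have := (@preserves_leb2_shift R r 0).1; under eq_fun do rewrite addr0.
- by move=> u; rewrite /= subrK -surjective_pairing.
Qed.

Lemma dens_swap nu f : dens nu f -> dens (swap nu) (fun t => f (t.2, t.1)).
Proof.
move=> h; apply: (@dens_image (fun u => (u.2, u.1)) (fun t => (t.2, t.1))) h.
- exact: preserves_leb2_swap.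
- exact: (@preserves_leb2_swap R).1.
- by move=> u; rewrite /= -surjective_pairing.
Qed.

Lemma dens_cscale c nu f : dens nu f ->
  dens (cscale c nu : signed_measure R) (fun t => c * f t).
Proof.
move=> [mf fl fE]; split=> [|B hB|B hB]; first exact: measurable_funM.
  under eq_integral do rewrite normrM EFinM.
  have m1 : measurable_fun B (fun t => `|f t|%:E).
    by apply: measurable_funTS; apply/measurable_EFinP; exact: measurableT_comp.
  rewrite (ge0_integralZl (leb2 : {measure set _ -> \bar R}) hB.1 m1)//.
  by rewrite lte_mul_pinfty// ?fl// lee_fin.
rewrite -[LHS]/(c%:E * nu B)%E fE//.
under [RHS]eq_integral do rewrite EFinM.
rewrite integralZl//; first exact: hB.1.
by apply: dens_integrable => //; [exact: hB.1|exact: fl].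
Qed.

Lemma dens_leak nu0 num nup f0 fm fp : dens nu0 f0 -> dens num fm -> dens nup fp ->
  dens (leak_measure nu0 num nup) (fun t => (if t.1 < 0 then fm t else fp t) - f0 t).
Proof.
move=> [m0 l0 e0] [mm lm em] [mp lp ep].
have mL := measurable_left_half; have mLc := measurableC mL.
pose fs t := \1_left_half t * fm t + \1_(~` left_half) t * fp t.
have fsE t : (if t.1 < 0 then fm t else fp t) = fs t.
  rewrite /fs !indicE in_setC; have [h|h] := boolP (t.1 < 0).
    by rewrite (mem_set (A := left_half))//= mul1r mul0r addr0.
  by rewrite (memNset (A := left_half))/= ?mul0r ?mul1r ?add0r//; exact/negP.
have mfs : measurable_fun setT fs.
  by apply: measurable_funD; apply: measurable_funM => //; exact: measurable_indic.
have I B (f : plane R -> R) : measurable_fun setT f -> bounded_borel B ->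
    (forall B, bounded_borel B -> \int[leb2]_(t in B) `|f t|%:E < +oo)%E ->
    leb2.-integrable B (EFin \o f).
  by move=> mf hB fl; apply: dens_integrable => //; [exact: hB.1|exact: fl].
have cutE B (L : set (plane R)) (f : plane R -> R) : measurable L -> bounded_borel B ->
    (\int[leb2]_(t in B `&` L) (f t)%:E = \int[leb2]_(t in B) (\1_L t * f t)%:E)%E.
  move=> mL' hB; rewrite integral_mkcond [RHS]integral_mkcond; apply: eq_integral => t _.
  rewrite !patchE in_setI indicE; case: (t \in B) => //=.
  by case: (t \in L); rewrite ?mul1r ?mul0r.
have Ic B (L : set (plane R)) (f : plane R -> R) : measurable L -> measurable_fun setT f ->
    leb2.-integrable B (EFin \o f) -> measurable B ->
    leb2.-integrable B (EFin \o (fun t => \1_L t * f t)).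
  move=> mL' mf fi mB; apply: (le_integrable mB _ _ fi).
    by apply: measurable_funTS; apply/measurable_EFinP; apply: measurable_funM => //; exact: measurable_indic.
  move=> t _ /=; rewrite lee_fin normrM indicE.
  by case: (_ \in _); rewrite ?normr1 ?mul1r// normr0 mul0r.
have Is B : bounded_borel B -> leb2.-integrable B (EFin \o fs).
  move=> hB; rewrite (_ : EFin \o fs = (EFin \o (fun t => (\1_left_half t * fm t)%R)) \+
     (EFin \o (fun t => (\1_(~` left_half) t * fp t)%R)))%E//.
  by apply: integrableD; [exact: hB.1|apply: Ic => //; [exact: I|exact: hB.1]
    |apply: Ic => //; [exact: I|exact: hB.1]].
have It B : bounded_borel B -> leb2.-integrable B (EFin \o (fun t => fs t - f0 t)).
  move=> hB; rewrite (_ : EFin \o _ = (EFin \o fs) \- (EFin \o f0))%E//.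
  by apply: integrableB; [exact: hB.1|exact: Is|exact: I].
under [X in dens _ X]eq_fun do rewrite fsE.
split=> [|B hB|B hB]; first exact: measurable_funB.
  by have /integrableP[] := It _ hB.
rewrite -[LHS]/(leak_value _ _ _ B) /leak_value em; last exact: bounded_borelI.
rewrite ep; last exact: bounded_borelI.
rewrite e0// !cutE//.
rewrite -integralD_EFin//; last 3 first.
- exact: hB.1.
- by apply: Ic => //; [exact: I|exact: hB.1].
- by apply: Ic => //; [exact: I|exact: hB.1].
rewrite -integralB_EFin//; [exact: hB.1|exact: Is|exact: I].
Qed.

Lemma variation_le (nu : signed_measure R) (f : plane R -> R) (B : set (plane R)) : dens nu f -> measurable B ->
  (Defs.variation nu B <= \int[leb2]_(t in B) `|f t|%:E)%E.
Proof.
move=> [mf fl fE] mB; apply: ge_ereal_sup => _ [n [F [hF FB tF ->]]].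
have mnf : measurable_fun setT (fun t => `|f t|%:E).
  by apply/measurable_EFinP; exact: measurableT_comp.
apply: (@le_trans _ _ (\sum_(i < n) \int[leb2]_(t in F i) `|f t|%:E)%E).
  apply: lee_sum => i _; rewrite fE//.
  apply: le_trans (le_abse_integral _ (hF i).1 _) _ => //.
  by apply: measurable_funTS; exact/measurable_EFinP.
rewrite -(big_mkord xpredT (fun i => \int[leb2]_(t in F i) `|f t|%:E)%E).
rewrite -ge0_integral_bigsetU//=; last 4 first.
- by move=> i; exact: (hF i).1.
- exact: iota_uniq.
- exact: sub_trivIset tF.
- exact: measurable_funTS.
apply: ge0_subset_integral => //.
- by apply: bigsetU_measurable => i _; exact: (hF i).1.
- exact: measurable_funTS.
- by move=> t; rewrite -bigcup_seq => -[i _ /FB].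
Qed.

End densities.

(** * Measurability and expectation of random signed measures *)

Section random_signed_measures.
Context {R : realType}.
Context d (T : measurableType d).
Implicit Types X : T -> signed_measure R.

Lemma measurable_to_signed_measure X :
  (forall B, bounded_borel B -> measurable_fun setT (fun w => X w B)) ->
  measurable_fun setT X.
Proof.
move=> mX; apply: (@measurability _ _ _ _ _ _ (\bigcup_(B in @bounded_borel R)
  preimage_set_system setT ((@signed_measure_ev R) ^~ B) measurable)) => //.
move=> _ [_ [B hB [A mA <-]] <-]; rewrite setTI.
rewrite -[X in measurable X]setTI.
have -> : [set: T] `&` X @^-1` ([set: signed_measure R] `&`
    (@signed_measure_ev R) ^~ B @^-1` A) = [set: T] `&` (fun w => X w B) @^-1` A.
  by rewrite !setTI.
exact: mX.
Qed.

Lemma measurable_signed_measure_ev X B : measurable_fun setT X -> bounded_borel B ->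
  measurable_fun setT (fun w => X w B).
Proof.
move=> mX hB _ A mA; have := mX measurableT ((@signed_measure_ev R) ^~ B @^-1` A).
apply; apply: sub_sigma_algebra; exists B => //; exists A => //.
by rewrite setTI.
Qed.

Lemma measurable_image (g : plane R -> plane R) hg X : measurable_fun setT X ->
  measurable_fun setT (fun w => @image_signed_measure R g hg (X w)).
Proof.
move=> mX; apply: measurable_to_signed_measure => B hB.
exact: (measurable_signed_measure_ev mX (hg _ hB)).
Qed.

Lemma measurable_shift1 r X : measurable_fun setT X ->
  measurable_fun setT (fun w => shift1 r (X w)).
Proof. exact: measurable_image. Qed.

Lemma measurable_swap X : measurable_fun setT X ->
  measurable_fun setT (fun w => swap (X w)).
Proof. exact: measurable_image. Qed.

Lemma measurable_cscale c X : measurable_fun setT X ->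
  measurable_fun setT (fun w => cscale c (X w) : signed_measure R).
Proof.
move=> mX; apply: measurable_to_signed_measure => B hB.
by apply: emeasurable_funM => //; exact: measurable_signed_measure_ev.
Qed.

Lemma measurable_leak X0 Xm Xp : measurable_fun setT X0 -> measurable_fun setT Xm ->
  measurable_fun setT Xp ->
  measurable_fun setT (fun w => leak_measure (X0 w) (Xm w) (Xp w)).
Proof.
move=> m0 mm mp; apply: measurable_to_signed_measure => B hB.
have mL := @measurable_left_half R.
apply: emeasurable_funB; last exact: measurable_signed_measure_ev.
apply: emeasurable_funD; apply: measurable_signed_measure_ev => //.
  exact: bounded_borelI.
exact: (bounded_borelI hB (measurableC mL)).
Qed.

Context (P : probability T R).

(** Integrability is included so that the property passes to differences, and hence to leaks. *)
Definition centered_field X : Prop := forall A, bounded_borel A ->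
  P.-integrable setT (fun w => X w A) /\ (\int[P]_w X w A = 0)%E.

Lemma centered_image (g : plane R -> plane R) hg X : centered_field X ->
  centered_field (fun w => @image_signed_measure R g hg (X w)).
Proof. by move=> cX A hA; exact: (cX _ (hg _ hA)). Qed.

Lemma centered_cscale c X : centered_field X ->
  centered_field (fun w => cscale c (X w) : signed_measure R).
Proof.
move=> cX A hA; have [iX eX] := cX _ hA; split; first exact: integrableZl.
by rewrite -[LHS]/(\int[P]_w (c%:E * X w A))%E integralZl// eX mule0.
Qed.

Lemma centered_leak X0 Xm Xp : centered_field X0 -> centered_field Xm ->
  centered_field Xp ->
  centered_field (fun w => leak_measure (X0 w) (Xm w) (Xp w)).
Proof.
move=> c0 cm cp A hA; have mL := @measurable_left_half R.
have [i0 e0] := c0 _ hA.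
have [im em] := cm _ (bounded_borelI hA mL).
have [ip ep] := cp _ (bounded_borelI hA (measurableC mL)).
have iD := integrableD measurableT im ip.
split; first exact: (integrableB measurableT iD i0).
transitivity (\int[P]_w ((fun w => Xm w (A `&` left_half) + Xp w (A `&` ~` left_half)) w
   - X0 w A))%E; first by [].
by rewrite integralB//= integralD// e0 em ep adde0 subee.
Qed.

End random_signed_measures.

(** * The random field as a function of the noise *)

Section fields_of_a_kernel.
Context {R : realType} (K a : R) (k : bool -> plane R * plane R -> R)
  (gam : plane R -> plane R) (Gam : bool -> plane R * state (@HC R) R -> R)
  (psi : plane R -> R).
Hypotheses (hk : good_kernel K a k gam) (hGam : field_version k Gam)
  (mpsi : measurable_fun setT psi).

Definition field_density (x : state (@HC R) R) (t : plane R) : R :=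
  psi (field_at Gam (t, x)).

Let mfd : measurable_fun setT (fun q : state (@HC R) R * plane R => field_density q.1 q.2).
Proof.
apply: (measurableT_comp mpsi); apply: (measurableT_comp (measurable_field_at hGam)).
by apply/measurable_fun_pair.
Qed.

Lemma measurable_field_density x : measurable_fun setT (field_density x).
Proof.
apply: (measurableT_comp mpsi); apply: (measurableT_comp (measurable_field_at hGam)).
by apply/measurable_fun_pair.
Qed.

Definition field_measure (x : state (@HC R) R) : signed_measure R :=
  density_measure (field_density x).

Lemma measurable_field_measure : measurable_fun setT field_measure.
Proof.
apply: measurable_to_signed_measure => B hB.
have mB := hB.1.
have mabs (A : set (plane R)) : measurable A -> measurable_fun setT
    (fun x => \int[leb2]_(t in A) `|field_density x t|%:E)%E.
  move=> mA; pose f (q : state (@HC R) R * plane R) : \bar R :=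
    (`|field_density q.1 q.2| * \1_A q.2)%:E.
  have mf : measurable_fun setT f.
    apply/measurable_EFinP; apply: measurable_funM; first exact: measurableT_comp.
    by apply: measurableT_comp => //; exact: measurable_indic.
  have f0 q : (0 <= f q)%E by rewrite lee_fin mulr_ge0// indicE.
  have := measurable_fun_fubini_tonelli_F (m2 := leb2) f mf f0.
  apply: eq_measurable_fun => x _; rewrite /fubini_F [RHS]integral_mkcond.
  apply: eq_integral => t _; rewrite patchE /f /= indicE.
  by case: (_ \in _); rewrite ?mulr1 ?mulr0.
(* The choice of the default value is measurable, because local integrability is tested on countably
   many windows. *)
apply: measurable_fun_ifT.
- apply: (measurable_fun_bool true); rewrite setTI.
  rewrite (_ : _ @^-1` _ = \bigcap_n [set x | (\int[leb2]_(t in window n)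
      `|field_density x t|%:E < +oo)%E]).
    apply: bigcapT_measurable => n; rewrite -[X in measurable X]setTI.
    apply: emeasurable_fun_infty_o => //; apply: mabs; exact: measurable_window.
  apply/seteqP; split => x /=; first by move=> /asboolP[_ h] n _; exact: h.
  by move=> h; apply/asboolP; split => [|n]; [exact: measurable_field_density|exact: h].
- pose f (q : state (@HC R) R * plane R) : \bar R :=
    (field_density q.1 q.2 * \1_B q.2)%:E.
  have mf : measurable_fun setT f.
    apply/measurable_EFinP; apply: measurable_funM => //.
    by apply: measurableT_comp => //; exact: measurable_indic.
  have mp := measurable_fun_fubini_tonelli_F (m2 := leb2) (f^\+)%E (measurable_funepos mf)
    (fun q => funepos_ge0 _ _).
  have mn := measurable_fun_fubini_tonelli_F (m2 := leb2) (f^\-)%E (measurable_funeneg mf)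
    (fun q => funeneg_ge0 _ _).
  have := emeasurable_funB mp mn; apply: eq_measurable_fun => x _.
  rewrite /fubini_F [RHS]integral_mkcond [RHS]integralE.
  have e t : f (x, t) = ((fun t => (field_density x t)%:E) \_ B)%E t.
    rewrite patchE /f /= indicE.
    by case: (_ \in _); rewrite ?mulr1 ?mulr0.
  by congr (_ - _)%E; apply: eq_integral => t _; rewrite ?funeposE ?funenegE -e.
- exact: measurable_cst.
Qed.

Context d (T : measurableType d) (P : probability T R) (Z : @HC R -> T -> R).
Hypothesis hZ : isonormal P (@ipC R) Z.

Let xi (w : T) : state (@HC R) R := fun f => Z f w.

Let mxi : measurable_fun setT xi.
Proof. by apply: measurable_to_state => f; exact: isonormal_measurable hZ _. Qed.

(** The normalization of the kernel gives both parts variance 1/2, and they are uncorrelated; so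
    they have the Gram matrix of the two coordinates of the standard complex Gaussian. *)
Lemma field_law t (h : plane R -> \bar R) : measurable_fun setT h ->
  (forall z, 0 <= h z)%E ->
  (\int[P]_w h (field_at Gam (t, xi w)) = \int[complex_gaussian]_z h z)%E.
Proof.
move=> mh h0; have mZ := isonormal_measurable hZ.
have hc : inner_product (fun a b : R^o => 2^-1 * (a * b)).
  by apply: inner_product_regular; rewrite invr_ge0.
have hip' := prod_inner_product hc hc.
pose u (b : bool) : @HC R := half_sd *: kvec k b t.
pose u' (b : bool) : (R^o * R^o)%type := if b then (0, 1) else (1, 0).
have gr b c : ipC (u b) (u c) = prod_ip (fun a b : R^o => 2^-1 * (a * b))
    (fun a b : R^o => 2^-1 * (a * b)) (u' b) (u' c).
  have hip := @inner_product_ipC R.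
  rewrite /u (ipZl hip) (ipZr hip) mulrA -expr2 half_sd_sq.
  have [<-|bc] := eqVneq b c.
    have -> : ipC (kvec k b t) (kvec k b t) = 1.
      apply: EFin_inj; have := kvec_diag hk b t measurableT.
      by rewrite maskHC_setT => ->; exact: gk_norm hk _.
    by rewrite /prod_ip /u'; case: b; rewrite /= !(mulr1, mulr0, addr0, add0r).
  have := kvec_cross k t measurableT bc; rewrite maskHC_setT => ->.
  by move: bc; rewrite /prod_ip /u'; case: b; case: c;
    rewrite //= !(mulr1, mulr0, mul0r, addr0, add0r).
pose f (x : state bool R) := h (x false, x true).
have mf : measurable_fun setT f.
  apply: (measurableT_comp mh).
  by apply/measurable_fun_pair => /=; exact: measurable_eval.
have := gram_integral (@inner_product_ipC R) hZ hip' complex_gaussian_isonormal gr mf (fun x => h0 _).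
rewrite /f /prod_noise /u' /=.
under [X in _ = X -> _]eq_integral do
  rewrite !(mul1r, mul0r, addr0, add0r) -surjective_pairing.
move=> <-; apply: ae_eq_integral => //.
- apply: (measurableT_comp mh); apply: (measurableT_comp (measurable_field_at hGam)).
  by apply/measurable_fun_pair.
- apply: (measurableT_comp mh).
  by apply/measurable_fun_pair => /=; exact: mZ.
have e b := isonormalZ hZ half_sd (kvec k b t).
have e' b := hGam.2 b t _ _ _ _ hZ.
move: (e false); apply: filter_app; move: (e true); apply: filter_app.
move: (e' false) (e' true); apply: filterS2 => w h1 h2 h3 h4 _.
by rewrite /field_at /u /= h3 h4 h1 h2.
Qed.

Hypothesis psi_int : (\int[complex_gaussian]_z `|psi z|%:E < +oo)%E.

Let mjoint : measurable_fun setT (fun q : T * plane R => field_density (xi q.1) q.2).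
Proof.
apply: (measurableT_comp mpsi); apply: (measurableT_comp (measurable_field_at hGam)).
by apply/measurable_fun_pair => //=; exact: measurableT_comp.
Qed.

(** By [field_law] the expectation of |psi| at t is the same finite constant for every t, and B has
    finite area. *)
Lemma field_density_integrable (B : set (plane R)) : bounded_borel B ->
  (P \x leb2)%E.-integrable setT (fun q : T * plane R =>
     (\1_B q.2 * field_density (xi q.1) q.2)%:E).
Proof.
move=> hB; have mB := hB.1; apply/integrable21ltyP.
  apply/measurable_EFinP; apply: measurable_funM => //.
  by apply: measurableT_comp => //; exact: measurable_indic.
have mpsiE : measurable_fun setT (fun z => `|psi z|%:E).
  by apply/measurable_EFinP; exact: measurableT_comp.
apply: (@le_lt_trans _ _ (\int[leb2]_t ((\1_B t)%:E * \int[complex_gaussian]_z `|psi z|%:E))%E).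
  rewrite le_eqVlt; apply/orP; left; apply/eqP; apply: eq_integral => t _ /=.
  rewrite -(field_law t mpsiE)// -ge0_integralZl//.
  - apply: eq_integral => w _; rewrite normrM EFinM; congr (_ * _)%E.
    by rewrite ger0_norm// indicE.
  - apply/measurable_EFinP; apply: measurableT_comp => //.
    apply: (measurableT_comp mpsi); apply: (measurableT_comp (measurable_field_at hGam)).
    by apply/measurable_fun_pair.
rewrite ge0_integralZr//; do ?[by apply/measurable_EFinP; exact: measurable_indic];
  do ?[exact: integral_ge0].
rewrite integral_indic// setIT lte_mul_pinfty//.
have [n Bn] := bounded_borel_window hB.
rewrite ge0_fin_numE//; apply: le_lt_trans (leb2_window_lty n).
by apply: le_measure; rewrite ?inE//; exact: measurable_window.
Qed.

Lemma locally_integrable_field :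
  \forall w \ae P, locally_integrable (field_density (xi w)).
Proof.
suff : \forall w \ae P, forall n, (\int[leb2]_(t in window n) `|field_density (xi w) t|%:E < +oo)%E.
  by apply: filterS => w h; split => //; exact: measurable_field_density.
apply: ae_foralln => n.
have hi := field_density_integrable (@window_bounded_borel R n).
have /integrable12ltyP := hi.
move=> /(_ (measurable_int _ hi)) hl.
pose I w := (\int[leb2]_t `|(\1_(window n) t * field_density (xi w) t)%:E|)%E.
have mI : measurable_fun setT I.
  apply: (measurable_fun_fubini_tonelli_F (m2 := leb2) (fun q : T * plane R =>
     `|(\1_(window n) q.2 * field_density (xi q.1) q.2)%:E|%E)) => //.
  by apply: measurableT_comp => //; exact: measurable_int hi.
have iI : P.-integrable setT I.
  apply/integrableP; split => //; under eq_integral do rewrite gee0_abs ?integral_ge0//.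
  exact: hl.
have := integrable_ae measurableT iI; apply: filterS => w /(_ Logic.I) Iw.
rewrite integral_mkcond; move: Iw; rewrite ge0_fin_numE; last exact: integral_ge0.
apply: le_lt_trans; rewrite le_eqVlt; apply/orP; left; apply/eqP; apply: eq_integral => t _.
rewrite patchE /= normrM indicE; case: (_ \in _); first by rewrite normr1 mul1r.
by rewrite normr0 mul0r.
Qed.

Hypothesis psi_mean : (\int[complex_gaussian]_z (psi z)%:E = 0)%E.

Lemma centered_field_measure : centered_field P (fun w => field_measure (xi w)).
Proof.
move=> B hB; have hi := field_density_integrable hB.
pose J w := (\int[leb2]_t (\1_B t * field_density (xi w) t)%:E)%E.
have JE : \forall w \ae P, field_measure (xi w) B = J w.
  apply: filterS locally_integrable_field => w hl.
  have [_ _ ->//] := dens_density_measure hl.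
  rewrite integral_mkcond; apply: eq_integral => t _; rewrite patchE indicE.
  by case: (_ \in _); rewrite ?mul1r// mul0r.
have iJ : P.-integrable setT J := integrable_fubini_F hi.
have mfm : measurable_fun setT (fun w => field_measure (xi w) B).
  apply: measurable_signed_measure_ev => //.
  exact: (measurableT_comp measurable_field_measure).
split.
  apply/integrableP; split => //.
  have /integrableP[mJ] := iJ; apply: le_lt_trans.
  rewrite le_eqVlt; apply/orP; left; apply/eqP; apply: ae_eq_integral => //.
  - exact: measurableT_comp.
  - exact: measurableT_comp.
  - by apply: filterS JE => w ->.
transitivity (\int[P]_w J w)%E.
  apply: ae_eq_integral => //; first exact: measurable_int iJ.
  by apply: filterS JE => w ->.
rewrite (Fubini hi) /= integral0_eq// => t _.
rewrite integralE.
(* The law of the field is available for nonnegative functions, so positive and negative parts are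
   treated apart; F 0 = 0 takes care of the points outside B. *)
have part (F : R -> \bar R) : measurable_fun setT F -> (forall x, 0 <= F x)%E -> F 0%R = 0%E ->
    (\int[P]_w F (\1_B t * field_density (xi w) t)%R =
     (\1_B t)%:E * \int[complex_gaussian]_z F (psi z))%E.
  move=> mF F0 Fz; rewrite -(field_law t (h := fun z => F (psi z)))//; last exact: measurableT_comp.
  rewrite indicE; case: (_ \in _).
    by rewrite mul1e; apply: eq_integral => w _; rewrite mul1r.
  by rewrite mul0e integral0_eq// => w _; rewrite mul0r.
have eP : (\int[complex_gaussian]_z (fun x : R => x%:E)^\+%E (psi z) -
     \int[complex_gaussian]_z (fun x : R => x%:E)^\-%E (psi z) = 0)%E.
  rewrite -psi_mean [RHS]integralE; congr (_ - _)%E; apply: eq_integral => z _;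
    by rewrite ?funeposE ?funenegE.
rewrite (eq_integral (fun w => (fun x : R => x%:E)^\+%E (\1_B t * field_density (xi w) t)%R)); last first.
  by move=> w _; rewrite !funeposE.
rewrite part//; last 2 first.
- by apply: measurable_funepos; exact/measurable_EFinP.
- by rewrite funeposE maxxx.
rewrite (eq_integral (fun w => (fun x : R => x%:E)^\-%E (\1_B t * field_density (xi w) t)%R)); last first.
  by move=> w _; rewrite !funenegE.
rewrite part//; last 2 first.
- by apply: measurable_funeneg; exact/measurable_EFinP.
- by rewrite funenegE oppe0 maxxx.
rewrite indicE; case: (_ \in _); first by rewrite !mul1e.
by rewrite !mul0e subee.
Qed.

End fields_of_a_kernel.

(** * Realizing a split by masks on two copies of the noise *)

Section splitting_a_noise.
Context {R : realType}.

(** What a split uses of f |-> f 1_E and its complement. In this form the construction also applies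
    to the doubled space, where a leak is split again. *)
Record complementary_masks (H : lmodType R) (ip : H -> H -> R) (mE mF : H -> H) : Prop := {
  cm_linearl : linear mE ;
  cm_linearr : linear mF ;
  cm_adjl : forall f g, ip f (mE g) = ip (mE f) g ;
  cm_adjr : forall f g, ip f (mF g) = ip (mF f) g ;
  cm_projl : forall f g, ip (mE f) (mE g) = ip (mE f) g ;
  cm_projr : forall f g, ip (mF f) (mF g) = ip (mF f) g ;
  cm_sum : forall f g, ip f g = ip (mE f) g + ip (mF f) g }.

Lemma maskHC_complementary (E : set (plane R)) : measurable E ->
  complementary_masks (@ipC R) (maskHC E) (maskHC (~` E)).
Proof.
move=> mE; have mC := measurableC mE; split.
- exact: maskHC_linear.
- exact: maskHC_linear.
- by move=> f g; have [_ ->] := ipC_maskHC f g mE.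
- by move=> f g; have [_ ->] := ipC_maskHC f g mC.
- by move=> f g; have [-> _] := ipC_maskHC f g mE.
- by move=> f g; have [-> _] := ipC_maskHC f g mC.
- by move=> f g; exact: ipC_maskC.
Qed.

Definition prod_mask (H : Type) (m : H -> H) (f : H * H) : H * H := (m f.1, m f.2).

Lemma prod_mask_complementary (H : lmodType R) (ip : H -> H -> R) (mE mF : H -> H) :
  complementary_masks ip mE mF ->
  complementary_masks (prod_ip ip ip) (prod_mask mE) (prod_mask mF).
Proof.
case=> lE lF aE aF pE pF s; split.
- by move=> c f g; rewrite /prod_mask /= !lE.
- by move=> c f g; rewrite /prod_mask /= !lF.
- by move=> f g; rewrite /prod_ip /= !aE.
- by move=> f g; rewrite /prod_ip /= !aF.
- by move=> f g; rewrite /prod_ip /= !pE.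
- by move=> f g; rewrite /prod_ip /= !pF.
- by move=> f g; rewrite /prod_ip /= (s f.1) (s f.2); ring.
Qed.

Section one_split.
Context (H : lmodType R) (ip : H -> H -> R) (mE mF : H -> H).
Hypotheses (hip : inner_product ip) (hm : complementary_masks ip mE mF).

Definition half_mask (b : bool) : H -> H := if b then mE else mF.

(* Some true, Some false and None stand for the fields X^-, X^+ and X^0 of a split. *)
Definition inj (o : option bool) (f : H) : (H * H)%type :=
  match o with Some true => (f, 0) | Some false => (0, f) | None => (mE f, mF f) end.

Lemma inj_linear o : linear (inj o).
Proof.
move=> c f g; case: o => [[]|]; rewrite /inj.
- by rewrite -[RHS]/(c *: f + g, c *: 0 + 0) scaler0 addr0.
- by rewrite -[RHS]/(c *: 0 + 0, c *: f + g) scaler0 addr0.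
- by rewrite (cm_linearl hm) (cm_linearr hm).
Qed.

Lemma inj_ip o f g : prod_ip ip ip (inj o f) (inj o g) = ip f g.
Proof.
case: o => [[]|]; rewrite /prod_ip /=.
- by rewrite (ip0l hip) addr0.
- by rewrite (ip0l hip) add0r.
- by rewrite (cm_projl hm) (cm_projr hm) -(cm_sum hm).
Qed.

(** The noise of X^0 agrees with that of X^- or X^+ exactly on the corresponding half: the
    correlation under which two fields are compared. *)
Lemma inj_half b f g : prod_ip ip ip (inj (Some b) f) (inj None g) = ip (half_mask b f) g.
Proof.
case: b; rewrite /prod_ip /=.
  by rewrite (ip0l hip) addr0 (cm_adjl hm).
by rewrite (ip0l hip) add0r (cm_adjr hm).
Qed.

Context d (T : measurableType d) (P : probability T R) (Z : H -> T -> R).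
Hypotheses (hZ : isonormal P ip Z) (Z0 : forall w, Z 0 w = 0).

Definition split_state (o : option bool) (w : T * T) : state H R :=
  fun f => prod_noise Z Z (inj o f) w.

Definition split_leak (Ups : state H R -> signed_measure R) (w : T * T) : signed_measure R :=
  leak_measure (Ups (split_state None w)) (Ups (split_state (Some true) w))
    (Ups (split_state (Some false) w)).

Lemma measurable_split_state o : measurable_fun setT (split_state o).
Proof.
apply: measurable_to_state => f.
exact: isonormal_measurable (isonormal_prod hZ hZ) _.
Qed.

Lemma isonormal_inj o : isonormal (P \x P)%E ip (prod_noise Z Z \o inj o).
Proof.
apply: (isonormal_pullback (isonormal_prod hZ hZ) (inj_linear o)) => f.
exact: inj_ip.
Qed.

(** The three laws agree by equality of Gram matrices. X^- and X^+ are independent because they are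
    functions of different factors of the product space; this uses that Z 0 vanishes everywhere. *)
Lemma is_leak_split (Ups : state H R -> signed_measure R) : measurable_fun setT Ups ->
  is_leak P (fun w => Ups (fun f => Z f w)) (P \x P)%E (split_leak Ups).
Proof.
move=> mU.
have mX o : measurable_fun setT (fun w => Ups (split_state o w)).
  exact: (measurableT_comp mU (measurable_split_state o)).
have mxi : measurable_fun setT (fun w => (fun f => Z f w) : state H R).
  by apply: measurable_to_state => f; exact: isonormal_measurable hZ _.
have mL : measurable_fun setT (split_leak Ups) by apply: measurable_leak; exact: mX.
split => //; exists _, _, (P \x P)%E, (fun w => Ups (split_state None w)),
  (fun w => Ups (split_state (Some true) w)), (fun w => Ups (split_state (Some false) w)),
  (split_leak Ups).
have law o : same_law (P \x P)%E P (fun w => Ups (split_state o w))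
    (fun w => Ups (fun f => Z f w)).
  move=> A mA; have mUA : measurable (Ups @^-1` A).
    by rewrite -[X in measurable X]setTI; exact: mU.
  exact: (gram_law hip (isonormal_inj o) hip hZ (v := id) (v' := id) (fun _ _ => erefl) mUA).
split => //; last exact: leak_measureP.
split => //.
move=> A B mA mB.
have mUA : measurable ((fun w => Ups (fun f => Z f w)) @^-1` A).
  by rewrite -[X in measurable X]setTI; exact: (measurableT_comp mU mxi).
have mUB : measurable ((fun w => Ups (fun f => Z f w)) @^-1` B).
  by rewrite -[X in measurable X]setTI; exact: (measurableT_comp mU mxi).
have sA w : split_state (Some true) w = (fun f => Z f w.1).
  by apply/funext => f; rewrite /split_state /prod_noise /= Z0 addr0.
have sB w : split_state (Some false) w = (fun f => Z f w.2).
  by apply/funext => f; rewrite /split_state /prod_noise /= Z0 add0r.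
have eA : (fun w => Ups (split_state (Some true) w)) @^-1` A =
    ((fun w => Ups (fun f => Z f w)) @^-1` A) `*` setT.
  by apply/seteqP; split => w /=; rewrite sA// => -[].
have eB : (fun w => Ups (split_state (Some false) w)) @^-1` B =
    setT `*` ((fun w => Ups (fun f => Z f w)) @^-1` B).
  by apply/seteqP; split => w /=; rewrite sB// => -[].
rewrite eA eB -setXI setTI setIT.
have PX U V : measurable U -> measurable V -> (P \x P)%E (U `*` V) = (P U * P V)%E.
  by move=> mU' mV; exact: product_measure1E.
apply: (etrans (PX _ _ mUA mUB)); congr (_ * _)%E; symmetry.
  by apply: (etrans (PX _ _ mUA measurableT)); rewrite probability_setT mule1.
by apply: (etrans (PX _ _ measurableT mUB)); rewrite probability_setT mul1e.
Qed.

End one_split.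

Lemma mask_comm (A B : set (plane R)) (g : L2 R) : measurable A -> measurable B ->
  mask A (mask B g) = mask B (mask A g).
Proof.
move=> mA mB; apply: L2_inj => s.
have e (E F : set (plane R)) : measurable E -> measurable F ->
    mask E (mask F g) s = \1_E s * (\1_F s * g s).
  move=> mE mF; apply: (etrans (maskE mE (mask F g) s)).
  by congr (_ * _); exact: maskE.
exact: (etrans (e _ _ mA mB) (etrans (mulrCA _ _ _) (esym (e _ _ mB mA)))).
Qed.

(** Masks commute, so the mask of an outer split can be moved inside the embedding of an inner
    one. *)
Lemma prod_mask_inj (E E' : set (plane R)) o (f : @HC R) : measurable E -> measurable E' ->
  prod_mask (maskHC E') (inj (maskHC E) (maskHC (~` E)) o f) =
  inj (maskHC E) (maskHC (~` E)) o (maskHC E' f).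
Proof.
move=> mE mE'; have mC := measurableC mE.
have comm (A B : set (plane R)) (g : @HC R) : measurable A -> measurable B ->
    maskHC A (maskHC B g) = maskHC B (maskHC A g).
  move=> mA mB; exact: (f_equal2 pair (mask_comm g.1 mA mB) (mask_comm g.2 mA mB)).
have z : maskHC E' 0 = 0.
  have := maskHC_linear mE' 1 0 0; rewrite scaler0 addr0 scale1r => /eqP.
  by rewrite eq_sym -subr_eq0 addrK => /eqP.
case: o => [[]|].
- exact: (f_equal2 pair (erefl _) z).
- exact: (f_equal2 pair z (erefl _)).
- exact: (f_equal2 pair (comm _ _ f mE' mE) (comm _ _ f mE' mC)).
Qed.

End splitting_a_noise.

(** * Integrals of functions known up to null sets *)

Section integrals_of_nonmeasurable_functions.
Context {R : realType} d (T : measurableType d) (P : {measure set T -> \bar R}).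

(** The integral of f is a supremum over simple functions below f, so f can be any function, such as
    the exponential of a variation. Raising g to +oo on the null set makes the bound hold everywhere
    without changing the integral of g. *)
Lemma ge0_le_integral_ae (f g : T -> \bar R) : (forall w, 0 <= f w)%E ->
  (forall w, 0 <= g w)%E -> measurable_fun setT g -> (\forall w \ae P, f w <= g w)%E ->
  (\int[P]_w f w <= \int[P]_w g w)%E.
Proof.
move=> f0 g0 mg [N [mN N0 fgN]].
pose h w := if w \in N then +oo%E else g w.
have h0 w : (0 <= h w)%E by rewrite /h; case: ifP => // _; exact: leey.
have mh : measurable_fun setT h.
  apply: measurable_fun_ifT => //; apply: (measurable_fun_bool true).
  rewrite setTI (_ : _ @^-1` _ = N)//.
  by apply/seteqP; split => w /=; [exact: set_mem|exact: mem_set].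
have -> : (\int[P]_w g w = \int[P]_w h w)%E.
  apply: ae_eq_integral => //; exists N; split => // w /=.
  move=> H; apply: contrapT => Nw; apply: H => _; rewrite /h.
  by rewrite memNset.
rewrite !ge0_integralTE//; apply: le_ereal_sup => _ [u fu <-]; exists u => //= w.
apply: le_trans (fu w) _; rewrite /h; case: ifPn => [_|/negP Nw]; first exact: leey.
by apply: contrapT => H; apply: Nw; rewrite inE; exact: fgN.
Qed.

Lemma ge0_ae_eq_integral_nonmeasurable (f g : T -> \bar R) : (forall w, 0 <= f w)%E ->
  (forall w, 0 <= g w)%E -> measurable_fun setT g -> (\forall w \ae P, f w = g w) ->
  (\int[P]_w f w = \int[P]_w g w)%E.
Proof.
move=> f0 g0 mg fg; apply/eqP; rewrite eq_le; apply/andP; split.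
  by apply: ge0_le_integral_ae => //; apply: filterS fg => w ->.
have [N [mN N0 fgN]] := fg.
pose h w := if w \in N then 0%E else g w.
have h0 w : (0 <= h w)%E by rewrite /h; case: ifP.
have mh : measurable_fun setT h.
  apply: measurable_fun_ifT => //; apply: (measurable_fun_bool true).
  rewrite setTI (_ : _ @^-1` _ = N)//.
  by apply/seteqP; split => w /=; [exact: set_mem|exact: mem_set].
have -> : (\int[P]_w g w = \int[P]_w h w)%E.
  apply: ae_eq_integral => //; exists N; split => // w /=.
  move=> H; apply: contrapT => Nw; apply: H => _; rewrite /h.
  by rewrite memNset.
rewrite !ge0_integralTE//; apply: le_ereal_sup => _ [u fu <-]; exists u => //= w.
apply: le_trans (fu w) _; rewrite /h; case: ifPn => [//|/negP Nw].
have -> // : f w = g w.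
by apply: contrapT => H; apply: Nw; rewrite inE; exact: fgN.
Qed.

Lemma ae_eq_integral_nonmeasurable (f g : T -> \bar R) : measurable_fun setT g ->
  (\forall w \ae P, f w = g w) -> (\int[P]_w f w = \int[P]_w g w)%E.
Proof.
move=> mg fg; rewrite integralE [RHS]integralE; congr (_ - _)%E.
  apply: ge0_ae_eq_integral_nonmeasurable => //; first exact: measurable_funepos.
  by apply: filterS fg => w e; rewrite !funeposE e.
apply: ge0_ae_eq_integral_nonmeasurable => //; first exact: measurable_funeneg.
by apply: filterS fg => w e; rewrite !funenegE e.
Qed.

End integrals_of_nonmeasurable_functions.

(** * Bringing an exponential moment below 2 *)

Section scaling.
Context {R : realType} d (T : measurableType d) (P : probability T R).

(** Convexity with weight eps on each u i and the rest of the weight on 0 bounds the exponential by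
    1 plus eps times the sum of the exp(u i), whose expectation is at most 1 + #|I| eps M <= 2. *)
Lemma exp_moment_scale (I : finType) (u : I -> T -> \bar R) (v : T -> \bar R) (M eps : R) :
  (forall i, measurable_fun setT (u i)) -> (forall i w, 0 <= u i w)%E -> 0 < eps ->
  eps *+ #|I| <= 1 -> (eps * M) *+ #|I| <= 1 ->
  (forall i, \int[P]_w expeR (u i w) <= M%:E)%E ->
  (\forall w \ae P, v w <= eps%:E * \sum_i u i w)%E ->
  (\int[P]_w expeR (v w) <= 2%:E)%E.
Proof.
move=> mu u0 e0 e1 eM uM vu.
have me i : measurable_fun setT (fun w => eps%:E * expeR (u i w))%E.
  by apply: emeasurable_funM => //; exact: measurable_expeR.
have ee i w : (0 <= eps%:E * expeR (u i w))%E by rewrite mule_ge0 ?expeR_ge0// lee_fin ltW.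
apply: (@le_trans _ _ (\int[P]_w (\sum_i eps%:E * expeR (u i w) + 1%:E))%E).
  apply: ge0_le_integral_ae.
  - by move=> w; exact: expeR_ge0.
  - by move=> w; rewrite adde_ge0// sume_ge0.
  - by apply: emeasurable_funD => //; exact: emeasurable_sum.
  apply: filterS vu => w vw; apply: (@le_trans _ _ (expeR (eps%:E * \sum_i u i w))).
    by rewrite lee_expeR.
  have [[i ui]|nf] := pselect (exists i, u i w = +oo%E).
    have r0 : (0 <= \sum_(j | j != i) eps%:E * expeR (u j w) + 1)%E.
      by rewrite adde_ge0// sume_ge0.
    rewrite [in leRHS](bigD1 i)//= ui /= gt0_muley ?lte_fin// -addeA addye ?leey//.
    by rewrite gt_eqF// (lt_le_trans _ r0)// ltNy0.
  have uf i : u i w = (fine (u i w))%:E.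
    rewrite fineK// ge0_fin_numE// ltey; apply/eqP => ui; apply: nf; by exists i.
  rewrite (eq_bigr (fun i => (fine (u i w))%:E))//.
  rewrite [in leRHS](eq_bigr (fun i => (eps * expR (fine (u i w)))%:E)); last first.
    by move=> i _; rewrite {1}uf.
  rewrite !sumEFin -EFinM -EFinD lee_fin mulr_sumr.
  have w1 : \sum_(i <- index_enum I) eps <= 1 by rewrite sumr_const.
  apply: le_trans (expR_convex_sum (w := fun=> eps) (fun i => fine (u i w)) (fun=> ltW e0) w1) _.
  by rewrite lerD2l lerBlDr lerDl sumr_ge0// => i _; exact: ltW.
rewrite ge0_integralD//; last 2 first.
- by move=> w _; exact: sume_ge0.
- exact: emeasurable_sum.
rewrite ge0_integral_sum// integral_cst//= probability_setT mule1.
rewrite -[leRHS]/((1 + 1)%R%:E) EFinD; apply: leeD => //.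
apply: (@le_trans _ _ (\sum_(i : I) (eps * M)%:E)%E); last first.
  by rewrite sumEFin lee_fin sumr_const.
apply: lee_sum => i _; rewrite ge0_integralZl//; last 3 first.
- exact: measurable_expeR.
- by move=> w _; exact: expeR_ge0.
- by rewrite lee_fin ltW.
by rewrite EFinM lee_wpmul2l// lee_fin ltW.
Qed.

End scaling.

(** * Coordinate changes of the field *)

Section change_of_coordinates.
Context {R : realType} (K a : R) (k : bool -> plane R * plane R -> R)
  (gam : plane R -> plane R) (Gam : bool -> plane R * state (@HC R) R -> R)
  (g g' : plane R -> plane R).
Hypotheses (mg : measurable_fun setT g) (pg' : preserves_leb2 g')
  (gE : forall t u, mnorm (g t - u) = mnorm (t - g' u)).

(** Only the argument t is moved and the noise stays in place, so the moved field is driven by the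
    same noise; the motion is recorded in the map gam. *)
Definition move_kernel (b : bool) (q : plane R * plane R) : R := k b (g q.1, q.2).

Definition move_version (b : bool) (q : plane R * state (@HC R) R) : R :=
  Gam b (g q.1, q.2).

Lemma good_kernel_move : good_kernel K a k gam -> good_kernel K a move_kernel (g' \o gam).
Proof.
case=> mk dk nk pgam; split.
- move=> b; apply: (measurableT_comp (mk b)).
  by apply/measurable_fun_pair => //=; exact: (measurableT_comp mg).
- by move=> t s; apply: le_trans (dk (g t) s) _; rewrite /decay gE.
- by move=> t; exact: (nk (g t)).
- exact: preserves_leb2_comp.
Qed.

Lemma field_version_move : field_version k Gam -> field_version move_kernel move_version.
Proof.
case=> mG hG; split.
- move=> b; apply: (measurableT_comp (mG b)).
  by apply/measurable_fun_pair => //=; exact: (measurableT_comp mg).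
- by move=> b t d T P Z hZ; exact: (hG b (g t) d T P Z hZ).
Qed.

End change_of_coordinates.

(** * Exponential moments of leaks and of leaks of leaks *)

Section exponential_moments_of_leaks.
Context {R : realType} (K a C delta : R) (psi : plane R -> R).
Hypotheses (K0 : 0 <= K) (C0 : 0 < C) (d01 : 0 < delta <= 1)
  (a_gt : 2 + 4 / delta < a) (mpsi : measurable_fun setT psi).
Hypothesis psi_holder : forall y h : plane R,
  (\int[complex_gaussian]_x (expR `|psi (halve ((x : plane R) + h + y)%R)
                              - psi (halve (x + h - y)%R)|)%:E <=
   (expR (C * (`|y.1| + `|y.2|) `^ delta))%:E)%E.
Variables (c eps : R).
Hypotheses (c0 : 0 < c) (eps0 : 0 < eps) (eps1 : eps *+ 16 <= 1)
  (epsM : (eps * fine (field_bound K a C delta)) *+ 16 <= 1)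
  (c_eps : c * spacing K ^+ 2 <= eps).

Context (k : bool -> plane R * plane R -> R) (gam : plane R -> plane R)
  (Gam : bool -> plane R * state (@HC R) R -> R).
Hypotheses (hk : good_kernel K a k gam) (hGam : field_version k Gam).

Definition coord (p : bool) (u : plane R) : R := if p then u.1 else u.2.

(** The half-plane is meant in the coordinates of t, where the noise point s sits at gam s; [p] is
    true for the first coordinate. *)
Definition below (p : bool) : set (plane R) := [set s | coord p (gam s) < 0].

Definition below_masks (p b : bool) : @HC R -> @HC R :=
  half_mask (maskHC (below p)) (maskHC (~` below p)) b.

Lemma measurable_coord p : measurable_fun setT (coord p).
Proof. by case: p; [exact: measurable_fst|exact: measurable_snd]. Qed.

Lemma measurable_coord_lt0 (h : plane R -> plane R) p : measurable_fun setT h ->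
  measurable [set s | coord p (h s) < 0].
Proof.
move=> mh; rewrite -[X in measurable X]setTI.
have -> : [set s | coord p (h s) < 0] = (coord p \o h) @^-1` `]-oo, 0[%classic.
  by apply/seteqP; split => t /=; rewrite in_itv.
by apply: (measurableT_comp (measurable_coord p) mh).
Qed.

Lemma measurable_below p : measurable (below p).
Proof. exact: measurable_coord_lt0 (gk_leb2 hk).1. Qed.

Lemma coord_mnorm p u : `|coord p u| <= mnorm u.
Proof. by rewrite /mnorm le_max; case: p; rewrite lexx ?orbT. Qed.

Local Notation fd := (field_density Gam psi).

Lemma measurable_gap_integral d (T : measurableType d) (x y : T -> state (@HC R) R)
    (D : set (plane R)) : measurable_fun setT x -> measurable_fun setT y -> measurable D ->
  measurable_fun setT (fun w => \int[leb2]_(t in D) `|fd (x w) t - fd (y w) t|%:E)%E.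
Proof.
move=> mx my mD.
have mf (z : T -> state (@HC R) R) : measurable_fun setT z ->
    measurable_fun setT (fun q : T * plane R => fd (z q.1) q.2).
  move=> mz; apply: (measurableT_comp mpsi).
  apply: (measurableT_comp (measurable_field_at hGam)).
  by apply/measurable_fun_pair => //=; exact: measurableT_comp.
pose f (q : T * plane R) : \bar R := (`|fd (x q.1) q.2 - fd (y q.1) q.2| * \1_D q.2)%:E.
have mF : measurable_fun setT f.
  apply/measurable_EFinP; apply: measurable_funM.
    by apply: measurableT_comp => //; apply: measurable_funB; exact: mf.
  by apply: measurableT_comp => //; exact: measurable_indic.
have f0 q : (0 <= f q)%E by rewrite lee_fin mulr_ge0// indicE.
have := measurable_fun_fubini_tonelli_F (m2 := leb2) f mF f0.
apply: eq_measurable_fun => w _; rewrite /fubini_F [RHS]integral_mkcond.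
apply: eq_integral => t _; rewrite patchE /f /= indicE.
by case: (_ \in _); rewrite ?mulr1 ?mulr0.
Qed.

(** The two noises agree on the half-plane that contains t. A point of the other half is at distance
    at least |coord p t| >= |t| - 1 from t, and the factor 2 in the growth condition absorbs the
    1. *)
Lemma pair_exp_bound d (T : measurableType d) (P : probability T R) (V : lmodType R)
    (ip : V -> V -> R) (Z : V -> T -> R) (al be : @HC R -> V) (D : set (plane R)) (p b : bool) :
  inner_product ip -> isonormal P ip Z -> linear al -> linear be ->
  (forall f g, ip (al f) (al g) = ipC f g) -> (forall f g, ip (be f) (be g) = ipC f g) ->
  (forall f g, ip (al f) (be g) = ipC (below_masks p b f) g) -> measurable D ->
  (forall t, D t -> (coord p t < 0) = b /\ mnorm t <= 1 + `|coord p t|) ->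
  (\int[P]_w expeR ((spacing K ^- 2)%:E *
      \int[leb2]_(t in D) `|fd (fun f => Z (al f) w) t - fd (fun f => Z (be f) w) t|%:E) <=
   (fine (field_bound K a C delta))%:E)%E.
Proof.
move=> hip hZ lal lbe alE beE abE mD hD.
have mB := measurable_below p; have mBc := measurableC mB.
rewrite fineK ?field_bound_fin//.
apply: (exp_moment_field_difference (E := if b then below p else ~` below p)
  K0 C0 d01 a_gt mpsi psi_holder hk hip hZ lal lbe alE beE _ mD _ _ hGam).
- by case: (b).
- by move=> f g; rewrite abE /below_masks; case: (b).
move=> t s Dt Es; have [tb tn] := hD t Dt.
suff : `|coord p t| <= mnorm (t - gam s).
  by have := mnorm_ge0 (t - gam s); move: tn; lra.
apply: le_trans (coord_mnorm p _).
have -> : coord p (t - gam s) = coord p t - coord p (gam s) by case: (p).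
have [t0|t0] := ltP (coord p t) 0.
  have : ~ below p s by move: tb Es; rewrite t0 => <-.
  rewrite /below /= => /negP; rewrite -leNgt => s0.
  by rewrite !ler0_norm//; lra.
have : below p s by apply: contrapT; move: tb Es; rewrite ltNge t0 => <-.
by rewrite /below /= => s0; rewrite !ger0_norm//; lra.
Qed.

Lemma integral_cover (I : finType) (D : set (plane R)) (Di : I -> set (plane R))
    (f : plane R -> R) (g : I -> plane R -> R) :
  measurable D -> (forall i, measurable (Di i)) -> measurable_fun setT f ->
  (forall i, measurable_fun setT (g i)) -> (forall i t, 0 <= g i t) ->
  (forall t, D t -> `|f t| <= \sum_i \1_(Di i) t * g i t) ->
  (\int[leb2]_(t in D) `|f t|%:E <= \sum_i \int[leb2]_(t in Di i) (g i t)%:E)%E.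
Proof.
move=> mD mDi mf mg g0 fg.
have mIg i : measurable_fun setT (fun t => (\1_(Di i) t * g i t)%:E).
  by apply/measurable_EFinP; apply: measurable_funM => //; exact: measurable_indic.
have Ig0 i t : setT t -> (0 <= (\1_(Di i) t * g i t)%:E)%E.
  by move=> _; rewrite lee_fin mulr_ge0// indicE.
apply: (@le_trans _ _ (\int[leb2]_t \sum_i (\1_(Di i) t * g i t)%:E)%E).
  rewrite integral_mkcond; apply: ge0_le_integral => //.
  - by move=> t _; rewrite patchE; case: ifP => // _; rewrite lee_fin.
  - apply/measurable_restrict => //; rewrite setTI; apply: measurable_funTS.
    by apply/measurable_EFinP; exact: measurableT_comp.
  - exact: emeasurable_sum.
  move=> t _; rewrite patchE; case: ifPn => [/set_mem Dt|_].
    by rewrite sumEFin lee_fin fg.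
  by apply: sume_ge0 => i _; exact: Ig0.
rewrite ge0_integral_sum//; apply: lee_sum => i _.
rewrite [leRHS]integral_mkcond le_eqVlt; apply/orP; left; apply/eqP; apply: eq_integral => t _.
by rewrite patchE indicE; case: (_ \in _); rewrite ?mul1r// mul0r.
Qed.

(** A leak is dominated piecewise by gaps between two fields. Sixteen pieces are the most that
    occur, for the leak of a leak; eps is the weight of each gap in the convexity bound, and c turns
    the normalization spacing^-2 into this weight. *)
Lemma exp_moment_of_gaps (I : finType) d (T : measurableType d) (P : probability T R)
    (x y : I -> T -> state (@HC R) R) (D : set (plane R)) (Di : I -> set (plane R))
    (f : T -> plane R -> R) (v : T -> \bar R) :
  (#|I| <= 16)%N -> (forall i, measurable_fun setT (x i)) ->
  (forall i, measurable_fun setT (y i)) -> measurable D -> (forall i, measurable (Di i)) ->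
  (forall w, measurable_fun setT (f w)) ->
  (forall w t, D t -> `|f w t| <= \sum_i \1_(Di i) t * `|fd (x i w) t - fd (y i w) t|) ->
  (forall i, \int[P]_w expeR ((spacing K ^- 2)%:E *
      \int[leb2]_(t in Di i) `|fd (x i w) t - fd (y i w) t|%:E) <=
   (fine (field_bound K a C delta))%:E)%E ->
  (\forall w \ae P, v w <= c%:E * \int[leb2]_(t in D) `|f w t|%:E)%E ->
  (\int[P]_w expeR (v w) <= 2%:E)%E.
Proof.
move=> I16 mx my mD mDi mf fxy uM vf.
have sp0 : 0 < spacing K.
  by rewrite /spacing ltr_pwDl// mulr_ge0// mulr_ge0// mulr_ge0// sqr_ge0.
have s2 : 0 < spacing K ^+ 2 by rewrite exprn_gt0.
pose u i w := ((spacing K ^- 2)%:E *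
      \int[leb2]_(t in Di i) `|fd (x i w) t - fd (y i w) t|%:E)%E.
have u0 i w : (0 <= u i w)%E.
  by apply: mule_ge0; [rewrite lee_fin invr_ge0 ltW|exact: integral_ge0].
have M0 : 0 <= fine (field_bound K a C delta).
  apply: fine_ge0; rewrite /field_bound adde_ge0// mule_ge0//.
  by apply: integral_ge0 => z _; rewrite lee_fin expR_ge0.
apply: (@exp_moment_scale _ _ _ P I u v (fine (field_bound K a C delta)) eps) => //.
- move=> i; apply: emeasurable_funM => //; exact: measurable_gap_integral.
- by apply: le_trans eps1; apply: ler_wpMn2l I16; exact: ltW.
- by apply: le_trans epsM; apply: ler_wpMn2l I16; rewrite mulr_ge0// ltW.
apply: filterS vf => w vw; apply: le_trans vw _.
have mfd z : measurable_fun setT (fd z) by exact: measurable_field_density hGam mpsi z.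
have cov := @integral_cover I D Di (f w) (fun i t => `|fd (x i w) t - fd (y i w) t|) mD mDi
  (mf w) _ _ (fxy w).
apply: (@le_trans _ _ (c%:E * \sum_i \int[leb2]_(t in Di i) `|fd (x i w) t - fd (y i w) t|%:E)%E).
  apply: lee_wpmul2l; first by rewrite lee_fin ltW.
  apply: cov => [i|//]; apply: measurableT_comp => //.
  by apply: measurable_funB; exact: mfd.
rewrite /u -ge0_sume_distrr; last by move=> i _; exact: integral_ge0.
rewrite muleA; apply: lee_wpmul2r.
  by apply: sume_ge0 => i _; exact: integral_ge0.
by rewrite -EFinM lee_fin ler_pdivlMr.
Qed.

Local Notation mB p := (maskHC (below p)).
Local Notation mBc p := (maskHC (~` below p)).

Lemma below_complementary p : complementary_masks (@ipC R) (mB p) (mBc p).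
Proof. by apply: maskHC_complementary; exact: measurable_below. Qed.

Section first_leak.
Context d (T : measurableType d) (P : probability T R) (Z : @HC R -> T -> R).
Hypothesis hZ : isonormal P (@ipC R) Z.

Definition first_state (o : option bool) (w : T * T) : state (@HC R) R :=
  split_state (mB false) (mBc false) Z o w.

(** The density of the leak after the swap: the split is now along t_2 = 0, which is the coordinate
    [false]. *)
Definition first_density (w : T * T) (t : plane R) : R :=
  fd (first_state (Some (t.2 < 0)) w) t - fd (first_state None w) t.

Let mfs o : measurable_fun setT (first_state o).
Proof. exact: (measurable_split_state _ _ hZ). Qed.

Let mfd z : measurable_fun setT (fd z).
Proof. exact: measurable_field_density hGam mpsi z. Qed.

Let msgn : measurable_fun setT (fun t : plane R => t.2 < 0).
Proof.
apply: (measurable_fun_bool true); rewrite setTI.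
exact: (@measurable_coord_lt0 id false (@measurable_id _ _ _)).
Qed.

Lemma measurable_first_density w : measurable_fun setT (first_density w).
Proof.
apply: measurable_funB => //.
have -> : (fun t : plane R => fd (first_state (Some (t.2 < 0)) w) t) =
    (fun t => if t.2 < 0 then fd (first_state (Some true) w) t else
       fd (first_state (Some false) w) t) by apply/funext => t; case: ifP.
exact: measurable_fun_ifT.
Qed.

(** On the strip 0 <= t_1 < 1 one has |t| <= 1 + |t_2|, so the distance to the line of the split
    grows linearly in |t|. *)
Lemma first_leak_exp_moment (v : T * T -> \bar R) :
  (\forall w \ae (P \x P)%E, v w <= c%:E *
     \int[leb2]_(t in `[0%R, 1%R[%classic `*` setT) `|first_density w t|%:E)%E ->
  (\int[(P \x P)%E]_w expeR (v w) <= 2%:E)%E.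
Proof.
have mS : measurable (`[0%R, 1%R[%classic `*` setT : set (plane R)).
  by apply: measurableX.
pose Di (b : bool) : set (plane R) :=
  (`[0%R, 1%R[%classic `*` setT) `&` [set t | (t.2 < 0) = b].
have mDi b : measurable (Di b).
  apply: measurableI => //; rewrite -[X in measurable X]setTI.
  rewrite (_ : [set t : plane R | (t.2 < 0) = b] = (fun t : plane R => t.2 < 0) @^-1` [set b])//.
  exact: msgn.
have hip := @inner_product_ipC R.
have cm := below_complementary false.
apply: (@exp_moment_of_gaps _ _ _ (P \x P)%E (fun b => first_state (Some b))
  (fun _ => first_state None) _ Di first_density) => //.
- by rewrite card_bool.
- exact: measurable_first_density.
- move=> w t Dt; rewrite big_bool /= /first_density !indicE.
  have in_Di b : (t \in Di b) = ((t.2 < 0) == b).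
    by apply/idP/eqP => [/set_mem[]//|tb]; apply/mem_set.
  rewrite !in_Di; case: (t.2 < 0); first by rewrite mul1r mul0r addr0.
  by rewrite mul0r mul1r add0r.
move=> b; apply: (@pair_exp_bound _ _ _ _ (prod_ip (@ipC R) (@ipC R)) (prod_noise Z Z) (inj (mB false) (mBc false) (Some b))
  (inj (mB false) (mBc false) None) (Di b) false b) => //.
- exact: prod_inner_product.
- exact: isonormal_prod.
- exact: (inj_linear cm).
- exact: (inj_linear cm).
- by move=> f g; exact: (inj_ip hip cm).
- by move=> f g; exact: (inj_ip hip cm).
- by move=> f g; exact: (inj_half hip cm).
move=> t [[/=]]; rewrite in_itv /= => /andP[t0 t1] _ tb; split => //.
by rewrite /mnorm ge_max ger0_norm// lerDr ler01 andbT (le_trans (ltW t1))// lerDl.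
Qed.

End first_leak.

Section second_leak.
Context d (T : measurableType d) (P : probability T R) (Z : @HC R -> T -> R).
Hypothesis hZ : isonormal P (@ipC R) Z.

Local Notation Z2 := (prod_noise Z Z).
Local Notation P2 := (P \x P)%E.
Local Notation P4 := (P2 \x P2)%E.

(** [i] is the role in the inner split, along t_2 = 0, and [j] the role in the outer split, along
    t_1 = 0: nine noises on four copies of Z. *)
Definition second_embedding (i j : option bool) (f : @HC R) :=
  inj (prod_mask (mB true)) (prod_mask (mBc true)) j (inj (mB false) (mBc false) i f).

Definition second_state (i j : option bool) (w : (T * T) * (T * T)) : state (@HC R) R :=
  fun f => prod_noise Z2 Z2 (second_embedding i j f) w.

Definition second_density (w : (T * T) * (T * T)) (t : plane R) : R :=
  let G j := fd (second_state (Some (t.2 < 0)) j w) t - fd (second_state None j w) t in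
  G (Some (t.1 < 0)) - G None.

Local Notation ip1 := (@ipC R).
Local Notation ip2' := (prod_ip ip1 ip1).
Local Notation ip4 := (prod_ip ip2' ip2').

Let hip1 := @inner_product_ipC R.
Let hip2 := prod_inner_product hip1 hip1.
Let hip4 := prod_inner_product hip2 hip2.
Let hZ2 := isonormal_prod hZ hZ.
Let hZ4 := isonormal_prod hZ2 hZ2.
Let cm1 := below_complementary false.
Let cm2 := prod_mask_complementary (below_complementary true).

Lemma second_embedding_linear i j : linear (second_embedding i j).
Proof. by move=> e f g; rewrite /second_embedding (inj_linear cm1) (inj_linear cm2). Qed.

Lemma second_embedding_ip i j f g :
  ip4 (second_embedding i j f) (second_embedding i j g) = ipC f g.
Proof. by rewrite /second_embedding (inj_ip hip2 cm2) (inj_ip hip1 cm1). Qed.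

Lemma second_embedding_inner b j f g :
  ip4 (second_embedding (Some b) j f) (second_embedding None j g) =
  ipC (below_masks false b f) g.
Proof. by rewrite /second_embedding (inj_ip hip2 cm2) (inj_half hip1 cm1). Qed.

Lemma second_embedding_outer i b f g :
  ip4 (second_embedding i (Some b) f) (second_embedding i None g) =
  ipC (below_masks true b f) g.
Proof.
rewrite /second_embedding (inj_half hip2 cm2).
have mb := measurable_below false; have mb' := measurable_below true.
have -> : half_mask (prod_mask (mB true)) (prod_mask (mBc true)) b
    (inj (mB false) (mBc false) i f) = inj (mB false) (mBc false) i (below_masks true b f).
  by case: b; [exact: prod_mask_inj|apply: prod_mask_inj => //; exact: measurableC].
by rewrite (inj_ip hip1 cm1).
Qed.

Let mss i j : measurable_fun setT (second_state i j).
Proof. by apply: measurable_to_state => f; exact: isonormal_measurable hZ4 _. Qed.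

Let mfd z : measurable_fun setT (fd z).
Proof. exact: measurable_field_density hGam mpsi z. Qed.

Let msgn p : measurable_fun setT (fun t : plane R => coord p t < 0).
Proof.
apply: (measurable_fun_bool true); rewrite setTI.
exact: (@measurable_coord_lt0 id p (@measurable_id _ _ _)).
Qed.

Let mpick p (F : bool -> plane R -> R) : (forall b, measurable_fun setT (F b)) ->
  measurable_fun setT (fun t : plane R => F (coord p t < 0) t).
Proof.
move=> mF; have -> : (fun t => F (coord p t < 0) t) =
  (fun t => if coord p t < 0 then F true t else F false t) by apply/funext => t; case: ifP.
exact: measurable_fun_ifT.
Qed.

Lemma measurable_second_density w : measurable_fun setT (second_density w).
Proof.
have mG j : measurable_fun setT (fun t : plane R =>
    fd (second_state (Some (t.2 < 0)) j w) t - fd (second_state None j w) t).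
  by apply: measurable_funB => //; apply: (mpick false
    (F := fun b t => fd (second_state (Some b) j w) t)).
apply: measurable_funB => //.
exact: (mpick true (F := fun b t =>
  fd (second_state (Some (t.2 < 0)) (Some b) w) t - fd (second_state None (Some b) w) t)).
Qed.

Lemma second_leak_exp_moment (v : (T * T) * (T * T) -> \bar R) :
  (\forall w \ae P4, v w <= c%:E * \int[leb2]_t `|second_density w t|%:E)%E ->
  (\int[P4]_w expeR (v w) <= 2%:E)%E.
Proof.
(* On a sector |t_1| <= |t_2| the four fields are paired so that the two fields of a
   pair differ only by the inner split, elsewhere only by the outer split. *)
pose I := ((bool * bool) * (bool * bool))%type.
pose Di (q : I) : set (plane R) := [set t | [&& (t.1 < 0) == q.1.1, (t.2 < 0) == q.1.2
   & (`|t.1| <= `|t.2|) == q.2.1]].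
(* The last boolean of an index tells the two pairs on a sector apart: it is the common role of both
   fields in the split that does not distinguish them. *)
pose opt (p b : bool) := if p then Some b else None.
pose ex (q : I) : option bool * option bool :=
  if q.2.1 then (Some q.1.2, opt q.2.2 q.1.1) else (opt q.2.2 q.1.2, Some q.1.1).
pose ey (q : I) : option bool * option bool :=
  if q.2.1 then (None, opt q.2.2 q.1.1) else (opt q.2.2 q.1.2, None).
have mabs p : measurable_fun setT (fun t : plane R => `|coord p t|).
  by apply: measurableT_comp => //; exact: measurable_coord.
have mDi q : measurable (Di q).
  rewrite -[X in measurable X]setTI.
  have -> : Di q = (fun t : plane R => coord true t < 0) @^-1` [set q.1.1] `&`
     ((fun t : plane R => coord false t < 0) @^-1` [set q.1.2] `&`
     (fun t : plane R => `|coord true t| <= `|coord false t|) @^-1` [set q.2.1]).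
    apply/seteqP; split => t /=; first by move=> /and3P[/eqP ? /eqP ? /eqP ?].
    by move=> [e1 [e2 e3]]; rewrite /Di /= e1 e2 e3 !eqxx.
  have mle : measurable_fun setT (fun t : plane R => `|coord true t| <= `|coord false t|).
    exact: (measurable_fun_ler (mabs true) (mabs false)).
  rewrite setTI; apply: measurableI.
    by rewrite -[X in measurable X]setTI; exact: msgn.
  apply: measurableI; first by rewrite -[X in measurable X]setTI; exact: msgn.
  by rewrite -[X in measurable X]setTI; exact: mle.
move=> hv; apply: (@exp_moment_of_gaps I _ _ P4 (fun q => second_state (ex q).1 (ex q).2)
  (fun q => second_state (ey q).1 (ey q).2) setT Di second_density) => //.
- by rewrite !card_prod !card_bool.
- exact: measurable_second_density.
- move=> w t _.
  pose g (q : I) := `|fd (second_state (ex q).1 (ex q).2 w) t -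
    fd (second_state (ey q).1 (ey q).2 w) t|.
  pose q (p : bool) : I := ((t.1 < 0, t.2 < 0), (`|t.1| <= `|t.2|, p)).
  have in_Di p : (t \in Di (q p)) by apply/mem_set; rewrite /Di /= !eqxx.
  have q12 : q false != q true by apply/eqP => -[].
  rewrite (bigD1 (q true))//= (bigD1 (q false) q12)/=.
  rewrite !indicE !in_Di !mul1r addrA; apply: (@le_trans _ _ (g (q true) + g (q false))).
    rewrite /g /second_density /ex /ey /q /opt /=.
    move: (t.1 < 0) (t.2 < 0) => b1 b2; case: (`|t.1| <= `|t.2|) => /=.
      exact: ler_normB.
    set A := fd _ t; set B := fd _ t; set C' := fd _ t; set E := fd _ t.
    rewrite (_ : A - B - (C' - E) = (A - C') - (B - E)); last by ring.
    exact: ler_normB.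
  by rewrite lerDl sumr_ge0// => r _; rewrite mulr_ge0// indicE.
- move=> q; case: q => [[b1 b2] [sec p]].
  have lin i j := second_embedding_linear i j.
  apply: (@pair_exp_bound _ _ _ _ ip4 (prod_noise Z2 Z2)
    (second_embedding (ex (b1, b2, (sec, p))).1 (ex (b1, b2, (sec, p))).2)
    (second_embedding (ey (b1, b2, (sec, p))).1 (ey (b1, b2, (sec, p))).2)
    (Di (b1, b2, (sec, p))) (~~ sec) (if sec then b2 else b1)) => //.
  + by move=> f g; exact: second_embedding_ip.
  + by move=> f g; exact: second_embedding_ip.
  + move=> f g; rewrite /ex /ey /=; case: (sec) => /=.
      exact: second_embedding_inner.
    exact: second_embedding_outer.
  move=> t /= /and3P[/eqP t1 /eqP t2 /eqP ts]; split; first by case: (sec).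
  rewrite /mnorm /coord; move: ts; case: (sec) => /= ts.
    by rewrite max_r// lerDr.
  by rewrite max_l ?lerDr// ltW// ltNge ts.
Qed.

End second_leak.

End exponential_moments_of_leaks.

(** * The scaled field satisfies the definition of splittability *)

Section splittability_of_the_field.
Context {R : realType} (K a C delta : R) (psi : plane R -> R).
Hypotheses (K0 : 0 <= K) (C0 : 0 < C) (d01 : 0 < delta <= 1)
  (a_gt : 2 + 4 / delta < a) (mpsi : measurable_fun setT psi).
Hypothesis psi_holder : forall y h : plane R,
  (\int[complex_gaussian]_x (expR `|psi (halve ((x : plane R) + h + y)%R)
                              - psi (halve (x + h - y)%R)|)%:E <=
   (expR (C * (`|y.1| + `|y.2|) `^ delta))%:E)%E.
Hypothesis psi_int : (\int[complex_gaussian]_z `|psi z|%:E < +oo)%E.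
Hypothesis psi_mean : (\int[complex_gaussian]_z (psi z)%:E = 0)%E.
Variables (c eps : R).
Hypotheses (c0 : 0 < c) (eps0 : 0 < eps) (eps1 : eps *+ 16 <= 1)
  (epsM : (eps * fine (field_bound K a C delta)) *+ 16 <= 1)
  (c_eps : c * spacing K ^+ 2 <= eps).
Variables (C' M' : R).
Hypotheses (C'0 : 0 < C') (cC' : c * C' <= 1) (cM' : c * C' * M' <= 1).
Hypothesis psi_exp : (\int[complex_gaussian]_z (expR (C'^-1 * `|psi z|))%:E <= M'%:E)%E.

Context (k : bool -> plane R * plane R -> R) (gam : plane R -> plane R)
  (Gam : bool -> plane R * state (@HC R) R -> R).
Hypotheses (hk : good_kernel K a k gam) (hGam : field_version k Gam).

Local Notation fd := (field_density Gam psi).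
Local Notation fm := (field_measure Gam psi).

(* Read through this map, both leaks of condition (c), once swapped and shifted
   by s, come from a split along t_2 = 0. *)
Definition relabel (b : bool) (r s : R) (t : plane R) : plane R :=
  if b then (t.1 + s, t.2 + r) else (t.2 + r, t.1 + s).

Definition unlabel (b : bool) (r s : R) (u : plane R) : plane R :=
  if b then (u.1 - s, u.2 - r) else (u.2 - s, u.1 - r).

Lemma measurable_relabel b r s : measurable_fun setT (relabel b r s).
Proof.
rewrite /relabel; case: b; first exact: (@preserves_leb2_shift R s r).1.
have := @preserves_leb2_comp R _ _ (@preserves_leb2_swap R) (@preserves_leb2_shift R s r).
by case.
Qed.

Lemma preserves_unlabel b r s : preserves_leb2 (unlabel b r s).
Proof.
rewrite /unlabel; case: b; first exact: (@preserves_leb2_shift R (- s) (- r)).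
exact: (preserves_leb2_comp (@preserves_leb2_shift R (- s) (- r)) (@preserves_leb2_swap R)).
Qed.

Lemma mnorm_relabel b r s t u : mnorm (relabel b r s t - u) = mnorm (t - unlabel b r s u).
Proof.
by rewrite /relabel /unlabel /mnorm; case: b => /=; rewrite ?opprB ?addrA;
  [|rewrite maxC]; congr Num.max; congr (`|_|); ring.
Qed.

Local Notation gam' b r s := (unlabel b r s \o gam).
Local Notation Gam' b r s := (move_version Gam (relabel b r s)).

Let hk' b r s := good_kernel_move (measurable_relabel b r s) (preserves_unlabel b r s)
  (@mnorm_relabel b r s) hk.
Let hGam' b r s := field_version_move (g := relabel b r s) (measurable_relabel b r s) hGam.

Definition scaled_field (x : state (@HC R) R) : signed_measure R :=
  cscale c (fm x) : signed_measure R.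

Definition oriented (b : bool) (nu : signed_measure R) : signed_measure R :=
  if b then swap nu else nu.

Definition shifted_field b r (x : state (@HC R) R) : signed_measure R :=
  shift1 r (oriented b (scaled_field x)).

Lemma measurable_scaled_field : measurable_fun setT scaled_field.
Proof. by apply: measurable_cscale; exact: measurable_field_measure hGam mpsi. Qed.

Lemma measurable_oriented d (T : measurableType d) b (X : T -> signed_measure R) :
  measurable_fun setT X -> measurable_fun setT (fun w => oriented b (X w)).
Proof. by move=> mX; case: b => //; exact: measurable_swap. Qed.

Lemma measurable_shifted_field b r : measurable_fun setT (shifted_field b r).
Proof.
apply: measurable_shift1; apply: measurable_oriented; exact: measurable_scaled_field.
Qed.

Lemma dens_ext (nu : signed_measure R) f g : dens nu f -> (forall t, f t = g t) -> dens nu g.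
Proof. by move=> h fg; have <- : f = g by apply/funext. Qed.

Lemma dens_scaled_leak (nu : option bool -> signed_measure R) (D : option bool -> plane R -> R) :
  (forall o, dens (nu o) (fun t => c * D o t)) ->
  dens (leak_measure (nu None) (nu (Some true)) (nu (Some false)))
    (fun t => c * (D (Some (t.1 < 0)) t - D None t)).
Proof.
move=> h; apply: (dens_ext (dens_leak (h None) (h (Some true)) (h (Some false)))) => t.
by rewrite [RHS]mulrBr; case: (t.1 < 0).
Qed.

Lemma dens_shifted_field b r x : locally_integrable (fd x) ->
  dens (shifted_field b r x) (fun t => c * fd x (relabel b r 0 (t.2, t.1))).
Proof.
move=> /(dens_density_measure) h; have hc := dens_cscale c h.
rewrite /shifted_field /oriented /relabel; case: b.
  by apply: (dens_ext (dens_shift1 r (dens_swap hc))) => t; rewrite /= addr0.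
by apply: (dens_ext (dens_shift1 r hc)) => t; rewrite /= addr0.
Qed.

Definition leak_of (b : bool) (r : R) (x : option bool -> state (@HC R) R) : signed_measure R :=
  leak_measure (shifted_field b r (x None)) (shifted_field b r (x (Some true)))
    (shifted_field b r (x (Some false))).

Definition moved_leak b r s x : signed_measure R := shift1 s (swap (leak_of b r x)).

Lemma dens_swap_leak b r x : (forall o, locally_integrable (fd (x o))) ->
  dens (swap (leak_of b r x)) (fun t =>
    c * (fd (x (Some (t.2 < 0))) (relabel b r 0 t) - fd (x None) (relabel b r 0 t))).
Proof.
move=> hx; have hd o := dens_shifted_field b r (hx o).
apply: (dens_ext (dens_swap (dens_leak (hd None) (hd (Some true)) (hd (Some false))))) => t.
rewrite /= -surjective_pairing mulrBr; case: ifP => //.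
Qed.

Lemma relabel_shift b r s t : relabel b r 0 (t.1 + s, t.2) = relabel b r s t.
Proof. by rewrite /relabel; case: b; rewrite /= addr0. Qed.

Lemma dens_moved_leak b r s x : (forall o, locally_integrable (fd (x o))) ->
  dens (moved_leak b r s x) (fun t =>
    c * (fd (x (Some (t.2 < 0))) (relabel b r s t) - fd (x None) (relabel b r s t))).
Proof.
move=> hx; apply: (dens_ext (dens_shift1 s (dens_swap_leak b r hx))) => t.
by rewrite /= relabel_shift.
Qed.

(** Moves a strip to position 0, at the price of shifting the density; the shift by s is then
    absorbed in the kernel, so a single estimate serves all strips. *)
Lemma variation_strip (nu : signed_measure R) (f h : plane R -> R) (D : set (measurableTypeR R)) (s : R) :
  dens nu f -> measurable D -> measurable_fun setT h ->
  (forall t, f (t.1 + s, t.2) = c * h t) ->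
  (Defs.variation nu ([set x : measurableTypeR R | D (x - s : R)%R] `*` setT) <=
   c%:E * \int[leb2]_(t in D `*` setT) `|h t|%:E)%E.
Proof.
move=> hf mD mh fh; pose B : set (plane R) := [set x : measurableTypeR R | D (x - s : R)%R] `*` setT.
pose g (t : plane R) : plane R := (t.1 + s, t.2 + 0).
have pg : preserves_leb2 g by exact: preserves_leb2_shift.
have mB : measurable B.
  apply: measurableX => //; rewrite -[X in measurable X]setTI.
  have ms : measurable_fun setT (fun x : measurableTypeR R => x - s) by exact: measurable_funB.
  exact: ms.
have mfa : measurable_fun setT (fun t => `|f t|%:E).
  by case: hf => mf _ _; apply/measurable_EFinP; exact: measurableT_comp.
apply: le_trans (variation_le hf mB) _.
rewrite -(integral_preserves_in pg mB mfa).
have gK t : (g t).1 - s = t.1 by exact: addrK.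
have -> : g @^-1` B = D `*` setT.
  by apply/seteqP; split => t [Dt _]; split => //; [rewrite -gK|rewrite /= gK].
rewrite -ge0_integralZl//.
- rewrite le_eqVlt; apply/orP; left; apply/eqP; apply: eq_integral => t _.
  by rewrite /g /= addr0 fh normrM EFinM (gtr0_norm c0).
- exact: measurableX.
- by apply: measurable_funTS; apply/measurable_EFinP; exact: measurableT_comp.
- by rewrite lee_fin ltW.
Qed.

Section with_noise.
Context d (T : measurableType d) (P : probability T R) (Z : @HC R -> T -> R).
Hypotheses (hZ : isonormal P (@ipC R) Z) (Z0 : forall w, Z 0 w = 0).

Let st (w : T) : state (@HC R) R := fun f => Z f w.

Let mst : measurable_fun setT st.
Proof. by apply: measurable_to_state => f; exact: isonormal_measurable hZ _. Qed.

(** Jensen's inequality on B, which has area 1, reduces the integral to single points, where the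
    field is standard complex Gaussian and [psi_exp] applies. The moment M' is then scaled below 2
    with the weight c C'. *)
Lemma field_exp_moment (B : set (plane R)) : measurable B -> leb2 B = 1%E ->
  bounded_borel B ->
  (exp_variation P (fun w => scaled_field (st w)) B <= 2%:E)%E.
Proof.
move=> mB B1 hB.
pose u (i : unit) w := (C'^-1%:E * \int[leb2]_(t in B) `|fd (st w) t|%:E)%E.
have mfd x : measurable_fun setT (fd x) by exact: measurable_field_density hGam mpsi x.
have mj : measurable_fun setT (fun q : T * plane R => fd (st q.1) q.2).
  apply: (measurableT_comp mpsi); apply: (measurableT_comp (measurable_field_at hGam)).
  by apply/measurable_fun_pair => //=; exact: measurableT_comp.
have mI : measurable_fun setT (fun w => \int[leb2]_(t in B) `|fd (st w) t|%:E)%E.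
  pose f (q : T * plane R) : \bar R := (`|fd (st q.1) q.2| * \1_B q.2)%:E.
  have mF : measurable_fun setT f.
    apply/measurable_EFinP; apply: measurable_funM; first exact: measurableT_comp.
    by apply: measurableT_comp => //; exact: measurable_indic.
  have f0 q : (0 <= f q)%E by rewrite lee_fin mulr_ge0// indicE.
  have := measurable_fun_fubini_tonelli_F (m2 := leb2) f mF f0.
  apply: eq_measurable_fun => w _; rewrite /fubini_F [RHS]integral_mkcond.
  apply: eq_integral => t _; rewrite patchE /f /= indicE.
  by case: (_ \in _); rewrite ?mulr1 ?mulr0.
have C'i : 0 <= C'^-1 by rewrite invr_ge0 ltW.
apply: (@exp_moment_scale _ _ _ P unit u _ M' (c * C')) => //.
- by move=> i; exact: emeasurable_funM.
- by move=> i w; rewrite mule_ge0// ?lee_fin//; exact: integral_ge0.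
- exact: mulr_gt0.
- by rewrite card_unit mulr1n.
- by rewrite card_unit mulr1n.
- case.
  pose f (q : T * plane R) : \bar R := ((expR (C'^-1 * `|fd (st q.1) q.2|)) * \1_B q.2)%:E.
  have mf : measurable_fun setT f.
    apply/measurable_EFinP; apply: measurable_funM; last first.
      by apply: measurableT_comp => //; exact: measurable_indic.
    by apply: measurableT_comp => //; apply: measurable_funM => //; exact: measurableT_comp.
  have f0 q : (0 <= f q)%E by rewrite lee_fin mulr_ge0 ?expR_ge0// indicE.
  have mexp : measurable_fun setT (fun z : plane R => (expR (C'^-1 * `|psi z|))%:E).
    by apply/measurable_EFinP; apply: measurableT_comp => //; apply: measurable_funM => //;
      exact: measurableT_comp.
  apply: (@le_trans _ _ (\int[P]_w \int[leb2]_t f (w, t))%E).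
    apply: ge0_le_integral => //.
    + by move=> w _; exact: expeR_ge0.
    + by apply: measurable_expeR; exact: emeasurable_funM.
    + exact: (measurable_fun_fubini_tonelli_F (m2 := leb2) f).
    move=> w _.
    have e : u tt w = (1%:E * \int[leb2]_(t in B) (C'^-1 * `|fd (st w) t|)%:E)%E.
      rewrite mul1e /u -ge0_integralZl//.
      by apply: measurable_funTS; apply/measurable_EFinP; exact: measurableT_comp.
    have m1 : measurable_fun setT (fun t => C'^-1 * `|fd (st w) t|).
      by apply: measurable_funM => //; exact: measurableT_comp.
    have := jensen_expeR mB ltr01 B1 m1 (fun t => mulr_ge0 C'i (normr_ge0 _)).
    rewrite invr1 -e mul1e => /le_trans; apply.
    rewrite integral_mkcond le_eqVlt; apply/orP; left; apply/eqP; apply: eq_integral => t _.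
    by rewrite patchE /f /= indicE; case: (_ \in _); rewrite ?mulr1 ?mulr0.
  rewrite (fubini_tonelli f mf f0).
  apply: (@le_trans _ _ (\int[leb2]_t ((\1_B t)%:E * \int[complex_gaussian]_z (expR (C'^-1 * `|psi z|))%:E))%E).
    rewrite le_eqVlt; apply/orP; left; apply/eqP; apply: eq_integral => t _ /=.
    rewrite -(field_law hk hGam hZ t mexp); last by move=> z; rewrite lee_fin expR_ge0.
    rewrite -ge0_integralZl//.
    + by apply: eq_integral => w _; rewrite /f /= EFinM muleC.
    + apply/measurable_EFinP; apply: measurableT_comp => //; apply: measurable_funM => //.
      apply: measurableT_comp => //.
      by apply: (@measurableT_comp _ _ _ _ _ _ (fun q : T * plane R => fd (st q.1) q.2) _ (fun w => (w, t))).
  rewrite ge0_integralZr//; do ?[by apply/measurable_EFinP; exact: measurable_indic];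
    do ?[by apply: integral_ge0 => z _; rewrite lee_fin expR_ge0].
  have -> : (\int[leb2]_x (\1_B x)%:E = 1)%E by rewrite integral_indic// setIT; exact: B1.
  by rewrite mul1e.
have := locally_integrable_field hk hGam mpsi hZ psi_int; apply: filterS => w hw.
have hd := dens_cscale c (dens_density_measure hw).
apply: le_trans (variation_le hd mB) _.
rewrite (bigD1 tt)//= big1 ?adde0; last by case.
rewrite /u muleA -EFinM -mulrA mulfV ?gt_eqF// mulr1 -ge0_integralZl//.
- rewrite le_eqVlt; apply/orP; left; apply/eqP; apply: eq_integral => t _.
  by rewrite normrM EFinM (gtr0_norm c0).
- by apply: measurable_funTS; apply/measurable_EFinP; exact: measurableT_comp.
- by rewrite lee_fin ltW.
Qed.

Local Notation Z2 := (prod_noise Z Z).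
Local Notation P2 := (P \x P)%E.
Local Notation P4 := (P2 \x P2)%E.
Local Notation inner b r s := (below (gam' b r s) false).
Local Notation outer b r s := (below (gam' b r s) true).

(** The shift by s acts on t_1, whereas the inner split is along t_2. Hence the first leak can be
    formed before s is chosen. *)
Lemma inner_shift b r s : inner b r s = inner b r 0.
Proof. by rewrite /below /unlabel; case: b. Qed.

Let cmi b r := below_complementary (hk' b r 0) false.
Let cmo b r s := prod_mask_complementary (below_complementary (hk' b r s) true).
Let hip := @inner_product_ipC R.
Let hip2 := prod_inner_product hip hip.
Let hZ2 := isonormal_prod hZ hZ.
Let hZ4 := isonormal_prod hZ2 hZ2.

Lemma ae_option d' (T' : measurableType d') (Q : probability T' R) (A : option bool -> set T') :
  (forall o, \forall w \ae Q, A o w) -> \forall w \ae Q, forall o, A o w.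
Proof.
move=> h; move: (h None) (h (Some true)) (h (Some false)).
by apply: filterS3 => w a1 a2 a3 [[]|].
Qed.

Lemma ae_sub d' (T' : measurableType d') (Q : probability T' R) (A B : set T') :
  A `<=` B -> (\forall w \ae Q, A w) -> \forall w \ae Q, B w.
Proof. exact: filterS. Qed.

Local Notation leak1_state b r o w :=
  (split_state (maskHC (inner b r 0)) (maskHC (~` inner b r 0)) Z o w).

Definition first_leak b r : T * T -> signed_measure R :=
  split_leak (maskHC (inner b r 0)) (maskHC (~` inner b r 0)) Z (shifted_field b r).

Lemma leak1_state_integrable b r :
  \forall w \ae P2, forall o, locally_integrable (fd (leak1_state b r o w)).
Proof.
apply: ae_option => o.
exact: (locally_integrable_field hk hGam mpsi (isonormal_inj hip (cmi b r) hZ o) psi_int).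
Qed.

Lemma first_leak_strip b r s :
  (exp_variation P2 (swap \o first_leak b r) (`[s, (s + 1)%R[%classic `*` setT) <= 2%:E)%E.
Proof.
apply: (first_leak_exp_moment K0 C0 d01 a_gt mpsi psi_holder c0 eps0 eps1 epsM c_eps
  (hk' b r s) (hGam' b r s) hZ).
apply: filterS (leak1_state_integrable b r) => w hw.
have -> : `[s, (s + 1)%R[%classic = [set x : measurableTypeR R | `[0%R, 1%R[%classic (x - s : R)%R].
  by apply/seteqP; split => x /=; rewrite !in_itv /= subr_ge0 ltrBlDl.
apply: (variation_strip (h := first_density psi (gam' b r s) (Gam' b r s) Z w)
  (dens_swap_leak b r hw)) => [//||t].
  exact: (measurable_first_density mpsi _ (hGam' b r s)).
congr (c * _); rewrite relabel_shift /first_density /first_state.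
by rewrite inner_shift.
Qed.

(** Reads the three states of the first split off a state of the doubled noise. The first leak
    becomes a function of an isonormal process and can be split in its turn. *)
Definition leak_state b r (x : state (@HC R * @HC R)%type R) (o : option bool) : state (@HC R) R :=
  fun f => x (inj (maskHC (inner b r 0)) (maskHC (~` inner b r 0)) o f).

Definition second_leak b r s : (T * T) * (T * T) -> signed_measure R :=
  split_leak (prod_mask (maskHC (outer b r s))) (prod_mask (maskHC (~` outer b r s))) Z2
    (fun x => moved_leak b r s (leak_state b r x)).

Lemma measurable_moved_leak b r s :
  measurable_fun setT (fun x => moved_leak b r s (leak_state b r x)).
Proof.
have ml o : measurable_fun setT (fun x => leak_state b r x o).
  by apply: measurable_to_state => f; exact: measurable_eval.
apply: measurable_shift1; apply: measurable_swap.
by apply: measurable_leak; apply: (measurableT_comp (measurable_shifted_field b r)); exact: ml.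
Qed.

Lemma second_leak_is_leak b r s :
  is_leak P2 (shift1 s \o (swap \o first_leak b r)) P4 (second_leak b r s).
Proof.
apply: (is_leak_split hip2 (cmo b r s) hZ2 _ (measurable_moved_leak b r s)).
by move=> w; rewrite /prod_noise /= !Z0 addr0.
Qed.

Lemma second_stateE b r s i j w :
  leak_state b r (split_state (prod_mask (maskHC (outer b r s)))
    (prod_mask (maskHC (~` outer b r s))) Z2 j w) i = second_state (gam' b r s) Z i j w.
Proof. by apply/funext => f; rewrite /second_state /second_embedding inner_shift. Qed.

Lemma second_leak_exp_variation b r s :
  (exp_variation P4 (second_leak b r s) setT <= 2%:E)%E.
Proof.
apply: (second_leak_exp_moment K0 C0 d01 a_gt mpsi psi_holder c0 eps0 eps1 epsM c_eps
  (hk' b r s) (hGam' b r s) hZ).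
have hst i j : isonormal P4 (@ipC R) (prod_noise Z2 Z2 \o second_embedding (gam' b r s) i j).
  apply: (isonormal_pullback hZ4 (second_embedding_linear (hk' b r s) i j)) => f.
  exact: (second_embedding_ip (hk' b r s)).
have hloc : \forall w \ae P4, forall j i,
    locally_integrable (fd (second_state (gam' b r s) Z i j w)).
  apply: ae_option => j; apply: ae_option => i.
  exact: (locally_integrable_field hk hGam mpsi (hst i j) psi_int).
apply: ae_sub hloc => w hw.
pose sj j := leak_state b r (split_state (prod_mask (maskHC (outer b r s)))
    (prod_mask (maskHC (~` outer b r s))) Z2 j w).
pose D j t := fd (second_state (gam' b r s) Z (Some (t.2 < 0)) j w) (relabel b r s t) -
  fd (second_state (gam' b r s) Z None j w) (relabel b r s t).
have hl j o : locally_integrable (fd (sj j o)).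
  by rewrite /sj second_stateE; exact: hw.
have hj j : dens (moved_leak b r s (sj j)) (fun t => c * D j t).
  by apply: (dens_ext (dens_moved_leak b r s (hl j))) => t; rewrite /sj !second_stateE.
pose D2 t := D (Some (t.1 < 0)) t - D None t.
have hd : dens (second_leak b r s w) (fun t => c * D2 t) := dens_scaled_leak hj.
have mD : measurable_fun setT (fun t => `|D2 t|%:E).
  apply/measurable_EFinP; apply: measurableT_comp => //.
  exact: (measurable_second_density mpsi _ (hGam' b r s) Z w).
apply: le_trans (variation_le hd measurableT) _.
apply: (@le_trans _ _ (c%:E * \int[leb2]_t `|D2 t|%:E)%E); last first.
  by rewrite le_eqVlt; apply/orP; left; apply/eqP.
rewrite -ge0_integralZl//; last by rewrite lee_fin ltW.
rewrite le_eqVlt; apply/orP; left; apply/eqP; apply: eq_integral => t _.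
by rewrite normrM EFinM (gtr0_norm c0).
Qed.

Lemma centered_scaled_field d' (T' : measurableType d') (Q : probability T' R)
    (Z' : @HC R -> T' -> R) : isonormal Q (@ipC R) Z' ->
  centered_field Q (fun w => scaled_field (fun f => Z' f w)).
Proof.
move=> hZ'; apply: centered_cscale.
exact: (centered_field_measure hk hGam mpsi hZ' psi_int psi_mean).
Qed.

Lemma centered_oriented d' (T' : measurableType d') (Q : probability T' R) b r
    (X : T' -> signed_measure R) : centered_field Q X ->
  centered_field Q (fun w => shift1 r (oriented b (X w))).
Proof.
move=> hX; apply: (@centered_image _ _ _ _ _ (@shift_bounded_borel R r)
  (fun w => oriented b (X w))).
case: b; last exact: hX.
exact: (centered_image (@swap_bounded_borel R) hX).
Qed.

Lemma centered_first_leak b r : centered_field P2 (swap \o first_leak b r).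
Proof.
have cs o : centered_field P2 (fun w => shifted_field b r (leak1_state b r o w)).
  apply: centered_oriented.
  exact: (centered_scaled_field (isonormal_inj hip (cmi b r) hZ o)).
apply: (@centered_image _ _ _ _ _ (@swap_bounded_borel R) (first_leak b r)).
exact: (centered_leak (cs None) (cs (Some true)) (cs (Some false))).
Qed.

Lemma first_leak_is_leak b r :
  is_leak P (fun w => shifted_field b r (st w)) P2 (first_leak b r).
Proof. exact: (is_leak_split hip (cmi b r) hZ Z0 (measurable_shifted_field b r)). Qed.

Lemma first_leak_splittable b r : splittable11 P2 (swap \o first_leak b r).
Proof.
split.
- exact: first_leak_strip.
- by move=> A hA; have [] := centered_first_leak b r hA.
- move=> s; exists _, _, P4, (second_leak b r s); split.
    exact: second_leak_is_leak.
  exact: second_leak_exp_variation.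
Qed.

Theorem scaled_field_splittable : splittable12 P (fun w => scaled_field (st w)).
Proof.
split.
- move=> s1 s2.
  have l1 s : lebesgue_measure (`[s, (s + 1)%R[%classic : set R) = 1%E.
    by rewrite lebesgue_measure_itv /= lte_fin ltrDl ltr01 -EFinD addrAC subrr add0r.
  have mB : measurable ((`[s1, (s1 + 1)%R[%classic `*` `[s2, (s2 + 1)%R[%classic) : set (plane R)).
    exact: measurableX.
  apply: field_exp_moment => //.
    rewrite /leb2 [LHS]product_measure1E//.
    by rewrite -[RHS]mule1; congr (_ * _)%E; exact: l1.
  split => //; apply/bounded_coord; exists (`|s1| + `|s2| + 1) => u [] /=.
  rewrite !in_itv /= => /andP[a1 b1] /andP[a2 b2].
  have := ler_norm s1; have := ler_norm (- s1); have := ler_norm s2; have := ler_norm (- s2).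
  by rewrite !normrN !ler_norml; split; apply/andP; split; lra.
- by move=> A hA; have [] := centered_scaled_field hZ hA.
(* The orientation [false] is the field itself and [true] the swapped field, the two requirements of
   condition (c). *)
- move=> r; split.
    exists _, _, P2, (first_leak false r); split; first exact: first_leak_is_leak.
    exact: first_leak_splittable.
  exists _, _, P2, (first_leak true r); split; first exact: first_leak_is_leak.
  exact: first_leak_splittable.
Qed.

End with_noise.

End splittability_of_the_field.

(** * Borel modifications of functions measurable for the completion *)

Section completion.
Context {R : realType} d (T : measurableType d) (mu : {measure set T -> \bar R}).

(** For each rational q the set where f > q is Borel up to a null set. Off the union N of these
    countably many null sets f is Borel, and on N it is set to 0. *)
Lemma completion_modification (f : T -> measurableTypeR R) : completion_measurable mu f ->
  exists2 g : T -> R, measurable_fun setT g & \forall x \ae mu, f x = g x.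
Proof.
move=> hf.
have /choice[F hF] : forall q : rat, exists AN : set T * set T,
    [/\ measurable AN.1, measurable AN.2, mu AN.2 = 0%E &
        forall x, ~ AN.2 x -> (AN.1 x <-> ratr q < f x)].
  move=> q; have mq : measurable (`](ratr q : R), +oo[%classic : set (measurableTypeR R)) by [].
  have [A mA [N [M [mM M0 NM]] e]] := hf _ mq.
  exists (A, M); split => // x nM.
  have -> : (ratr q < f x) = (A `|` N) x :> Prop by rewrite e /= in_itv /= andbT.
  by split => [Ax|[//|/NM]]; [left|].
pose N := \bigcup_q (F q).2.
have mN : measurable N.
  by apply: bigcupT_measurable_rat => q; have [] := hF q.
have N0 : mu N = 0%E.
  apply: (measure_negligible mN).
  pose G (n : nat) := if choice.unpickle n is Some q then (F q).2 else set0.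
  apply: (negligibleS (A := \bigcup_n G n)).
    move=> x [q _ Fx]; have e : G (choice.pickle q) = (F q).2 by rewrite /G choice.pickleK.
    exists (choice.pickle q); first exact: I.
    rewrite e; exact: Fx.
  apply: negligible_bigcup => n; rewrite /G; case: choice.unpickle => [q|]; last exact: negligible_set0.
  by have [_ mq q0 _] := hF q; exists (F q).2; split.
exists (fun x => if x \in N then 0 else f x); last first.
  exists N; split => // x /= h; apply: contrapT => Nx; apply: h.
  by rewrite memNset.
apply: (measurability (@RGenOInfty.G R)); first exact: RGenOInfty.measurableE.
move=> _ [_ [r ->] <-]; rewrite setTI.
pose B q := if r < ratr q then (F q).1 else set0.
rewrite (_ : _ @^-1` _ = (N `&` [set _ | r < 0]) `|` (~` N `&` \bigcup_q B q)).
  apply: measurableU.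
    by apply: measurableI => //; case: (r < 0); [rewrite (_ : [set _ | _] = setT)
      |rewrite (_ : [set _ | _] = set0)]; try exact: measurableT; try exact: measurable0;
      apply/seteqP; split.
  apply: measurableI; first exact: measurableC.
  apply: bigcupT_measurable_rat => q; rewrite /B; case: ifP => // _.
  by have [] := hF q.
apply/seteqP; split => x /=; rewrite in_itv /= andbT.
  case: ifPn => [/set_mem Nx r0|/negP nN rf]; first by left.
  have {}nN : ~ N x by move=> Nx; apply: nN; exact: mem_set.
  right; split => //.
  have [q] := rat_in_itvoo rf; rewrite in_itv /= => /andP[rq qf].
  exists q => //; rewrite /B rq.
  have [_ _ _ h] := hF q; apply/h => // Nx; apply: nN; by exists q.
case=> [[Nx r0]|[nN [q _]]]; first by rewrite mem_set.
rewrite memNset// /B; case: ifP => // rq Fx.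
have [_ _ _ h] := hF q; apply: lt_trans rq _; apply/h => // Nx.
by apply: nN; exists q.
Qed.

Lemma ae_completion_measurable d' (U : measurableType d') (f g : T -> U) :
  measurable_fun setT g -> (\forall x \ae mu, f x = g x) -> completion_measurable mu f.
Proof.
move=> mg [N [mN N0 fgN]] B mB.
have fg x : ~ N x -> f x = g x.
  by move=> nN; apply: contrapT => h; apply: nN; exact: fgN.
exists (g @^-1` B `\` N).
  by apply: measurableD => //; rewrite -[X in measurable X]setTI; exact: mg.
exists (f @^-1` B `&` N).
  have nN : mu.-negligible N by exists N; split.
  by apply: negligibleS nN => x [].
apply/seteqP; split => x /=.
  by move=> [[gB /fg ->]|[]].
move=> fB; have [Nx|nN] := pselect (N x); first by right.
by left; split => //; rewrite -fg.
Qed.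

End completion.

(** * From two white noises to an isonormal process *)

Section independent_pairs.
Context {R : realType} d (T : measurableType d) (P : probability T R).

Lemma integral_independent_pair (X Y : T -> measurableTypeR R)
    (h : measurableTypeR R * measurableTypeR R -> \bar R) :
  measurable_fun setT X -> measurable_fun setT Y ->
  (forall A B, measurable A -> measurable B ->
    P (X @^-1` A `&` Y @^-1` B) = (P (X @^-1` A) * P (Y @^-1` B))%E) ->
  measurable_fun setT h -> (forall q, 0 <= h q)%E ->
  (\int[P]_w h (X w, Y w) = \int[(P \x P)%E]_w h (X w.1, Y w.2))%E.
Proof.
move=> mX mY XY mh h0.
have mXY : measurable_fun setT (fun w => (X w, Y w)) by exact/measurable_fun_pair.
have mXY2 : measurable_fun setT (fun w : T * T => (X w.1, Y w.2)).
  by apply/measurable_fun_pair => /=; exact: measurableT_comp.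
rewrite -(ge0_integral_pushforward mXY P measurableT)//.
rewrite -(ge0_integral_pushforward mXY2 (P \x P)%E measurableT)//.
pose QX : probability (measurableTypeR R) R := distribution P (mkRV mX).
pose QY : probability (measurableTypeR R) R := distribution P (mkRV mY).
have prodE (m' : {measure set (measurableTypeR R * measurableTypeR R) -> \bar R}) :
    (forall A B, measurable A -> measurable B ->
      m' (A `*` B) = (P (X @^-1` A) * P (Y @^-1` B))%E) ->
    forall D, measurable D -> (QX \x QY)%E D = m' D.
  by move=> hm D mD; apply: product_measure_unique => // A B mA mB; exact: hm.
have mpX A : measurable A -> measurable (X @^-1` A).
  by move=> mA; rewrite -[X in measurable X]setTI; exact: (mX measurableT _ mA).
have mpY A : measurable A -> measurable (Y @^-1` A).
  by move=> mA; rewrite -[X in measurable X]setTI; exact: (mY measurableT _ mA).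
apply: eq_measure_integral => D mD _.
transitivity ((QX \x QY)%E D).
  symmetry; apply: (prodE (pushforward P (mkRV mXY))) => //.
apply: (prodE (pushforward (P \x P)%E (mkRV mXY2))) => // A B mA mB.
rewrite -[LHS]/((P \x P)%E ((X @^-1` A) `*` (Y @^-1` B))).
exact: (product_measure1E P P (mpX _ mA) (mpY _ mB)).
Qed.

End independent_pairs.

Section isonormal_from_white_noises.
Context {R : realType} d (T : measurableType d) (P : probability T R).

Lemma isonormal_modification (V : lmodType R) (ip : V -> V -> R) (Z Z' : V -> T -> R) :
  isonormal P ip Z -> (forall v, measurable_fun setT (Z' v)) ->
  (forall v, \forall w \ae P, Z' v w = Z v w) -> isonormal P ip Z'.
Proof.
move=> hZ mZ' ZZ'; split => //.
- move=> a u v; move: (ZZ' u); apply: filter_app; move: (ZZ' v); apply: filter_app.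
  move: (ZZ' (a *: u + v)) (isonormal_linear hZ a u v).
  by apply: filterS2 => w e1 e2 e3 e4; rewrite e1 e2 e3 e4.
- move=> v b; rewrite -(isonormal_cos hZ); apply: ae_eq_Rintegral.
  + by apply: measurable_cos_comp; exact: measurable_funD.
  + by apply: measurable_cos_comp; apply: measurable_funD => //; exact: isonormal_measurable hZ v.
  + by apply: filterS (ZZ' v) => w ->.
Qed.

Lemma Rintegral_cos_law (X : T -> measurableTypeR R) (Q : probability (measurableTypeR R) R) b :
  measurable_fun setT X -> (forall B, measurable B -> P (X @^-1` B) = Q B) ->
  \int[P]_w cos (X w + b) = \int[Q]_x cos (x + b).
Proof.
move=> mX XQ; pose f (x : measurableTypeR R) : \bar R := (cos (x + b))%:E.
have mf : measurable_fun setT f.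
  by apply/measurable_EFinP; apply: measurable_cos_comp; exact: measurable_funD.
have fi : P.-integrable (X @^-1` setT) (f \o X).
  apply: (@bounded_integrable _ _ _ _ _ 1) => [|x]; last exact: cos_max.
  by apply: measurable_cos_comp; exact: measurable_funD.
congr fine; rewrite -[LHS](integral_pushforward mX mf fi measurableT).
apply: eq_measure_integral => A mA _; exact: XQ.
Qed.

Section one_noise.
Context (w : (plane R -> R) -> T -> R) (hw : is_white_noise P w).

Lemma square_integrable_L2 (f : L2 R) : square_integrable f.
Proof.
split; last exact: L2_lty.
by apply: (ae_completion_measurable (measurable_L2 f)); exact: aeW.
Qed.

Lemma square_integrable_ae (f g : plane R -> R) : g \in L2pred ->
  (\forall s \ae leb2, f s = g s) -> square_integrable f.
Proof.
move=> /L2predP[mg g2] fg; split; first exact: (ae_completion_measurable mg fg).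
rewrite (ge0_ae_eq_integral_nonmeasurable (g := fun s => ((g s) ^+ 2)%:E))//.
- by move=> s; rewrite lee_fin sqr_ge0.
- by move=> s; rewrite lee_fin sqr_ge0.
- exact: measurable_sqr.
- by apply: filterS fg => s ->.
Qed.

(** A function vanishing almost everywhere has norm 0, so its integral has the Dirac law at 0. This
    lets the noise, which is indexed by functions, be evaluated at Borel modifications. *)
Lemma noise_eq0 (f : plane R -> R) : (\forall s \ae leb2, f s = 0) ->
  \forall o \ae P, w f o = 0.
Proof.
move=> f0.
have sf : square_integrable f.
  by apply: (@square_integrable_ae f (0 : L2 R)); [exact: L2funP|].
have n0 : L2norm f = 0.
  rewrite /L2norm (ge0_ae_eq_integral_nonmeasurable (g := cst 0%E))//.
  - by rewrite integral0 sqrtr0.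
  - by move=> s; rewrite lee_fin sqr_ge0.
  - by apply: filterS f0 => s ->; rewrite expr0n.
have := white_noise_variance hw sf; rewrite n0 => h.
have m0 : measurable (~` [set 0%R] : set (measurableTypeR R)) by exact: measurableC.
exists (w f @^-1` ~` [set 0]); split => //.
- rewrite -[X in measurable X]setTI; exact: (white_noise_measurable hw sf).
- by rewrite h// /centered_gaussian_law eqxx diracE memNset//= => h0; apply: h0.
Qed.

Lemma noise_ae_eq (f g : plane R -> R) : g \in L2pred ->
  (\forall s \ae leb2, f s = g s) -> \forall o \ae P, w f o = w g o.
Proof.
move=> hg fg; have sf := square_integrable_ae hg fg.
have sg : square_integrable g by apply: (square_integrable_ae hg); exact: aeW.
have h0 : \forall o \ae P, w (fun s => -1 * g s + f s) o = 0.
  by apply: noise_eq0; apply: filterS fg => s ->; rewrite mulN1r addNr.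
move: (white_noise_linear hw (-1) sg sf) h0; apply: filterS2 => o -> /eqP.
by rewrite mulN1r addrC subr_eq0 => /eqP.
Qed.

Lemma white_noise_isonormal : isonormal P (@ip2 R) (fun f : L2 R => w f).
Proof.
split.
- by move=> f; exact: (white_noise_measurable hw (square_integrable_L2 f)).
- move=> a f g; have := white_noise_linear hw a (square_integrable_L2 f) (square_integrable_L2 g).
  have -> // : (fun s => a * f s + g s) = (a *: f + g : L2 R).
  by apply/funext => s; rewrite L2_addE L2_scaleE.
- move=> f b; have sf := square_integrable_L2 f.
  have mf := white_noise_measurable hw sf.
  have nE : L2norm f ^+ 2 = ip2 f f.
    by rewrite /L2norm ip2_sqr /= sqr_sqrtr// (ip_ge0 (@inner_product_ip2 R)).
  have := white_noise_variance hw sf.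
  have [n0|n0] := eqVneq (L2norm f) 0.
    have e0 : ip2 f f = 0 by rewrite -nE n0 expr0n.
    move=> h; rewrite e0 mul0r oppr0 expR0 mulr1.
    have Q : forall B, measurable B -> P (w f @^-1` B) = (dirac (0 : measurableTypeR R)) B.
      by move=> B mB; rewrite h// /centered_gaussian_law n0 eqxx.
    rewrite (@Rintegral_cos_law (w f) (dirac (0 : measurableTypeR R)) b mf Q).
    rewrite /Rintegral integral_dirac//; last first.
      by apply/measurable_EFinP; apply: measurable_cos_comp; exact: measurable_funD.
    by rewrite diracT mul1e /= add0r.
  move=> h.
  have Q : forall B, measurable B -> P (w f @^-1` B) = normal_prob 0 (L2norm f) B.
    by move=> B mB; rewrite h// /centered_gaussian_law (negbTE n0).
  rewrite (@Rintegral_cos_law (w f) (normal_prob 0 (L2norm f)) b mf Q).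
  have := isonormal_cos (normal_prob_isonormal n0) 1 b.
  by under eq_Rintegral do rewrite mul1r; rewrite !mulr1 nE.
Qed.

End one_noise.

Context (w1 w2 : (plane R -> R) -> T -> R) (hw1 : is_white_noise P w1)
  (hw2 : is_white_noise P w2) (w12 : independent_noises P w1 w2).

Lemma isonormal_sum_noise :
  isonormal P (@ipC R) (fun (f : @HC R) o => w1 f.1 o + w2 f.2 o).
Proof.
have h1 := white_noise_isonormal hw1; have h2 := white_noise_isonormal hw2.
split.
- by move=> f; apply: measurable_funD; [exact: isonormal_measurable h1 _|exact: isonormal_measurable h2 _].
- move=> a f g; move: (isonormal_linear h1 a f.1 g.1) (isonormal_linear h2 a f.2 g.2).
  by apply: filterS2 => o /= -> ->; ring.
- move=> f b; rewrite -(isonormal_cos (isonormal_prod h1 h2) f b).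
  have m1 := isonormal_measurable h1 f.1; have m2 := isonormal_measurable h2 f.2.
  have ind A B : measurable A -> measurable B ->
      P (w1 f.1 @^-1` A `&` w2 f.2 @^-1` B) = (P (w1 f.1 @^-1` A) * P (w2 f.2 @^-1` B))%E.
    move=> mA mB; apply: w12; apply: sub_sigma_algebra.
      by exists (f.1 : plane R -> R); [exact: square_integrable_L2|exists A].
    by exists (f.2 : plane R -> R); [exact: square_integrable_L2|exists B].
  pose h (q : measurableTypeR R * measurableTypeR R) := cos (q.1 + q.2 + b).
  have mh : measurable_fun setT h.
    by apply: measurable_cos_comp; apply: measurable_funD => //; apply: measurable_funD.
  (* The cosine is again raised by 1, since the comparison with the product space is for nonnegative
     integrands. *)
  have mh1 : measurable_fun setT (fun q => (h q + 1)%:E).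
    by apply/measurable_EFinP; exact: measurable_funD.
  have h0 q : (0 <= (h q + 1)%:E)%E.
    by rewrite lee_fin -lerBlDr sub0r; have := cos_max (q.1 + q.2 + b); rewrite ler_norml => /andP[].
  have key d' (T' : measurableType d') (Q : probability T' R) (X : T' -> measurableTypeR R * measurableTypeR R) :
      measurable_fun setT X -> (\int[Q]_w (h (X w) + 1)%:E)%E = (\int[Q]_w h (X w) + 1)%:E.
    move=> mX.
    have ih : Q.-integrable setT (EFin \o (fun w => h (X w))).
      by apply: (@bounded_integrable _ _ _ _ _ 1) => [|w]; [exact: measurableT_comp|exact: cos_max].
    have i1 : Q.-integrable setT (EFin \o (fun=> 1 : R)).
      by apply: (@bounded_integrable _ _ _ _ _ 1) => // x /=; rewrite normr1.
    under eq_integral do rewrite EFinD.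
    rewrite integralD//= integral_cst//= probability_setT mule1 EFinD; congr (_ + _)%E.
    by rewrite fineK//; exact: integrable_fin_num.
  have := integral_independent_pair m1 m2 ind mh1 h0.
  rewrite (key _ _ P (fun o => (w1 f.1 o, w2 f.2 o))); last exact/measurable_fun_pair.
  rewrite (key _ _ (P \x P)%E (fun o => (w1 f.1 o.1, w2 f.2 o.2))); last first.
    by apply/measurable_fun_pair => /=; exact: measurableT_comp.
  by case=> e; apply: (addIr 1); exact: e.
Qed.

(** The minus sign is i^2 = -1: the real part of the integral of f_1 + i f_2 against w_1 + i w_2 is
    w_1(f_1) - w_2(f_2). *)
Theorem noise_isonormal : exists Z : @HC R -> T -> R,
  [/\ isonormal P (@ipC R) Z, forall o, Z 0 o = 0 &
      forall f, \forall o \ae P, Z f o = w1 f.1 o - w2 f.2 o].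
Proof.
pose j (f : @HC R) : @HC R := (f.1, - f.2).
have lj : linear j.
  move=> a f g; have e2 : - (a *: f.2 + g.2) = a *: - f.2 - g.2 by rewrite scalerN opprD.
  exact: (f_equal2 pair (erefl (a *: f.1 + g.1)) e2).
have h : isonormal P (@ipC R) ((fun (f : @HC R) o => w1 f.1 o + w2 f.2 o) \o j).
  apply: (isonormal_pullback isonormal_sum_noise lj) => f.
  rewrite /ipC /prod_ip /=; congr (_ + _).
  have hip := @inner_product_ip2 R; rewrite (ipNl hip) (ipNr hip) opprK//.
(* The white noises vanish at 0 only almost surely; the value at 0 is corrected because the
   independence in a split relies on Z 0 = 0 everywhere. *)
pose Z (f : @HC R) o := if f == 0 then 0 else w1 f.1 o + w2 (- f.2 : L2 R) o.
have ZE f : \forall o \ae P, Z f o = w1 f.1 o + w2 (- f.2 : L2 R) o.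
  have [->|f0] := eqVneq f 0; last by apply: aeW => o; rewrite /Z (negbTE f0).
  by apply: filterS (isonormal0 h) => o e; rewrite /Z eqxx -[LHS]e.
exists Z; split.
- apply: (isonormal_modification h) => //.
  move=> f; rewrite /Z; case: eqVneq => // _; exact: (isonormal_measurable h f).
- by move=> o; rewrite /Z eqxx.
- move=> f; have h2 := white_noise_isonormal hw2.
  move: (ZE f) (isonormalZ h2 (-1) f.2); apply: filterS2 => o ->.
  by rewrite scaleN1r mulN1r => ->.
Qed.

End isonormal_from_white_noises.

(** * Null sets under sections and under scaling of the plane *)

Section null_sections.
Context {R : realType} d1 d2 (T1 : measurableType d1) (T2 : measurableType d2).
Context (m1 : {sigma_finite_measure set T1 -> \bar R})
  (m2 : {sigma_finite_measure set T2 -> \bar R}).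

Let ae0 d (T : measurableType d) (m : {measure set T -> \bar R}) (f : T -> \bar R) :
  measurable_fun setT f -> (forall x, 0 <= f x)%E ->
  ((\int[m]_x f x)%E = 0%E <-> \forall x \ae m, f x = 0%E).
Proof.
move=> mf f0; have := ae_eq_integral_abs m measurableT mf.
rewrite (eq_integral f); last by move=> x _; rewrite gee0_abs.
move=> [h1 h2]; split.
  by move=> /h1; apply: filterS => x /(_ I).
by move=> h; apply: h2; apply: filterS h => x ? _.
Qed.

Lemma null_xsections (N : set (T1 * T2)) : measurable N ->
  (m1 \x m2)%E N = 0%E <-> \forall x \ae m1, m2 (xsection N x) = 0%E.
Proof.
move=> mN; apply: (ae0 m1 (f := fun x => m2 (xsection N x))).
  exact: measurable_fun_xsection.
by move=> x; exact: measure_ge0.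
Qed.

Lemma null_ysections (N : set (T1 * T2)) : measurable N ->
  (m1 \x m2)%E N = 0%E <-> \forall y \ae m2, m1 (ysection N y) = 0%E.
Proof.
move=> mN; have -> : (m1 \x m2)%E N = (m1 \x^ m2)%E N.
  by apply: product_measure_unique => // A B mA mB; exact: product_measure2E.
apply: (ae0 m2 (f := fun y => m1 (ysection N y))).
  exact: measurable_fun_ysection.
by move=> y; exact: measure_ge0.
Qed.

Lemma ae_xsection (A : set (T1 * T2)) : (\forall p \ae (m1 \x m2)%E, A p) ->
  \forall x \ae m1, \forall y \ae m2, A (x, y).
Proof.
move=> [N [mN N0 AN]]; move/(null_xsections mN) : N0; apply: filterS => x Nx.
exists (xsection N x); split => //; first exact: measurable_xsection.
by move=> y nA; rewrite /xsection /ysection /=; apply/mem_set; exact: AN.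
Qed.

Lemma ae_ysection (A : set (T1 * T2)) : (\forall p \ae (m1 \x m2)%E, A p) ->
  \forall y \ae m2, \forall x \ae m1, A (x, y).
Proof.
move=> [N [mN N0 AN]]; move/(null_ysections mN) : N0; apply: filterS => y Ny.
exists (ysection N y); split => //; first exact: measurable_ysection.
by move=> x nA; rewrite /xsection /ysection /=; apply/mem_set; exact: AN.
Qed.

(** Almost all x-sections of the complement of A are null; being measurable, the complement is then
    null in the product, so almost all its y-sections are null too. *)
Lemma ae_exchange (A : set (T1 * T2)) : measurable A ->
  (\forall x \ae m1, \forall y \ae m2, A (x, y)) ->
  \forall y \ae m2, \forall x \ae m1, A (x, y).
Proof.
move=> mA h; apply: ae_ysection; exists (~` A); split => //; first exact: measurableC.
apply/(null_xsections (measurableC mA)); apply: filterS h => x hx.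
have mx : measurable (xsection (~` A) x) by apply: measurable_xsection; exact: measurableC.
apply: (measure_negligible mx); move: hx => [N [mN N0 AN]]; exists N; split => //.
by move=> y /set_mem; exact: AN.
Qed.

End null_sections.

Section scaling_the_plane.
Context {R : realType}.
Local Notation mu := (@lebesgue_measure R).

Lemma ge0_integral_halve1 (h : measurableTypeR R -> \bar R) :
  measurable_fun setT h -> (forall x, 0 <= h x)%E ->
  (\int[mu]_x h (x / 2)%R = 2%:E * \int[mu]_x h x)%E.
Proof.
move=> mh h0.
have ms : measurable_fun [set: measurableTypeR R]
    ((fun x => x / 2) : measurableTypeR R -> measurableTypeR R) by apply: measurable_funM.
rewrite -(@ge0_integral_pushforward _ _ _ _ _ _ ms mu setT h)//.
have half_ge0 : 0 <= 2^-1 :> R by [].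
pose D : {measure set (measurableTypeR R) -> \bar R} := pushforward mu (mkRV ms).
pose m' : {measure set (measurableTypeR R) -> \bar R} := mscale (NngNum half_ge0) (D ms).
have muE A : measurable A -> mu A = m' A.
  move=> mA; apply: (@lebesgue_measure_unique R m') => // _ [[b c] _ <-].
  rewrite lebesgue_measure_itv /= /m' /mscale /= /D /= /pushforward.
  have -> : (fun x : R => x / 2) @^-1` `]b, c]%classic = `]b * 2, c * 2]%classic.
    by apply/seteqP; split => x /=; rewrite !in_itv/= ltr_pdivlMr// ler_pdivrMr.
  rewrite lebesgue_measure_itv /= !lte_fin ltr_pM2r//.
  by case: ifP => // _; rewrite -?EFinB -?EFinM ?mule0//; congr EFin; field.
have -> : (\int[mu]_x h x = \int[m']_x h x)%E.
  by apply: eq_measure_integral => A mA _; exact: muE.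
rewrite /m' ge0_integral_mscale// muleA -EFinM /= mulfV// mul1e.
by [].
Qed.

Lemma ge0_integral_halve (h : plane R -> \bar R) :
  measurable_fun setT h -> (forall x, 0 <= h x)%E ->
  (\int[leb2]_u h (halve u) = 4%:E * \int[leb2]_u h u)%E.
Proof.
move=> mh h0.
have mhalf : measurable_fun setT (@halve R).
  by apply/measurable_fun_pair => /=; apply: measurable_funM.
rewrite leb2_tonelli1//; last exact: measurableT_comp.
have mF : measurable_fun setT (fun x => \int[mu]_y h (x, y))%E.
  exact: measurable_fun_fubini_tonelli_F.
transitivity (\int[mu]_x (2%:E * (\int[mu]_y h ((x / 2)%R, y))))%E.
  apply: eq_integral => x _.
  by apply: (ge0_integral_halve1 (h := fun y => h (x / 2, y)%R)) => //; exact: measurableT_comp.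
have mF2 : measurable_fun setT (fun x : measurableTypeR R => \int[mu]_y h ((x / 2)%R, y))%E.
  by apply: (measurableT_comp mF); apply: measurable_funM.
rewrite ge0_integralZl//; last by move=> x _; exact: integral_ge0.
rewrite (ge0_integral_halve1 (h := fun x => \int[mu]_y h (x, y))%E)//; last first.
  by move=> x; exact: integral_ge0.
by rewrite muleA -EFinM -leb2_tonelli1//; congr (_%:E * _)%E; lra.
Qed.

(** The map x |-> (x + v)/2 pulls null sets back to null sets, so psi may be replaced by a
    modification inside the Hoelder hypothesis. *)
Lemma ae_halve_shift (A : set (plane R)) (v : plane R) : (\forall z \ae leb2, A z) ->
  \forall x \ae leb2, A (halve ((x : plane R) + v)).
Proof.
move=> [N [mN N0 AN]].
have mg : measurable_fun setT (fun x : plane R => halve (x + v)).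
  have := measurable_subr (- v); under eq_fun do rewrite opprK; move=> ms.
  by apply: measurableT_comp ms; apply/measurable_fun_pair => /=; apply: measurable_funM.
have mgN : measurable ((fun x : plane R => halve (x + v)) @^-1` N).
  by rewrite -[X in measurable X]setTI; exact: mg.
exists ((fun x : plane R => halve (x + v)) @^-1` N); split => //; last by move=> x; exact: AN.
pose h (z : plane R) := (\1_N z)%:E : \bar R.
have mh : measurable_fun setT h by apply/measurable_EFinP; exact: measurable_indic.
have h0 z : (0 <= h z)%E by rewrite lee_fin indicE.
have : (\int[leb2]_x h (halve ((x : plane R) + v)%R))%E = 0%E.
  transitivity (\int[leb2]_x h (halve ((x : plane R) - (- v))%R))%E.
    by apply: eq_integral => x _; rewrite opprK.
  have mhh : measurable_fun setT (fun x => h (halve x)).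
    apply: (measurableT_comp mh).
    by apply/measurable_fun_pair => /=; apply: measurable_funM.
  rewrite ((preserves_leb2_sub (- v)).2 (fun x => h (halve x)) mhh)//.
  rewrite ge0_integral_halve//.
  have -> : (\int[leb2]_u h u)%E = 0%E by rewrite /h integral_indic// setIT; exact: N0.
  by rewrite mule0.
move=> <-; symmetry; apply: (etrans (integral_indic leb2 measurableT mgN)).
by rewrite setIT.
Qed.

End scaling_the_plane.

(** * A Borel version of psi *)

Section regular_observables.
Context {R : realType}.

Lemma normc_C_of_plane (u : plane R) : normc (C_of_plane u) ^+ 2 = u.1 ^+ 2 + u.2 ^+ 2.
Proof. by rewrite /= sqr_sqrtr// addr_ge0// sqr_ge0. Qed.

Lemma normc_le (z : R[i]) : normc z <= `|complex.Re z| + `|complex.Im z|.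
Proof.
case: z => a b; rewrite /= -(ler_sqr (x := Num.sqrt _)) ?nnegrE ?sqrtr_ge0 ?addr_ge0//.
rewrite sqr_sqrtr ?addr_ge0 ?sqr_ge0// sqrrD !real_normK ?num_real// lerD2r lerDl.
by rewrite mulrn_wge0// mulr_ge0.
Qed.

Lemma C_of_plane_halve (u : plane R) : C_of_plane (halve u) = C_of_plane u / 2.
Proof.
apply: (canRL (mulfK _)); first by rewrite pnatr_eq0.
rewrite (_ : 2 = 1 + 1)// mulrDr mulr1; apply/eqP; rewrite eq_complex /=.
by apply/andP; split; apply/eqP; field.
Qed.

Context (C delta : R) (C_gt0 : 0 < C) (delta_gt0 : 0 < delta).
Context (psi : R[i] -> R).
Hypothesis psi_measurable : completion_measurable leb2 (psi \o C_of_plane).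
Hypothesis psi_exp : (\int[leb2]_z (expR (C^-1 * `|psi (C_of_plane z)|)
  * expR (- normc (C_of_plane z) ^+ 2))%:E < +oo)%E.
Hypothesis psi_mean : (\int[leb2]_z (psi (C_of_plane z)
  * expR (- normc (C_of_plane z) ^+ 2))%:E = 0)%E.
Hypothesis psi_holder : forall y h : R[i],
    (lne (\int[leb2]_x
       (expR `|psi ((C_of_plane x + h + y) / 2)
               - psi ((C_of_plane x + h - y) / 2)|
        * (pi^-1 * expR (- normc (C_of_plane x) ^+ 2)))%:E)
     <= (C * normc y `^ delta)%:E)%E.

Let gw (z : plane R) : R := expR (- (z.1 ^+ 2 + z.2 ^+ 2)).

Let mgw : measurable_fun setT gw.
Proof.
apply: measurableT_comp => //; apply: measurableT_comp => //.
by apply: measurable_funD; apply: measurable_funX => //; exact: measurableT_comp.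
Qed.

Let pi0 : 0 <= (pi : R)^-1. Proof. by rewrite invr_ge0 pi_ge0. Qed.

Let cgE (f : plane R -> R) : measurable_fun setT f -> (forall z, 0 <= f z) ->
  (\int[complex_gaussian]_z (f z)%:E = (pi : R)^-1%:E * \int[leb2]_z (f z * gw z)%:E)%E.
Proof.
move=> mf f0; have f0' z : (0 <= (f z)%:E)%E by rewrite lee_fin.
rewrite ge0_integral_complex_gaussian//; last exact/measurable_EFinP.
rewrite -ge0_integralZl//.
- by apply: eq_integral => z _; rewrite -!EFinM /gw; congr EFin; ring.
- by apply/measurable_EFinP; exact: measurable_funM.
- by move=> z _; rewrite lee_fin mulr_ge0// expR_ge0.
Qed.

(** All conditions on psi are integrals with a Gaussian density and survive a change on a null set.
    The norm of y is enlarged to |y_1| + |y_2|, which weakens the bound harmlessly. *)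
Lemma regular_observable : exists psi' : plane R -> R,
  [/\ measurable_fun setT psi', \forall z \ae leb2, psi (C_of_plane z) = psi' z,
      exists M : R, (\int[complex_gaussian]_z (expR (C^-1 * `|psi' z|))%:E <= M%:E)%E,
      (\int[complex_gaussian]_z `|psi' z|%:E < +oo)%E &
      (\int[complex_gaussian]_z (psi' z)%:E = 0)%E /\ forall y h : plane R,
  (\int[complex_gaussian]_x (expR `|psi' (halve ((x : plane R) + h + y)%R)
                              - psi' (halve (x + h - y)%R)|)%:E <=
   (expR (C * (`|y.1| + `|y.2|) `^ delta))%:E)%E].
Proof.
have [psi' mpsi' psiE] := completion_modification psi_measurable.
have mabs : measurable_fun setT (fun z => `|psi' z|) by exact: measurableT_comp.
have mexp : measurable_fun setT (fun z => expR (C^-1 * `|psi' z|)).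
  by apply: measurableT_comp => //; exact: measurable_funM.
have pi_gt : 0 < (pi : R)^-1 by rewrite invr_gt0 pi_gt0.
have hexp : (\int[complex_gaussian]_z (expR (C^-1 * `|psi' z|))%:E < +oo)%E.
  rewrite cgE//.
  rewrite lte_mul_pinfty ?lee_fin//; apply: le_lt_trans psi_exp.
  rewrite le_eqVlt; apply/orP; left; apply/eqP; symmetry.
  apply: ge0_ae_eq_integral_nonmeasurable.
  - by move=> z; rewrite lee_fin mulr_ge0 ?expR_ge0.
  - by move=> z; rewrite lee_fin mulr_ge0 ?expR_ge0.
  - by apply/measurable_EFinP; exact: measurable_funM.
  - by apply: filterS psiE => z /= ->; rewrite normc_C_of_plane.
have hint : (\int[complex_gaussian]_z `|psi' z|%:E < +oo)%E.
  apply: (@le_lt_trans _ _ (C%:E * \int[complex_gaussian]_z (expR (C^-1 * `|psi' z|))%:E)%E).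
    rewrite -ge0_integralZl//; do ?[exact/measurable_EFinP]; do ?[by rewrite lee_fin ltW].
    apply: ge0_le_integral => //.
    - exact/measurable_EFinP.
    - by apply: emeasurable_funM => //; exact/measurable_EFinP.
    move=> z _; rewrite -EFinM lee_fin mulrC -ler_pdivrMr// mulrC.
    by apply: le_trans (expR_ge1Dx _); rewrite lerDr.
  by rewrite lte_mul_pinfty// lee_fin ltW.
exists psi'; split => //.
  exists (fine (\int[complex_gaussian]_z (expR (C^-1 * `|psi' z|))%:E)%E).
  by rewrite fineK// ge0_fin_numE//; apply: integral_ge0 => z _; rewrite lee_fin expR_ge0.
split.
  pose f (z : plane R) := (psi' z * gw z)%:E.
  have mf : measurable_fun setT f by apply/measurable_EFinP; exact: measurable_funM.
  have f0 : (\int[leb2]_z f z = 0)%E.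
    rewrite -psi_mean; symmetry; apply: ae_eq_integral_nonmeasurable => //.
    by apply: filterS psiE => z /= ->; rewrite normc_C_of_plane.
  (* [cgE] passes between the two measures for nonnegative functions only. Both parts have finite
     integrals by [hint], so the constant pi^-1 can be factored out of their difference. *)
  pose pp z := Num.max (psi' z) 0; pose pn z := Num.max (- psi' z) 0.
  have mpp : measurable_fun setT pp by exact: measurable_maxr.
  have mpn : measurable_fun setT pn by apply: measurable_maxr => //; exact: measurableT_comp.
  have pp0 z : 0 <= pp z by rewrite le_max lexx orbT.
  have pn0 z : 0 <= pn z by rewrite le_max lexx orbT.
  have fin (q : plane R -> R) : measurable_fun setT q -> (forall z, 0 <= q z <= `|psi' z|) ->
      (\int[complex_gaussian]_z (q z)%:E < +oo)%E.
    move=> mq hq; apply: le_lt_trans hint; apply: ge0_le_integral => //.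
    - by move=> z _; rewrite lee_fin; have /andP[] := hq z.
    - exact/measurable_EFinP.
    - exact/measurable_EFinP.
    - by move=> z _; rewrite lee_fin; have /andP[] := hq z.
  have fp := fin pp mpp; have fn := fin pn mpn.
  rewrite integralE.
  rewrite (eq_integral (fun z => (pp z)%:E)); last first.
    by move=> z _; rewrite funeposE /pp EFin_max.
  rewrite [X in (_ - X)%E](eq_integral (fun z => (pn z)%:E)); last first.
    by move=> z _; rewrite funenegE /pn EFin_max.
  have fpf : (\int[complex_gaussian]_z (pp z)%:E < +oo)%E.
    by apply: fp => z; rewrite pp0 /= /pp ge_max ler_norm normr_ge0.
  have fnf : (\int[complex_gaussian]_z (pn z)%:E < +oo)%E.
    by apply: fn => z; rewrite pn0 /= /pn ge_max -normrN ler_norm normr_ge0.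
  move: fpf fnf; rewrite !cgE// => fpf fnf.
  have e : (\int[leb2]_z (pp z * gw z)%:E - \int[leb2]_z (pn z * gw z)%:E = 0)%E.
    rewrite -f0 [RHS]integralE; congr (_ - _)%E; apply: eq_integral => z _.
      by rewrite funeposE /f /pp -EFin_max maxr_pMl ?expR_ge0// mul0r.
    by rewrite funenegE /f /pn -EFinN -EFin_max maxr_pMl ?expR_ge0// mul0r mulNr.
  have gfin (q : plane R -> R) : (forall z, 0 <= q z) ->
      ((pi : R)^-1%:E * \int[leb2]_z (q z * gw z)%:E < +oo)%E ->
      (\int[leb2]_z (q z * gw z)%:E)%E \is a fin_num.
    move=> q0; rewrite ge0_fin_numE; last first.
      by apply: integral_ge0 => z _; rewrite lee_fin mulr_ge0 ?expR_ge0.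
    move: (\int[leb2]_z (q z * gw z)%:E)%E => [r _|/=|//]; first exact: ltry.
    by rewrite gt0_muley ?lte_fin// ltxx.
  have ffp := gfin _ pp0 fpf; have ffn := gfin _ pn0 fnf.
  rewrite -muleBr ?e ?mule0//.
  by rewrite fin_num_adde_defr.
move=> y h.
pose g (x : plane R) := expR `|psi' (halve ((x : plane R) + h + y)%R) - psi' (halve (x + h - y)%R)|.
have msh (v : plane R) : measurable_fun setT (fun x : plane R => psi' (halve (x + v))).
  have := measurable_subr (- v); under eq_fun do rewrite opprK; move=> ms.
  apply: (measurableT_comp mpsi'); apply: measurableT_comp ms.
  by apply/measurable_fun_pair => /=; apply: measurable_funM.
have mg : measurable_fun setT g.
  apply: measurableT_comp => //; apply: measurableT_comp => //; apply: measurable_funB.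
    by under eq_fun do rewrite -addrA; exact: msh.
  by under eq_fun do rewrite -addrA; exact: msh.
have g0 z : 0 <= g z by exact: expR_ge0.
have := psi_holder (C_of_plane y) (C_of_plane h).
set J := (X in lne X) => hJ.
have -> : (\int[complex_gaussian]_x (g x)%:E)%E = J.
  rewrite cgE// /J -ge0_integralZl//;
    do ?[by apply/measurable_EFinP; exact: measurable_funM];
    do ?[by move=> z _; rewrite lee_fin mulr_ge0 ?expR_ge0].
  symmetry; apply: ge0_ae_eq_integral_nonmeasurable.
  - by move=> z; rewrite lee_fin !mulr_ge0 ?expR_ge0.
  - by move=> z; rewrite -EFinM lee_fin !mulr_ge0 ?expR_ge0.
  - by apply: emeasurable_funM => //; apply/measurable_EFinP; exact: measurable_funM.
  move: (ae_halve_shift (h + y) psiE) (ae_halve_shift (h - y) psiE).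
  apply: filterS2 => x /= e1 e2; rewrite normc_C_of_plane -EFinM /g /gw; congr EFin.
  have cD (u v : plane R) : C_of_plane (u + v) = C_of_plane u + C_of_plane v.
    by apply/eqP; rewrite eq_complex /= !eqxx.
  have cN (u : plane R) : C_of_plane (- u) = - C_of_plane u.
    by apply/eqP; rewrite eq_complex /= !eqxx.
  have -> : (C_of_plane x + C_of_plane h + C_of_plane y) / 2 = C_of_plane (halve (x + (h + y))).
    by rewrite C_of_plane_halve !cD addrA.
  have -> : (C_of_plane x + C_of_plane h - C_of_plane y) / 2 = C_of_plane (halve (x + (h - y))).
    by rewrite C_of_plane_halve !cD cN addrA.
  by rewrite e1 e2 -!addrA; ring.
have J0 : (0 <= J)%E.
  apply: integral_ge0 => z _; rewrite lee_fin !mulr_ge0 ?expR_ge0//.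
have := hJ; rewrite -lee_expeR lneK ?in_itv /= ?J0 ?leey// => /le_trans; apply.
have n0 : 0 <= normc (C_of_plane y) by exact: sqrtr_ge0.
rewrite lee_fin ler_expR ler_wpM2l ?(ltW C_gt0)//.
by apply: (ge0_ler_powR (ltW delta_gt0) n0 _ (normc_le _)); rewrite nnegrE addr_ge0.
Qed.

End regular_observables.

(** * A Borel version of phi, and a version of its field *)

Section regular_kernels.
Context {R : realType}.

Lemma mnorm_euclid (u : plane R) : mnorm u <= euclid u.
Proof.
have h (x y : R) : `|x| <= Num.sqrt (x ^+ 2 + y ^+ 2).
  by rewrite -sqrtr_sqr ler_wsqrtr// lerDl sqr_ge0.
by rewrite /mnorm /euclid ge_max h/= addrC h.
Qed.

(** Z(., 0) and Z(0, .) are isonormal over the real space. Versions for the real and the imaginary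
    part of the kernel are evaluated in both and combined with the signs of [turn]. *)
Lemma field_version_exists (K a : R) k (gam : plane R -> plane R) :
  good_kernel K a k gam -> exists Gam, field_version k Gam.
Proof.
move=> hk; have L2k b t := gk_L2 hk b t.
have [G0 [mG0 hG0]] := kernel_has_version (gk_measurable hk false) (L2k false).
have [G1 [mG1 hG1]] := kernel_has_version (gk_measurable hk true) (L2k true).
pose fl (x : state (@HC R) R) : state (L2 R) R := fun f => x (f, 0).
pose fr (x : state (@HC R) R) : state (L2 R) R := fun f => x (0, f).
have mfl : measurable_fun setT fl.
  by apply: measurable_to_state => f; exact: (@measurable_eval _ _ ((f, 0) : @HC R)).
have mfr : measurable_fun setT fr.
  by apply: measurable_to_state => f; exact: (@measurable_eval _ _ ((0, f) : @HC R)).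
pose Gam (b : bool) (q : plane R * state (@HC R) R) : R :=
  if b then G1 (q.1, fl q.2) - G0 (q.1, fr q.2) else G0 (q.1, fl q.2) + G1 (q.1, fr q.2).
have mc (F : plane R * state (L2 R) R -> R) f : measurable_fun setT F ->
    measurable_fun setT f -> measurable_fun setT (fun q : plane R * state (@HC R) R => F (q.1, f q.2)).
  move=> mF mf; apply: (measurableT_comp mF).
  by apply/measurable_fun_pair => //=; exact: (measurableT_comp mf).
exists Gam; split.
  by case; [apply: measurable_funB|apply: measurable_funD]; exact: mc.
move=> b t d T P Z hZ.
pose Zl (f : L2 R) : T -> R := Z ((f, 0) : @HC R).
pose Zr (f : L2 R) : T -> R := Z ((0, f) : @HC R).
have hip := @inner_product_ip2 R.
have hl : isonormal P (@ip2 R) Zl.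
  apply: (isonormal_pullback (j := fun f => ((f, 0) : @HC R)) hZ) => [e f g|f].
    have e2 : 0 = e *: 0 + 0 :> L2 R by rewrite scaler0 addr0.
    exact: (f_equal2 pair (erefl (e *: f + g)) e2).
  by rewrite /ipC /prod_ip /= (ip0l hip) addr0.
have hr : isonormal P (@ip2 R) Zr.
  apply: (isonormal_pullback (j := fun f => ((0, f) : @HC R)) hZ) => [e f g|f].
    have e2 : 0 = e *: 0 + 0 :> L2 R by rewrite scaler0 addr0.
    exact: (f_equal2 pair e2 (erefl (e *: f + g))).
  by rewrite /ipC /prod_ip /= (ip0l hip) add0r.
pose u := toL2 (fun s => k false (t, s)); pose v := toL2 (fun s => k true (t, s)).
have sum (f g : L2 R) : \forall w \ae P, Z ((f, g) : @HC R) w = Zl f w + Zr g w.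
  have -> : ((f, g) : @HC R) = ((f, 0) : @HC R) + ((0, g) : @HC R).
    exact: (f_equal2 pair (esym (addr0 f)) (esym (add0r g))).
  exact: (isonormalD hZ).
have opp : \forall w \ae P, Zr (- u) w = - Zr u w.
  by have := isonormalZ hr (-1) u; apply: filterS => w; rewrite scaleN1r mulN1r.
rewrite /kvec /turn -/u -/v /Gam; case: b => /=.
  move: (sum v (- u)); apply: filter_app; move: opp; apply: filter_app.
  by move: (hG1 t _ _ _ _ hl) (hG0 t _ _ _ _ hr); apply: filterS2 => w /= -> -> -> ->.
move: (sum u v); apply: filter_app.
by move: (hG0 t _ _ _ _ hl) (hG1 t _ _ _ _ hr); apply: filterS2 => w /= -> -> ->.
Qed.

Context (alpha : R) (alpha_gt0 : 0 < alpha) (phi : plane R -> plane R -> R[i]).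
Hypothesis phi_measurable : completion_measurable (leb2 \x leb2)%E
  (fun p : plane R * plane R => plane_of_C (phi p.1 p.2)).
Hypothesis phi_norm : \forall t \ae leb2,
  (\int[leb2]_s (normc (phi t s) ^+ 2)%:E = 1)%E.
Hypothesis phi_decay : (ess_sup (leb2 \x leb2)
  (fun p : plane R * plane R => let s := p.1 in let t := p.2 in
    ((1 + euclid (t - s)) `^ alpha * normc (phi t s) ^+ 2)%:E) < +oo)%E.

Let part (b : bool) (z : R[i]) : R := if b then complex.Im z else complex.Re z.

Lemma normc_sqr (z : R[i]) : normc z ^+ 2 = complex.Re z ^+ 2 + complex.Im z ^+ 2.
Proof. by case: z => a b; rewrite /= sqr_sqrtr// addr_ge0// sqr_ge0. Qed.

Lemma part_modification b : exists2 k : plane R * plane R -> R, measurable_fun setT k &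
  \forall p \ae (leb2 \x leb2)%E, part b (phi p.1 p.2) = k p.
Proof.
apply: completion_modification => B mB.
pose E : set (plane R) := if b then setT `*` B else B `*` setT.
have -> : (fun p => part b (phi p.1 p.2)) @^-1` B =
    (fun p : plane R * plane R => plane_of_C (phi p.1 p.2)) @^-1` E.
  by apply/seteqP; split => p; rewrite /E /part; case: (b) => //= -[].
by apply: phi_measurable; rewrite /E; case: (b); exact: measurableX.
Qed.

Lemma decay_bound : exists2 M : R, 0 <= M & \forall t \ae leb2, \forall s \ae leb2,
  normc (phi t s) ^+ 2 <= M * decay alpha (t - s).
Proof.
pose f (p : plane R * plane R) : \bar R :=
  ((1 + euclid (p.2 - p.1)) `^ alpha * normc (phi p.2 p.1) ^+ 2)%:E.
have fE := ess_sup_ge (leb2 \x leb2)%E f.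
pose E := ess_sup (leb2 \x leb2)%E f; have E_lty : (E < +oo)%E := phi_decay.
exists `|fine E| => //.
have h : \forall p \ae (leb2 \x leb2)%E,
    normc (phi p.2 p.1) ^+ 2 <= `|fine E| * decay alpha (p.2 - p.1).
  apply: filterS fE => -[s t]; rewrite /f /= => fE.
  have e0 : 0 < 1 + euclid (t - s) by rewrite ltr_pwDl// sqrtr_ge0.
  have n0 : 0 < (1 + euclid (t - s)) `^ alpha by exact: powR_gt0.
  apply: (@le_trans _ _ (`|fine E| * (1 + euclid (t - s)) `^ (- alpha))); last first.
    apply: ler_wpM2l => //; rewrite /decay !powRN lef_pV2 ?posrE//; last first.
      by apply: powR_gt0; rewrite ltr_pwDl// mnorm_ge0.
    have m0 : 0 <= 1 + mnorm (t - s) by rewrite addr_ge0// mnorm_ge0.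
    by apply: (ge0_ler_powR (ltW alpha_gt0)); rewrite ?nnegrE ?(ltW e0)// lerD2l mnorm_euclid.
  rewrite powRN ler_pdivlMr// mulrC; rewrite -/E in fE; move: E_lty fE; case: E => [r|//|].
    by move=> _; rewrite lee_fin => /le_trans; apply; exact: ler_norm.
  by move=> _; rewrite leeNy_eq.
exact: (ae_ysection h).
Qed.

(** Decay and normalization must hold at every point. Values that violate the decay are cut to 0,
    and then each row whose norm is not 1 is replaced by the indicator of a unit square based at t.
    For almost every t neither change affects almost any s. *)
Lemma regular_kernel : exists (K : R) (k : bool -> plane R * plane R -> R),
  [/\ 0 <= K, good_kernel K alpha k id &
      \forall t \ae leb2, \forall s \ae leb2, forall b, part b (phi t s) = k b (t, s)].
Proof.
have [M M0 hM] := decay_bound.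
have /choice[k0 hk0] : forall b, exists k : plane R * plane R -> R, measurable_fun setT k /\
    \forall p \ae (leb2 \x leb2)%E, part b (phi p.1 p.2) = k p.
  by move=> b; have [k mk hk] := part_modification b; exists k.
(* [M] serves phi, and 2^alpha serves the unit square, on which 1 + |t - s| <= 2. *)
pose K := M + 2 `^ alpha; have K0 : 0 <= K by rewrite addr_ge0// powR_ge0.
have mk0 b : measurable_fun setT (k0 b) by have [] := hk0 b.
have msub (F G : plane R * plane R -> plane R) : measurable_fun setT F ->
    measurable_fun setT G -> measurable_fun setT (fun q => F q - G q).
  move=> mF mG; apply/measurable_fun_pair => /=.
    exact: (measurable_funB (measurableT_comp measurable_fst mF) (measurableT_comp measurable_fst mG)).
  exact: (measurable_funB (measurableT_comp measurable_snd mF) (measurableT_comp measurable_snd mG)).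
have mdec : measurable_fun setT (fun q : plane R * plane R => K * decay alpha (q.1 - q.2)).
  apply: measurable_funM => //; apply: (measurableT_comp (measurable_decay alpha)).
  exact: (msub fst snd).
pose sq (k : bool -> plane R * plane R -> R) q := k false q ^+ 2 + k true q ^+ 2.
have msq k : (forall b, measurable_fun setT (k b)) -> measurable_fun setT (sq k).
  by move=> mk; apply: measurable_funD; apply: measurable_funX; exact: mk.
pose k1 b q := if sq k0 q <= K * decay alpha (q.1 - q.2) then k0 b q else 0.
have mk1 b : measurable_fun setT (k1 b).
  by apply: measurable_fun_ifT => //; exact: measurable_fun_ler (msq _ mk0) mdec.
pose kd b (q : plane R * plane R) : R := if b then 0 else \1_(base_cell 1) (q.2 - q.1).
have mkd b : measurable_fun setT (kd b).
  rewrite /kd; case: b => //.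
  apply: (measurableT_comp (measurable_indic (measurable_base_cell 1))).
  exact: (msub snd fst).
pose n (t : plane R) : \bar R := (\int[leb2]_s (sq k1 (t, s))%:E)%E.
have mn : measurable_fun setT n.
  apply: (measurable_fun_fubini_tonelli_F (m2 := leb2) (fun q => (sq k1 q)%:E)).
    by apply/measurable_EFinP; exact: msq.
  by move=> q; rewrite lee_fin addr_ge0// sqr_ge0.
pose k b (q : plane R * plane R) := if n q.1 == 1%E then k1 b q else kd b q.
exists K, k; split => //; first split.
- move=> b; apply: measurable_fun_ifT => //.
  apply: (measurable_fun_bool true); rewrite setTI.
  have -> : (fun q : plane R * plane R => n q.1 == 1%E) @^-1` [set true] =
      (n \o fst) @^-1` [set 1%E].
    by apply/seteqP; split => q /= /eqP.
  have mnf : measurable_fun setT (n \o (fst : plane R * plane R -> plane R)).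
    exact: (measurableT_comp mn).
  by rewrite -[X in measurable X]setTI; exact: (mnf measurableT _ (emeasurable_set1 1%E)).
- move=> t s; rewrite /k /=; case: ifP => _.
    rewrite /k1; case: ifP => //= _; rewrite expr0n /= addr0 mulr_ge0// decay_ge0//.
  rewrite /kd expr0n /= addr0 indicE.
  have [/set_mem ts|_] := boolP (_ \in _); last by rewrite expr0n /= mulr_ge0// decay_ge0.
  have m1 := base_cell_mnorm ts; rewrite expr1n.
  have -> : decay alpha (t - s) = decay alpha (s - t) by rewrite /decay -mnormN opprB.
  rewrite /decay powRN ler_pdivlMr ?powR_gt0//; last by rewrite ltr_pwDl// mnorm_ge0.
  rewrite mul1r; apply: (@le_trans _ _ (2 `^ alpha)); last by rewrite lerDr.
  apply: (ge0_ler_powR (ltW alpha_gt0)); rewrite ?nnegrE ?addr_ge0 ?mnorm_ge0//.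
  by rewrite -lerBrDl (_ : 2 - 1 = 1)//; ring.
- move=> t; have [nt|/negbTE nt] := eqVneq (n t) 1%E.
    by rewrite -[RHS]nt; apply: eq_integral => s _; rewrite /k /= nt eqxx.
  have -> : (fun s => (k false (t, s) ^+ 2 + k true (t, s) ^+ 2)%:E) =
     (fun s : plane R => (fun u => (\1_(base_cell 1) u)%:E : \bar R) (s - t)).
    apply/funext => s; rewrite /k /= nt /kd /= expr0n /= addr0 indicE.
    by case: (_ \in _); rewrite ?expr1n ?expr0n.
  rewrite ((preserves_leb2_sub t).2 (fun u => (\1_(base_cell 1) u)%:E)); last first.
  + by move=> u; rewrite lee_fin indicE.
  + by apply/measurable_EFinP; apply: measurable_indic; exact: measurable_base_cell.
  have mB := measurable_base_cell (1 : R).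
  rewrite integral_indic// setIT.
  by apply: (etrans (leb2_base_cell (@ltr01 R))); rewrite expr1n.
- exact: preserves_leb2_id.
have h0 b := ae_xsection (hk0 b).2.
move: phi_norm; apply: filter_app; move: hM; apply: filter_app.
move: (h0 false) (h0 true); apply: filterS2 => t a0 a1 hMt nt.
have e1 : \forall s \ae leb2, forall b, part b (phi t s) = k1 b (t, s).
  move: hMt; apply: filter_app; move: a0 a1; apply: filterS2 => s /= b0 b1 b2 b.
  have e b' : part b' (phi t s) = k0 b' (t, s) by case: b'.
  rewrite /k1 ifT ?e// /sq -!e /part /= -normc_sqr (le_trans b2)//.
  by rewrite ler_wpM2r ?decay_ge0// lerDl powR_ge0.
have n1 : n t = 1%E.
  rewrite -nt; symmetry; apply: ge0_ae_eq_integral_nonmeasurable.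
  - by move=> s; rewrite lee_fin sqr_ge0.
  - by move=> s; rewrite lee_fin addr_ge0// sqr_ge0.
  - apply/measurable_EFinP; apply: (measurableT_comp (msq _ mk1)) => //.
  - by apply: filterS e1 => s e; rewrite normc_sqr /sq -(e false) -(e true).
by apply: filterS e1 => s e b; rewrite /k /= n1 eqxx.
Qed.

End regular_kernels.

(** * The constructed measure has the density psi (G t) *)

Section density_of_the_field.
Context {R : realType}.

Lemma has_density_ae (nu : signed_measure R) (f g : plane R -> R) : dens nu f ->
  (\forall t \ae leb2, g t = f t) -> has_density g nu.
Proof.
move=> [mf fl fE] gf; split; first exact: (ae_completion_measurable mf gf).
- move=> B hB; have mB := hB.1; apply: le_lt_trans (fl B hB).
  rewrite integral_mkcond [leRHS]integral_mkcond le_eqVlt; apply/orP; left; apply/eqP.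
  apply: ae_eq_integral_nonmeasurable.
    apply/measurable_restrict => //; rewrite setTI; apply: measurable_funTS.
    by apply/measurable_EFinP; exact: measurableT_comp.
  by apply: filterS gf => t e; rewrite !patchE e.
- move=> B hB; have mB := hB.1; rewrite fE// integral_mkcond [RHS]integral_mkcond; symmetry.
  apply: ae_eq_integral_nonmeasurable.
    apply/measurable_restrict => //; rewrite setTI; apply: measurable_funTS.
    exact/measurable_EFinP.
  by apply: filterS gf => t e; rewrite !patchE e.
Qed.

Context (K a : R) (k : bool -> plane R * plane R -> R)
  (Gam : bool -> plane R * state (@HC R) R -> R) (phi : plane R -> plane R -> R[i])
  (psi : R[i] -> R) (psi' : plane R -> R).
Hypotheses (hk : good_kernel K a k id) (hGam : field_version k Gam).
Hypothesis phiE : \forall t \ae leb2, \forall s \ae leb2,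
  complex.Re (phi t s) = k false (t, s) /\ complex.Im (phi t s) = k true (t, s).
Hypothesis psiE : \forall z \ae leb2, psi (C_of_plane z) = psi' z.
Context d (T : measurableType d) (P : probability T R) (w1 w2 : (plane R -> R) -> T -> R).
Hypotheses (w1_noise : is_white_noise P w1) (w2_noise : is_white_noise P w2).
Context (G : plane R -> T -> R[i]).
Hypothesis G_field : is_complex_gaussian_field P w1 w2 phi G.
Context (Z : @HC R -> T -> R).
Hypotheses (hZ : isonormal P (@ipC R) Z)
  (ZE : forall f, \forall o \ae P, Z f o = w1 f.1 o - w2 f.2 o).

Let st (o : T) : state (@HC R) R := fun f => Z f o.

Let mst : measurable_fun setT st.
Proof. by apply: measurable_to_state => f; exact: isonormal_measurable hZ _. Qed.

Lemma complex_noise_field_at (t : plane R) :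
  (\forall s \ae leb2, complex.Re (phi t s) = k false (t, s) /\
                       complex.Im (phi t s) = k true (t, s)) ->
  \forall o \ae P, plane_of_C (complex_noise w1 w2 (phi t) o) = field_at Gam (t, st o).
Proof.
move=> ht; have L2k b := gk_L2 hk b t.
pose u := toL2 (fun s => k false (t, s)); pose v := toL2 (fun s => k true (t, s)).
have uE : u = (fun s => k false (t, s)) :> (plane R -> R) by exact: toL2E.
have vE : v = (fun s => k true (t, s)) :> (plane R -> R) by exact: toL2E.
have re w (hw : is_white_noise P w) : \forall o \ae P, w (fun s => complex.Re (phi t s)) o = w u o.
  by apply: (noise_ae_eq hw (L2funP u)); rewrite uE; apply: filterS ht => s [].
have im w (hw : is_white_noise P w) : \forall o \ae P, w (fun s => complex.Im (phi t s)) o = w v o.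
  by apply: (noise_ae_eq hw (L2funP v)); rewrite vE; apply: filterS ht => s [].
have hG b := hGam.2 b t _ _ _ _ hZ.
move: (re _ w1_noise); apply: filter_app; move: (im _ w1_noise); apply: filter_app.
move: (re _ w2_noise); apply: filter_app; move: (im _ w2_noise); apply: filter_app.
move: (hG false); apply: filter_app; move: (hG true); apply: filter_app.
move: (ZE (kvec k false t)); apply: filter_app; move: (ZE (kvec k true t)); apply: filter_app.
have opp := isonormalZ (white_noise_isonormal w2_noise) (-1) u.
apply: filterS opp => o; rewrite scaleN1r mulN1r => e0 e1 e2 e3 e4 e5 e6 e7 e8.
rewrite /field_at /st e3 e4 e1 e2 /kvec /turn /= -/u -/v e0.
rewrite /plane_of_C /complex_noise e5 e6 e7 e8 /=; congr (_, _); rewrite /half_sd; ring.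
Qed.

(** The law of the field at t has a density, so the field avoids the null set where psi and its
    Borel version differ. *)
Lemma field_at_null (N : set (plane R)) (t : plane R) : measurable N -> leb2 N = 0%E ->
  \forall o \ae P, ~ N (field_at Gam (t, st o)).
Proof.
move=> mN N0.
have mX : measurable_fun setT (fun o => field_at Gam (t, st o)).
  apply: (measurableT_comp (measurable_field_at hGam)).
  by apply/measurable_fun_pair.
pose h (z : plane R) : \bar R := (\1_N z)%:E.
have mh : measurable_fun setT h by apply/measurable_EFinP; exact: measurable_indic.
have h0 z : (0 <= h z)%E by rewrite lee_fin indicE.
have mXN : measurable ((fun o => field_at Gam (t, st o)) @^-1` N).
  by rewrite -[X in measurable X]setTI; exact: mX.
exists ((fun o => field_at Gam (t, st o)) @^-1` N); split => //; last by move=> o /contrapT.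
have e := field_law hk hGam hZ t mh h0.
transitivity (\int[P]_o h (field_at Gam (t, st o)))%E.
  by symmetry; apply: (etrans (integral_indic P measurableT mXN)); rewrite setIT.
rewrite e ge0_integral_complex_gaussian//.
have n0 : \forall z \ae leb2, h z = 0%E.
  exists N; split => // z /= hz; apply: contrapT => Nz; apply: hz.
  by rewrite /h indicE memNset.
rewrite (ae_eq_integral_nonmeasurable (g := cst 0%E)) ?integral0//.
by apply: filterS n0 => z ->; rewrite mul0e.
Qed.

(** For almost every t the identity holds almost surely. The set [A] replaces it by a measurable
    condition, thanks to the joint measurability of G, so that the order of the two quantifiers can
    be exchanged. *)
Lemma field_density_ae :
  \forall o \ae P, \forall t \ae leb2, psi (G t o) = field_density Gam psi' (st o) t.
Proof.
have [N [mN N0 NE]] := psiE; case: G_field => mG hG.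
pose X (q : plane R * T) : plane R := plane_of_C (G q.1 q.2).
pose Y (q : plane R * T) : plane R := field_at Gam (q.1, st q.2).
have mY : measurable_fun setT Y.
  apply: (measurableT_comp (measurable_field_at hGam)).
  by apply/measurable_fun_pair => //=; exact: (measurableT_comp mst).
pose A : set (plane R * T) := [set q | X q = Y q /\ ~ N (Y q)].
have mA : measurable A.
  have -> : A = [set q | (X q).1 - (Y q).1 = 0] `&` [set q | (X q).2 - (Y q).2 = 0] `&` ~` (Y @^-1` N).
    apply/seteqP; split => q.
      move=> [e nN]; have s1 : (X q).1 - (Y q).1 = 0 by rewrite e subrr.
      by have s2 : (X q).2 - (Y q).2 = 0 by rewrite e subrr.
    move=> [[/eqP e1 /eqP e2] nN]; split => //; move: e1 e2.
    rewrite !subr_eq0 => /eqP e1 /eqP e2.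
    by rewrite [X q]surjective_pairing [Y q]surjective_pairing e1 e2.
  have mz (f g : plane R * T -> R) : measurable_fun setT f -> measurable_fun setT g ->
      measurable [set q | f q - g q = 0].
    move=> mf mg; rewrite -[X in measurable X]setTI.
    exact: (measurable_funB mf mg measurableT (measurable_set1 0)).
  apply: measurableI; last first.
    by apply: measurableC; rewrite -[X in measurable X]setTI; exact: mY.
  apply: measurableI; apply: mz.
  - exact: (measurableT_comp measurable_fst mG).
  - exact: (measurableT_comp measurable_fst mY).
  - exact: (measurableT_comp measurable_snd mG).
  - exact: (measurableT_comp measurable_snd mY).
have hA : \forall t \ae leb2, \forall o \ae P, A (t, o).
  move: hG phiE; apply: filterS2 => t hGt pt.
  move: hGt (complex_noise_field_at pt) (field_at_null t mN N0).
  by apply: filterS3 => o e1 e2 e3; split => //; rewrite /X /= e1.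
apply: filterS (ae_exchange mA hA) => o; apply: filterS => t [XY nN].
have -> : G t o = C_of_plane (X (t, o)) by rewrite /X /=; case: (G t o).
rewrite XY /field_density; apply: contrapT => h; apply: nN; exact: NE.
Qed.

End density_of_the_field.

Theorem theorem5p23 (R : realType) (C alpha delta : R)
  (C_gt0 : 0 < C) (alpha_gt0 : 0 < alpha) (delta_gt0 : 0 < delta)
  (delta_le1 : delta <= 1) (alpha_gt : 2 * (1 + 2 / delta) < alpha)
  (phi : plane R -> plane R -> R[i])
  (phi_measurable : completion_measurable (leb2 \x leb2)%E
    (fun p : plane R * plane R => plane_of_C (phi p.1 p.2)))
  (phi_shift : exists tau1 tau2 : plane R -> plane R -> R[i],
    [/\ measurable_fun setT
          (fun p : plane R * plane R => plane_of_C (tau1 p.1 p.2)),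
        measurable_fun setT
          (fun p : plane R * plane R => plane_of_C (tau2 p.1 p.2)),
        forall u v, normc (tau1 u v) = 1,
        forall u v, normc (tau2 u v) = 1
      & forall r : plane R, \forall p \ae (leb2 \x leb2)%E,
          let s := p.1 in let t := p.2 in
          phi (t + r) (s + r) = tau1 r t * phi t s * tau2 r s])
  (phi_norm : \forall t \ae leb2,
    (\int[leb2]_s (normc (phi t s) ^+ 2)%:E = 1)%E)
  (phi_decay : (ess_sup (leb2 \x leb2)
    (fun p : plane R * plane R => let s := p.1 in let t := p.2 in
      ((1 + euclid (t - s)) `^ alpha * normc (phi t s) ^+ 2)%:E) < +oo)%E)
  (psi : R[i] -> R)
  (psi_measurable : completion_measurable leb2 (psi \o C_of_plane))
  (psi_exp : (\int[leb2]_z (expR (C^-1 * `|psi (C_of_plane z)|)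
      * expR (- normc (C_of_plane z) ^+ 2))%:E < +oo)%E)
  (psi_mean : (\int[leb2]_z (psi (C_of_plane z)
      * expR (- normc (C_of_plane z) ^+ 2))%:E = 0)%E)
  (psi_holder : forall y h : R[i],
    (lne (\int[leb2]_x
       (expR `|psi ((C_of_plane x + h + y) / 2)
               - psi ((C_of_plane x + h - y) / 2)|
        * (pi^-1 * expR (- normc (C_of_plane x) ^+ 2)))%:E)
     <= (C * normc y `^ delta)%:E)%E)
  (d : measure_display) (T : measurableType d) (P : probability T R)
  (w1 w2 : (plane R -> R) -> T -> R)
  (w1_noise : is_white_noise P w1) (w2_noise : is_white_noise P w2)
  (w12_indep : independent_noises P w1 w2)
  (G : plane R -> T -> R[i])
  (G_field : is_complex_gaussian_field P w1 w2 phi G) :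
  exists X : T -> signed_measure R,
    [/\ measurable_fun setT X,
        \forall o \ae P, has_density (fun t => psi (G t o)) (X o)
      & splittable P X].
Proof.
have a_gt : 2 + 4 / delta < alpha.
  by rewrite (_ : 2 + 4 / delta = 2 * (1 + 2 / delta))//; field; rewrite gt_eqF.
have d01 : 0 < delta <= 1 by rewrite delta_gt0.
have [psi' [mpsi' psiE [M hM] psi_int [psi'_mean psi'_holder]]] :=
  regular_observable C_gt0 delta_gt0 psi_measurable psi_exp psi_mean psi_holder.
have [K [k [K0 hk kE]]] := regular_kernel alpha_gt0 phi_measurable phi_norm phi_decay.
have [Gam hGam] := field_version_exists hk.
have [Z [hZ Z0 ZE]] := noise_isonormal w1_noise w2_noise w12_indep.
have phiE : \forall t \ae leb2, \forall s \ae leb2,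
    complex.Re (phi t s) = k false (t, s) /\ complex.Im (phi t s) = k true (t, s).
  by apply: filterS kE => t; apply: filterS => s e; rewrite -(e false) -(e true).
pose F := fine (field_bound K alpha C delta).
have F0 : 0 <= F.
  apply: fine_ge0; rewrite /field_bound adde_ge0// mule_ge0//.
  by apply: integral_ge0 => z _; rewrite lee_fin expR_ge0.
(* The factor 1 + F makes both 16 eps and 16 eps F at most 1. *)
pose eps := (16 * (1 + F))^-1.
have e16 : 0 < 16 * (1 + F) by rewrite mulr_gt0// ltr_pwDl.
have eps0 : 0 < eps by rewrite invr_gt0.
have epsE : eps * (16 * (1 + F)) = 1 by rewrite mulVf// gt_eqF.
have eps1 : eps *+ 16 <= 1.
  by rewrite -mulr_natr -[leRHS]epsE ler_wpM2l ?(ltW eps0)// ler_peMr// lerDl.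
have epsM : (eps * F) *+ 16 <= 1.
  by rewrite -mulr_natr -[leRHS]epsE -mulrA ler_wpM2l ?(ltW eps0)// mulrC ler_wpM2l// lerDr.
pose s2 := spacing K ^+ 2; have s20 : 0 <= s2 by rewrite sqr_ge0.
(* Each of the three smallness conditions on c compares c times one of these summands with eps, so
   dividing eps by their sum meets all of them. *)
pose D := 1 + s2 + C + C * `|M|.
have CM0 : 0 <= C * `|M| by rewrite mulr_ge0// ltW.
have D0 : 0 < D by rewrite /D; lra.
pose c := eps / D; have c0 : 0 < c by rewrite divr_gt0.
have cle x : x <= D -> c * x <= eps.
  by move=> xD; rewrite /c mulrAC ler_pdivrMr// ler_wpM2l// ltW.
have epsle1 : eps <= 1 by apply: le_trans eps1; rewrite -[eps *+ 16]mulr_natr ler_peMr ?ler1n ?(ltW eps0).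
have c_eps : c * s2 <= eps by apply: cle; rewrite /D; lra.
have cC : c * C <= 1 by apply: le_trans epsle1; apply: cle; rewrite /D; lra.
have cM : c * C * M <= 1.
  apply: (@le_trans _ _ (c * (C * `|M|))).
    by rewrite mulrA ler_wpM2l ?ler_norm// mulr_ge0// ltW.
  by apply: le_trans epsle1; apply: cle; rewrite /D; lra.
have splits := scaled_field_splittable K0 C_gt0 d01 a_gt mpsi' psi'_holder psi_int psi'_mean
  c0 eps0 eps1 epsM c_eps C_gt0 cC cM hM hk hGam hZ Z0.
exists (fun o => field_measure Gam psi' (fun f => Z f o)); split.
- apply: (measurableT_comp (measurable_field_measure hGam mpsi')).
  by apply: measurable_to_state => f; exact: isonormal_measurable hZ _.
- move: (locally_integrable_field hk hGam mpsi' hZ psi_int)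
    (field_density_ae hk hGam phiE psiE w1_noise w2_noise G_field hZ ZE).
  apply: filterS2 => o hl he.
  exact: has_density_ae (dens_density_measure hl) he.
- exists c^-1; first by rewrite invr_gt0.
  by rewrite /C_splittable invrK.
Qed.
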